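(* Let $A$ be an $n\times n$ Berglund–Hübsch matrix over $\mathbb F_p$ and let $G$ be a subgroup of $G_A$ such that $J\in G\cap G^T$. Assume further that $JA^{-T}J^T=1$ and $n\ge 3$. Let $X_A(\mathbb F_p)$ be the hypersurface cut out by $W_A(x)=0$ in the weighted projective space over $\mathbb F_p$ with weights $w_i=m(JA^{-T})_i$, where $m$ is the smallest positive integer such that each $w_i$ is an integer. Then $\mathrm{ST}_p(A,G)$ is congruent modulo $p$ to the number of points of $X_A(\mathbb F_p)$.
   Context: Vectors are row vectors, $\mathbb N$ contains $0$, $e_1,\dots,e_n$ is the standard basis of $\mathbb Z^n$, $J=e_1+\dots+e_n$, $|v|$ is the sum of the entries of $v$, and $A^{-T}$ is the inverse transpose of $A$. **Berglund–Hübsch matrices.** Let $A$ be an invertible $n\times n$ matrix with non-negative integer entries and $W_A(x)=\sum_{i=1}^n x^{e_iA}$. $A$ is Berglund–Hübsch over $\mathbb F_p$ if (1) $W_A$ is quasi-homogeneous; (2) $(\partial_{x_1}W_A,\dots,\partial_{x_n}W_A)$ is a regular sequence in $\mathbb F_p[x_1,\dots,x_n]$; (3) $\det(A)$ divides $p-1$. **Groups.** $G_A=\mathbb Z^n/\mathbb Z^nA^T$ and $G_{A^T}=\mathbb Z^n/\mathbb Z^nA$; $J$ also denotes its class in either group. For a subgroup $G\le G_A$, the transpose $G^T\le G_{A^T}$ is the set of $\gamma$ with $\gamma A^{-1}\lambda^T\in\mathbb Z$ for all $\lambda\in G$. For $\lambda\in G_A$ represented so that $0\le(\lambda A^{-T})_i<1$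 for all $i$, $\mathrm{age}(\lambda)=\sum_i(\lambda A^{-T})_i$, and $\dim(\lambda)$ is the number of $i$ with $(\lambda A^{-T})_i\in\mathbb Z$. **The bicomplex.** Fix $\pi\in\mathbb C_p$ with $\pi^{p-1}=-p$. Let $x_i,y_i$ be even (commuting) variables and $\theta_i$ odd (anticommuting) variables, $1\le i\le n$. $\widetilde{\mathcal B}_A$ is the space of overconvergent series over $\mathbb C_p$ (coefficients bounded in absolute value by $C r^{\text{total degree}}$ for some $C>0$, $r<1$) in the monomials $x^\gamma y^\lambda\theta^I$, $\gamma,\lambda\in\mathbb N^n$, $I\in\{0,1\}^n$, with $\lambda A^{-T}\ge 0$ entrywise. $\mathcal B_A$ is its quotient by the ideal generated by the monomials with $\gamma A^{-1}\lambda^T>0$. Let $q^\vee(\lambda,I)$ be the number of indices $i$ with $(\lambda A^{-T})_i>(\lambda A^{-T})_iI_i$, and $q(\lambda,I)=I_1+\dots+I_n+q^\vee(\lambda,I)$. Define on $\mathcal B_A$ $$d_A(x^\gamma y^\lambda\theta^I)=\sum_{i}\gamma_i x^\gamma y^\lambda\theta^{I+e_i}+\pi\sum_{i,j}A_{ji}x^{\gamma+e_jA}y^\lambda\theta^{I+e_i},$$ $$d_A^\vee(x^\gamma y^\lambda\theta^I)=\sum_i\pi^{-1}(\lambda A^{-T})_i x^\gamma y^\lambda\partial_{\theta_i}\theta^I+\sum_i x^\gamma y^{\lambda+e_iA^T}\partial_{\theta_i}\theta^I,$$ where $\theta^{I+e_i}$ means $\theta_i\theta^I$ (zero if $I_i=1$).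 For $(\gamma,\lambda)\in G_{A^T}\times G_A$, $\mathcal B_A(\gamma,\lambda)$ is the sub-bicomplex spanned by monomials $x^{\gamma'}y^{\lambda'}\theta^I$ with $\gamma'\equiv\gamma$ mod $\mathbb Z^nA$ and $\lambda'\equiv\lambda$ mod $\mathbb Z^nA^T$, and $\mathcal B_A^G=\bigoplus_{(\gamma,\lambda)\in G^T\times G}\mathcal B_A(\gamma,\lambda)$. **Frobenius and supertrace.** Define $c_k$ for $k\in\mathbb Z^n$ by $c_0=1$, $c_k=0$ if some $k_j<0$, and $k_jc_k=c_{k-e_j}+c_{k-pe_j}$ for all $j$ otherwise. $\mathrm{Fr}_A$ is the linear endomorphism of $\mathcal B_A$ with $$\mathrm{Fr}_A(x^\gamma y^\lambda\theta^I)=p^{-q(\lambda,I)}\sum_k c_k\pi^{|k|}x^{(\gamma+kA)/p}y^\lambda\theta^I,$$ the sum being over $k\in\mathbb N^n$ with $\gamma+kA\in p\mathbb N^n$. It commutes with $d_A$ and $d_A^\vee$, preserves each $\mathcal B_A(\gamma,\lambda)$, and induces $H(\mathrm{Fr}_A)$ on total cohomology. $\mathrm{ST}_p(A,G)$ is the supertrace of $p^{\mathrm{age}+n-1}H(\mathrm{Fr}_A)$ on $H(\mathcal B_A^G,d_A+d_A^\vee)$, where the operator $\mathrm{age}$ acts as $\mathrm{age}(\lambda)$ on the cohomology of $\mathcal B_A(\gamma,\lambda)$, and the cohomology of $\mathcal B_A(\gamma,\lambda)$ has parity that of $\dim(\lambda)$ (the total Hodge degree is $\dim(\lambda)+2\,\mathrm{age}(\lambda)-2$).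 That is, $$\mathrm{ST}_p(A,G)=\sum_{\gamma\in G^T,\lambda\in G}(-1)^{\dim(\lambda)}p^{\mathrm{age}(\lambda)+n-1}\,\mathrm{Tr}\big(H(\mathrm{Fr}_A)\mid H(\mathcal B_A(\gamma,\lambda),d_A+d_A^\vee)\big).$$ *)

(* Defs.v *)
From HB Require Import structures.
From mathcomp Require Import all_boot all_order all_algebra.
From mathcomp Require Import generic_quotient ring_quotient closed_field.
From mathcomp Require Import mpoly.
From mathcomp Require Import boolp classical_sets functions cardinality fsbigop.
From mathcomp Require Import finmap reals.

Set Implicit Arguments.
Unset Strict Implicit.
Unset Printing Implicit Defensive.

Import Order.TTheory GRing.Theory Num.Theory.
Local Open Scope ring_scope.
Local Open Scope classical_set_scope.
Local Open Scope quotient_scope.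

(** * Regular sequences and quasi-homogeneous polynomials *)

Definition generated_by (S : comNzRingType) (s : seq S) (x : S) : Prop :=
  exists a : nat -> S, x = \sum_(i < size s) a i * s`_i.

Definition regular_seq (S : comNzRingType) (s : seq S) : Prop :=
  (forall i, (i < size s)%N ->
     forall x, generated_by (take i s) (x * s`_i) -> generated_by (take i s) x)
  /\ ~ generated_by s 1.

(* The weights are required to be positive: they are to be the weights of a
   weighted projective space, and without positivity the condition would be
   void for the polynomial of an invertible matrix. *)
Definition quasi_homogeneous (S : nzRingType) (n : nat) (f : {mpoly S[n]}) :
    Prop :=
  exists (w : 'I_n -> nat) (d : nat), (forall j, (0 < w j)%N) /\
    forall m, m \in msupp f -> (\sum_j m j * w j)%N = d.

(** * Berglund-Huebsch matrices *)

Definition intmx (m n : nat) (A : 'M[nat]_(m, n)) : 'M[int]_(m, n) :=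
  map_mx Posz A.

Definition ratmx (m n : nat) (A : 'M[int]_(m, n)) : 'M[rat]_(m, n) :=
  map_mx intr A.

Definition invA (n : nat) (A : 'M[nat]_n) : 'M[rat]_n :=
  invmx (ratmx (intmx A)).

Definition W (S : nzRingType) (n : nat) (A : 'M[nat]_n) : {mpoly S[n]} :=
  \sum_(i < n) 'X_[S, [multinom A i j | j < n]].

Record berglund_hubsch (p n : nat) (A : 'M[nat]_n) : Prop := {
  bh_invertible : ratmx (intmx A) \in unitmx;
  bh_quasi_homogeneous : quasi_homogeneous (W 'F_p A);
  bh_regular : regular_seq [seq mderiv i (W 'F_p A) | i <- enum 'I_n];
  bh_det : (\det (intmx A) %| p%:Z - 1)%Z
}.

(** * The groups [Z^n / Z^n A^T] and [Z^n / Z^n A] *)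

Definition lattice (n : nat) (M : 'M[nat]_n) : {pred 'rV[int]_n} :=
  [pred v | `[< exists u : 'rV[int]_n, v = u *m intmx M >]].

Lemma lattice_zmod_closed (n : nat) (M : 'M[nat]_n) : zmod_closed (lattice M).
Proof.
split=> [|x y]; rewrite !inE; first by apply/asboolP; exists 0; rewrite mul0mx.
move=> /asboolP[u ->] /asboolP[v ->]; apply/asboolP; exists (u - v).
by rewrite mulmxBl.
Qed.

HB.instance Definition _ (n : nat) (M : 'M[nat]_n) :=
  GRing.isZmodClosed.Build 'rV[int]_n (lattice M) (lattice_zmod_closed M).

Definition coker (n : nat) (M : 'M[nat]_n) : zmodType :=
  Quotient.quot (lattice M).

Notation GA A := (coker (trmx A)).
Notation GAT A := (coker A).

Definition cls (n : nat) (M : 'M[nat]_n) (v : 'rV[int]_n) : coker M :=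
  \pi_(Quotient.quot (lattice M)) v.

Definition rep (n : nat) (M : 'M[nat]_n) (g : coker M) : 'rV[int]_n :=
  repr (g : Quotient.quot (lattice M)).

Definition J (n : nat) : 'rV[int]_n := const_mx 1.

(* [gamma A^-1 lambda^T], [lambda A^-T] *)
Definition pairing (n : nat) (A : 'M[nat]_n) (gamma lambda : 'rV[int]_n) : rat :=
  (ratmx gamma *m invA A *m (ratmx lambda)^T) 0 0.

Definition mulAmT (n : nat) (A : 'M[nat]_n) (lambda : 'rV[int]_n) : 'rV[rat]_n :=
  ratmx lambda *m (invA A)^T.

(* The pairing of two classes is well defined modulo [Z]. *)
Definition transpose_group (n : nat) (A : 'M[nat]_n) (G : {pred GA A}) :
    {pred GAT A} :=
  [pred gamma | `[< forall lambda, lambda \in G ->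
     pairing A (rep gamma) (rep lambda) \is a Num.int >]].

(* Passing to fractional parts amounts to choosing the representative with
   [0 <= (lambda A^-T)_i < 1]. *)
Definition age (n : nat) (A : 'M[nat]_n) (lambda : GA A) : rat :=
  \sum_i (mulAmT A (rep lambda) 0 i
          - (Num.floor (mulAmT A (rep lambda) 0 i))%:~R).

Definition dimn (n : nat) (A : 'M[nat]_n) (lambda : GA A) : nat :=
  #|[set i | mulAmT A (rep lambda) 0 i \is a Num.int]%SET|.

(** * The field of complex p-adic numbers *)

(* [K] with the absolute value [v] is (a copy of) [C_p]: it is complete and
   algebraically closed, [v] extends the p-adic absolute value of [Q], and the
   elements algebraic over the closure [Q_p] of [Q] in [K] are dense.  These
   properties determine [(K, v)] up to isometric isomorphism. *)
Section Cp.
Variables (R : realType) (p : nat) (K : closedFieldType) (v : K -> R).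

Definition in_Qp (z : K) : Prop :=
  forall e : R, 0 < e -> exists q : rat, v (z - ratr q) < e.

Record is_Cp : Prop := {
  Cp_ge0 : forall x, 0 <= v x;
  Cp_eq0 : forall x, v x = 0 -> x = 0;
  Cp_mul : forall x y, v (x * y) = v x * v y;
  Cp_ultrametric : forall x y, v (x + y) <= Num.max (v x) (v y);
  Cp_normp : v p%:R = p%:R^-1;
  Cp_complete : forall u : nat -> K,
    (forall e : R, 0 < e -> exists N : nat,
       forall i j, (N <= i)%N -> (N <= j)%N -> v (u i - u j) < e) ->
    exists l : K, forall e : R, 0 < e -> exists N : nat,
      forall i, (N <= i)%N -> v (u i - l) < e;
  Cp_dense : forall (x : K) (e : R), 0 < e ->
    exists2 y : K, v (x - y) < e &
      exists q : {poly K}, [/\ q != 0, forall i, in_Qp q`_i & root q y]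
}.

Definition congr_modp (x y : K) : Prop :=
  exists2 z : K, v z <= 1 & x - y = p%:R * z.

End Cp.

(* [c k] for [k] in [Z^n] *)
Definition is_frobenius_coef (p n : nat) (K : fieldType)
    (c : 'rV[int]_n -> K) : Prop :=
  [/\ c 0 = 1,
      forall k : 'rV[int]_n, (exists j, k 0 j < 0) -> c k = 0
    & forall k : 'rV[int]_n, (forall j, 0 <= k 0 j) -> forall j,
        (k 0 j)%:~R * c k
        = c (k - delta_mx 0 j) + c (k - delta_mx 0 j *+ p)].

(** * Trace of an endomorphism of a subquotient *)

(* [F] induces on [Z / B] an endomorphism of trace [t]: the [b i] are a basis
   of [Z] modulo [B], and [M] is the matrix of [F] in that basis. *)
Definition is_subquotient_trace (K : fieldType) (V : lmodType K)
    (Z B : set V) (F : V -> V) (t : K) : Prop :=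
  exists (d : nat) (b : 'I_d -> V) (M : 'M[K]_d),
    [/\ forall i, Z (b i),
        forall z, Z z ->
          exists! a : 'rV[K]_d, B (z - \sum_i a 0 i *: b i),
        forall i, B (F (b i) - \sum_j M i j *: b j)
      & t = \tr M].

(* 0 if [Z / B] is not finite-dimensional *)
Definition subquotient_trace (K : fieldType) (V : lmodType K)
    (Z B : set V) (F : V -> V) : K :=
  xget 0 (is_subquotient_trace Z B F).

(** * The bicomplex and its Frobenius *)

(* [(gamma, lambda, E)] stands for [x^gamma y^lambda theta^E], where
   [theta^E] is the product of the [theta_i], [i \in E], in increasing order;
   series are families of coefficients. *)
Definition mono (n : nat) : choiceType :=
  ('rV[nat]_n * 'rV[nat]_n * {set 'I_n})%type.

Definition series (K : fieldType) (n : nat) : lmodType K := mono n -> K^o.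

Definition vsum (n : nat) (k : 'rV[nat]_n) : nat := (\sum_i k 0%R i)%N.

Definition total_degree (n : nat) (m : mono n) : nat :=
  (vsum m.1.1 + vsum m.1.2 + #|m.2|)%N.

Section Bicomplex.
Variables (R : realType) (p : nat) (K : fieldType) (v : K -> R).
Variables (pi : K) (n : nat) (c : 'rV[int]_n -> K) (A : 'M[nat]_n).
Implicit Types (gamma lambda : 'rV[nat]_n) (E : {set 'I_n}) (m : mono n).
Implicit Types (f : series K n).

Definition mon m : series K n := fun m' => (m' == m)%:R.

(* The linear map determined by the images of the monomials.  For each of the
   maps below (for [FrA], if [A] has no zero row), a given monomial occurs in
   the images of finitely many monomials only, so that the sum is finite for
   any family [f]. *)
Definition lin_ext (D : mono n -> series K n) f : series K n :=
  fun m' => \sum_(m \in [set: mono n]) f m * D m m'.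

(* [theta^E theta^E' = theta_sign E E' theta^(E :|: E')] *)
Definition theta_sign (E E' : {set 'I_n}) : K :=
  if (E :&: E' == finset.set0)%SET then
    (-1) ^+ #|[set ij : 'I_n * 'I_n |
                 [&& ij.1 \in E, ij.2 \in E' & (ij.2 < ij.1)%N]]%SET|
  else 0.

Definition mono_mul m m' : series K n :=
  theta_sign m.2 m'.2 *: mon (m.1.1 + m'.1.1, m.1.2 + m'.1.2, m.2 :|: m'.2).

(* [x^gamma y^lambda theta_i theta^E] *)
Definition mon_theta i gamma lambda E : series K n :=
  theta_sign [set i]%SET E *: mon (gamma, lambda, i |: E)%SET.

(* [x^gamma y^lambda d/dtheta_i theta^E], where
   [theta^E = theta_sign [set i] (E :\ i) theta_i theta^(E :\ i)] if [i \in E] *)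
Definition mon_dtheta i gamma lambda E : series K n :=
  if i \in E then
    theta_sign [set i]%SET (E :\ i)%SET *: mon (gamma, lambda, E :\ i)%SET
  else 0.

Definition lamt lambda : 'rV[rat]_n := mulAmT A (intmx lambda).

Definition overconvergent f : Prop :=
  (forall m, f m != 0 -> forall i, 0 <= lamt m.1.2 0 i) /\
  exists C r : R, [/\ 0 < C, 0 <= r, r < 1
    & forall m, v (f m) <= C * r ^+ total_degree m].

(* The ideal by which the ring of overconvergent series is divided. *)
Definition in_ideal f : Prop :=
  exists (k : nat) (m : 'I_k -> mono n) (g : 'I_k -> series K n),
    [/\ forall t i, 0 <= lamt (m t).1.2 0 i,
        forall t, 0 < pairing A (intmx (m t).1.1) (intmx (m t).1.2),
        forall t, overconvergent (g t)
      & f = \sum_t lin_ext (mono_mul (m t)) (g t)].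

Definition dA : series K n -> series K n := lin_ext (fun m =>
  let: (gamma, lambda, E) := m in
  \sum_i (gamma 0 i)%:R *: mon_theta i gamma lambda E
  + pi *: \sum_i \sum_j (A j i)%:R *: mon_theta i (gamma + row j A) lambda E).

Definition dAv : series K n -> series K n := lin_ext (fun m =>
  let: (gamma, lambda, E) := m in
  \sum_i (pi^-1 * ratr (lamt lambda 0 i)) *: mon_dtheta i gamma lambda E
  + \sum_i mon_dtheta i gamma (lambda + row i A^T) E).

Definition qv lambda E : nat :=
  #|[set i | lamt lambda 0 i * (i \in E)%:R < lamt lambda 0 i]%SET|.

Definition q lambda E : nat := (#|E| + qv lambda E)%N.

(* The coefficient of [m'] in the image of [x^gamma y^lambda theta^E] collects
   the [k] with [(gamma + k A) / p = m'.1.1]. *)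
Definition FrA : series K n -> series K n := lin_ext (fun m =>
  let: (gamma, lambda, E) := m in
  fun m' =>
    p%:R ^- q lambda E
    * (\sum_(k \in [set k : 'rV[nat]_n | gamma + k *m A = m'.1.1 *+ p])
         c (intmx k) * pi ^+ vsum k)
    * ((m'.1.2 == lambda) && (m'.2 == E))%:R).

(* Overconvergent series representing the elements of [B_A(gamma, lambda)] *)
Definition in_piece (gamma : GAT A) (lambda : GA A) : set (series K n) :=
  [set f | overconvergent f /\ forall m, f m != 0 ->
     cls A (intmx m.1.1) = gamma /\ cls A^T (intmx m.1.2) = lambda].

Definition dtot f : series K n := dA f + dAv f.

Definition cocycle (gamma : GAT A) (lambda : GA A) : set (series K n) :=
  [set f | in_piece gamma lambda f /\ in_ideal (dtot f)].

Definition coboundary (gamma : GAT A) (lambda : GA A) : set (series K n) :=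
  [set f | in_piece gamma lambda f /\
           exists2 g, in_piece gamma lambda g & in_ideal (f - dtot g)].

Definition trace_HFr (gamma : GAT A) (lambda : GA A) : K :=
  subquotient_trace (cocycle gamma lambda) (coboundary gamma lambda) FrA.

(* [age lambda] is a non-negative integer for [lambda] in [G] if [J] is in
   [transpose_group G]. *)
Definition ST (G : {pred GA A}) : K :=
  \sum_(gamma \in [set` transpose_group G])
    \sum_(lambda \in [set` G])
      (-1) ^+ dimn lambda * p%:R ^+ (Num.truncn (age lambda) + n - 1)
      * trace_HFr gamma lambda.

End Bicomplex.

Arguments ST {R} p {K} v pi {n} c A G.

(** * Rational points of the hypersurface [W_A = 0] *)

Definition Fpbar (p : nat) : closedFieldType :=
  projT1 (countable_algebraic_closure 'F_p).

Definition Fp_in_Fpbar (p : nat) : {rmorphism 'F_p -> Fpbar p} :=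
  projT1 (projT2 (countable_algebraic_closure 'F_p)).

Definition wproj_eq (L : fieldType) (n : nat) (w : 'I_n -> nat)
    (x y : 'rV[L]_n) : Prop :=
  exists2 t : L, t != 0 & forall i, y 0 i = t ^+ w i * x 0 i.

(* The points of the weighted projective variety over an algebraic closure of
   [F_p] are the orbits of its multiplicative group; those defined over [F_p]
   are the orbits fixed by the Frobenius map.  In general this differs from the
   set of orbits of the multiplicative group of [F_p] on vectors over [F_p]. *)
Definition X_points (p n : nat) (A : 'M[nat]_n) (w : 'I_n -> nat) :
    set (set 'rV[Fpbar p]_n) :=
  [set P | exists x : 'rV[Fpbar p]_n,
     [/\ x != 0,
         mmap (Fp_in_Fpbar p) (fun i => x 0 i) (W 'F_p A) = 0,
         wproj_eq w x (map_mx (fun a => a ^+ p) x)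
       & P = [set y | wproj_eq w x y]]].

Arguments X_points p {n} A w.

(* Main.v *)
Require Import Defs.
From HB Require Import structures.
From mathcomp Require Import all_boot all_order all_algebra.
From mathcomp Require Import mpoly.
From mathcomp Require Import boolp classical_sets functions cardinality fsbigop.
From mathcomp Require Import finmap reals.
From mathcomp Require Import finfield.
From mathcomp Require Import zify ring lra.

(** In the coordinates [gamma = x0 + y A], [lambda = l0 + k A^T] the bicomplex
    of a pair of classes becomes a Koszul-type complex on families indexed by
    [(y, k, E)], with the operators [u_j + pi (shift in y_j)] and
    [s_i + pi (shift in k_i)], [u = x A^-1], [s = lambda A^-T].  Inverting or
    contracting these operators term by term (the factorials in the inverses
    are compensated by powers of [pi]) removes the variables [k_i], so that
    only [k = 0] and the [theta_i] with [x_i] in the monomial remain.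
    There [p^(age + n - 1) Fr] multiplies norms by at most [p^-1] as soon as
    [age + dim + level - #|E| >= 2]: an eigenvalue of absolute value larger
    than [p^-1] then gives a coboundary, because the geometric series of the
    operator converges among overconvergent chains.  So the trace on such a
    piece is [0] modulo [p].

    Since [J A^-T] and [J A^-1] are positive, only two pieces escape.  In
    [(0, J)] the cohomology is a line on which [Fr] is [p^-n]; its
    contribution is [1].  In [(J, 0)] the cohomology is a line and, modulo [p],
    [p^(n-1) Fr] acts as [- prod_j c_(k_j)] with [k = (p - 1) J A^-1], where
    [c_(k_j) = 1 / k_j!].  By the argument of Chevalley and Warning the number
    of zeros of [W_A] in [F_p^n] is [- (-1)^n (p - 1)! / prod_j k_j!] modulo
    [p], and [(p-1)! = -1]; by Lang's theorem each rational point of [X_A]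
    comes from exactly [p - 1] nonzero zeros.

    Positivity of [J A^-1] is where regularity enters: the monomials of a
    regular sequence of length [n] and one more transcendental element would
    be linearly independent, so no curve lies in the zero locus of the
    gradient of [W_A]; this forces every row of [A] to be [b_i e_i + e_(tau i)]
    with each [i] the [tau]-image of at most one [j <> i]. *)

Set Implicit Arguments.
Unset Strict Implicit.
Unset Printing Implicit Defensive.

Import Order.TTheory GRing.Theory Num.Theory.
Local Open Scope ring_scope.
Local Open Scope classical_set_scope.

(** * Regular sequences of maximal length *)

Section Ideals.
Variable S : comNzRingType.
Implicit Types (s : seq S) (x y : S).

(** Congruence modulo [p] is the inequality [v x <= p^-1], so the goal splits into one estimate per
    pair of classes. The trace of a piece is that of a matrix or the default 0; a bound on
    eigenvalues covers both cases, and cohomology is computed only for the two exceptional pairs.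
    Two obstacles shape the estimates. The coefficients [c_k] come from exp(t + t^p/p), a truncation
    of the Artin-Hasse exponential, and stop being p-integral at degree p^2; the loss, measured by
    [gap], has to be absorbed by the level, which takes [5 <= p]. That inequality follows from n <=
    |det A| <= p - 1. Secondly, Frobenius contracts a Banach space of chains that decay like
    |pi|^level, while an overconvergent chain may decay more slowly. Each application of Frobenius
    raises the rate of decay to the p-th power, so finitely many bring every chain into the Banach
    space; on an eigenvector they only multiply by a power of the eigenvalue, up to a coboundary. *)

Lemma gen0 s : generated_by s 0.
Proof. by exists (fun=> 0); rewrite big1 // => i _; rewrite mul0r. Qed.

Lemma gen_take s j x q : (j < size s)%N -> generated_by (take j s) x ->
  generated_by (take j.+1 s) (x + q * s`_j).
Proof.
move=> hj [a ->]; exists (fun i => if (i < j)%N then a i else q).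
rewrite !size_takel // ?(ltnW hj) // big_ord_recr /= ltnn nth_take //; congr (_ + _).
by apply: eq_bigr => i _; rewrite ltn_ord !nth_take // ltnS ltnW.
Qed.

End Ideals.

Section Tables.
Variables (F : finFieldType) (S : comAlgType F) (s : seq S) (x : S) (N : nat).

Fixpoint table (d : nat) : finType :=
  if d is d'.+1 then {ffun 'I_N -> table d'} else {ffun 'I_N -> F}.

Lemma card_table d : #|table d| = (#|F| ^ (N ^ d.+1))%N.
Proof.
elim: d => [|d IH] /=; first by rewrite card_ffun card_ord expn1.
by rewrite card_ffun IH card_ord -expnM -expnSr.
Qed.

(* A table of depth [d] lists the coefficients of the monomials in
   [s`_(size s - d), ..., s`_(size s - 1), x] with exponents less than [N]. *)
Fixpoint eval_table (d : nat) : table d -> S :=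
  match d with
  | 0 => fun T => \sum_(m < N) T m *: x ^+ m
  | d'.+1 => fun T => \sum_(e < N) s`_(size s - d'.+1) ^+ e * eval_table (T e)
  end.

Hypothesis s_reg : regular_seq s.
Hypothesis x_trans : forall T : {ffun 'I_N -> F},
  generated_by s (\sum_(m < N) T m *: x ^+ m) -> forall m, T m = 0.

(** Each element of the sequence is a non-zero-divisor modulo the earlier ones. So the coefficients
    of its powers can be compared one after the other: the lowest one modulo the element itself, by
    induction on the depth, and the others after division by it. *)
Lemma eval_table_inj d (T T' : table d) : (d <= size s)%N ->
  generated_by (take (size s - d) s) (eval_table T - eval_table T') -> T = T'.
Proof.
elim: d T T' => [|d IH] T T' hd.
  rewrite subn0 take_size /= -sumrB => h; apply/ffunP => m; apply/eqP; rewrite -subr_eq0.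
  have := @x_trans [ffun m => T m - T' m] _ m; rewrite ffunE => -> //.
  rewrite (eq_bigr (fun m => T m *: x ^+ m - T' m *: x ^+ m)) // => i _.
  by rewrite ffunE scalerBl.
set j := (size s - d.+1)%N; have hj : (j < size s)%N by rewrite /j; lia.
have ej : (size s - d)%N = j.+1 by rewrite /j; lia.
rewrite [eval_table _]/= [X in _ - X]/= -/j -sumrB => h.
pose E (e : 'I_N) := eval_table (T e) - eval_table (T' e).
(* Invariant: the coefficients of the powers below [k] agree, and the remaining sum, divided by the
   [k]-th power, still lies in the ideal of the first [j] elements. *)
have h0 k : (k <= N)%N -> (forall e : 'I_N, (e < k)%N -> T e = T' e) /\
    generated_by (take j s) (\sum_(e < N | (k <= e)%N) s`_j ^+ (e - k) * E e).
  elim: k => [_|k IHk hk].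
    split=> //; rewrite (eq_bigr (fun e : 'I_N => s`_j ^+ e * eval_table (T e) - s`_j ^+ e * eval_table (T' e))) // => e _.
    by rewrite subn0 -mulrBr.
  have [h1 h2] := IHk (ltnW hk); pose ek := Ordinal hk.
  move: h2; rewrite (bigD1 ek) //= subnn expr0 mul1r => h2.
  have eS : \sum_(e < N | (k <= e)%N && (e != ek)) s`_j ^+ (e - k) * E e =
      (\sum_(e < N | (k < e)%N) s`_j ^+ (e - k.+1) * E e) * s`_j.
    rewrite mulr_suml; apply: eq_big => [e|e /andP[ke ne]].
      by rewrite ltn_neqAle andbC eq_sym.
    have : (k < e)%N by rewrite ltn_neqAle ke eq_sym andbT.
    by move=> k1; rewrite mulrAC -exprSr; congr (_ ^+ _ * _); lia.
  rewrite eS in h2; set Q := \sum_(e < N | (k < e)%N) _ in h2 *.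
  have Ek : T ek = T' ek.
    apply: IH; first exact: ltnW.
    rewrite ej; have := gen_take (- Q) hj h2.
    by rewrite mulNr addrK.
  split=> [e|]; first by rewrite ltnS leq_eqVlt => /orP[/eqP e1|/h1 //]; rewrite (_ : e = ek) //; apply: val_inj.
  by move: h2; rewrite /E Ek subrr add0r => /(proj1 s_reg _ hj).
have [h1 _] := h0 N (leqnn _); by apply/ffunP => e; apply: h1; exact: ltn_ord.
Qed.

End Tables.

Section Counting.
Variables (F : finFieldType) (n : nat) (s : seq {mpoly F[n]}) (x : {mpoly F[n]}).

Lemma msizeM_deg (q r : {mpoly F[n]}) a b :
  (msize q <= a.+1)%N -> (msize r <= b.+1)%N -> (msize (q * r) <= (a + b).+1)%N.
Proof.
have [->|q0] := eqVneq q 0; first by rewrite mul0r msize0.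
have [->|r0] := eqVneq r 0; first by rewrite mulr0 msize0.
move=> h1 h2; rewrite msizeM //; move: h1 h2; move: (msize q) (msize r) => u t; clear; lia.
Qed.

Lemma msizeX_deg (q : {mpoly F[n]}) a e : (msize q <= a.+1)%N -> (msize (q ^+ e) <= (a * e).+1)%N.
Proof.
move=> h; elim: e => [|e IH]; first by rewrite expr0 msize1.
by rewrite exprS mulnS; exact: msizeM_deg.
Qed.

Lemma msize_sum_deg (I : finType) (G : I -> {mpoly F[n]}) a :
  (forall i, (msize (G i) <= a)%N) -> (msize (\sum_i G i) <= a)%N.
Proof. by move=> h; apply: leq_trans (mmeasure_sum _ _ _ _) _; apply/bigmax_leqP => i _; exact: h. Qed.

Lemma msize_eval N B d (T : table F N d) :
  (forall q, q \in x :: s -> (msize q <= B.+1)%N) ->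
  (msize (eval_table s x T) <= (d.+1 * (N * B)).+1)%N.
Proof.
move=> hB; have h0 (q : {mpoly F[n]}) (e : 'I_N) : (msize q <= B.+1)%N -> (msize (q ^+ e) <= (N * B).+1)%N.
  move=> h; apply: leq_trans (msizeX_deg e h) _; rewrite ltnS mulnC leq_mul2r ltnW ?orbT //.
elim: d T => [|d IH] T /=.
  apply: msize_sum_deg => e; apply: leq_trans (msizeZ_le _ _) _.
  by rewrite mul1n; apply: h0; apply: hB; rewrite mem_head.
apply: msize_sum_deg => e; rewrite mulSn; apply: msizeM_deg; last exact: IH.
apply: h0; have [h|h] := ltnP (size s - d.+1) (size s); last by rewrite nth_default // msize0.
by apply: hB; rewrite inE mem_nth ?orbT.
Qed.

(* The residue class of [x] is algebraic: otherwise the monomials in [x] and in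
   the [n] elements of [s] would be linearly independent, which is impossible
   since there are about [N^(n+1)] of them in degree at most [C N], against
   [(C N)^n] monomials in the variables. *)
Lemma regular_algebraic : regular_seq s -> size s = n ->
  exists2 P : {poly F}, P != 0 & generated_by s (horner_alg x P).
Proof.
move=> hreg hs; apply: contrapT => hP.
(* The values of tables have degree less than [M], and M <= N ((n+1) B + 1). As [N] exceeds ((n+1) B
   + 1)^n, the N^(n+1) entries of a table outnumber the M^n possible coefficients of its value. *)
pose B := (\max_(q <- x :: s) msize q)%N; pose N := (((n.+1 * B).+1 ^ n).+1)%N.
pose M := ((n.+1 * (N * B)).+1)%N.
have xt (T : {ffun 'I_N -> F}) : generated_by s (\sum_(m < N) T m *: x ^+ m) -> forall m, T m = 0.
  move=> hT; pose P : {poly F} := \poly_(i < N) (if insub i is Some j then T j else 0).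
  have Pc (m : 'I_N) : P`_m = T m.
    rewrite coef_poly ltn_ord; case: insubP => [j _ e|]; last by rewrite ltn_ord.
    by congr (T _); apply: val_inj.
  have P0 : P = 0.
    apply/eqP/negPn/negP => P0; apply: hP; exists P => //.
    rewrite -[P]/(\poly_(i < N) _) poly_def linear_sum.
    rewrite (eq_bigr (fun m : 'I_N => T m *: x ^+ m)) // => m _.
    rewrite linearZ rmorphXn /= horner_algX -[in RHS]Pc coef_poly ltn_ord mulr_algl; congr (_ *: _).
  by move=> m; rewrite -Pc P0 coef0.
pose ex (a : {ffun 'I_n -> 'I_M}) : 'X_{1..n} := [multinom (a i : nat) | i < n].
pose phi (T : table F N n) : {ffun {ffun 'I_n -> 'I_M} -> F} :=
  [ffun a => (eval_table s x T)@_(ex a)].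
have phi_inj : injective phi.
  move=> T T' e; apply: (eval_table_inj hreg xt); first by rewrite hs.
  suff -> : eval_table s x T = eval_table s x T' by rewrite subrr; exact: gen0.
  have hsz (T0 : table F N n) : (msize (eval_table s x T0) <= M)%N.
    apply: (@msize_eval N B n T0) => q hq; apply: leqW.
    by rewrite /B (big_rem q) //= leq_maxl.
  apply/mpolyP => m; have [hm|hm] := ltnP (mdeg m) M; last first.
    by rewrite !memN_msupp_eq0 // msize_mdeg_ge // (leq_trans (hsz _)).
  have hmi i : (m i < M)%N.
    apply: leq_ltn_trans hm; rewrite mdegE (bigD1 i) //=; exact: leq_addr.
  have := congr1 (fun g : {ffun {ffun 'I_n -> 'I_M} -> F} => g [ffun i => Ordinal (hmi i)]) e.
  rewrite !ffunE; have -> // : ex [ffun i => Ordinal (hmi i)] = m.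
  by apply/mnmP => i; rewrite mnmE ffunE.
have := leq_card phi phi_inj; rewrite card_table card_ffun card_ffun !card_ord.
have F1 : (1 < #|F|)%N by rewrite (cardD1 0) (cardD1 1) !inE oner_eq0.
rewrite leq_exp2l // => hle.
have M_le : (M <= N * (n.+1 * B).+1)%N by rewrite /M; have : (0 < N)%N by []; nia.
have : (N ^ n.+1 <= N ^ n * (n.+1 * B).+1 ^ n)%N.
  have mono k : (M ^ k <= (N * (n.+1 * B).+1) ^ k)%N by elim: k => // k IH; rewrite !expnS leq_mul.
  by rewrite -expnMn; exact: leq_trans hle (mono n).
by rewrite expnSr leq_pmul2l ?expn_gt0 // /N ltnn.
Qed.

End Counting.

(** A coordinate is algebraic modulo the regular sequence. On a curve where the sequence vanishes
    this gives P(h_i) = 0 with P nonzero, and a root of P among the polynomials over [L] is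
    constant. *)
Lemma regular_no_curve (F : finFieldType) (n : nat) (s : seq {mpoly F[n]}) (L : fieldType)
    (iota : {rmorphism F -> L}) (h : 'I_n -> {poly L}) (i : 'I_n) :
  regular_seq s -> size s = n -> (forall q, q \in s -> mmap (polyC \o iota) h q = 0) ->
  (size (h i) <= 1)%N.
Proof.
move=> hreg hs h0; have [P P0 [a ha]] := regular_algebraic 'X_i hreg hs.
rewrite leqNgt; apply/negP => h1.
have e0 : mmap (polyC \o iota) h (horner_alg 'X_i P) = 0.
  rewrite ha rmorph_sum big1 // => j _; rewrite rmorphM.
  by apply/eqP; rewrite mulf_eq0; apply/orP; right; apply/eqP; exact: (h0 _ (mem_nth _ (ltn_ord j))).
have : map_poly iota P \Po h i == 0.
  have e1 : horner_alg 'X_i P = \sum_(k < size P) P`_k *: 'X_i ^+ k.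
    rewrite -{1}[P]coefK poly_def linear_sum; apply: eq_bigr => k _.
    by rewrite linearZ rmorphXn /= horner_algX mulr_algl.
  rewrite comp_polyE size_map_poly; apply/eqP; rewrite -[RHS]e0 e1 raddf_sum.
  apply: eq_bigr => k _; rewrite coef_map /= mmapZ /= mul_polyC; congr (_ *: _).
  have := rmorphXn (mmap (polyC \o iota) h) k 'X_i; rewrite /= => ->.
  by rewrite mmapX mmap1U.
by rewrite comp_poly_eq0 // map_poly_eq0 (negbTE P0).
Qed.

(** * Positivity of the weights *)

Section Positivity.
Variables (p n : nat) (A : 'M[nat]_n).
Hypothesis p_prime : prime p.
Hypothesis A_BH : berglund_hubsch p A.
Hypothesis A_CY : pairing A (J n) (J n) = 1.
Hypothesis n_ge3 : (3 <= n)%N.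

Let w i : rat := mulAmT A (J n) 0 i.
Let V j : rat := (ratmx (J n) *m invA A) 0 j.
Let A_unit := bh_invertible A_BH.

Lemma bh_invAE l j : \sum_i (A l i)%:R * invA A i j = (l == j)%:R.
Proof.
have := mulmxV A_unit => /matrixP/(_ l j); rewrite !mxE => <-.
by apply: eq_bigr => i _; rewrite !mxE.
Qed.

Lemma bh_AinvE i l : \sum_j invA A i j * (A j l)%:R = (i == l)%:R.
Proof.
have := mulVmx A_unit => /matrixP/(_ i l); rewrite !mxE => <-.
by apply: eq_bigr => j _; rewrite !mxE.
Qed.

Lemma wE i : w i = \sum_j invA A i j.
Proof. by rewrite /w /mulAmT mxE; apply: eq_bigr => j _; rewrite !mxE mul1r. Qed.

Lemma VE j : V j = \sum_i invA A i j.
Proof. by rewrite /V mxE; apply: eq_bigr => i _; rewrite !mxE mul1r. Qed.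

Lemma Aw1 j : \sum_i (A j i)%:R * w i = 1.
Proof.
rewrite (eq_bigr (fun i => \sum_l (A j i)%:R * invA A i l)) => [|i _]; last by rewrite wE mulr_sumr.
rewrite exchange_big /= (bigD1 j) //= bh_invAE eqxx big1 ?addr0 // => l lj.
by rewrite bh_invAE eq_sym (negbTE lj).
Qed.

Lemma VA1 i : \sum_j V j * (A j i)%:R = 1.
Proof.
rewrite (eq_bigr (fun j => \sum_l invA A l j * (A j i)%:R)) => [|j _]; last by rewrite VE mulr_suml.
rewrite exchange_big /= (bigD1 i) //= bh_AinvE eqxx big1 ?addr0 // => l li.
by rewrite bh_AinvE (negbTE li).
Qed.

Lemma sum_w1 : \sum_i w i = 1.
Proof.
rewrite -A_CY /pairing -mulmxA mxE; apply: eq_bigr => i _; rewrite wE !mxE mul1r.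
by apply: eq_bigr => j _; rewrite !mxE mulr1.
Qed.

Lemma row_inj j1 j2 : (forall i, A j1 i = A j2 i) -> j1 = j2.
Proof.
move=> h; have := bh_invAE j1 j1; rewrite (eq_bigr (fun i => (A j2 i)%:R * invA A i j1)) => [|i _]; last by rewrite h.
by rewrite bh_invAE eqxx; case: eqP => // _ /eqP; rewrite eq_sym oner_eq0.
Qed.

(** The rows of [A] are distinct, so the monomials of [W] cannot add up to a multiple of [p] times a
    monomial. *)
Lemma row_msupp r : [multinom A r j | j < n] \in msupp (W 'F_p A).
Proof.
rewrite mcoeff_msupp /W raddf_sum /= (bigD1 r) //= mcoeffX eqxx big1 ?addr0 ?oner_eq0 // => j jr.
rewrite mcoeffX; case: eqP => // /mnmP h; case/eqP: jr; apply: row_inj => i.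
by have := h i; rewrite !mnmE.
Qed.

(** Quasi-homogeneity provides positive weights with A wt = d J. As [A] is invertible they are [d]
    times [w], and [d] is positive. *)
Lemma w_pos i : 0 < w i.
Proof.
have [wt [d [wt0 hd]]] := bh_quasi_homogeneous A_BH.
have e r : (\sum_j A r j * wt j)%N = d.
  by rewrite -(hd _ (row_msupp r)); apply: eq_bigr => j _; rewrite mnmE.
have key : w i * d%:R = (wt i)%:R.
  rewrite wE mulr_suml (eq_bigr (fun j => \sum_l invA A i j * (A j l)%:R * (wt l)%:R)) => [|j _]; last first.
    by rewrite -(e j) natr_sum mulr_sumr; apply: eq_bigr => l _; rewrite natrM mulrA.
  rewrite exchange_big /= (bigD1 i) //= -mulr_suml bh_AinvE eqxx mul1r big1 ?addr0 // => l li.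
  by rewrite -mulr_suml bh_AinvE eq_sym (negbTE li) mul0r.
have d0 : (0 : rat) < d%:R.
  rewrite ltr0n lt0n; apply/eqP => d0; move: key; rewrite d0 mulr0 => /esym/eqP.
  by rewrite pnatr_eq0 -leqn0 leqNgt wt0.
by rewrite -(pmulr_lgt0 _ d0) key ltr0n.
Qed.

(** This is where [n >= 3] enters: a third positive weight fits below the total 1. It excludes the
    monomials x_i and x_i x_j from [W]. *)
Lemma w_two_lt1 i j : i != j -> w i + w j < 1.
Proof.
move=> ij; have [k /andP[ki kj]] : exists k, (k != i) && (k != j).
  apply/existsP; apply: contraTT n_ge3 => /existsPn h; rewrite -ltnNge ltnS -[X in (X <= _)%N]card_ord.
  have := subset_leq_card (A := 'I_n) (B := [set i; j]%SET) _; rewrite cards2 ij; apply.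
  by apply/fintype.subsetP => k _; have := h k; rewrite negb_and !negbK !inE.
rewrite -sum_w1 (bigD1 i) //= (bigD1 j) 1?eq_sym //= addrA (bigD1 k) /=; last by rewrite ki.
by rewrite ltrDl ltr_wpDr ?w_pos // sumr_ge0 // => l _; rewrite ltW ?w_pos.
Qed.

Lemma w_lt1 i : w i < 1.
Proof.
have [j ij] : exists j, i != j.
  have n2 : (1 < n)%N by exact: ltnW.
  apply/existsP; apply: contraTT n2 => /existsPn h; rewrite -leqNgt -[X in (X <= _)%N]card_ord -(cards1 i).
  by apply: subset_leq_card; apply/fintype.subsetP => k _; have := h k; rewrite negbK !inE eq_sym.
by apply: lt_trans (w_two_lt1 ij); rewrite ltrDl w_pos.
Qed.

Lemma no_unit_row r l : ~ (forall m, A r m = (m == l)).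
Proof.
move=> h; have := w_lt1 l; rewrite -(Aw1 r) (bigD1 l) //= h eqxx mul1r big1 ?addr0 ?ltxx // => i il.
by rewrite h (negbTE il) mul0r.
Qed.

Lemma no_pair_row r i j : i != j -> ~ (forall m, A r m = (m == i) + (m == j))%N.
Proof.
move=> ij h; have := w_two_lt1 ij; rewrite -(Aw1 r) (bigD1 i) //= (bigD1 j) 1?eq_sym //= !h !eqxx.
rewrite (negbTE ij) eq_sym (negbTE ij) !mul1r big1 ?addr0 ?ltxx // => k /andP[ki kj].
by rewrite h (negbTE ki) (negbTE kj) mul0r.
Qed.

(** The equations express that the partial derivatives of [W] vanish along [h]. Truncated
    subtraction in the exponent is harmless: where it truncates, the factor [A r l] is zero. *)
Lemma no_curve (L : fieldType) (iota : {rmorphism 'F_p -> L}) (h : 'I_n -> {poly L}) i :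
  (forall l, \sum_r (A r l)%:R * \prod_m h m ^+ (A r m - (l == m)) = 0) -> (size (h i) <= 1)%N.
Proof.
move=> h0; apply: (regular_no_curve (iota := iota) i (bh_regular A_BH)).
  by rewrite size_map size_enum_ord.
move=> q /mapP[l _ ->]; rewrite /W linear_sum raddf_sum -[RHS](h0 l); apply: eq_bigr => r _ /=.
rewrite mderivX mmapZ mmapX mnmE /= !rmorph_nat; congr (_ * _).
by apply: eq_bigr => m _; rewrite mnmBE mnmE mnm1E.
Qed.

(** A coordinate that vanishes on the curve must have exponent 0 after differentiation; so it occurs
    in the monomial only if it is the variable of differentiation, and then with exponent 1. *)
Lemma term_neq0 (L : fieldType) (h : 'I_n -> {poly L}) r l :
  (A r l)%:R * \prod_m h m ^+ (A r m - (l == m)) != 0 ->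
  (0 < A r l)%N /\ forall m, h m = 0 -> A r m = (l == m).
Proof.
rewrite mulf_eq0 negb_or => /andP[h1 /prodf_neq0 h2].
have Al : (0 < A r l)%N by rewrite lt0n; apply: contraNneq h1 => ->.
split=> // m hm; have := h2 m isT; rewrite hm expf_eq0 eqxx andbT -leqNgt leqn0 subn_eq0 => h3.
by case: (eqVneq l m) h3 => [<-|_]; rewrite ?leqn0; [move=> h3; apply/eqP; rewrite eqn_leq h3|move/eqP].
Qed.

(* Along the [i]-th axis some partial derivative must not vanish. *)
Lemma row_form i : exists r t b, (0 < b)%N /\ forall m, A r m = (b * (m == i) + (m == t))%N.
Proof.
pose h (m : 'I_n) : {poly 'F_p} := if m == i then 'X else 0.
have [l /eqP hl] : exists l, \sum_r (A r l)%:R * \prod_m h m ^+ (A r m - (l == m)) <> 0.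
  apply/existsNP => h0; have := @no_curve _ idfun h i h0.
  by rewrite /h eqxx size_polyX.
have [r /term_neq0[h1 h2]] : exists r, (A r l)%:R * \prod_m h m ^+ (A r m - (l == m)) != 0.
  apply: contrapT => /forallNP hr; move: hl; rewrite big1 ?eqxx // => r _.
  by apply/eqP/negPn/negP => /hr.
have h3 m : m != i -> A r m = (l == m) by move=> mi; apply: h2; rewrite /h (negbTE mi).
have [li|li] := eqVneq l i.
  (* Here the row is a pure power of x_i, which is written with [t = i]; the exponent is at least 2
     because no row is a unit vector. *)
  exists r, i, (A r i).-1; rewrite -li in h1 h3 *; split; last first.
    move=> m; have [->|ml] := eqVneq m l; first by rewrite muln1 addn1 prednK.
    by rewrite muln0 h3 // eq_sym (negbTE ml).
  rewrite -subn1 subn_gt0 ltn_neqAle h1 andbT eq_sym; apply/eqP => e.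
  apply: (@no_unit_row r l) => m; have [->|ml] := eqVneq m l; first by rewrite e.
  by rewrite h3 // eq_sym (negbTE ml).
exists r, l, (A r i); split; last first.
  move=> m; have [->|mi] := eqVneq m i; first by rewrite muln1 eq_sym (negbTE li) addn0.
  by rewrite muln0 h3 // eq_sym.
rewrite lt0n; apply/eqP => e; apply: (@no_unit_row r l) => m.
have [->|mi] := eqVneq m i; first by rewrite e eq_sym (negbTE li).
by rewrite h3 // eq_sym.
Qed.

(** With rows b_i e_i + e_(tau i), the equation V A = J reads, column by column, a_i U_i + U_k = 1
    with a_i >= 2 and at most one further term U_k. Comparing with a maximal |U_i| gives |U| <= 1;
    hence U >= 0, hence U <= 1/2, hence a_i U_i >= 1/2. *)
Lemma V_pos j : 0 < V j.
Proof.
have /choice[f hf] : forall i, exists x : 'I_n * 'I_n * nat, (0 < x.2)%N /\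
    forall m, A x.1.1 m = (x.2 * (m == i) + (m == x.1.2))%N.
  by move=> i; have [r [t [b hb]]] := row_form i; exists (r, t, b).
pose r i := (f i).1.1; pose tau i := (f i).1.2; pose b i := (f i).2.
have b_gt0 i : (0 < b i)%N by have [] := hf i.
have rE i m : A (r i) m = (b i * (m == i) + (m == tau i))%N by have [] := hf i.
have r_inj : injective r.
  move=> i k e; apply/eqP/negPn/negP => ik.
  have := rE i i; rewrite e rE eqxx (negbTE ik) muln0 muln1 add0n => e1.
  have := rE i k; rewrite e rE eqxx [k == i]eq_sym (negbTE ik) muln0 muln1 add0n => e2.
  have b1 := b_gt0 i; have b2 := b_gt0 k.
  have bi1 : b i = 1%N by move: e1 b1; case: (i == tau k); case: (i == tau i) => /=; lia.
  have ti : k == tau i by move: e2 b2; case: (k == tau i) => //; case: (k == tau k) => /=; lia.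
  apply: (no_pair_row (r := r i) ik) => m.
  by rewrite rE bi1 mul1n (eqP ti).
have two_le i : (2 <= b i + (i == tau i))%N.
  rewrite leqNgt; apply/negP => h; have bi := b_gt0 i.
  have [e1 e2] : b i = 1%N /\ i != tau i by move: h bi; case: (i == tau i) => /=; lia.
  by apply: (no_pair_row (r := r i) e2) => m; rewrite rE e1 mul1n.
have tau_inj i j1 j2 : j1 != i -> j2 != i -> tau j1 = i -> tau j2 = i -> j1 = j2.
  move=> n1 n2 t1 t2; apply/eqP/negPn/negP => j12.
  (* Two arrows j1, j2 into [i] would make the derivative in x_i contain x_j1^b1 + x_j2^b2. The
     curve (c t^b2, t^b1) in the plane of these two variables, with c^b1 = -1, annihilates this
     binomial, and every other term of the gradient contains a vanishing coordinate. *)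
  have [c hc] : exists c : Fpbar p, c ^+ b j1 = -1.
    have [|c] := @closed_rootP (Fpbar p) ('X^(b j1) - (-1)%:P) _.
      by rewrite size_XnsubC // eqSS -lt0n.
    by rewrite rootE !hornerE => ?; exists c; apply/eqP; rewrite -subr_eq0.
  pose h (m : 'I_n) : {poly Fpbar p} := if m == j1 then c%:P * 'X^(b j2) else if m == j2 then 'X^(b j1) else 0.
  suff h0 l : \sum_r (A r l)%:R * \prod_m h m ^+ (A r m - (l == m)) = 0.
    have := @no_curve _ (Fp_in_Fpbar p) h j2 h0.
    by rewrite /h eq_sym (negbTE j12) eqxx size_polyXn ltnS leqNgt b_gt0.
  have hz m : m != j1 -> m != j2 -> h m = 0 by move=> m1 m2; rewrite /h (negbTE m1) (negbTE m2).
  rewrite (reindex_inj r_inj) /=.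
  have tz k : k != j1 -> k != j2 -> (A (r k) l)%:R * \prod_m h m ^+ (A (r k) m - (l == m)) = 0.
    move=> k1 k2; apply/eqP/negPn/negP => /term_neq0[h1 h2].
    have := h2 k (hz k k1 k2); rewrite rE eqxx muln1 => e1; have bk := b_gt0 k.
    have [e2 [e3 e4]] : b k = 1%N /\ k != tau k /\ l == k.
      by move: e1 bk; case: (k == tau k); case: (l == k) => /=; lia.
    by apply: (no_pair_row (r := r k) e3) => m; rewrite rE e2 mul1n.
  have hi : h i = 0 by apply: hz; rewrite eq_sym.
  rewrite (bigD1 j1) //= [X in _ + X](bigD1 j2) 1?eq_sym //= [X in _ + (_ + X)]big1 ?addr0; last by move=> k /andP[k1 k2]; exact: tz.
  have pr k : k != i -> tau k = i -> (A (r k) l)%:R * \prod_m h m ^+ (A (r k) m - (l == m)) =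
      if l == i then h k ^+ b k else 0.
    move=> ki tk; case: eqP => [->|/eqP li].
      rewrite rE tk eqxx eq_sym (negbTE ki) muln0 mul1r (bigD1 k) //= big1 ?mulr1.
        by rewrite rE tk eqxx [i == k]eq_sym (negbTE ki) muln1 subn0 addn0.
      by move=> m mk; rewrite rE tk (negbTE mk) muln0 add0n [i == m]eq_sym subnn.
    apply/eqP/negPn/negP => /term_neq0[_ /(_ i hi)]; rewrite rE tk eqxx (negbTE li) eq_sym (negbTE ki).
    by rewrite muln0.
  rewrite !pr //; case: eqP => _; last by rewrite addr0.
  rewrite /h !eqxx eq_sym (negbTE j12) exprMn -polyC_exp hc -!exprM mulnC polyCN mulN1r.
  by rewrite addrC subrr.
have r_bij := injF_bij r_inj.
pose U i := V (r i).
have col i : (b i + (i == tau i))%:R * U i + \sum_(k | (k != i) && (tau k == i)) U k = 1.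
  rewrite -[RHS](VA1 i) [RHS](reindex_inj r_inj) /= [RHS](bigD1 i) //= rE eqxx muln1 mulrC; congr (_ + _).
  rewrite big_mkcondr; apply: eq_bigr => k ki; rewrite rE [i == k]eq_sym (negbTE ki) muln0 add0n eq_sym.
  by case: eqP => _; rewrite ?mulr1 ?mulr0.
have colE i : exists2 a : nat, (2 <= a)%N & a%:R * U i = 1 \/ exists k, a%:R * U i + U k = 1.
  exists (b i + (i == tau i))%N; first exact: two_le.
  have := col i; case: (pickP (fun k => (k != i) && (tau k == i))) => [k /andP[ki /eqP tk]|hk].
    rewrite (bigD1 k) /=; last by rewrite ki tk eqxx.
    rewrite [X in _ + (_ + X)]big1 ?addr0 => [e|l /andP[/andP[li /eqP tl] lk]]; first by right; exists k.
    by case/eqP: lk; apply: (tau_inj i).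
  by rewrite big_pred0 // addr0; left.
have [j' ej] : exists j', j = r j' by have [g _ gK] := r_bij; exists (g j); rewrite gK.
have h1 i : `|U i| <= 1.
  case: (Order.TotalTheory.arg_maxP (fun i => `|U i|) (isT : xpredT j')) => k _ hk.
  apply: le_trans (hk i isT) _; have [a a2 [e|[l e]]] := colE k.
    have : (2 : rat) <= a%:R by rewrite ler_nat.
    have := normr_ge0 (U k); have := congr1 Num.norm e; rewrite normrM normr_nat normr1.
    move: `|U k| (a%:R : rat) => x y; nra.
  have hl : `|U l| <= `|U k| := hk l isT.
  have : (2 : rat) <= a%:R by rewrite ler_nat.
  have : a%:R * `|U k| <= 1 + `|U l|.
    have e' : a%:R * U k = 1 - U l by apply/eqP; rewrite eq_sym subr_eq eq_sym; apply/eqP.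
    rewrite -[X in X * _](@normr_nat rat) -normrM e'.
    by apply: le_trans (ler_normB _ _) _; rewrite normr1.
  have := normr_ge0 (U k); move: hl; move: `|U k| `|U l| (a%:R : rat) => x z y; nra.
have h2 i : 0 <= U i <= 2^-1.
  have U1 k : U k <= 1 by exact: le_trans (ler_norm _) (h1 k).
  have U0 k : 0 <= U k.
    have [a a2 h] := colE k; have a2' : (2 : rat) <= a%:R by rewrite ler_nat.
    have a0 : (0 : rat) < a%:R by lra.
    rewrite -(pmulr_rge0 _ a0); case: h => [->//|[l e]]; have := U1 l; lra.
  rewrite U0 /=; have [a a2 h] := colE i; have a2' : (2 : rat) <= a%:R by rewrite ler_nat.
  have h3 : a%:R * U i <= 1 by case: h => [->//|[l e]]; have := U0 l; lra.
  have := U0 i; move: h3 a2'; move: (U i) (a%:R : rat) => x y; nra.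
rewrite ej -/(U j'); have [a a2 h] := colE j'; have a2' : (2 : rat) <= a%:R by rewrite ler_nat.
have a0 : (0 : rat) < a%:R by lra.
rewrite -(pmulr_rgt0 _ a0); case: h => [->//|[l e]]; have /andP[_ ] := h2 l; lra.
Qed.

End Positivity.

(** * Counting solutions modulo [p] *)

Lemma sum_count_mem (T : finType) (s : seq T) : (\sum_x count_mem x s = size s)%N.
Proof.
rewrite (eq_bigr (fun x => \sum_(y <- s) (y == x))%N) => [|x _]; last by rewrite -sum1_count big_mkcond.
rewrite exchange_big /= -sum1_size; apply: eq_bigr => y _.
by rewrite (bigD1 y) //= eqxx big1 // => x; rewrite eq_sym => /negbTE ->.
Qed.

(** The multinomial formula without division; the recursion comes from choosing the first entry of
    an arrangement. *)
Lemma size_permutations_fact (T : finType) (s : seq T) :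
  (size (permutations s) * \prod_x (count_mem x s)`! = (size s)`!)%N.
Proof.
move Dn: (size s) => N; elim: N s Dn => [|N IH] s Dn.
  by rewrite (size0nil Dn) big1.
rewrite (perm_size (permutationsE _)) ?Dn // size_allpairs_dep sumnE big_map big_distrl /=.
transitivity (\sum_(x <- undup s) count_mem x s * N`!)%N.
  apply: eq_big_seq => x; rewrite mem_undup => xs.
  rewrite -(IH (rem x s)); last by rewrite size_rem // Dn.
  rewrite mulnCA; congr (_ * _)%N; rewrite (bigD1 x) //= [in RHS](bigD1 x) //= mulnA; congr (_ * _)%N.
    have -> : count_mem x s = (count_mem x (rem x s)).+1.
      by have /permP/(_ (pred1 x)) /= := perm_to_rem xs; rewrite eqxx.
    by rewrite factS.
  apply: eq_bigr => y yx; have /permP/(_ (pred1 y)) /= := perm_to_rem xs.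
  by rewrite eq_sym (negbTE yx) => ->.
rewrite -big_distrl /= factS -Dn -(sum_count_mem s); congr (_ * _)%N.
rewrite big_uniq ?undup_uniq //= big_mkcond; apply: eq_bigr => x _.
by rewrite mem_undup; case: ifPn => // /count_memPn ->.
Qed.

Section PowerSums.
Variable p : nat.
Hypothesis p_prime : prime p.

Let cardp : #|'F_p| = p. Proof. exact: card_Fp. Qed.

Lemma Fp_fermat (a : 'F_p) : a != 0 -> a ^+ p.-1 = 1.
Proof.
move=> a0; apply: (mulfI a0); rewrite -exprS prednK ?prime_gt0 // mulr1.
by have := expf_card a; rewrite cardp.
Qed.

Lemma Fp_p0 : (p%:R : 'F_p) = 0.
Proof. exact: (pcharf0 (pchar_Fp p_prime)). Qed.

(** If p - 1 does not divide [m], some nonzero [b] has b^m <> 1, and the substitution a -> b a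
    forces the sum to vanish. For [m = 0] the convention 0^0 = 1 makes the sum equal to [p], that is
    0. *)
Lemma power_sum m : \sum_(a : 'F_p) a ^+ m =
  if (0 < m)%N && (p.-1 %| m)%N then -1 else 0.
Proof.
have p1 : (1 < p)%N := prime_gt1 p_prime.
case: posnP => [->|m0] /=.
  by rewrite (eq_bigr (fun=> 1)) // sumr_const cardp Fp_p0.
case: ifPn => [/dvdnP[k ek]|hm].
  rewrite (bigD1 0) //= expr0n gtn_eqF // add0r (eq_bigr (fun=> 1)) => [|a a0]; last first.
    by rewrite ek mulnC exprM Fp_fermat // expr1n.
  rewrite sumr_const cardC1 cardp.
  by apply/eqP; rewrite -addr_eq0 -[X in _ + X](mulr1n 1) -mulrnDr addn1 prednK ?prime_gt0 // Fp_p0.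
(* Otherwise all p - 1 nonzero elements would be roots of unity of exponent m mod (p - 1), which is
   positive and less than p - 1. *)
have [b b0 hb] : exists2 b : 'F_p, b != 0 & b ^+ m != 1.
  apply: contrapT => hn.
  pose m' := (m %% p.-1)%N; have m'0 : (0 < m')%N by rewrite lt0n.
  have hr (b : 'F_p) : b != 0 -> b ^+ m' = 1.
    move=> b0; have : b ^+ m = 1 by apply/eqP/negPn/negP => h; apply: hn; exists b.
    by rewrite {1}(divn_eq m p.-1) exprD mulnC exprM Fp_fermat // expr1n mul1r.
  have := @max_unity_roots _ m' [seq b <- enum 'F_p | b != 0] m'0 _ _.
  rewrite filter_uniq ?enum_uniq // size_filter.
  have -> : count (fun b => b != 0) (enum 'F_p) = p.-1.
    by rewrite -sum1_count big_enum_cond sum1_card -[RHS](congr1 predn cardp) -(cardC1 0); apply: eq_card => b; rewrite !inE.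
  rewrite leqNgt ltn_pmod ?ltn_predRL // => h; have //: false; apply: h => //.
  by apply/allP => b; rewrite mem_filter => /andP[b0 _]; rewrite unity_rootE hr.
have : \sum_(a : 'F_p) a ^+ m = b ^+ m * \sum_(a : 'F_p) a ^+ m.
  rewrite [LHS](reindex_inj (mulfI b0)) mulr_sumr; apply: eq_bigr => a _; exact: exprMn.
move/eqP; rewrite -subr_eq0 -[X in X - _]mul1r -mulrBl mulf_eq0 subr_eq0 eq_sym (negbTE hb).
by move/eqP.
Qed.

End PowerSums.

Section Affine.
Variables (p n : nat) (A : 'M[nat]_n).
Hypothesis p_prime : prime p.
Hypothesis A_BH : berglund_hubsch p A.
Hypothesis A_CY : pairing A (J n) (J n) = 1.
Hypothesis n_ge3 : (3 <= n)%N.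
Variable k : 'I_n -> nat.
Hypothesis kE : forall j, (k j)%:R = (p.-1)%:R * (ratmx (J n) *m invA A) 0 j.

Definition We (y : 'rV['F_p]_n) : 'F_p := \sum_i \prod_j y 0 j ^+ A i j.

Let s := flatten [seq nseq (k i) i | i <- enum 'I_n].

Lemma count_s i : count_mem i s = k i.
Proof.
rewrite /s count_flatten -map_comp sumnE big_map big_enum /= (bigD1 i) //= count_nseq /= eqxx mul1n.
by rewrite big1 ?addn0 // => j ji; rewrite count_nseq /= (negbTE ji).
Qed.

Lemma sum_k : (\sum_i k i = p.-1)%N.
Proof.
have e : \sum_j (ratmx (J n) *m invA A) 0 j = 1.
  rewrite -A_CY /pairing mxE; apply: eq_bigr => j _; by rewrite !mxE mulr1.
apply/eqP; rewrite -(eqr_nat rat) natr_sum (eq_bigr _ (fun j _ => kE j)) -mulr_sumr e mulr1 //.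
Qed.

Lemma size_s : size s = p.-1.
Proof.
rewrite -sum_k /s size_flatten /shape -map_comp sumnE big_map big_enum /=.
by apply: eq_bigr => i _; rewrite size_nseq.
Qed.

(** [phi] picks one monomial of [W] from each of the p - 1 factors of the power; this is an exponent
    of their product. *)
Definition expo (phi : {ffun 'I_p.-1 -> 'I_n}) j : nat := (\sum_e A (phi e) j)%N.

Lemma expoE phi j : expo phi j = (\sum_i count_mem i (codom phi) * A i j)%N.
Proof.
rewrite /expo (partition_big phi xpredT) //=; apply: eq_bigr => i _.
rewrite (eq_bigr (fun=> A i j)) => [|e /eqP -> //]; rewrite sum_nat_const; congr (_ * _)%N.
by rewrite -!sum1_card -sum1_count big_map big_enum_cond.
Qed.

(** Weighted by [w], the exponents add up to p - 1, just as if each of them were p - 1; positive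
    multiples of p - 1 must therefore all equal p - 1. The numbers of times the rows are chosen then
    form a vector c with c A = (p - 1) J, and [A] is invertible. *)
Lemma expo_perm phi : [forall j, (0 < expo phi j)%N && (p.-1 %| expo phi j)%N] = perm_eq (codom phi) s.
Proof.
have A_unit := bh_invertible A_BH.
apply/idP/idP => [/forallP h|/permP h].
  have h1 j : (p.-1 <= expo phi j)%N by have /andP[h1 h2] := h j; exact: dvdn_leq.
  have h2 : \sum_j (expo phi j)%:R * mulAmT A (J n) 0 j = (p.-1)%:R.
    rewrite (eq_bigr (fun j => \sum_e (A (phi e) j)%:R * mulAmT A (J n) 0 j)) => [|j _]; last first.
      by rewrite natr_sum mulr_suml.
    rewrite exchange_big /= (eq_bigr (fun=> 1)) => [|e _]; last exact: (Aw1 A_BH).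
    by rewrite sumr_const card_ord.
  have h3 j : expo phi j = p.-1.
    apply/eqP; rewrite eqn_leq h1 andbT leqNgt; apply/negP => hj.
    have : (p.-1)%:R < \sum_j (expo phi j)%:R * mulAmT A (J n) 0 j.
      rewrite -[X in X < _]mulr1 -[X in _ * X < _](sum_w1 A_CY) mulr_sumr (bigD1 j) //= [X in _ < X](bigD1 j) //=.
      apply: ltr_leD; first by rewrite ltr_pM2r ?(w_pos A_BH) // ltr_nat.
      by apply: ler_sum => i _; rewrite ler_wpM2r ?ler_nat // ltW // (w_pos A_BH).
    by rewrite h2 ltxx.
  apply/allP => i _ /=; rewrite count_s -(eqr_nat rat) kE.
  have -> : (count_mem i (codom phi))%:R = \sum_l (count_mem l (codom phi))%:R * (l == i)%:R :> rat.
    by rewrite (bigD1 i) //= eqxx mulr1 big1 ?addr0 // => l li; rewrite (negbTE li) mulr0.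
  rewrite (eq_bigr (fun l => \sum_j (count_mem l (codom phi))%:R * ((A l j)%:R * invA A j i))) => [|l _]; last first.
    by rewrite -(bh_invAE A_BH) mulr_sumr.
  rewrite exchange_big /= (VE A i) mulr_sumr; apply/eqP; apply: eq_bigr => j _.
  rewrite (eq_bigr (fun l => (count_mem l (codom phi) * A l j)%:R * invA A j i)) => [|l _]; last by rewrite natrM mulrA.
  by rewrite -mulr_suml -natr_sum -expoE h3.
apply/forallP => j; suff -> : expo phi j = p.-1 by rewrite dvdnn -ltnS prednK ?prime_gt1 // prime_gt0.
apply/eqP; rewrite expoE -(eqr_nat rat) natr_sum.
rewrite (eq_bigr (fun i => p.-1%:R * ((ratmx (J n) *m invA A) 0 i * (A i j)%:R))) => [|i _]; last first.
  by rewrite h count_s natrM kE mulrA.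
by rewrite -mulr_sumr (VA1 A_BH) mulr1.
Qed.

Definition Nk : nat := size (permutations s).

Lemma Nk_fact : (Nk * \prod_i (k i)`! = (p.-1)`!)%N.
Proof.
rewrite -size_s -(size_permutations_fact s); congr (_ * _)%N.
by apply: eq_bigr => i _; rewrite count_s.
Qed.

Lemma card_phi : #|[set phi : {ffun 'I_p.-1 -> 'I_n} | perm_eq (codom phi) s]%SET| = Nk.
Proof.
rewrite cardE -(size_map (fun phi : {ffun 'I_p.-1 -> 'I_n} => codom phi)) /Nk; apply: perm_size.
apply: uniq_perm; [|exact: permutations_uniq|move=> t].
  rewrite map_inj_uniq ?enum_uniq // => f g e; apply/ffunP => x.
  have /eq_in_map h : map f (enum 'I_p.-1) = map g (enum 'I_p.-1) by exact: e.
  by apply: h; rewrite mem_enum.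
rewrite mem_permutations; apply/mapP/idP => [[phi]|ht]; first by rewrite mem_enum inE => h ->.
have st : size t = p.-1 by rewrite (perm_size ht) size_s.
have n0 : (0 < n)%N by exact: leq_trans n_ge3.
pose phi : {ffun 'I_p.-1 -> 'I_n} := [ffun e : 'I_p.-1 => nth (Ordinal n0) t e].
have e : codom phi = t.
  apply: (@eq_from_nth _ (Ordinal n0)) => [|i]; rewrite size_codom card_ord ?st // => hi.
  rewrite (nth_map (Ordinal hi)) ?size_enum_ord // ffunE nth_enum_ord //.
by exists phi; rewrite ?mem_enum ?inE e.
Qed.

(** After expansion the sum of each monomial factors over the coordinates. Only the choices with all
    exponents equal to p - 1 survive, and each contributes (-1)^n. *)
Lemma sum_We : \sum_y We y ^+ p.-1 = (-1) ^+ n * Nk%:R.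
Proof.
have e1 y : We y ^+ p.-1 = \sum_(phi : {ffun 'I_p.-1 -> 'I_n}) \prod_j y 0 j ^+ expo phi j.
  rewrite -[in LHS](card_ord p.-1) -prodr_const /We.
  rewrite (bigA_distr_bigA (fun (e : 'I_p.-1) i => \prod_j y 0 j ^+ A i j)) /=.
  apply: eq_bigr => phi _; rewrite exchange_big /=; apply: eq_bigr => j _.
  by rewrite prodrXr.
rewrite (eq_bigr _ (fun y _ => e1 y)) exchange_big /=.
have e2 (m : 'I_n -> nat) : \sum_(y : 'rV['F_p]_n) \prod_j y 0 j ^+ m j =
    if [forall j, (0 < m j)%N && (p.-1 %| m j)%N] then (-1) ^+ n else 0.
  rewrite (reindex (fun f : {ffun 'I_n -> 'F_p} => \row_j f j)) /=; last first.
    apply: onW_bij; exists (fun y : 'rV['F_p]_n => [ffun j => y 0 j]) => [f|y].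
      by apply/ffunP => j; rewrite ffunE mxE.
    by apply/rowP => j; rewrite mxE ffunE.
  rewrite (eq_bigr (fun f : {ffun 'I_n -> 'F_p} => \prod_j (fun j a => a ^+ m j) j (f j))) => [|f _]; last first.
    by apply: eq_bigr => j _; rewrite mxE.
  rewrite -(bigA_distr_bigA (fun j (a : 'F_p) => a ^+ m j)) /=.
  rewrite (eq_bigr _ (fun j _ => power_sum p_prime (m j))).
  case: ifPn => [/forallP h|/forallPn[j hj]].
    rewrite (eq_bigr (fun=> -1)) => [|j _]; last by rewrite h.
    by rewrite prodr_const card_ord.
  by rewrite (bigD1 j) //= (negbTE hj) mul0r.
rewrite (eq_bigr (fun phi : {ffun 'I_p.-1 -> 'I_n} => if perm_eq (codom phi) s then (-1) ^+ n else 0)) => [|phi _]; last first.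
  by rewrite e2 expo_perm.
rewrite -big_mkcond /= (eq_bigl (fun phi : {ffun 'I_p.-1 -> 'I_n} => phi \in [set phi : {ffun 'I_p.-1 -> 'I_n} | perm_eq (codom phi) s]%SET)) => [|phi]; last by rewrite inE.
by rewrite sumr_const card_phi mulr_natr.
Qed.

(** By Fermat 1 - W^(p-1) is the indicator function of the zeros, and the p^n points contribute 0 to
    the constant part. *)
Lemma card_affine : (#|[set y | We y == 0]%SET|%:R : 'F_p) = - (-1) ^+ n * Nk%:R.
Proof.
have p1 : (0 < p.-1)%N by rewrite -ltnS prednK ?prime_gt1 // prime_gt0.
rewrite mulNr -sum_We -sum1_card natr_sum.
have -> : \sum_(y in [set y | We y == 0]%SET) (1%:R : 'F_p) = \sum_y (1 - We y ^+ p.-1).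
  rewrite big_mkcond; apply: eq_bigr => y _; rewrite inE; case: eqP => [->|/eqP h].
    by rewrite expr0n gtn_eqF // subr0.
  by rewrite Fp_fermat // subrr.
rewrite sumrB sumr_const card_mx mul1n card_Fp // -mulr_natr natrX Fp_p0 //.
by rewrite expr0n gtn_eqF ?mulr0 ?sub0r //; exact: leq_trans n_ge3.
Qed.

End Affine.

(** * Rational points of the hypersurface *)

Section Points.
Variables (p n : nat) (A : 'M[nat]_n) (w : 'I_n -> nat) (m : nat).
Hypothesis p_prime : prime p.
Hypothesis w_gt0 : forall i, (0 < w i)%N.
Hypothesis W_weight : forall i, (\sum_j A i j * w j = m)%N.

Local Notation L := (Fpbar p).
Local Notation io := (Fp_in_Fpbar p).
Implicit Types (x y z : 'rV[L]_n) (a b : 'rV['F_p]_n).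

Let p_gt0 : (0 < p)%N := prime_gt0 p_prime.
Let p1_gt0 : (0 < p.-1)%N.
Proof. by rewrite -ltnS prednK ?prime_gt1. Qed.

Lemma expr_p (z : L) : z ^+ p = z * z ^+ p.-1.
Proof. by rewrite -exprS; congr (_ ^+ _); rewrite prednK. Qed.

Lemma Frobenius_fixed (z : L) : z ^+ p = z -> exists a : 'F_p, z = io a.
Proof.
move=> hz; have := congr1 (fun q => (map_poly io q).[z]) (finField_genPoly 'F_p).
rewrite card_Fp // rmorphB rmorph_prod rmorphXn /= map_polyX !hornerE hz subrr horner_prod.
move=> /esym/eqP/prodf_eq0[a _]; rewrite rmorphB /= map_polyX map_polyC !hornerE subr_eq0 => /eqP ->.
by exists a.
Qed.

Lemma io_Frobenius (a : 'F_p) : io a ^+ p = io a.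
Proof. by rewrite -rmorphXn /=; congr (io _); have := expf_card a; rewrite card_Fp. Qed.

Lemma eval_W x : mmap io (fun i => x 0 i) (W 'F_p A) = \sum_i \prod_j x 0 j ^+ A i j.
Proof.
rewrite /W raddf_sum; apply: eq_bigr => i _; rewrite /= mmapX.
by apply: eq_bigr => j _; rewrite mnmE.
Qed.

Lemma eval_W_io a : mmap io (fun i => (map_mx io a) 0 i) (W 'F_p A) = io (We A a).
Proof.
rewrite eval_W rmorph_sum; apply: eq_bigr => i _; rewrite rmorph_prod; apply: eq_bigr => j _.
by rewrite mxE rmorphXn.
Qed.

Lemma eval_W_scale x y (t : L) : (forall i, y 0 i = t ^+ w i * x 0 i) ->
  mmap io (fun i => y 0 i) (W 'F_p A) = t ^+ m * mmap io (fun i => x 0 i) (W 'F_p A).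
Proof.
move=> h; rewrite !eval_W mulr_sumr; apply: eq_bigr => i _.
rewrite -(W_weight i) -prodrXr -big_split; apply: eq_bigr => j _.
by rewrite h exprMn -exprM mulnC.
Qed.

Lemma wproj_refl x : wproj_eq w x x.
Proof. by exists 1; rewrite ?oner_eq0 // => i; rewrite expr1n mul1r. Qed.

Lemma wproj_sym x y : wproj_eq w x y -> wproj_eq w y x.
Proof.
move=> [t t0 h]; exists t^-1; rewrite ?invr_eq0 // => i.
by rewrite h mulrA -exprMn mulVf // expr1n mul1r.
Qed.

Lemma wproj_trans x y z : wproj_eq w x y -> wproj_eq w y z -> wproj_eq w x z.
Proof.
move=> [t t0 h] [u u0 g]; exists (u * t); rewrite ?mulf_neq0 // => i.
by rewrite g h exprMn mulrA.
Qed.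

Definition orb a : set 'rV[L]_n := [set z | wproj_eq w (map_mx io a) z].

Lemma orb_eq a b : orb a = orb b <-> wproj_eq w (map_mx io a) (map_mx io b).
Proof.
split=> [e|h]; first by have : orb b (map_mx io b) by [exact: wproj_refl]; rewrite -e.
apply/seteqP; split=> z hz; last exact: wproj_trans h hz.
exact: wproj_trans (wproj_sym h) hz.
Qed.

Definition Sol : {set 'rV['F_p]_n} := [set a | (a != 0) && (We A a == 0)]%SET.

(* Hilbert 90: an orbit fixed by the Frobenius map has a rational point. *)
Lemma X_pointsE : X_points p A w = orb @` [set a | a \in Sol].
Proof.
apply/seteqP; split=> [P [x [x0 Wx [t t0 ht] ->]]|P [a /= + <-]].
  (* With s^(p-1) = t^-1 the rescaled coordinates are fixed by the p-th power map: s^(p w) t^w x =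
     s^w x. *)
  have [s hs] : exists s : L, s ^+ p.-1 = t^-1.
    have [|s] := @closed_rootP L ('X^(p.-1) - (t^-1)%:P) _.
      by rewrite size_XnsubC // eqSS -lt0n.
    by rewrite rootE !hornerE => hs; exists s; apply/eqP; rewrite -subr_eq0.
  have s0 : s != 0.
    by apply/eqP => s0; move: hs; rewrite s0 expr0n gtn_eqF //= => /esym/eqP; rewrite invr_eq0 (negbTE t0).
  have hfix i : exists a : 'F_p, s ^+ w i * x 0 i = io a.
    apply: Frobenius_fixed; have := ht i; rewrite mxE => hti.
    rewrite exprMn hti mulrA; congr (_ * _); rewrite -exprM mulnC exprM -exprMn.
    by rewrite expr_p hs mulfVK.
  have [f hf] := choice hfix; pose a : 'rV['F_p]_n := \row_i f i.
  have hxa : wproj_eq w x (map_mx io a).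
    by exists s => // i; rewrite !mxE hf.
  exists a => /=.
    rewrite inE; apply/andP; split.
      apply: contraNneq x0 => a0; apply/eqP/rowP => i; apply: (mulfI (expf_neq0 (w i) s0)).
      have fi0 : f i = 0 by have /rowP/(_ i) := a0; rewrite !mxE.
      by rewrite hf fi0 rmorph0 mxE mulr0.
    have [s' _ hs'] := hxa; have := eval_W_scale hs'; rewrite Wx mulr0 eval_W_io => /eqP.
    by rewrite fmorph_eq0.
  apply/seteqP; split=> z hz; first exact: wproj_trans hxa hz.
  exact: wproj_trans (wproj_sym hxa) hz.
rewrite inE => /andP[a0 /eqP Wa]; exists (map_mx io a); split=> //.
- by rewrite map_mx_eq0.
- by rewrite eval_W_io Wa rmorph0.
exists 1; rewrite ?oner_eq0 // => i; by rewrite expr1n mul1r !mxE io_Frobenius.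
Qed.

Lemma biggcd_gt0 a : a != 0 -> (0 < \big[gcdn/0]_(i | a 0%R i != 0%R) w i)%N.
Proof.
move=> a0; have [i ai] : exists i, a 0 i != 0.
  apply: contrapT => /forallNP h; case/eqP: a0; apply/rowP => i; rewrite mxE.
  by apply/eqP/negPn/negP => /h.
by rewrite (bigD1 i) //= gcdn_gt0 w_gt0.
Qed.

(** The exponent [c] ensures that [z] has a finite order; this order divides all the [u i] in
    question, hence their gcd. *)
Lemma expr_gcd_eq1 (F : fieldType) (z : F) (P : pred 'I_n) (u : 'I_n -> nat) c :
  (0 < c)%N -> z ^+ c = 1 -> (forall i, P i -> z ^+ u i = 1) -> z ^+ (\big[gcdn/0]_(i | P i) u i) = 1.
Proof.
move=> c0 hc h; have [o ho _] := prim_order_exists c0 hc.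
apply/eqP; rewrite -(prim_order_dvd ho); apply/dvdn_biggcdP => i Pi.
by rewrite (prim_order_dvd ho) h.
Qed.

Lemma biggcd_muln (P : pred 'I_n) (u : 'I_n -> nat) c :
  (\big[gcdn/0]_(i | P i) u i * c = \big[gcdn/0]_(i | P i) (u i * c))%N.
Proof. by elim/big_rec2: _ => [|i x y _ <-]; rewrite ?mul0n ?muln_gcdl. Qed.

(** The weights may share a factor on the support of [a], so F_p^* acts on the fibre through the
    exponents w_i / g, with [g] their gcd over the support. If [t] moves [a] to a rational vector,
    then t^(w_i) is in F_p^* for [i] in the support, hence t^g is in F_p^*. The action is free
    because the w_i / g are coprime. *)
Lemma card_orb a : a \in Sol -> #|[set b in Sol | `[< orb b = orb a >]]%SET| = p.-1.
Proof.
rewrite inE => /andP[a0 /eqP Wa]; set g := (\big[gcdn/0]_(i | a 0%R i != 0%R) w i)%N.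
have g0 : (0 < g)%N by exact: biggcd_gt0.
have gw i : a 0 i != 0 -> (g %| w i)%N by move=> ai; apply: (biggcdn_inf i).
pose act (c : 'F_p) : 'rV['F_p]_n := \row_i (c ^+ (w i %/ g) * a 0 i).
have -> : [set b in Sol | `[< orb b = orb a >]]%SET = (act @: [set~ 0])%SET.
  apply/setP => b; rewrite !inE; apply/andP/imsetP => [[/andP[b0 _] /asboolP/orb_eq/wproj_sym[t t0 ht]]|[c]].
    have htg : (t ^+ g) ^+ p = t ^+ g.
      rewrite expr_p -[RHS]mulr1; congr (_ * _); rewrite -exprM.
      have gE : (g * p.-1 = \big[gcdn/0]_(i | a 0%R i != 0%R) (w i * p.-1))%N.
        exact: biggcd_muln.
      have key i : a 0 i != 0 -> t ^+ (w i * p.-1) = 1.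
        move=> ai; have hi := ht i; rewrite !mxE in hi.
        have ia0 : io (a 0 i) != 0 by rewrite fmorph_eq0.
        have e : t ^+ w i = io (b 0 i / a 0 i) by rewrite fmorph_div hi mulfK.
        have bi : b 0 i / a 0 i != 0 by rewrite -(fmorph_eq0 io) -e expf_neq0.
        by rewrite exprM e -rmorphXn /= Fp_fermat // rmorph1.
      have [i ai] : exists i, a 0 i != 0.
        apply: contrapT => /forallNP h; case/eqP: a0; apply/rowP => i; rewrite mxE.
        by apply/eqP/negPn/negP => /h.
      rewrite gE; apply: (expr_gcd_eq1 (c := (w i * p.-1)%N)) => //; last exact: key.
      by rewrite muln_gt0 w_gt0.
    have [c hc] := Frobenius_fixed htg; exists c.
      by rewrite !inE -(fmorph_eq0 io) -hc expf_neq0.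
    apply/rowP => i; apply: (fmorph_inj io); have hi := ht i; rewrite !mxE in hi *.
    rewrite hi rmorphM rmorphXn /= -hc -exprM; have [->|ai] := eqVneq (a 0 i) 0; first by rewrite rmorph0 !mulr0.
    by rewrite mulnC divnK ?gw.
  rewrite !inE => c0 ->.
  have [t ht] : exists t : L, t ^+ g = io c.
    have [|t] := @closed_rootP L ('X^g - (io c)%:P) _.
      by rewrite size_XnsubC // eqSS -lt0n.
    by rewrite rootE !hornerE => ht; exists t; apply/eqP; rewrite -subr_eq0.
  have t0 : t != 0.
    apply/eqP => t0; move: ht; rewrite t0 expr0n gtn_eqF //= => /esym/eqP.
    by rewrite fmorph_eq0 (negbTE c0).
  have hact i : (map_mx io (act c)) 0 i = t ^+ w i * (map_mx io a) 0 i.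
    rewrite !mxE rmorphM rmorphXn /= -ht -exprM; have [->|ai] := eqVneq (a 0 i) 0; first by rewrite rmorph0 !mulr0.
    by rewrite mulnC divnK ?gw.
  have hw : wproj_eq w (map_mx io a) (map_mx io (act c)) by exists t.
  split; last by apply/asboolP/orb_eq; exact: wproj_sym.
  apply/andP; split; last first.
    by have := eval_W_scale hact; rewrite !eval_W_io Wa rmorph0 mulr0 => /eqP; rewrite fmorph_eq0.
  apply: contraNneq a0 => e; apply/eqP/rowP => i; apply: (mulfI (expf_neq0 (w i %/ g) c0)).
  by have /rowP/(_ i) := e; rewrite !mxE mulr0.
rewrite card_in_imset ?cardsC1 ?card_Fp // => c d; rewrite !inE => c0 d0 e.
have : (c / d) ^+ 1 = 1.
  have hcd i : a 0 i != 0 -> (c / d) ^+ (w i %/ g) = 1.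
    move=> ai; have /rowP/(_ i) := e; rewrite !mxE => /(mulIf ai) ei.
    by rewrite exprMn exprVn ei mulfV // expf_neq0.
  have e1 : (\big[gcdn/0]_(i | a 0%R i != 0%R) (w i %/ g) = 1)%N.
    apply/eqP; rewrite -(eqn_pmul2r g0) mul1n; apply/eqP.
    rewrite biggcd_muln.
    by apply: eq_bigr => i ai; rewrite divnK ?gw.
  rewrite -e1; apply: (expr_gcd_eq1 p1_gt0) => //.
  by apply: Fp_fermat => //; rewrite mulf_neq0 // invr_eq0.
by rewrite expr1 => /(congr1 (fun x : 'F_p => x * d)); rewrite mulfVK // mul1r.
Qed.

(** Double counting of the pairs of a rational point and a nonzero rational zero on its orbit. *)
Lemma card_X_points : (#|` fset_set (X_points p A w)| * p.-1 = #|Sol|)%N.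
Proof.
have fX : finite_set (X_points p A w).
  by rewrite X_pointsE; apply: finite_image; apply: finite_finset.
rewrite -[in RHS]sum1_card.
have -> : (\sum_(b in Sol) 1 = \sum_(b in Sol) \sum_(P <- fset_set (X_points p A w)) (P == orb b))%N.
  apply: eq_bigr => b hb; rewrite (bigD1_seq (orb b)) ?fset_uniq //=.
    by rewrite eqxx big1 // => P /negbTE ->.
  by rewrite in_fset_set //; apply/mem_set; rewrite X_pointsE; exists b.
rewrite exchange_big /= (eq_big_seq (fun=> p.-1)).
  by rewrite big_const_seq count_predT iter_addn_0 mulnC.
move=> P; rewrite in_fset_set // => /set_mem; rewrite X_pointsE => -[a /= ha <-].
rewrite -(card_orb ha) -sum1_card [RHS]big_mkcond [LHS]big_mkcond; apply: eq_bigr => b _.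
rewrite inE; case: (b \in Sol) => //=.
have -> : (orb a == orb b) = `[< orb b = orb a >] by apply/eqP/asboolP.
by case: `[< _ >].
Qed.

End Points.

(** * The absolute value of [K] *)

Section Main.
Set Default Proof Using "All".
Variables (R : realType) (p : nat) (K : closedFieldType) (v : K -> R).
Hypotheses (p_prime : prime p) (K_Cp : is_Cp p v).

Lemma p_gt1 : (1 < p)%N. Proof. exact: prime_gt1. Qed.
Lemma p_gt0 : (0 < p)%N. Proof. exact: prime_gt0. Qed.
Lemma pR_gt0 : (0 : R) < p%:R. Proof. by rewrite ltr0n p_gt0. Qed.

Lemma v_ge0 x : 0 <= v x. Proof. exact: (Cp_ge0 K_Cp). Qed.
#[local] Hint Extern 0 (is_true (0 <= v _)) => exact: v_ge0 : core.
#[local] Hint Extern 0 (is_true (0 < p)%N) => exact: p_gt0 : core.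
#[local] Hint Extern 0 (is_true (1 < p)%N) => exact: p_gt1 : core.
#[local] Hint Extern 0 (is_true (0 < p%:R)) => exact: pR_gt0 : core.

Lemma vM x y : v (x * y) = v x * v y. Proof. exact: (Cp_mul K_Cp). Qed.
Lemma vp : v p%:R = p%:R^-1. Proof. exact: (Cp_normp K_Cp). Qed.

(** [is_Cp] provides only that v x = 0 forces x = 0. The value at 0 comes from v 0 = v 0 * p^-1, as
    p^-1 differs from 1. *)
Lemma v0 : v 0 = 0.
Proof.
have := vM 0 p%:R; rewrite mul0r vp => h.
have pn : (p%:R : R)^-1 != 1.
  by rewrite invr_eq1 pnatr_eq1; by case: p p_gt1 => [|[|]].
have : v 0 * (1 - p%:R^-1) = 0 by rewrite mulrBr mulr1 -h subrr.
by move/eqP; rewrite mulf_eq0 subr_eq0 [1 == _]eq_sym (negbTE pn) orbF => /eqP.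
Qed.

Lemma v_eq0 x : (v x == 0) = (x == 0).
Proof.
by apply/eqP/eqP => [/(Cp_eq0 K_Cp)//|->]; exact: v0.
Qed.

Lemma v_gt0 x : (0 < v x) = (x != 0).
Proof. by rewrite lt_neqAle v_ge0 andbT eq_sym v_eq0. Qed.

Lemma v1 : v 1 = 1.
Proof.
have h : v 1 != 0 by rewrite v_eq0 oner_neq0.
by apply: (mulfI h); rewrite -vM !mulr1.
Qed.

Lemma vX x n : v (x ^+ n) = v x ^+ n.
Proof. by elim: n => [|n IH]; rewrite ?expr0 ?v1 // !exprS vM IH. Qed.

Lemma vN1 : v (-1) = 1.
Proof.
apply: (@pexpIrn _ 2) => //; rewrite ?nnegrE ?v_ge0 ?ler01 //.
by rewrite -vX sqrrN expr1n v1 expr1n.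
Qed.

Lemma vN x : v (- x) = v x. Proof. by rewrite -mulN1r vM vN1 mul1r. Qed.

Lemma vsign n : v ((-1) ^+ n) = 1. Proof. by rewrite vX vN1 expr1n. Qed.

Lemma vV x : v x^-1 = (v x)^-1.
Proof.
have [->|x0] := eqVneq x 0; first by rewrite invr0 v0 invr0.
have h : v x != 0 by rewrite v_eq0.
by apply: (mulfI h); rewrite -vM !mulfV // v1.
Qed.

Lemma vD x y (B : R) : v x <= B -> v y <= B -> v (x + y) <= B.
Proof.
move=> hx hy; apply: le_trans (Cp_ultrametric K_Cp x y) _.
by rewrite ge_max hx.
Qed.

Lemma vB x y (B : R) : v x <= B -> v y <= B -> v (x - y) <= B.
Proof. by move=> hx hy; apply: vD; rewrite ?vN. Qed.

Lemma v_sum (I : Type) (r : seq I) (P : pred I) (F : I -> K) (B : R) :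
  0 <= B -> (forall i, P i -> v (F i) <= B) -> v (\sum_(i <- r | P i) F i) <= B.
Proof.
move=> B0 h; apply: (big_ind (fun x => v x <= B)) => //; first by rewrite v0.
by move=> x y hx hy; apply: vD.
Qed.

Lemma v_nat_le1 n : v n%:R <= 1.
Proof.
elim: n => [|n IH]; first by rewrite v0 ler01.
by rewrite -natr1; apply: vD => //; rewrite v1.
Qed.

Lemma v_int_le1 (z : int) : v z%:~R <= 1.
Proof. by case: (intP z) => [|n|n]; rewrite ?v0 ?ler01 // ?mulrNz ?vN; exact: v_nat_le1. Qed.

Lemma v_natM_le n x (B : R) : v x <= B -> v (n%:R * x) <= B.
Proof.
move=> h; rewrite vM; apply: le_trans h; rewrite -[leRHS]mul1r.
by apply: ler_wpM2r; rewrite ?v_ge0 ?v_nat_le1.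
Qed.

Lemma pV_lt1 : (p%:R : R)^-1 < 1.
Proof. by rewrite invf_lt1 ?pR_gt0 // ltr1n p_gt1. Qed.

Lemma pV_gt0 : (0 : R) < p%:R^-1. Proof. by rewrite invr_gt0 pR_gt0. Qed.

(** By a Bezout relation between [n] and [p], the inequality v n < 1 would give v 1 < 1. *)
Lemma v_coprime n : coprime p n -> v n%:R = 1.
Proof.
move=> cop; apply/eqP; rewrite eq_le v_nat_le1 /= leNgt; apply/negP => h.
have [n0|n0] := posnP n.
  by move: cop h; rewrite n0 /coprime gcdn0 => /eqP e; move: p_gt1; rewrite e.
case: (egcdnP p n0) => km kn e _.
have eK : (km%:R * n%:R : K) = kn%:R * p%:R + 1.
  by rewrite -!natrM e gcdnC (eqP cop) natrD.
have : v 1 < 1.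
  have -> : (1 : K) = km%:R * n%:R - kn%:R * p%:R by rewrite eK addrAC subrr add0r.
  apply: le_lt_trans (_ : Num.max (v n%:R) (v p%:R) < 1).
    by apply: vB; apply: v_natM_le; rewrite le_max lexx ?orbT.
  by rewrite gt_max h vp pV_lt1.
by rewrite v1 ltxx.
Qed.

(** Characteristic zero is read off from the absolute value: powers of [p] and integers prime to [p]
    have nonzero absolute value. *)
Lemma natK_neq0 n : (n.+1)%:R != 0 :> K.
Proof.
have [e [m [cm en]]] : exists e m, coprime p m /\ n.+1 = (m * p ^ e)%N.
  have [m cm en] := pfactor_coprime p_prime (ltn0Sn n).
  by exists (logn p n.+1), m.
rewrite -v_eq0 en natrM natrX vM vX vp (v_coprime cm) mul1r.
by rewrite expf_neq0 // gt_eqF // pV_gt0.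
Qed.

Lemma natK_eq0 n : ((n%:R : K) == 0) = (n == 0%N).
Proof. by case: n => [|n]; rewrite ?eqxx // (negbTE (natK_neq0 n)). Qed.

Lemma v_nat n : (0 < n)%N -> v n%:R = (p%:R^-1) ^+ logn p n.
Proof.
move=> n0; have [m cm en] := pfactor_coprime p_prime n0.
by rewrite {1}en natrM natrX vM vX vp (v_coprime cm) mul1r.
Qed.

Lemma v_nat_ge n : (0 < n)%N -> n%:R^-1 <= v n%:R.
Proof.
move=> n0; rewrite v_nat // exprVn lef_pV2 ?posrE ?exprn_gt0 ?ltr0n ?p_gt0 //.
by rewrite -natrX ler_nat dvdn_leq // pfactor_dvdnn.
Qed.

Lemma intK_eq0 (z : int) : ((z%:~R : K) == 0) = (z == 0).
Proof.
case: (intP z) => [|n|n]; rewrite ?eqxx // ?mulrNz ?oppr_eq0.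
  by rewrite (negbTE (natK_neq0 n)).
by rewrite (negbTE (natK_neq0 n)).
Qed.

(** Since [K] has characteristic zero, the denominators stay invertible in [K]; the identity is then
    one between numerators and denominators. *)
Lemma ratrKD x y : ratr (x + y) = ratr x + ratr y :> K.
Proof.
have nz z : ((denq z)%:~R : K) != 0 by rewrite intK_eq0 denq_eq0.
have nzQ z : ((denq z)%:~R : rat) != 0 by rewrite intr_eq0 denq_eq0.
have e : (numq (x + y) * (denq x * denq y)
   = (numq x * denq y + numq y * denq x) * denq (x + y))%R.
  apply/eqP; rewrite -(eqr_int rat) !(intrM, intrD); apply/eqP.
  rewrite -[(numq (x + y))%:~R](divfK (nzQ (x + y))) divq_num_den.
  rewrite -[(numq x)%:~R](divfK (nzQ x)) divq_num_den.
  by rewrite -[(numq y)%:~R](divfK (nzQ y)) divq_num_den; ring.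
rewrite /ratr; apply/eqP; rewrite addf_div // eqr_div ?mulf_neq0 //.
by rewrite -!intrM -!intrD -!intrM e.
Qed.

Lemma ratrKM x y : ratr (x * y) = ratr x * ratr y :> K.
Proof.
have nz z : ((denq z)%:~R : K) != 0 by rewrite intK_eq0 denq_eq0.
have nzQ z : ((denq z)%:~R : rat) != 0 by rewrite intr_eq0 denq_eq0.
have e : (numq (x * y) * (denq x * denq y)
   = (numq x * numq y) * denq (x * y))%R.
  apply/eqP; rewrite -(eqr_int rat) !(intrM, intrD); apply/eqP.
  rewrite -[(numq (x * y))%:~R](divfK (nzQ (x * y))) divq_num_den.
  rewrite -[(numq x)%:~R](divfK (nzQ x)) divq_num_den.
  by rewrite -[(numq y)%:~R](divfK (nzQ y)) divq_num_den; ring.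
rewrite /ratr; apply/eqP; rewrite mulf_div // eqr_div ?mulf_neq0 //.
by rewrite -!intrM e.
Qed.

Lemma ratrK0 : ratr 0 = 0 :> K. Proof. exact: (ratr_int _ 0). Qed.
Lemma ratrK1 : ratr 1 = 1 :> K. Proof. exact: (ratr_int _ 1). Qed.

Lemma ratrK_sum (I : Type) (r : seq I) (P : pred I) (F : I -> rat) :
  ratr (\sum_(i <- r | P i) F i) = \sum_(i <- r | P i) ratr (F i) :> K.
Proof. exact: (big_morph _ ratrKD ratrK0). Qed.

Lemma ratrK_eq0 x : ((ratr x : K) == 0) = (x == 0).
Proof.
rewrite /ratr mulf_eq0 invr_eq0 !intK_eq0 denq_eq0 orbF.
by rewrite numq_eq0.
Qed.

(** * Convergent series in [K] *)

Definition tends_to (u : nat -> K) (l : K) : Prop :=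
  forall e : R, 0 < e -> exists N, forall i, (N <= i)%N -> v (u i - l) < e.

Lemma tends_to_unique u l l' : tends_to u l -> tends_to u l' -> l = l'.
Proof.
move=> h h'; apply/eqP; rewrite -subr_eq0 -v_eq0 eq_le v_ge0 andbT.
apply/ler_addgt0Pl => e e0; rewrite addr0.
have [N hN] := h _ e0; have [N' hN'] := h' _ e0.
pose i := maxn N N'.
have -> : l - l' = (u i - l') - (u i - l) by ring.
apply: vB; apply: ltW; first by apply: hN'; exact: leq_maxr.
by apply: hN; exact: leq_maxl.
Qed.

Definition ksum (u : nat -> K) : K :=
  xget 0 [set l | tends_to (fun n => \sum_(i < n) u i) l].

(** In a complete ultrametric field a series converges as soon as its terms tend to zero. *)
Definition summable (u : nat -> K) : Prop :=
  forall e : R, 0 < e -> exists N, forall i, (N <= i)%N -> v (u i) < e.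

Lemma ksumP u : summable u -> tends_to (fun n => \sum_(i < n) u i) (ksum u).
Proof.
move=> h; rewrite /ksum; apply: xgetPex.
have := Cp_complete K_Cp (u := fun n => \sum_(i < n) u i); apply=> e e0.
have e20 : 0 < e / 2 by rewrite divr_gt0.
have [N hN] := h _ e20; exists N.
have key a b : (N <= a)%N -> v (\sum_(i < a + b) u i - \sum_(i < a) u i) <= e / 2.
  move=> Na; rewrite big_split_ord /= addrAC subrr add0r.
  apply: v_sum => [|i _]; first exact: ltW.
  by apply/ltW/hN; rewrite (leq_trans Na) // leq_addr.
have e2 : e / 2 < e by rewrite ltr_pdivrMr // ltr_pMr // ltr1n.
move=> i j Ni Nj; case: (leqP i j) => ij.
  by rewrite -vN opprB; apply: le_lt_trans e2; rewrite -(subnKC ij); exact: key.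
by apply: le_lt_trans e2; rewrite -(subnKC (ltnW ij)); exact: key.
Qed.

Lemma ksum_eq (u : nat -> K) (l : K) : tends_to (fun n => \sum_(i < n) u i) l -> ksum u = l.
Proof.
move=> h; rewrite /ksum; apply: xget_unique => // y hy.
exact: tends_to_unique hy h.
Qed.

Lemma eq_ksum u u' : u =1 u' -> ksum u = ksum u'.
Proof. by move=> /funext ->. Qed.

Lemma eq_summable u u' : u =1 u' -> summable u -> summable u'.
Proof. by move=> /funext ->. Qed.

Lemma summableD u u' : summable u -> summable u' -> summable (fun i => u i + u' i).
Proof.
move=> h h' e e0; have [N hN] := h _ e0; have [N' hN'] := h' _ e0.
exists (maxn N N') => i; rewrite geq_max => /andP[Ni Ni'].
apply: le_lt_trans (Cp_ultrametric K_Cp _ _) _.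
by rewrite gt_max hN ?hN'.
Qed.

Lemma summableZ c u : summable u -> summable (fun i => c * u i).
Proof.
move=> h e e0; have c1 : 0 < v c + 1 by rewrite ltr_wpDl ?v_ge0.
have [N hN] := h (e / (v c + 1)) (divr_gt0 e0 c1).
exists N => i Ni; rewrite vM; apply: le_lt_trans (_ : (v c + 1) * v (u i) < e).
  by apply: ler_wpM2r; rewrite ?v_ge0 // lerDl.
by rewrite mulrC -ltr_pdivlMr //; apply: hN.
Qed.

Lemma ksumD u u' : summable u -> summable u' ->
  ksum (fun i => u i + u' i) = ksum u + ksum u'.
Proof.
move=> h h'; apply: ksum_eq => e e0.
have [N hN] := ksumP h e0; have [N' hN'] := ksumP h' e0.
exists (maxn N N') => i; rewrite geq_max => /andP[Ni Ni'].
rewrite big_split /= opprD addrACA.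
apply: le_lt_trans (Cp_ultrametric K_Cp _ _) _.
by rewrite gt_max hN ?hN'.
Qed.

Lemma ksumZ c u : summable u -> ksum (fun i => c * u i) = c * ksum u.
Proof.
move=> h; apply: ksum_eq => e e0.
have c1 : 0 < v c + 1 by rewrite ltr_wpDl ?v_ge0.
have [N hN] := ksumP h (divr_gt0 e0 c1).
exists N => i Ni; rewrite -mulr_sumr -mulrBr vM.
set x := (_ - _); apply: le_lt_trans (_ : (v c + 1) * v x < e).
  by apply: ler_wpM2r; rewrite ?v_ge0 // lerDl.
by rewrite mulrC -ltr_pdivlMr //; apply: hN.
Qed.

Lemma summable0 : summable (fun=> 0).
Proof. by move=> e e0; exists 0%N => i _; rewrite v0. Qed.

Lemma ksum0 : ksum (fun=> 0) = 0.
Proof. by apply: ksum_eq => e e0; exists 0%N => i _; rewrite big1 // subrr v0. Qed.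

Lemma summable_sum (I : Type) (r : seq I) (F : I -> nat -> K) :
  (forall i, summable (F i)) -> summable (fun m => \sum_(i <- r) F i m).
Proof.
move=> h; elim: r => [|i r IH].
  by apply: (@eq_summable (fun=> 0)) => [m|]; rewrite ?big_nil //; exact: summable0.
apply: (@eq_summable (fun m => F i m + \sum_(j <- r) F j m)).
  by move=> m; rewrite big_cons.
exact: summableD.
Qed.

Lemma ksum_sum (I : Type) (r : seq I) (F : I -> nat -> K) :
  (forall i, summable (F i)) ->
  ksum (fun m => \sum_(i <- r) F i m) = \sum_(i <- r) ksum (F i).
Proof.
move=> h; elim: r => [|i r IH].
  by rewrite big_nil -[RHS]ksum0; apply: eq_ksum => m; rewrite big_nil.
rewrite big_cons -IH -ksumD //; last exact: summable_sum.
by apply: eq_ksum => m; rewrite big_cons.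
Qed.

Lemma ksum_recl u : summable u -> ksum u = u 0%N + ksum (fun i => u i.+1).
Proof.
move=> h; have hS : summable (fun i => u i.+1).
  by move=> e e0; have [N hN] := h e e0; exists N => i Ni; apply: hN; exact: leqW.
apply: ksum_eq => e e0; have [N hN] := ksumP hS e0.
exists N.+1 => -[//|i] Ni; rewrite big_ord_recl /=.
set s := \sum_(_ < _) _.
by rewrite (_ : _ - _ = s - ksum (fun i => u i.+1)); [exact: hN|rewrite opprD addrACA subrr add0r].
Qed.

Lemma summableS u : summable u -> summable (fun i => u i.+1).
Proof.
by move=> h e e0; have [N hN] := h e e0; exists N => i Ni; apply: hN; exact: leqW.
Qed.

Lemma ksum_telescope u : summable u -> ksum (fun i => u i - u i.+1) = u 0%N.
Proof.
move=> h; rewrite (@eq_ksum _ (fun i => u i + (-1) * u i.+1)); last first.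
  by move=> i; rewrite mulN1r.
have hS := summableS h.
rewrite ksumD //; last exact: summableZ.
by rewrite ksumZ // (ksum_recl h) mulN1r addrK.
Qed.

Lemma v_ksum u B : 0 <= B -> summable u -> (forall i, v (u i) <= B) ->
  v (ksum u) <= B.
Proof.
move=> B0 h hB; apply/ler_addgt0Pl => e e0.
have [N /(_ N (leqnn N)) hN] := ksumP h e0.
have -> : ksum u = \sum_(i < N) u i - (\sum_(i < N) u i - ksum u) by rewrite opprB addrC subrK.
apply: vB; last by apply: ltW; apply: (lt_le_trans hN); rewrite lerDl.
apply: v_sum => [|i _]; first by rewrite addr_ge0 // ltW.
by apply: le_trans (hB _) _; rewrite lerDr ltW.
Qed.

Lemma summable_ev0 u N : (forall i, (N <= i)%N -> u i = 0) -> summable u.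
Proof. by move=> h e e0; exists N => i Ni; rewrite h // v0. Qed.

Lemma geom_to0 (C r e : R) : 0 <= r -> r < 1 -> 0 < e ->
  exists N, forall i, (N <= i)%N -> C * r ^+ i < e.
Proof.
move=> r0 r1 e0.
have [C0|C0] := leP C 0.
  exists 0%N => i _; apply: le_lt_trans e0.
  by rewrite mulr_le0_ge0 // exprn_ge0.
have [->|rn0] := eqVneq r 0.
  by exists 1%N => -[//|i] _; rewrite expr0n /= mulr0.
have rp : 0 < r by rewrite lt_neqAle eq_sym rn0.
pose d := r^-1 - 1.
have d0 : 0 < d by rewrite subr_gt0 invf_gt1.
have bern n : 1 + n%:R * d <= r^-1 ^+ n.
  elim: n => [|n IH]; first by rewrite mul0r addr0 expr0.
  rewrite exprS; apply: le_trans (_ : r^-1 * (1 + n%:R * d) <= _); last first.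
    by apply: ler_wpM2l => //; rewrite invr_ge0.
  have -> : r^-1 = d + 1 by rewrite subrK.
  have : 0 <= n%:R * d * d by rewrite !mulr_ge0 // ltW.
  by rewrite -natr1; lra.
pose N := Num.truncn (C / e / d).
exists N.+1 => i Ni.
have h : C / e < 1 + i%:R * d.
  rewrite -(@ltrBlDl) -ltr_pdivrMr // mulrBl.
  apply: lt_le_trans (_ : N.+1%:R <= _); last by rewrite ler_nat.
  apply: le_lt_trans (truncnS_gt _); rewrite /N gerBl divr_ge0 ?ler01 // ltW //.
have := lt_le_trans h (bern i); rewrite exprVn ltr_pdivrMr //.
by rewrite mulrC -ltr_pdivlMr ?invr_gt0 ?exprn_gt0 // invrK.
Qed.

Lemma summable_geom u (C r : R) : 0 <= r -> r < 1 ->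
  (forall i, v (u i) <= C * r ^+ i) -> summable u.
Proof.
move=> r0 r1 h e e0; have [N hN] := geom_to0 C r0 r1 e0.
by exists N => i Ni; apply: le_lt_trans (h i) (hN i Ni).
Qed.

(** * The root [pi] and the size of factorials *)

Variable (pi : K).
Hypothesis pi_root : pi ^+ p.-1 = - p%:R.

Lemma vpi_pow : v pi ^+ p.-1 = p%:R^-1.
Proof. by rewrite -vX pi_root vN vp. Qed.

Lemma vpi_gt0 : 0 < v pi.
Proof.
rewrite lt_neqAle v_ge0 andbT eq_sym; apply/eqP => h.
have := vpi_pow; rewrite h expr0n.
have -> : (p.-1 == 0)%N = false by case: p p_gt1 => [|[|]].
by move/eqP; rewrite eq_sym gt_eqF // pV_gt0.
Qed.

Lemma vpi_ge0 : 0 <= v pi. Proof. exact: ltW vpi_gt0. Qed.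

#[local] Hint Extern 0 (is_true (0 < v pi)) => exact: vpi_gt0 : core.

Lemma pi_neq0 : pi != 0.
Proof. by rewrite -v_gt0 vpi_gt0. Qed.

Lemma vpi_lt1 : v pi < 1.
Proof.
rewrite ltNge; apply/negP => h.
have : 1 <= v pi ^+ p.-1 by rewrite exprn_ege1.
by rewrite vpi_pow leNgt pV_lt1.
Qed.

Lemma vpi_le1 : v pi <= 1. Proof. exact: ltW vpi_lt1. Qed.

Lemma vpi_mono m n : (m <= n)%N -> v pi ^+ n <= v pi ^+ m.
Proof. by move=> mn; rewrite ler_wiXn2l // ?vpi_ge0 ?vpi_le1. Qed.

(** Legendre's formula as a recursion: every multiple of [p] up to [m] gives one factor [p], and the
    cofactors form a factorial again. *)
Lemma logn_fact_rec m : logn p m`! = (m %/ p + logn p (m %/ p)`!)%N.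
Proof.
have trunc k N : (k <= N)%N ->
    (\sum_(1 <= i < k.+1) k %/ p ^ i = \sum_(1 <= i < N.+1) k %/ p ^ i)%N.
  move=> kN; rewrite [RHS](@big_cat_nat _ _ _ k.+1) //=.
  rewrite [X in _ = (_ + X)%N](_ : _ = 0%N) ?addn0 //.
  rewrite big_nat_cond big1 // => i /andP[/andP[ki _] _].
  by rewrite divn_small // (leq_trans ki) // ltnW // ltn_expl // p_gt1.
rewrite !logn_fact //; case: m => [|m]; first by rewrite div0n !big_geq.
rewrite big_nat_recl // expn1; congr addn.
rewrite (trunc (m.+1 %/ p)%N m); last first.
  by rewrite -ltnS ltn_Pdiv ?p_gt1.
by apply: eq_bigr => i _; rewrite -divnMA -expnS.
Qed.

Lemma v_fact m : v (m`!)%:R = (v pi) ^+ (p.-1 * (m %/ p)) * v ((m %/ p)`!)%:R.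
Proof.
rewrite !v_nat ?fact_gt0 // logn_fact_rec exprD.
by rewrite -{1}vpi_pow -exprM.
Qed.

(** As |pi| = p^(-1/(p-1)), this is v_p(m!) <= m / (p - 1): the quotients pi^m / m! are integral. *)
Lemma v_fact_ge m : v pi ^+ m <= v (m`!)%:R.
Proof.
elim/ltn_ind: m => m IH; case: m IH => [|m] IH.
  by rewrite expr0 fact0 v1.
rewrite v_fact; set d := (_ %/ p)%N.
have dm : (p * d <= m.+1)%N by rewrite mulnC leq_trunc_div.
apply: le_trans (vpi_mono dm) _.
rewrite -{1}(prednK p_gt0) mulSn addnC exprD.
apply: ler_wpM2l; first by rewrite exprn_ge0 // vpi_ge0.
by apply: IH; rewrite ltn_Pdiv ?p_gt1.
Qed.

(** The converse up to a linear factor: v_p(m!) is (m - s) / (p - 1) with [s] the digit sum of [m],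
    which grows only logarithmically. So m! / pi^m grows at most linearly, and geometric decay
    survives multiplication by it. *)
Lemma v_fact_le m : v (m`!)%:R <= p%:R * (m.+1)%:R * v pi ^+ m.
Proof.
have small r : (r < p)%N -> 1 <= p%:R * v pi ^+ r.
  move=> rp; rewrite -ler_pdivrMl ?pR_gt0 // mulr1 -vpi_pow; apply: vpi_mono.
  by rewrite -ltnS prednK ?p_gt0.
suff h k : v ((k.+1)`!)%:R <= p%:R * (k.+1)%:R * v pi ^+ k.+1.
  case: m => [|m]; first by rewrite fact0 v1 mulr1; exact: small p_gt0.
  apply: le_trans (h m) _; rewrite ler_wpM2r ?exprn_ge0 ?vpi_ge0 //.
  by rewrite ler_wpM2l ?ler_nat // ltW.
elim/ltn_ind: k => k IH.
rewrite v_fact; set d := (_ %/ p)%N.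
have ek : (k.+1 = d * p + k.+1 %% p)%N by rewrite {1}(divn_eq k.+1 p).
have rp : (k.+1 %% p < p)%N by rewrite ltn_mod p_gt0.
case ed : d => [|d'].
  rewrite muln0 expr0 fact0 v1 mulr1 {2}ek ed mul0n add0n.
  apply: le_trans (small _ rp) _; rewrite ler_wpM2r ?exprn_ge0 ?vpi_ge0 //.
  by rewrite ler_pMr ?pR_gt0 // ler1n.
have dk : (d' < k)%N by rewrite -ltnS -ed ltn_Pdiv ?p_gt1.
apply: le_trans (ler_wpM2l _ (IH _ dk)) _; first by rewrite exprn_ge0 // vpi_ge0.
have -> : v pi ^+ (p.-1 * d'.+1) * (p%:R * d'.+1%:R * v pi ^+ d'.+1) =
   (p * d'.+1)%:R * v pi ^+ (d'.+1 * p).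
  by rewrite mulrCA -exprD natrM -mulSnr prednK // [(p * _)%N]mulnC.
apply: le_trans (_ : (p * d'.+1)%:R * (v pi ^+ (d'.+1 * p) *
    (p%:R * v pi ^+ (k.+1 %% p))) <= _).
  apply: ler_wpM2l => //; rewrite ler_peMr ?exprn_ge0 ?vpi_ge0 //.
  exact: small.
rewrite [v pi ^+ _ * _]mulrCA -exprD -ed -ek mulrA [_ * p%:R]mulrC.
rewrite ler_wpM2r ?exprn_ge0 ?vpi_ge0 // ler_wpM2l ?ler_nat ?ltW //.
by rewrite mulnC leq_trunc_div.
Qed.

(** * Series that invert first-order difference operators *)

Definition poch (a : K) m : K := \prod_(i < m) (a + i%:R).

Lemma poch0 a : poch a 0 = 1. Proof. by rewrite /poch big_ord0. Qed.

Lemma pochS a m : poch a m.+1 = poch a m * (a + m%:R).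
Proof. by rewrite /poch big_ord_recr. Qed.

Lemma poch_recl a m : poch a m.+1 = a * poch (a + 1) m.
Proof.
rewrite /poch big_ord_recl addr0; congr (_ * _); apply: eq_bigr => i _.
by rewrite /= /bump /= add1n -natr1 -addrA [1 + _]addrC.
Qed.

Definition zp_rational (a : K) : Prop :=
  exists (N : int) (D : nat), coprime p D /\ a = N%:~R / D%:R.

Lemma zp_rationalD_nat a n : zp_rational a -> zp_rational (a + n%:R).
Proof.
move=> [N [D [cD ->]]]; exists (N + (n * D)%:Z), D; split=> //.
have D0 : (D%:R : K) != 0.
  rewrite natK_eq0.
  by apply/eqP => h; move: cD; rewrite h /coprime gcdn0 => /eqP e; move: p_gt1; rewrite e.
rewrite intrD mulrDl (_ : (n * D)%N%:~R = n%:R * D%:R); last by rewrite -natrM.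
by rewrite mulfK.
Qed.

Lemma v_prod_sub m (x y : 'I_m -> K) (B : R) : 0 <= B ->
  (forall i, v (x i) <= 1) -> (forall i, v (y i) <= 1) ->
  (forall i, v (x i - y i) <= B) ->
  v (\prod_i x i - \prod_i y i) <= B.
Proof.
elim: m x y => [|m IH] x y B0 hx hy hxy.
  by rewrite !big_ord0 subrr v0.
rewrite !big_ord_recl.
set X := \prod_(i < m) _; set Y := \prod_(i < m) y _.
have -> : x ord0 * X - y ord0 * Y = x ord0 * (X - Y) + (x ord0 - y ord0) * Y by ring.
have Y1 : v Y <= 1.
  rewrite /Y; apply: (big_ind (fun z => v z <= 1)) => //.
    by rewrite v1.
  by move=> a b ha hb; rewrite vM -[leRHS]mulr1 ler_pM.
apply: (vD); rewrite vM.
  rewrite -[leRHS]mul1r ler_pM //; apply: IH => // i.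
by rewrite -[leRHS]mulr1 ler_pM.
Qed.

(** Replace [a] by a positive integer congruent to it modulo p^e, where [e] is the valuation of m!.
    At an integer the Pochhammer symbol is m! times a binomial coefficient, and the replacement
    changes the product by at most |m!|. *)
Lemma v_poch_le a m : zp_rational a -> v (poch a m) <= v (m`!)%:R.
Proof.
move=> [N [D [cD eaN]]].
have D0 : (0 < D)%N.
  rewrite lt0n; apply/eqP => h; move: cD; rewrite h /coprime gcdn0 => /eqP e.
  by move: p_gt1; rewrite e.
have DK : (D%:R : K) != 0 by rewrite natK_eq0 -lt0n.
pose e := logn p m`!.
have cDe : coprime D (p ^ e) by rewrite coprime_sym coprimeXl.
have [z zP] : exists z : nat, exists t : int, N - (D * z.+1)%:Z = (p ^ e)%:Z * t.
  case: (egcdnP (p ^ e) D0) => km kn eg _.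
  move: eg; rewrite (eqP cDe) => eg.
  (* The numerator times an inverse of the denominator modulo p^e, moved by a multiple of p^e to
     become positive. *)
  pose M : int := (N * km%:Z) + ((`|(N * km%:Z)%R|%N).+1 * p ^ e)%:Z.
  have M1 : 1 <= M.
    have pe : (0 < p ^ e)%N by rewrite expn_gt0 p_gt0.
    rewrite /M; set A := N * km%:Z.
    have : ((`|A|%N).+1 <= (`|A|%N).+1 * p ^ e)%N by rewrite leq_pmulr.
    by set B := ((_ * _)%N); lia.
  exists (`|M|.-1)%N, (- N * kn%:Z - D%:Z * (`|(N * km%:Z)%R|%N).+1%:Z).
  have -> : (D * (`|M|.-1).+1)%:Z = D%:Z * M.
    rewrite prednK; last by lia.
    by rewrite PoszM; congr (_ * _); rewrite gez0_abs //; lia.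
  have eg' : km%:Z * D%:Z = kn%:Z * (p ^ e)%:Z + 1 by rewrite -!PoszM eg; lia.
  rewrite /M !PoszM; rewrite mulrDr.
  have -> : D%:Z * (N * km%:Z) = N * (km%:Z * D%:Z) by ring.
  by rewrite eg'; ring.
case: zP => t ht.
have va : v a <= 1.
  by rewrite eaN vM vV (v_coprime cD) invr1 mulr1 v_int_le1.
have vaz : v (a - (z.+1)%:R) <= v (m`!)%:R.
  have -> : a - (z.+1)%:R = (p ^ e)%:R * (t%:~R / D%:R).
    rewrite eaN mulrA.
    have -> : ((p ^ e)%:R : K) = ((p ^ e)%:Z)%:~R by [].
    rewrite -intrM -ht intrB mulrBl; congr (_ - _).
    have -> : (((D * z.+1)%N%:Z)%:~R : K) = (D * z.+1)%:R by [].
    by rewrite natrM mulrC mulKf.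
  rewrite vM natrX vX vp -/(e) v_nat ?fact_gt0 //.
  rewrite -[leRHS]mulr1 ler_wpM2l ?exprn_ge0 ?invr_ge0 //.
  by rewrite vM vV (v_coprime cD) invr1 mulr1 v_int_le1.
have pz : poch (z.+1)%:R m = (m`!)%:R * ('C(z + m, m))%:R.
  rewrite -natrM mulnC bin_ffact; elim: (m) => [|k IH]; first by rewrite poch0 ffactn0.
  by rewrite pochS IH addnS ffactnS /= -natrD -natrM mulnC addSn addnC.
have -> : poch a m = (poch a m - poch (z.+1)%:R m) + poch (z.+1)%:R m by rewrite subrK.
apply: (vD); last first.
  by rewrite pz vM -[leRHS]mulr1 ler_wpM2l // v_nat_le1.
apply: v_prod_sub => // i.
- by apply: (vD) => //; exact: v_nat_le1.
- by rewrite -natrD; exact: v_nat_le1.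
- by rewrite opprD addrACA subrr addr0.
Qed.

(** By partial fractions m! / (b)_(m+1) is the alternating sum of C(m,i) / (b + i). The induction
    uses the difference equation of these sums instead of the closed form. *)
Lemma v_fact_poch_le b m (B : R) : (forall i, (i <= m)%N -> b + i%:R != 0) ->
  (forall i, (i <= m)%N -> v (b + i%:R)^-1 <= B) ->
  v ((m`!)%:R / poch b m.+1) <= B.
Proof.
elim: m b => [|m IH] b b0 hB.
  by rewrite pochS poch0 mul1r fact0 mul1r; exact: hB.
have p0 c k : (forall i, (i < k)%N -> c + i%:R != 0) -> poch c k != 0.
  by move=> h; apply/prodf_neq0 => i _; apply: h.
have bb : b != 0 by have := b0 0%N; rewrite addr0 => /(_ isT).
have bm : b + m.+1%:R != 0 by exact: b0.
have e1 i : b + 1 + i%:R = b + i.+1%:R by rewrite -natr1 -addrA [1 + _]addrC.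
have q0 : poch (b + 1) m != 0 by apply: p0 => i im; rewrite e1; apply: b0; rewrite ltnS ltnW.
have -> : (m.+1`!)%:R / poch b m.+2 =
    (m`!)%:R / poch b m.+1 - (m`!)%:R / poch (b + 1) m.+1.
  rewrite poch_recl pochS e1 poch_recl factS natrM.
  have em : (m.+1)%:R = b + m.+1%:R - b by rewrite addrAC subrr add0r.
  rewrite {1}em; set c := b + m.+1%:R in bm *; set q := poch _ _ in q0 *.
  move: (m`!)%:R => f; clearbody c q; clear -bb bm q0.
  by field; rewrite ?bm ?q0 ?bb.
apply: vB.
  by apply: IH => i im; [apply: b0|apply: hB]; exact: leqW.
by apply: IH => i im; rewrite e1; [apply: b0|apply: hB].
Qed.

Definition Tcoef a m : K := (- pi^-1) ^+ m * poch a m.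

(** If psi_m = (a + m) phi_m + pi phi_(m-1), then eliminating phi_1, phi_2, ... in turn expresses
    phi_0 by psi_1, psi_2, ...; this is the resulting series. It divides by [pi] alone, never by a +
    m, which may vanish. *)
Definition Tser a (phi : nat -> K) : K :=
  pi^-1 * ksum (fun m => Tcoef (a + 1) m * phi m.+1).

(** This is [pi] times the [Tser] taken one index further down. At a boundary that index is absent,
    and [Rser] becomes the defect of [Tser] as a solution. *)
Definition Rser a (phi : nat -> K) : K := ksum (fun m => Tcoef a m * phi m).

Definition Scoef b m : K := pi ^+ m / poch b m.+1.

(** The elimination in the opposite direction. It divides by b + m and is meant for sequences that
    end. *)
Definition Sser b (phi : nat -> K) : K :=
  - ksum (fun m => Scoef b m * phi m).

Lemma TcoefS a m : Tcoef a m.+1 = - pi^-1 * a * Tcoef (a + 1) m.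
Proof. by rewrite /Tcoef exprS poch_recl; ring. Qed.

Lemma TcoefSr a m : Tcoef a m.+1 = - pi^-1 * (a + m%:R) * Tcoef a m.
Proof. by rewrite /Tcoef exprS pochS; ring. Qed.

Lemma v_Tcoef a m : zp_rational a -> v (Tcoef a m) <= p%:R * m.+1%:R.
Proof.
move=> ha; rewrite /Tcoef vM vX vN vV exprVn mulrC.
rewrite ler_pdivrMr ?exprn_gt0 ?vpi_gt0 //.
exact: le_trans (v_poch_le _ ha) (v_fact_le _).
Qed.

(** With r' halfway between [r] and 1 and s = r / r', the product (m + 1) s^m is at most a partial
    sum of the geometric series of [s]. *)
Lemma lin_geom (r : R) : 0 <= r -> r < 1 ->
  exists B r' : R, [/\ 0 < B, 0 <= r', r' < 1 & forall m, m.+1%:R * r ^+ m <= B * r' ^+ m].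
Proof.
move=> r0 r1; pose r' := (1 + r) / 2.
have r'0 : 0 < r' by rewrite /r'; lra.
have r'1 : r' < 1 by rewrite /r'; lra.
pose s := r / r'.
have s0 : 0 <= s by rewrite divr_ge0 // ltW.
have s1 : s < 1 by rewrite ltr_pdivrMr // mul1r /r'; lra.
exists (1 - s)^-1, r'; split=> //; [by rewrite invr_gt0 subr_gt0|exact: ltW|].
move=> m; have -> : r = s * r' by rewrite divfK // gt_eqF.
rewrite exprMn mulrA; apply: ler_wpM2r; first by rewrite exprn_ge0 // ltW.
rewrite -[leRHS]div1r ler_pdivlMr ?subr_gt0 //.
have hg : 1 - s ^+ m.+1 = (1 - s) * \sum_(i < m.+1) s ^+ i.
  by rewrite -[RHS]opprK -mulNr opprB -subrX1 opprB.
apply: le_trans (_ : 1 - s ^+ m.+1 <= 1); last first.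
  by rewrite gerBl exprn_ge0.
rewrite hg mulrC; apply: ler_wpM2l; first by rewrite subr_ge0 ltW.
rewrite mulr_natl -[X in _ *+ X]card_ord -sumr_const; apply: ler_sum => i _.
by rewrite ler_wiXn2l // ?ltW // -ltnS ltn_ord.
Qed.

Lemma Tsummable a phi k (C r : R) : zp_rational a -> 0 <= C -> 0 <= r -> r < 1 ->
  (forall m, v (phi m) <= C * r ^+ m) ->
  summable (fun m => Tcoef a m * phi (k + m)%N).
Proof.
move=> ha C0 r0 r1 hphi.
have [B [r' [B0 r'0 r'1 hB]]] := lin_geom r0 r1.
apply: (@summable_geom _ (p%:R * C * B) r') => // m.
rewrite vM; apply: le_trans (ler_pM _ _ (v_Tcoef m ha) (hphi _)) _ => //.
have -> : p%:R * m.+1%:R * (C * r ^+ (k + m)) = p%:R * C * (m.+1%:R * r ^+ (k + m)) by ring.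
rewrite -[leRHS]mulrA ler_wpM2l ?mulr_ge0 ?(ltW pR_gt0) //.
apply: le_trans (hB m); rewrite ler_wpM2l //.
by rewrite ler_wiXn2l // ?ltW // leq_addl.
Qed.

(** The constant [B] depends on the rate [r] alone. This uniformity preserves decay when the series
    is formed at all points of a lattice at once. *)
Lemma v_Tser (r : R) : 0 <= r -> r < 1 -> exists2 B : R, 0 < B &
  forall a phi C, zp_rational a -> 0 <= C ->
  (forall m, v (phi m) <= C * r ^+ m) -> v (Tser a phi) <= B * C.
Proof.
move=> r0 r1; have [B [r' [B0 r'0 r'1 hB]]] := lin_geom r0 r1.
exists ((v pi)^-1 * (p%:R * B)); first by rewrite !mulr_gt0 ?invr_gt0 ?vpi_gt0.
move=> a phi C ha C0 hphi.
have ha1 : zp_rational (a + 1) by exact: (zp_rationalD_nat 1 ha).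
rewrite /Tser vM vV -mulrA ler_wpM2l ?invr_ge0 ?vpi_ge0 //.
apply: v_ksum.
- by rewrite !mulr_ge0 // ltW.
- exact: (Tsummable 1 ha1 C0 r0 r1 hphi).
move=> m; rewrite vM; apply: le_trans (ler_pM _ _ (v_Tcoef m ha1) (hphi _)) _ => //.
have -> : p%:R * m.+1%:R * (C * r ^+ m.+1) = p%:R * (m.+1%:R * r ^+ m.+1) * C by ring.
rewrite ler_wpM2r // ler_wpM2l ?(ltW pR_gt0) //.
apply: le_trans (_ : m.+1%:R * r ^+ m <= _).
  by rewrite ler_wpM2l // ler_wiXn2l // ltW.
apply: le_trans (hB m) _; rewrite ger_pMr //; exact: exprn_ile1 (ltW r'1).
Qed.

Lemma Tser_sol a phi : zp_rational a ->
  summable (fun m => Tcoef a m * phi m) ->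
  summable (fun m => Tcoef (a + 1) m * phi m.+1) ->
  a * Tser a phi + Rser a phi = phi 0%N.
Proof.
move=> ha h h1; rewrite /Rser (ksum_recl h) {1}/Tcoef expr0 poch0 !mul1r.
rewrite (@eq_ksum (fun i => Tcoef a i.+1 * phi i.+1)
  (fun i => (- pi^-1 * a) * (Tcoef (a + 1) i * phi i.+1))); last first.
  by move=> m; rewrite TcoefS !mulrA.
rewrite (ksumZ _ h1) /Tser; ring.
Qed.

Lemma Tser_inj a phi : summable (fun m => Tcoef (a + 1) m * phi m) ->
  Tser a (fun m => (a + m%:R) * phi m + pi * phi m.-1) = phi 0%N.
Proof.
move=> h; rewrite /Tser.
have e m : Tcoef (a + 1) m * ((a + m.+1%:R) * phi m.+1 + pi * phi m) =
    pi * (Tcoef (a + 1) m * phi m - Tcoef (a + 1) m.+1 * phi m.+1).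
  have -> : pi * (Tcoef (a + 1) m * phi m - Tcoef (a + 1) m.+1 * phi m.+1) =
    Tcoef (a + 1) m * (pi * phi m) - (pi * Tcoef (a + 1) m.+1) * phi m.+1 by ring.
  rewrite TcoefSr -addrA [1 + _]addrC natr1; have := pi_neq0 => ?; by field.
rewrite (eq_ksum e) ksumZ; last first.
  have hS := summableS h.
  apply: (@eq_summable (fun m => Tcoef (a + 1) m * phi m + (-1) * (Tcoef (a + 1) m.+1 * phi m.+1))); last exact: summableD h (summableZ _ hS).
  by move=> m; rewrite mulN1r.
by rewrite (ksum_telescope h) mulKf ?pi_neq0 // /Tcoef expr0 poch0 !mul1r.
Qed.

Lemma ScoefS b m : Scoef b m.+1 = pi / b * Scoef (b + 1) m.
Proof. by rewrite /Scoef exprS poch_recl invfM; ring. Qed.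

Lemma ScoefSr b m : b + m.+1%:R != 0 -> (b + m.+1%:R) * Scoef b m.+1 = pi * Scoef b m.
Proof.
move=> h; rewrite /Scoef exprS pochS invfM.
by rewrite [LHS]mulrC -!mulrA mulVf // mulr1.
Qed.

Lemma Sser_sol b phi N : b != 0 -> (forall m, (N <= m)%N -> phi m = 0) ->
  - b * Sser b phi + pi * Sser (b + 1) (fun m => phi m.+1) = phi 0%N.
Proof.
move=> b0 hN; rewrite /Sser.
have h : summable (fun m => Scoef b m * phi m).
  by apply: (summable_ev0 (N := N)) => m Nm; rewrite hN // mulr0.
rewrite (ksum_recl h).
rewrite (@eq_ksum (fun i => Scoef b i.+1 * phi i.+1)
  (fun i => (pi / b) * (Scoef (b + 1) i * phi i.+1))); last first.
  by move=> m; rewrite ScoefS mulrA.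
rewrite ksumZ; last first.
  by apply: (summable_ev0 (N := N)) => m Nm; rewrite hN ?mulr0 // ltnW.
rewrite /Scoef expr0 pochS poch0 mul1r addr0 mul1r.
by field.
Qed.

Lemma Sser_inj b phi N : (forall m, b + m%:R != 0) -> (forall m, (N <= m)%N -> phi m = 0) ->
  Sser b (fun m => (- b - m%:R) * phi m + pi * phi m.+1) = phi 0%N.
Proof.
move=> b0 hN; rewrite /Sser.
pose u m := (b + m%:R) * Scoef b m * phi m.
have h : summable u.
  by apply: (summable_ev0 (N := N)) => m Nm; rewrite /u hN // mulr0.
have e m : Scoef b m * ((- b - m%:R) * phi m + pi * phi m.+1) = (-1) * (u m - u m.+1).
  by rewrite /u ScoefSr //; ring.
rewrite (eq_ksum e) ksumZ; last first.
  apply: (@eq_summable (fun m => u m + (-1) * u m.+1)); last exact: summableD h (summableZ _ (summableS h)).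
  by move=> m; rewrite mulN1r.
rewrite (ksum_telescope h) mulN1r opprK /u /Scoef expr0 pochS poch0 addr0 !mul1r.
by have := b0 0%N; rewrite addr0 => bb; rewrite mulfV // mul1r.
Qed.

(** Split the coefficient as (pi^m / m!) (m! / (b)_(m+1)): the first factor is integral and the
    second is bounded by the largest 1 / (b + i), so only a single denominator is lost and not their
    product. *)
Lemma v_Sser b phi N (C : R) : 0 <= C -> (forall m, b + m%:R != 0) ->
  (forall m, (N <= m)%N -> phi m = 0) ->
  (forall m i, (i <= m)%N -> v (b + i%:R)^-1 * v (phi m) <= C) ->
  v (Sser b phi) <= C.
Proof.
move=> C0 b0 hN hC; rewrite /Sser vN.
apply: v_ksum => //.
  by apply: (summable_ev0 (N := N)) => m Nm; rewrite hN // mulr0.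
move=> m; rewrite vM.
have [f0|f0] := eqVneq (phi m) 0; first by rewrite f0 v0 mulr0.
have vf : 0 < v (phi m) by rewrite v_gt0.
rewrite -ler_pdivlMr //.
have -> : Scoef b m = (pi ^+ m / (m`!)%:R) * ((m`!)%:R / poch b m.+1).
  by rewrite /Scoef mulrA divfK // natK_eq0 -lt0n fact_gt0.
rewrite vM -[leRHS]mul1r ler_pM //.
  rewrite vM vV vX ler_pdivrMr ?mul1r ?v_fact_ge //.
  by rewrite v_gt0 natK_eq0 -lt0n fact_gt0.
by apply: v_fact_poch_le => // i im; rewrite ler_pdivlMr //; exact: hC.
Qed.

(** * Traces on subquotients *)

(** The trace is the sum of the roots of the characteristic polynomial, and [v] is ultrametric. *)
Lemma v_trace_le d (M : 'M[K]_d) (B : R) : 0 <= B ->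
  (forall beta, eigenvalue M beta -> v beta <= B) -> v (\tr M) <= B.
Proof.
case: d M => [|d] M B0 h; first by rewrite /mxtrace big_ord0 v0.
have [r hr] := closed_field_poly_normal (char_poly M).
rewrite (monicP (char_poly_monic M)) scale1r in hr.
have sr : size r = d.+1.
  by have := size_char_poly M; rewrite hr size_prod_XsubC => -[].
have h1 : (char_poly M)`_d = - \tr M := char_poly_trace M isT.
have h2 : (char_poly M)`_d = - \sum_(z <- r) z.
  by rewrite hr -[d]/(d.+1.-1) -sr coefPn_prod_XsubC // sr.
move: h1; rewrite h2 => /eqP; rewrite eqr_opp => /eqP <-.
rewrite big_seq; apply: v_sum => // z zr; apply: h.
by rewrite eigenvalue_root_char hr root_prod_XsubC.
Qed.

Section Subquotients.
Variables (V : lmodType K).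
Implicit Types (Z B P : set V) (F : V -> V).

Definition subspace P : Prop := P 0 /\ forall a x y, P x -> P y -> P (a *: x + y).

Lemma subspace_sum P (I : Type) (r : seq I) (a : I -> K) (b : I -> V) : subspace P ->
  (forall i, P (b i)) -> P (\sum_(i <- r) a i *: b i).
Proof.
move=> [P0 PL] hb; elim: r => [|i r IH]; first by rewrite big_nil.
by rewrite big_cons; apply: PL.
Qed.

Lemma subspaceB P x y : subspace P -> P x -> P y -> P (x - y).
Proof. by move=> [P0 PL] hx hy; rewrite addrC -scaleN1r; exact: PL. Qed.

Definition linear_on Z F : Prop := forall a x y, Z x -> Z y -> F (a *: x + y) = a *: F x + F y.

Lemma linear_on_sum Z F (I : Type) (r : seq I) (a : I -> K) (b : I -> V) : subspace Z ->
  linear_on Z F -> (forall i, Z (b i)) ->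
  F (\sum_(i <- r) a i *: b i) = \sum_(i <- r) a i *: F (b i).
Proof.
move=> hZ hF hb; have [Z0 ZL] := hZ.
have F0 : F 0 = 0 by have := hF (-1) 0 0 Z0 Z0; rewrite scaler0 addr0 scaleN1r addNr.
elim: r => [|i r IH]; first by rewrite !big_nil.
by rewrite !big_cons hF ?IH //; exact: subspace_sum.
Qed.

Definition basis_mod Z B d (b : 'I_d -> V) : Prop := (forall i, Z (b i)) /\
  forall z, Z z -> exists! a : 'rV[K]_d, B (z - \sum_i a 0 i *: b i).

Lemma basis_inj Z B d (b : 'I_d -> V) (a a' : 'rV[K]_d) : subspace Z -> subspace B ->
  basis_mod Z B b -> B (\sum_i a 0 i *: b i - \sum_i a' 0 i *: b i) -> a = a'.
Proof.
move=> hZ hB [hb1 hb2] h; have [a0 [_ hu]] := hb2 _ (subspace_sum (index_enum 'I_d) (a 0) hZ hb1).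
have e1 : a0 = a by apply: hu; rewrite subrr; exact: (proj1 hB).
by rewrite -e1; exact: hu.
Qed.

(** Bases modulo [B] are related by matrices [P] and [Q], a priori rectangular, with PQ = 1 and QP =
    1; this suffices for the two matrices of [F] to have the same trace. *)
Lemma trace_unique Z B F t t' : subspace Z -> subspace B -> (forall x, B x -> Z x) ->
  linear_on Z F -> (forall x, B x -> B (F x)) ->
  is_subquotient_trace Z B F t -> is_subquotient_trace Z B F t' -> t = t'.
Proof.
move=> hZ hB BZ hF FB [d [b [M [b1 b2 b3 ->]]]] [d' [b' [M' [b1' b2' b3' ->]]]].
have change m m' (e : 'I_m -> V) (e' : 'I_m' -> V) : (forall i, Z (e i)) ->
    (forall z, Z z -> exists! a : 'rV[K]_m', B (z - \sum_i a 0 i *: e' i)) ->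
    exists P : 'M[K]_(m, m'), forall i, B (e i - \sum_j P i j *: e' j).
  move=> he he'; have /choice[f hf] : forall i, exists a : 'rV[K]_m', B (e i - \sum_j a 0 j *: e' j).
    by move=> i; have [a [ha _]] := he' _ (he i); exists a.
  exists (\matrix_(i, j) f i 0 j) => i.
  by rewrite (eq_bigr (fun j => f i 0 j *: e' j)) // => j _; rewrite mxE.
have comb m m' m'' (e : 'I_m -> V) (e' : 'I_m' -> V) (e'' : 'I_m'' -> V) (P : 'M[K]_(m, m')) (Q : 'M[K]_(m', m'')) :
    (forall i, B (e i - \sum_j P i j *: e' j)) -> (forall j, B (e' j - \sum_l Q j l *: e'' l)) ->
    forall i, B (e i - \sum_l (P *m Q) i l *: e'' l).
  move=> h1 h2 i; have -> : e i - \sum_l (P *m Q) i l *: e'' l =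
      1 *: (e i - \sum_j P i j *: e' j) + \sum_j P i j *: (e' j - \sum_l Q j l *: e'' l).
    rewrite scale1r; have -> : \sum_l (P *m Q) i l *: e'' l = \sum_j P i j *: \sum_l Q j l *: e'' l.
      under eq_bigr => l _ do rewrite mxE scaler_suml.
      rewrite exchange_big; apply: eq_bigr => j _; rewrite scaler_sumr.
      by apply: eq_bigr => l _; rewrite scalerA.
    under [X in _ = _ + X]eq_bigr => j _ do rewrite scalerBr.
    by rewrite sumrB addrA subrK.
  by apply: (proj2 hB) => //; apply: subspace_sum.
have [P hP] := change _ _ b b' b1 b2'; have [Q hQ] := change _ _ b' b b1' b2.
have rowE m m' (e : 'I_m -> V) (X : 'M[K]_(m', m)) i : \sum_j X i j *: e j = \sum_j (row i X) 0 j *: e j.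
  by apply: eq_bigr => j _; rewrite mxE.
have uniq m m' (e : 'I_m -> V) (e1 : 'I_m' -> V) (X Y : 'M[K]_(m', m)) : basis_mod Z B e ->
    (forall i, B (e1 i - \sum_j X i j *: e j)) -> (forall i, B (e1 i - \sum_j Y i j *: e j)) -> X = Y.
  move=> he hX hY; apply/row_matrixP => i; apply: (basis_inj hZ hB he).
  rewrite -!rowE; have := subspaceB hB (hY i) (hX i).
  by rewrite opprB addrC addrA subrK.
have hb : basis_mod Z B b by []. have hb' : basis_mod Z B b' by [].
have QP : Q *m P = 1%:M.
  apply: (uniq _ _ b' b') => // [|i]; first exact: comb hQ hP.
  rewrite (bigD1 i) //= mxE eqxx scale1r big1 ?addr0 ?subrr; first exact: (proj1 hB).
  by move=> j ji; rewrite mxE eq_sym (negbTE ji) scale0r.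
have PQ : P *m Q = 1%:M.
  apply: (uniq _ _ b b) => // [|i]; first exact: comb hP hQ.
  rewrite (bigD1 i) //= mxE eqxx scale1r big1 ?addr0 ?subrr; first exact: (proj1 hB).
  by move=> j ji; rewrite mxE eq_sym (negbTE ji) scale0r.
have MP : M *m P = P *m M'.
  apply: (uniq _ _ b' (fun i => F (b i))) => // [|i]; first exact: comb b3 hP.
  have hi : Z (\sum_j P i j *: b' j) by exact: subspace_sum.
  have e1 : F (b i) = F (b i - \sum_j P i j *: b' j) + \sum_j P i j *: F (b' j).
    rewrite -(linear_on_sum _ _ hZ hF b1') -[F (b i - _)]scale1r -hF ?scale1r ?subrK //.
    exact: BZ.
  have e2 := @comb 1%N _ _ (fun _ => \sum_j P i j *: F (b' j)) (fun j => F (b' j)) b' (row i P) M' _ b3' 0.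
  rewrite e1 -addrA -[F _]scale1r; apply: (proj2 hB); first exact: FB.
  have <- : \sum_l (row i P *m M') 0 l *: b' l = \sum_j (P *m M') i j *: b' j.
    by apply: eq_bigr => l _; rewrite -row_mul mxE.
  by apply: e2 => i0; rewrite (ord1 i0) -rowE subrr; exact: (proj1 hB).
have -> : M = P *m (M' *m Q) by rewrite mulmxA -MP -mulmxA PQ mulmx1.
by rewrite mxtrace_mulC -mulmxA QP mulmx1.
Qed.

(** An eigenvector of the matrix of [s F] gives [z] with s F z - beta z in [B]. If |beta| > r then
    [z] itself lies in [B], against the independence of the basis. *)
Lemma trace_bound Z B F t (r : R) (s : K) : subspace Z -> subspace B -> linear_on Z F -> 0 <= r -> s != 0 ->
  (forall beta z, r < v beta -> Z z -> B (s *: F z - beta *: z) -> B z) ->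
  is_subquotient_trace Z B F t -> v (s * t) <= r.
Proof.
move=> hZ hB hF r0 s0 heig [d [b [M [b1 b2 b3 ->]]]].
rewrite -mxtraceZ; apply: v_trace_le => // beta /eigenvalueP[a ha a0].
rewrite leNgt; apply/negP => hb; case/eqP: a0.
pose z := \sum_i a 0 i *: b i.
have zZ : Z z by exact: subspace_sum.
apply: (basis_inj (b := b) hZ hB (conj b1 b2)).
rewrite [X in B (_ - X)]big1 => [|i _]; last by rewrite mxE scale0r.
rewrite subr0; apply: (heig beta) => //.
have -> : s *: F z - beta *: z = \sum_i (s * a 0 i) *: (F (b i) - \sum_j M i j *: b j).
  rewrite /z (linear_on_sum _ _ hZ hF b1) !scaler_sumr.
  under [RHS]eq_bigr => i _ do rewrite scalerBr.
  rewrite sumrB; congr (_ - _); first by apply: eq_bigr => i _; rewrite scalerA.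
  have -> : \sum_i beta *: (a 0 i *: b i) = \sum_j (beta *: a) 0 j *: b j.
    by apply: eq_bigr => j _; rewrite mxE scalerA.
  rewrite -ha; under eq_bigr => j _ do rewrite mxE scaler_suml.
  rewrite exchange_big /=; apply: eq_bigr => i _; rewrite scaler_sumr; apply: eq_bigr => j _.
  by rewrite scalerA mxE mulrCA mulrA.
exact: subspace_sum.
Qed.

End Subquotients.

Lemma trace_line (V : lmodType K) (Z B : set V) (F : V -> V) (b : V) (t : K) :
  subspace B -> Z b -> ~ B b ->
  (forall z, Z z -> exists a : K, B (z - a *: b)) -> B (F b - t *: b) ->
  is_subquotient_trace Z B F t.
Proof.
move=> hB hb nb hz hF; exists 1%N, (fun=> b), (t%:M); split=> //.
- move=> z /hz[a ha]; exists (a%:M); split; first by rewrite big_ord1 mxE eqxx mulr1n.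
  move=> a'; rewrite big_ord1 => ha'; apply/rowP => i; rewrite (ord1 i) mxE eqxx mulr1n.
  apply: contrapT => ne; apply: nb.
  have h : B ((a' 0 0 - a) *: b).
    have := subspaceB hB ha ha'; rewrite opprB addrC addrA subrK -scalerBl.
    by [].
  have d0 : a' 0 0 - a != 0 by rewrite subr_eq0; apply/eqP => e; apply: ne.
  have := (proj2 hB) (a' 0 0 - a)^-1 _ _ h (proj1 hB).
  by rewrite scalerA mulVf // scale1r addr0.
- by move=> i; rewrite big_ord1 (ord1 i) mxE eqxx mulr1n.
by rewrite mxtrace1' || by rewrite /mxtrace big_ord1 mxE eqxx mulr1n.
Qed.

(* The subquotient is determined by its image under a surjection [phi] split by [rho]. *)
Lemma trace_transfer (V V' : lmodType K) (P Z B : set V) (Z' B' : set V')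
    (F : V -> V) (F' : V' -> V') (phi : {linear V -> V'}) (rho : V' -> V) (t : K) :
  subspace P -> (forall z, Z z <-> P z /\ Z' (phi z)) -> (forall z, B z <-> P z /\ B' (phi z)) ->
  (forall z, Z' z -> P (rho z) /\ phi (rho z) = z) ->
  (forall z, P z -> P (F z) /\ phi (F z) = F' (phi z)) ->
  is_subquotient_trace Z B F t <-> is_subquotient_trace Z' B' F' t.
Proof.
move=> hP hZ hB hr hF.
have key d (b : 'I_d -> V) (a : 'I_d -> K) x : (forall i, Z (b i)) -> P x ->
    B (x - \sum_i a i *: b i) <-> B' (phi x - \sum_i a i *: phi (b i)).
  have ephi : phi (x - \sum_i a i *: b i) = phi x - \sum_i a i *: phi (b i).
    by rewrite linearB linear_sum; congr (_ - _); apply: eq_bigr => i _; rewrite linearZ.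
  move=> hb Px; rewrite hB ephi.
  split=> [[]//|h]; split=> //; apply: (subspaceB hP Px); apply: (subspace_sum _ _ hP).
  by move=> i; have /hZ[] := hb i.
split=> -[d [b [M [b1 b2 b3 ->]]]].
  exists d, (fun i => phi (b i)), M; split=> // [i|z hz|i].
  - by have /hZ[] := b1 i.
  - have [r1 r2] := hr _ hz; have [a [ha hu]] : exists! a : 'rV[K]_d, B (rho z - \sum_i a 0 i *: b i).
      by apply: b2; apply/hZ; rewrite r2.
    exists a; split; first by have := proj1 (key _ b _ _ b1 r1) ha; rewrite r2.
    by move=> a' ha'; apply: hu; apply/(key _ b _ _ b1 r1); rewrite r2.
  have /hZ[Pb _] := b1 i; have [F1 F2] := hF _ Pb.
  by have := proj1 (key _ b _ _ b1 F1) (b3 i); rewrite F2.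
have c1 i : Z (rho (b i)) by have [h1 h2] := hr _ (b1 i); apply/hZ; rewrite h2.
have c2 i : phi (rho (b i)) = b i by have [] := hr _ (b1 i).
have cE (a : 'I_d -> K) : \sum_i a i *: phi (rho (b i)) = \sum_i a i *: b i.
  by apply: eq_bigr => i _; rewrite c2.
exists d, (fun i => rho (b i)), M; split=> // [z /hZ[Pz hz]|i].
  have [a [ha hu]] := b2 _ hz; exists a; split; first by apply/(key _ _ _ _ c1 Pz); rewrite cE.
  by move=> a' /(key _ _ _ _ c1 Pz); rewrite cE; exact: hu.
have /hZ[Pb _] := c1 i; have [F1 F2] := hF _ Pb.
by apply/(key _ _ _ _ c1 F1); rewrite F2 cE c2.
Qed.

(** * Finitely supported sums *)

Section FiniteSums.
Variable (T : choiceType).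

Definition finsupp (F : T -> K) : Prop := finite_set [set x | F x != 0].

Lemma fsumE (r : seq T) (F : T -> K) : uniq r -> (forall x, x \notin r -> F x = 0) ->
  \sum_(x \in [set: T]) F x = \sum_(x <- r) F x.
Proof.
move=> ur h; rewrite (fsbigE r) //; last by move=> x _; exact: h.
by rewrite big_mkcond /=; apply: eq_bigr => x _; rewrite in_setT.
Qed.

Lemma finsupp_seq (F : T -> K) : finsupp F ->
  exists2 r : seq T, uniq r & forall x, x \notin r -> F x = 0.
Proof.
move=> h; exists (fset_set [set x | F x != 0]) => [|x]; first exact: fset_uniq.
by rewrite in_fset_set // notin_setE /= => /negP; rewrite negbK => /eqP.
Qed.

Lemma finsupp_sub (r : seq T) (F : T -> K) : (forall x, x \notin r -> F x = 0) -> finsupp F.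
Proof.
move=> h; apply: sub_finite_set (finite_seq r) => x /= hx.
by apply: contraNT hx => /h ->.
Qed.

Lemma finsuppD (F G : T -> K) : finsupp F -> finsupp G -> finsupp (fun x => F x + G x).
Proof.
move=> hF hG; apply: sub_finite_set (_ : finite_set ([set x | F x != 0] `|` [set x | G x != 0])).
  move=> x /= h; have [F0|] := eqVneq (F x) 0; last by left.
  by right; apply: contraNneq h => /= ->; rewrite F0 addr0.
by rewrite finite_setU.
Qed.

Lemma finsuppZ a (F : T -> K) : finsupp F -> finsupp (fun x => a * F x).
Proof. by apply: sub_finite_set => x /=; apply: contraNN => /eqP ->; rewrite mulr0. Qed.

Lemma fsumD (F G : T -> K) : finsupp F -> finsupp G ->
  \sum_(x \in [set: T]) (F x + G x) = \sum_(x \in [set: T]) F x + \sum_(x \in [set: T]) G x.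
Proof.
move=> /finsupp_seq[r ur hr] /finsupp_seq[s us hs].
have ht x : x \notin undup (r ++ s) -> F x = 0 /\ G x = 0.
  by rewrite mem_undup mem_cat negb_or => /andP[/hr -> /hs ->].
rewrite !(fsumE (r := undup (r ++ s))) ?undup_uniq ?big_split //.
- by move=> x /ht[].
- by move=> x /ht[].
by move=> x /ht[-> ->]; rewrite addr0.
Qed.

Lemma fsum_lin (J : Type) (s : seq J) (a : J -> K) (G : J -> T -> K) :
  (forall j, finsupp (G j)) ->
  \sum_(x \in [set: T]) (\sum_(j <- s) a j * G j x) =
  \sum_(j <- s) a j * \sum_(x \in [set: T]) G j x.
Proof.
move=> hG; have fs (s' : seq J) : finsupp (fun x => \sum_(j <- s') a j * G j x).
  elim: s' => [|j s' IH].
    by apply: (@finsupp_sub [::]) => x _; rewrite big_nil.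
  rewrite (_ : (fun x => _) = fun x => a j * G j x + \sum_(j <- s') a j * G j x).
    by apply: finsuppD IH; exact: finsuppZ.
  by apply/funext => x; rewrite big_cons.
elim: s => [|j s IH]; first by rewrite big_nil fsbig1 // => x _; rewrite big_nil.
rewrite big_cons -IH mulr_fsumr -fsumD; [|exact: finsuppZ|exact: fs].
by apply: eq_fsbigr => x _; rewrite big_cons.
Qed.

Lemma v_fsum (F : T -> K) (B : R) : 0 <= B -> (forall x, v (F x) <= B) ->
  v (\sum_(x \in [set: T]) F x) <= B.
Proof. by move=> B0 h; apply: v_sum. Qed.

End FiniteSums.

Section Exp.
(** * Coefficients of [exp (t + t^p / p)] *)

Variable (h : nat -> K).
Hypothesis h_0 : h 0 = 1.
Hypothesis h_rec : forall n, n.+1%:R * h n.+1 = h n + (if (p <= n.+1)%N then h (n.+1 - p)%N else 0).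

Definition cong_Xn N (a b : {poly K}) : Prop := exists r, a = b + r * 'X^N.

Lemma cong_coef N (a b : {poly K}) : (forall i, (i < N)%N -> a`_i = b`_i) -> cong_Xn N a b.
Proof.
move=> hab; exists (drop_poly N (a - b)); rewrite -[LHS](subrK b) addrC; congr (_ + _).
rewrite -{1}[a - b](poly_take_drop N) [take_poly _ _](_ : _ = 0) ?add0r //.
by apply/polyP => i; rewrite coef_take_poly coefB coef0; case: ifP => // /hab ->; rewrite subrr.
Qed.

Lemma cong_eq N a b i : cong_Xn N a b -> (i < N)%N -> a`_i = b`_i.
Proof. by move=> [r ->] iN; rewrite coefD coefMXn iN addr0. Qed.

(** The logarithmic derivative [L] determines the coefficients recursively from the constant one,
    division by the index being possible in characteristic zero. *)
Lemma ode_unique N (G H L : {poly K}) : L`_0 = 0 -> G`_0 = H`_0 ->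
  cong_Xn N ('X * G^`()) (G * L) -> cong_Xn N ('X * H^`()) (H * L) ->
  forall i, (i < N)%N -> G`_i = H`_i.
Proof.
move=> L0 GH0 hG hH i; elim/ltn_ind: i => -[//|i] IH iN.
have coefXd (F : {poly K}) : ('X * F^`())`_i.+1 = F`_i.+1 *+ i.+1.
  by rewrite coefXM coef_deriv.
have := cong_eq hG iN; have := cong_eq hH iN; rewrite !coefXd => eH eG.
suff : G`_i.+1 *+ i.+1 = H`_i.+1 *+ i.+1.
  rewrite -mulr_natr -[RHS]mulr_natr; apply: mulIf; exact: natK_neq0.
rewrite eG eH !coefM [LHS]big_ord_recr [RHS]big_ord_recr /= subnn L0 !mulr0 !addr0; apply: eq_bigr => j _.
by rewrite IH // ?(ltn_trans (ltn_ord _)) // (leq_ltn_trans _ iN) // ltnW // ltnW.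
Qed.

Definition exp_poly N (a : K) : {poly K} := \poly_(i < N) (a ^+ i / (i`!)%:R).

Lemma exp_poly_ode N a : cong_Xn N ('X * (exp_poly N a)^`()) (exp_poly N a * (a *: 'X)).
Proof.
apply: cong_coef => -[|i] iN.
  by rewrite coefXM /= -scalerAr coefZ coefMX /= mulr0.
rewrite coefXM coef_deriv /= -scalerAr coefZ coefMX /= !coef_poly iN ltnW //.
have f0 : (i`!)%:R != 0 :> K by rewrite natK_eq0 -lt0n fact_gt0.
have i0 := natK_neq0 i; rewrite factS natrM exprS -[LHS]mulr_natr.
move: (i.+1%:R) (i`!%:R) (a ^+ i) f0 i0 => x y z y0 x0.
by field; rewrite ?x0 ?y0.
Qed.

Lemma comp_ode N q (F L : {poly K}) : (0 < q)%N ->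
  cong_Xn N ('X * F^`()) (F * L) ->
  cong_Xn N ('X * (F \Po 'X^q)^`()) ((F \Po 'X^q) * (q%:R *: (L \Po 'X^q))).
Proof.
move=> q0 [r hr]; exists (q%:R *: (r \Po 'X^q) * 'X^(q * N - N)).
have -> : 'X * (F \Po 'X^q)^`() = q%:R *: (('X * F^`()) \Po 'X^q).
  have e : 'X * 'X^(q.-1) = 'X^q :> {poly K} by rewrite -exprS prednK.
  rewrite deriv_comp derivXn comp_polyM comp_polyX; set G := _ \Po _.
  by rewrite -e scaler_nat !mulrnAr; congr (_ *+ _); ring.
rewrite hr comp_polyD !comp_polyM scalerDr -scalerAr; congr (_ + _).
rewrite comp_Xn_poly -exprM -mulrA -exprD subnK ?leq_pmull //.
by rewrite scalerAl.
Qed.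

Lemma mul_ode N (F G L M : {poly K}) :
  cong_Xn N ('X * F^`()) (F * L) -> cong_Xn N ('X * G^`()) (G * M) ->
  cong_Xn N ('X * (F * G)^`()) (F * G * (L + M)).
Proof.
move=> [r hr] [s hs]; exists (r * G + F * s).
by rewrite derivM mulrDr mulrA hr mulrCA hs; ring.
Qed.

Lemma exp_ode N k (F L : {poly K}) : cong_Xn N ('X * F^`()) (F * L) ->
  cong_Xn N ('X * (F ^+ k)^`()) (F ^+ k * (k%:R *: L)).
Proof.
move=> hF; elim: k => [|k IH].
  by exists 0; rewrite expr0 derivC scale0r !mulr0 mul0r addr0.
by rewrite exprS -natr1 scalerDl scale1r addrC; exact: mul_ode.
Qed.

Definition h_poly N : {poly K} := \poly_(i < N) h i.

Lemma h_poly_ode N : cong_Xn N ('X * (h_poly N)^`()) (h_poly N * ('X + 'X^p)).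
Proof.
apply: cong_coef => -[|i] iN.
  by rewrite coefXM /= mulrDr coefD coefMX coefMXn p_gt0 addr0.
rewrite coefXM coef_deriv /= mulrDr coefD coefMX coefMXn /= !coef_poly iN (ltnW iN).
rewrite -mulr_natl h_rec leqNgt; congr (_ + _); case: (i.+1 < p)%N => //=.
by rewrite (leq_ltn_trans (leq_subr _ _) iN).
Qed.

(** With H = exp(X + X^p/p) this is H^p = H(X^p) exp(pX) exp(-X^(p^2)/p). Both sides have constant
    term 1 and logarithmic derivative p (X + X^p) with respect to X d/dX. *)
Lemma h_poly_pow N i : (i < N)%N ->
  (h_poly N ^+ p)`_i = ((h_poly N \Po 'X^p) *
     (exp_poly N p%:R * (exp_poly N (- p%:R^-1) \Po 'X^(p ^ 2))))`_i.
Proof.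
case: N => // N iN.
apply: (@ode_unique N.+1 _ _ (p%:R *: ('X + 'X^p))) => //.
- by rewrite coefZ coefD coefX coefXn /= ltn_eqF ?p_gt0 // addr0 mulr0.
- rewrite -!horner_coef0 !hornerE !horner_comp !hornerE expr0n gtn_eqF ?p_gt0 //=.
  rewrite expr0n /= gtn_eqF ?expn_gt0 ?p_gt0 //= !horner_coef0 !coef_poly /= h_0.
  by rewrite !expr0 fact0 expr1n divr1 !mulr1.
- exact/exp_ode/h_poly_ode.
have hp : cong_Xn N.+1 ('X * (exp_poly N.+1 (- p%:R^-1) \Po 'X^(p ^ 2))^`())
   ((exp_poly N.+1 (- p%:R^-1) \Po 'X^(p ^ 2)) *
     ((p ^ 2)%:R *: ((- p%:R^-1 *: 'X) \Po 'X^(p ^ 2)))).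
  by apply: comp_ode; [rewrite expn_gt0 p_gt0|exact: exp_poly_ode].
have := mul_ode (comp_ode p_gt0 (h_poly_ode N.+1))
  (mul_ode (exp_poly_ode N.+1 p%:R) hp).
congr (cong_Xn _ _ (_ * _)).
rewrite comp_polyD comp_polyX comp_polyZ comp_polyX comp_Xn_poly -exprM -(expnS p 1).
rewrite scalerA natrX mulrN -mulrA mulfV ?mulr1; last by rewrite natK_eq0 -lt0n.
by rewrite !scalerDr scaleNr; ring.
Qed.

(** The exponent of [p] allowed in the denominator of the coefficient of index [n]. It is 0 below
    p^2, where the coefficients are those of the Artin-Hasse exponential. The rate 3 / p^2 is crude,
    but it closes the induction: the factor exp(-X^(p^2)/p) respects the bound with one factor [p]
    to spare. *)
Definition gap n := (3 * (n %/ p ^ 2)).-1.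

Lemma gap_add m n : (gap m + gap n <= gap (m + n))%N.
Proof.
have h1 : (m %/ p ^ 2 + n %/ p ^ 2 <= (m + n) %/ p ^ 2)%N.
  rewrite leq_divRL ?expn_gt0 ?p_gt0 // mulnDl.
  by rewrite leq_add // leq_trunc_div.
rewrite /gap; move: h1; set a := (m %/ _)%N; set b := (n %/ _)%N; set c := (_ %/ _)%N.
by move=> h1; clear -h1; lia.
Qed.

Lemma gap_mono m n : (m <= n)%N -> (gap m <= gap n)%N.
Proof.
move=> mn; rewrite /gap; have := leq_div2r (p ^ 2) mn.
by set a := (m %/ _)%N; set c := (_ %/ _)%N; lia.
Qed.

Definition bounded N (C : R) (a : {poly K}) : Prop :=
  forall i, (i < N)%N -> v a`_i <= C * p%:R ^+ gap i.

Lemma pX_ge0 n : (0 : R) <= p%:R ^+ n. Proof. by rewrite exprn_ge0 // ltW. Qed.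

Lemma pX_mono m n : (m <= n)%N -> (p%:R : R) ^+ m <= p%:R ^+ n.
Proof. by move=> mn; rewrite ler_weXn2l // ler1n. Qed.

Lemma boundedM N C D a b : 0 <= C -> 0 <= D ->
  bounded N C a -> bounded N D b -> bounded N (C * D) (a * b).
Proof.
move=> C0 D0 ha hb i iN; rewrite coefM; apply: v_sum => [|j _].
  by rewrite !mulr_ge0 // pX_ge0.
have ji : (j <= i)%N by rewrite -ltnS.
rewrite vM; apply: le_trans (ler_pM _ _ (ha j _) (hb (i - j)%N _)) _ => //.
- exact: leq_ltn_trans iN.
- by rewrite (leq_ltn_trans (leq_subr _ _)).
rewrite mulrACA -exprD ler_wpM2l ?mulr_ge0 // pX_mono //.
by have := gap_add j (i - j); rewrite subnKC.
Qed.

Lemma boundedD N C a b : bounded N C a -> bounded N C b -> bounded N C (a + b).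
Proof. by move=> ha hb i iN; rewrite coefD; apply: vD; [exact: ha|exact: hb]. Qed.

Lemma boundedX N C a k : 0 <= C -> C <= 1 -> bounded N C a -> (0 < k)%N -> bounded N C (a ^+ k).
Proof.
move=> C0 C1 ha; elim: k => // -[|k] IH _; first by rewrite expr1.
rewrite exprS => i iN; apply: le_trans (boundedM C0 C0 ha (IH isT) iN) _.
by rewrite ler_wpM2r ?pX_ge0 // -[leRHS]mulr1 ler_wpM2l.
Qed.

Lemma logn_fact_lt i : (0 < i)%N -> (logn p i`! < i)%N.
Proof.
elim/ltn_ind: i => i IH i0; rewrite logn_fact_rec.
have := IH (i %/ p)%N (ltn_Pdiv p_gt1 i0); case: (i %/ p)%N (leq_trunc_div i p) => [|d] hd.
  by rewrite fact0 logn1 addn0.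
move=> /(_ isT) h1; have := p_gt1; clear -hd h1 => p1; nia.
Qed.

Lemma v_exp_poly_p N : bounded N p%:R^-1 (exp_poly N p%:R - 1).
Proof.
move=> i iN; rewrite coefB coef_poly iN coef1; case: i iN => [|i] iN.
  by rewrite expr0 fact0 divr1 subrr v0 mulr_ge0 ?pX_ge0 // invr_ge0 ltW.
rewrite subr0; apply: le_trans (_ : p%:R^-1 <= _); last first.
  by rewrite ler_peMr ?invr_ge0 ?(ltW pR_gt0) // exprn_ege1 // ler1n.
rewrite vM vX vV vp v_nat ?fact_gt0 // exprVn invrK.
have := logn_fact_lt (ltn0Sn i); set l := logn _ _ => li.
by rewrite exprVn ler_pdivrMl ?exprn_gt0 // exprSr mulfK ?gt_eqF // pX_mono.
Qed.

Lemma v_exp_poly_Vp N :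
  bounded N p%:R^-1 ((exp_poly N (- p%:R^-1) \Po 'X^(p ^ 2)) - 1).
Proof.
have p20 : (0 < p ^ 2)%N by rewrite expn_gt0 p_gt0.
move=> i iN; rewrite coefB coef_comp_poly_Xn // coef1.
case: ifP => [/dvdnP[m ei]|ndv]; last first.
  have h0 : 0 <= p%:R^-1 * p%:R ^+ gap i :> R by rewrite mulr_ge0 ?pX_ge0 // invr_ge0 ltW.
  by case: i iN h0 ndv => [|i] iN h0; rewrite ?dvdn0 //= subrr v0.
rewrite ei mulnK // coef_poly.
case: m ei => [|m] ei.
  have -> : (0 < N)%N by rewrite (leq_ltn_trans _ iN).
  rewrite mul0n expr0 fact0 divr1 subrr v0.
  by rewrite mulr_ge0 ?pX_ge0 // invr_ge0 ltW.
rewrite muln_eq0 /= gtn_eqF // subr0 -ei.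
have -> : (m.+1 < N)%N by rewrite (leq_ltn_trans _ iN) // ei leq_pmulr.
rewrite vM vX vN !vV vp invrK v_nat ?fact_gt0 // exprVn invrK -exprD.
rewrite -ler_pdivrMl ?invr_gt0 // invrK -exprS pX_mono //.
have := logn_fact_lt (ltn0Sn m); set l := logn _ _ => lm.
by rewrite /gap ei mulnK //; clear -lm; lia.
Qed.

Lemma exprDn_ends (a b : {poly K}) k : (a + b) ^+ k.+1 - a ^+ k.+1 - b ^+ k.+1 =
  \sum_(i < k) a ^+ (k.+1 - (1 + i)) * b ^+ (1 + i) *+ 'C(k.+1, 1 + i).
Proof.
rewrite exprDn big_ord_recl big_ord_recr /= subn0 bin0 mulr1n expr0 mulr1.
by rewrite /bump /= add1n subnn expr0 mul1r binn mulr1n; ring.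
Qed.

Lemma exprDn_head (a b : {poly K}) k :
  exists c, (a + b) ^+ k.+1 = a ^+ k.+1 + k.+1%:R * (a ^+ k * b) + b ^+ 2 * c.
Proof.
elim: k => [|k [c e]]; first by exists 0; rewrite !expr1 expr0; ring.
by exists (c * (a + b) + k.+1%:R * a ^+ k); rewrite exprS e -(natr1 k.+1) !exprS; ring.
Qed.

(** The mixed binomial coefficients of a p-th power are divisible by [p]; adding one monomial at a
    time avoids multinomial coefficients. *)
Lemma h_poly_pow_bounded N m : (m <= N)%N ->
  (forall i, (i < m)%N -> v (h i) <= p%:R ^+ gap i) ->
  bounded N p%:R^-1 (h_poly m ^+ p - \sum_(i < m) h i ^+ p *: 'X^(i * p)).
Proof.
have pp : p = p.-1.+1 by rewrite prednK.
elim: m => [|m IH] mN hm.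
  rewrite big_ord0 subr0 (_ : h_poly 0 = 0) ?expr0n ?gtn_eqF ?p_gt0 //; last first.
    by apply/polyP => i; rewrite coef_poly coef0.
  by move=> i iN; rewrite coef0 v0 mulr_ge0 ?pX_ge0 // invr_ge0 ltW.
have hP : h_poly m.+1 = h_poly m + h m *: 'X^m.
  by rewrite /h_poly !poly_def big_ord_recr.
have b1 : bounded N 1 (h_poly m).
  move=> i iN; rewrite coef_poly mul1r; case: ifP => im; first by apply: hm; exact: ltnW.
  by rewrite v0 pX_ge0.
have b2 : bounded N 1 (h m *: 'X^m).
  move=> i iN; rewrite coefZ coefXn mul1r; case: eqP => [->|_]; last by rewrite mulr0 v0 pX_ge0.
  by rewrite mulr1 hm.
have key : bounded N p%:R^-1 (h_poly m.+1 ^+ p - h_poly m ^+ p - (h m *: 'X^m) ^+ p).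
  have := exprDn_ends (h_poly m) (h m *: 'X^m) p.-1; rewrite -pp hP => ->.
  move=> j jN; rewrite coef_sum; apply: v_sum => [|i _].
    by rewrite mulr_ge0 ?pX_ge0 // invr_ge0 ltW.
  have ip : (0 < 1 + i < p)%N by rewrite add1n /= [ltnRHS]pp ltnS.
  have /dvdnP[d ->] := prime_dvd_bin p_prime ip.
  rewrite coefMn -[X in v X]mulr_natl (natrM _ d) -mulrA; apply: v_natM_le.
  rewrite vM vp; apply: ler_wpM2l; first by rewrite invr_ge0 ltW.
  have [p1 p2] : (0 < p - (1 + i))%N /\ (0 < 1 + i)%N by move/andP: ip => [_ ip]; rewrite subn_gt0.
  have := boundedM ler01 ler01 (boundedX ler01 (lexx 1) b1 p1) (boundedX ler01 (lexx 1) b2 p2) jN.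
  by rewrite mulr1 mul1r.
have := boundedD key (IH (ltnW mN) (fun i im => hm i (leqW im))).
rewrite big_ord_recr /= [X in bounded _ _ X -> _](_ : _ =
  h_poly m.+1 ^+ p - (\sum_(i < m) h i ^+ p *: 'X^(i * p) + h m ^+ p *: 'X^(m * p))) //.
by rewrite exprZn -exprM; ring.
Qed.

Lemma h_rational n : exists x : rat, h n = ratr x.
Proof.
elim/ltn_ind: n => -[|n] IH; first by exists 1; rewrite ratrK1.
have [x hx] := IH n (ltnSn n).
have [y hy] : exists y : rat, (if (p <= n.+1)%N then h (n.+1 - p)%N else 0) = ratr y.
  case: ifP => pn; last by exists 0; rewrite ratrK0.
  by apply: IH; rewrite ltn_subrL p_gt0.
exists ((x + y) / n.+1%:R).
have n0 := natK_neq0 n; apply: (mulfI n0); rewrite h_rec hx hy -ratrKD.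
by rewrite -(@ratr_nat K) -ratrKM mulrC divfK // pnatr_eq0.
Qed.

(** The congruence x^p = x modulo [p] is a property of rational numbers and fails for general
    integral elements of [K]. Integrality makes the denominator prime to [p]. *)
Lemma fermat_rat (x : K) : (exists y : rat, x = ratr y) -> v x <= 1 ->
  v (x - x ^+ p) <= p%:R^-1.
Proof.
move=> [y ->] hy; set a := numq y; set d := `|denq y|%N.
have d0 : (0 < d)%N by rewrite absz_gt0 denq_eq0.
have dK : (d%:R : K) != 0 by rewrite natK_eq0 -lt0n.
have ex : (ratr y : K) = a%:~R / d%:R by rewrite /ratr /d -[in LHS](gez0_abs (denq_ge0 y)).
have cop : coprime p d.
  rewrite prime_coprime //; apply/negP => pd.
  have pa : ~~ (p %| `|a|)%N.
    apply/negP => pa; have := coprime_num_den y.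
    have : (p %| gcdn `|numq y| `|denq y|)%N by rewrite dvdn_gcd pa.
    by move=> + /eqP e; rewrite e dvdn1 gtn_eqF ?p_gt1.
  have va : v a%:~R = 1.
    have va' : v (`|a|%N)%:R = 1 by apply: v_coprime; rewrite prime_coprime.
    by rewrite -va'; case: (a) => k //=; rewrite NegzE mulrNz vN.
  have vd : v d%:R <= p%:R^-1.
    by move/dvdnP: pd => [q ->]; rewrite natrM; apply: v_natM_le; rewrite vp.
  move: hy; rewrite ex vM va mul1r vV invf_le1 ?v_gt0 // => h1.
  by have := le_lt_trans (le_trans h1 vd) pV_lt1; rewrite ltxx.
have vd : v d%:R = 1 by exact: v_coprime.
have -> : ratr y - ratr y ^+ p = (a%:~R * d%:R ^+ p - a%:~R ^+ p * d%:R) / d%:R ^+ p.+1 :> K.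
  rewrite ex expr_div_n exprS; move: (d%:R ^+ p) (expf_neq0 p dK) => D D0.
  by field; rewrite ?dK ?D0.
rewrite vM vV vX vd expr1n invr1 mulr1.
have -> : a%:~R * d%:R ^+ p - a%:~R ^+ p * d%:R = (a * d%:Z ^+ p - a ^+ p * d%:Z)%:~R :> K.
  by rewrite rmorphB !rmorphM !rmorphXn.
have fl (z : int) : (z ^+ p)%:~R = z%:~R :> 'F_p.
  by rewrite rmorphXn /= -(pFrobenius_autE (pchar_Fp p_prime)) rmorph_int.
have : (a * d%:Z ^+ p - a ^+ p * d%:Z)%:~R = 0 :> 'F_p.
  by rewrite rmorphB !rmorphM /= !fl subrr.
set z := (_ - _) => hz.
have /dvdzP[q ->] : (p%:Z %| z)%Z.
  by rewrite (dvdz_pcharf (pchar_Fp p_prime)) hz.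
rewrite intrM vM -[leRHS]mul1r; apply: ler_pM => //; first exact: v_int_le1.
by rewrite -vp.
Qed.

(** As h_0 = 1, the coefficient of X^N in H^p is p h_N plus an expression in earlier coefficients,
    so the identity for H^p bounds p h_N. At N = p j it remains to compare h_j with h_j^p: this is
    Fermat's congruence if h_j is integral, and otherwise p gap(j) < gap(N) leaves room for both. *)
Lemma v_h_le n : v (h n) <= p%:R ^+ gap n.
Proof.
elim/ltn_ind: n => -[|n] IH.
  by rewrite h_0 v1 /gap div0n muln0 expr0.
set N := n.+1 in IH *.
have Vp0 : 0 <= p%:R^-1 * p%:R ^+ gap N :> R by rewrite mulr_ge0 ?pX_ge0 // invr_ge0 ltW.
have pn (q r : R) : p%:R * q <= r -> q <= p%:R^-1 * r by rewrite ler_pdivlMl.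
suff : v (p%:R * h N) <= p%:R^-1 * p%:R ^+ gap N.
  by rewrite vM vp ler_pM2l // invr_gt0.
have pp : p = p.-1.+1 by rewrite prednK.
have hP : h_poly N.+1 = h_poly N + h N *: 'X^N by rewrite /h_poly !poly_def big_ord_recr.
have eqN : (h_poly N.+1 ^+ p)`_N = (h_poly N ^+ p)`_N + p%:R * h N.
  have [c] := exprDn_head (h_poly N) (h N *: 'X^N) p.-1; rewrite -pp hP => ->.
  rewrite !coefD [X in _ + _ + X = _](_ : _ = 0) ?addr0; last first.
    by rewrite exprZn -exprM -scalerAl coefZ -commr_polyXn coefMXn ltn_Pmulr // mulr0.
  congr (_ + _); rewrite mulr_natl coefMn -scalerAr coefZ coefMXn ltnn subnn.
  rewrite -horner_coef0 hornerE horner_coef0 coef_poly /= h_0 expr1n mulr1.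
  by rewrite mulr_natl.
have := h_poly_pow (ltnSn N); rewrite eqN.
set Q := _ \Po _; set E1 := exp_poly _ _; set E2 := _ \Po _ => eqR.
have bQ : bounded N.+1 1 Q.
  move=> i iN; rewrite mul1r coef_comp_poly_Xn // coef_poly.
  case: ifP => [/dvdnP[j ej]|_]; last by rewrite v0 pX_ge0.
  rewrite ej mulnK //; case: ifP => jN; last by rewrite v0 pX_ge0.
  have [->|j0] := posnP j; first by rewrite h_0 v1 exprn_ege1 // ler1n.
  apply: le_trans (IH j _) (pX_mono _); last by rewrite gap_mono // leq_pmulr.
  by rewrite -ltnS (leq_trans _ iN) // ej ltnS ltn_Pmulr ?p_gt1.
have bE1 := @v_exp_poly_p N.+1; have bE2 := @v_exp_poly_Vp N.+1.
have bE : bounded N.+1 1 E1.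
  move=> i iN; have := bE1 i iN; rewrite coefB => h1.
  rewrite -[E1`_i](subrK (1 : {poly K})`_i).
  apply: vD.
    by apply: le_trans h1 _; rewrite ler_wpM2r ?pX_ge0 // ltW // pV_lt1.
  rewrite coef1 mul1r; apply: le_trans (v_nat_le1 _) _; by rewrite exprn_ege1 // ler1n.
have bR : bounded N.+1 p%:R^-1 (Q * (E1 * E2) - Q).
  have -> : Q * (E1 * E2) - Q = Q * (E1 - 1) + Q * E1 * (E2 - 1) by ring.
  apply: boundedD.
    by rewrite -[p%:R^-1]mul1r; apply: boundedM; rewrite ?invr_ge0 ?(ltW pR_gt0).
  rewrite -[p%:R^-1]mul1r; apply: boundedM; rewrite ?invr_ge0 ?(ltW pR_gt0) //.
  by rewrite -[1]mul1r; apply: boundedM.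
have bP := h_poly_pow_bounded (leqnSn N) IH.
have -> : p%:R * h N = (Q * (E1 * E2) - Q)`_N
   - (h_poly N ^+ p - \sum_(i < N) h i ^+ p *: 'X^(i * p))`_N
   + (Q`_N - (\sum_(i < N) h i ^+ p *: 'X^(i * p))`_N).
  by rewrite !coefB -eqR; ring.
apply: vD; first by apply: vB; [exact: bR|exact: bP].
have eS : (\sum_(i < N) h i ^+ p *: 'X^(i * p))`_N = if (p %| N)%N then h (N %/ p)%N ^+ p else 0.
  rewrite coef_sum; case: ifP => [/dvdnP[j ej]|pN].
    have jN : (j < N)%N by rewrite ej ltn_Pmulr ?p_gt1 // -(@ltn_pmul2r p) // mul0n -ej.
    rewrite (bigD1 (Ordinal jN)) //= coefZ coefXn -ej eqxx mulr1 big1 ?addr0.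
      by rewrite ej mulnK.
    move=> i /eqP hi; rewrite coefZ coefXn; case: eqP => [e|_]; last by rewrite mulr0.
    case: hi; apply/val_inj => /=; apply/eqP; rewrite -(@eqn_pmul2r p) //.
    by rewrite -e ej.
  apply: big1 => i _; rewrite coefZ coefXn; case: eqP => [e|_]; last by rewrite mulr0.
  by have : (p %| N)%N by [apply/dvdnP; exists i]; rewrite pN.
rewrite eS coef_comp_poly_Xn // coef_poly; case: ifP => [/dvdnP[j ej]|_]; last by rewrite subrr v0.
rewrite ej mulnK // -ej.
have jN : (j < N)%N by rewrite ej ltn_Pmulr ?p_gt1 // -(@ltn_pmul2r p) // mul0n -ej.
rewrite (leq_trans jN (leqnSn _)).
have pg : (0 < gap j)%N -> (p * gap j < gap N)%N /\ (gap j < gap N)%N.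
  rewrite /gap => g0.
  have e1 : (p * (j %/ p ^ 2) <= N %/ p ^ 2)%N.
    rewrite leq_divRL ?expn_gt0 ?p_gt0 // -mulnA ej [(j * p)%N]mulnC leq_mul2l.
    by rewrite leq_trunc_div orbT.
  move: e1 g0 p_gt1; clear; set a := (j %/ _)%N; set b := (N %/ _)%N => e1 g0 p1; nia.
have [g0|g0] := posnP (gap j).
  have hj : v (h j) <= 1 by have := IH j jN; rewrite g0 expr0.
  apply: le_trans (fermat_rat (h_rational j) hj) _.
  by rewrite ler_peMr ?invr_ge0 ?(ltW pR_gt0) // exprn_ege1 // ler1n.
have [g1 g2] := pg g0.
have split1 k : (k < gap N)%N -> p%:R ^+ k <= p%:R^-1 * p%:R ^+ gap N :> R.
  by move=> kN; apply: pn; rewrite -exprS pX_mono.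
apply: vB; first exact: le_trans (IH j jN) (split1 _ g2).
rewrite vX; apply: le_trans (split1 _ g1); rewrite mulnC exprM.
by apply: lerXn2r; rewrite ?nnegrE ?pX_ge0 //; exact: IH.
Qed.

End Exp.
Variable (n : nat).

(** * Creation and annihilation operators on the exterior algebra *)

Definition ext : lmodType K := {set 'I_n} -> K^o.

(** The sign of moving theta_i past the elements of [E] of smaller index. *)
Definition eps (i : 'I_n) (E : {set 'I_n}) : K :=
  (-1) ^+ #|[set k in E | (k < i)%N]%SET|.

Definition Th (i : 'I_n) (g : ext) : ext :=
  fun E => if i \in E then eps i E * g (E :\ i)%SET else 0.

Definition Dt (i : 'I_n) (g : ext) : ext :=
  fun E => if i \in E then 0 else eps i E * g (i |: E)%SET.

Lemma eps_rem (i j : 'I_n) (E : {set 'I_n}) : j \in E -> eps i (E :\ j)%SET = (-1) ^+ (j < i)%N * eps i E.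
Proof.
move=> jE; rewrite /eps mulr_sign; case: (ltnP j i) => ji.
  have -> : [set k in E | (k < i)%N]%SET = (j |: [set k in E :\ j | (k < i)%N])%SET.
    by apply/setP => k; rewrite !inE; case: (eqVneq k j) => [->|//]; rewrite jE.
  by rewrite cardsU1 !inE eqxx /= add1n exprS mulN1r opprK.
congr (_ ^+ #|pred_of_set _|); apply/setP => k; rewrite !inE.
by case: (eqVneq k j) => [->|//] /=; rewrite [(j < i)%N]ltnNge ji andbF.
Qed.

Lemma eps_add (i j : 'I_n) (E : {set 'I_n}) : j \notin E -> eps i (j |: E)%SET = (-1) ^+ (j < i)%N * eps i E.
Proof.
move=> jE; have h := @eps_rem i j (j |: E)%SET (finset.setU11 _ _).
rewrite -{2}(finset.setU1K jE) h mulrA -expr2 -exprM mulnC exprM sqrrN expr1n expr1n mul1r.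
by [].
Qed.

Lemma eps2 i E : eps i E * eps i E = 1.
Proof. by rewrite /eps -expr2 -exprM mulnC exprM sqrrN expr1n expr1n. Qed.

Lemma sign_ord (i j : 'I_n) : i != j -> (-1) ^+ (i < j)%N = - (-1) ^+ (j < i)%N :> K.
Proof.
by move=> ij; case: (ltngtP i j) => [||/val_inj e]; rewrite ?opprK //; rewrite e eqxx in ij.
Qed.

Lemma ThTh i j g : Th i (Th j g) = - Th j (Th i g).
Proof.
apply/funext => E; rewrite fctE /Th.
have [->|ij] := eqVneq i j; first by rewrite !inE eqxx /= mulr0; case: ifP; rewrite oppr0.
rewrite !inE ij eq_sym ij /=; case iE: (i \in E); case jE: (j \in E); rewrite ?mulr0 ?oppr0 //.
rewrite !eps_rem // (sign_ord ij) !finset.setDDl [([set j] :|: _)%SET]finset.setUC.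
by ring.
Qed.

Lemma DtDt i j g : Dt i (Dt j g) = - Dt j (Dt i g).
Proof.
apply/funext => E; rewrite fctE /Dt.
have [->|ij] := eqVneq i j; first by rewrite !inE eqxx /= mulr0; case: ifP; rewrite oppr0.
rewrite !inE (negbTE ij) eq_sym (negbTE ij) /=.
case iE: (i \in E); case jE: (j \in E); rewrite ?mulr0 ?oppr0 //.
rewrite !eps_add ?iE ?jE // (sign_ord ij) [(j |: (i |: E))%SET]finset.setUCA.
by ring.
Qed.

Lemma DtTh i j g : Dt i (Th j g) = (i == j)%:R *: g - Th j (Dt i g).
Proof.
apply/funext => E; rewrite !fctE /Th /Dt /=.
have [->|ij] := eqVneq i j.
  rewrite !inE eqxx /= scale1r; case jE: (j \in E).
    by rewrite finset.setD1K // eps_rem // ltnn mul1r mulrA eps2 mul1r subrr.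
  by rewrite finset.setU1K ?jE // subr0 eps_add ?jE // ltnn mul1r mulrA eps2 mul1r.
rewrite scale0r !inE (negbTE ij) eq_sym (negbTE ij) /= sub0r.
case iE: (i \in E); case jE: (j \in E); rewrite ?mulr0 ?oppr0 //.
rewrite eps_add ?iE // eps_rem // (sign_ord ij).
have -> : ((i |: E) :\ j = i |: (E :\ j))%SET.
  by apply/setP => k; rewrite !inE; case: (eqVneq k i) => [->|//]; rewrite ij.
by ring.
Qed.

Lemma Th_is_linear i : linear (Th i).
Proof using Type.
move=> a f g; apply/funext => E; rewrite !fctE /Th; case: ifP => _.
  by rewrite mulrDr /= mulrCA.
by rewrite addr0 scaler0.
Qed.

Lemma Dt_is_linear i : linear (Dt i).
Proof using Type.
move=> a f g; apply/funext => E; rewrite !fctE /Dt; case: ifP => _.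
  by rewrite addr0 scaler0.
by rewrite mulrDr /= mulrCA.
Qed.

HB.instance Definition _ i := GRing.isLinear.Build K ext ext _ (Th i) (Th_is_linear i).
HB.instance Definition _ i := GRing.isLinear.Build K ext ext _ (Dt i) (Dt_is_linear i).

Section Model.
Variables (A : 'M[nat]_n) (u0 s0 : 'rV[rat]_n) (x0 : 'rV[int]_n).
Hypothesis x0E : forall i, (x0 0 i)%:~R = \sum_j u0 0 j * (A j i)%:R.
Hypothesis u0_zp : forall j, zp_rational (ratr (u0 0 j) : K).
Hypothesis s0_zp : forall i, zp_rational (ratr (s0 0 i) : K).

(** * The bicomplex in lattice coordinates *)

Definition Xe (y : 'rV[int]_n) (i : 'I_n) : int := x0 0 i + \sum_j y 0 j * (A j i)%:Z.
Definition Uc (y : 'rV[int]_n) (j : 'I_n) : K := ratr (u0 0 j) + (y 0 j)%:~R.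
Definition Sc (k : 'rV[int]_n) (i : 'I_n) : K := ratr (s0 0 i) + (k 0 i)%:~R.
Definition Ei (j : 'I_n) : 'rV[int]_n := delta_mx 0 j.

(** In the application s0 lies in [0, 1), so that s_i + k_i = 0 with k_i >= 0 means that both
    vanish. The good points are then the exponents of pairing zero, the ones that survive in the
    quotient by the ideal. *)
Definition good (y k : 'rV[int]_n) : bool :=
  [forall i, [&& 0 <= Xe y i, 0 <= k 0 i &
     (Xe y i == 0) || (s0 0 i == 0) && (k 0 i == 0)]].

Definition chain : lmodType K := 'rV[int]_n -> 'rV[int]_n -> ext.

Definition sz (y k : 'rV[int]_n) : nat := (\sum_i (`|Xe y i|%N + `|k 0%R i|%N))%N.

Definition decays (f : chain) : Prop := exists C r : R,
  [/\ 0 <= C, 0 < r, r < 1 & forall y k E, v (f y k E) <= C * r ^+ sz y k].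

Definition vanishes_off_good (f : chain) : Prop := forall y k, ~~ good y k -> f y k = 0.

Definition inX (f : chain) : Prop := decays f /\ vanishes_off_good f.

Definition Nop (j : 'I_n) (f : chain) : chain :=
  fun y k => Uc y j *: f y k + pi *: f (y - Ei j) k.

Definition nab (i : 'I_n) (f : chain) : chain :=
  fun y k => \sum_j (A j i)%:R *: Nop j f y k.

(** This is [pi] times the i-th coefficient operator of the second differential; so scaled, [del]
    and [Nop] both have the form scalar plus [pi] times a shift. *)
Definition del (i : 'I_n) (f : chain) : chain :=
  fun y k => Sc k i *: f y k + pi *: f y (k - Ei i).

Definition dfull (f : chain) : chain := fun y k =>
  \sum_i Th i (nab i f y k) + pi^-1 *: \sum_i Dt i (del i f y k).

(** Restriction to good points plays the part of reduction modulo the ideal. *)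
Definition Dg (f : chain) : chain := fun y k => if good y k then dfull f y k else 0.

Implicit Types (y k : 'rV[int]_n) (f g : chain).

Lemma chD f g y k : (f + g) y k = f y k + g y k. Proof using Type. by []. Qed.
Lemma chN f y k : (- f) y k = - f y k. Proof using Type. by []. Qed.
Lemma chZ a f y k : (a *: f) y k = a *: f y k. Proof using Type. by []. Qed.
Lemma exD (g h : ext) E : (g + h) E = g E + h E. Proof using Type. by []. Qed.
Lemma exN (g : ext) E : (- g) E = - g E. Proof using Type. by []. Qed.
Lemma exZ a (g : ext) E : (a *: g) E = a * g E. Proof using Type. by []. Qed.

Lemma EiE (j i : 'I_n) : Ei j 0 i = (i == j)%:R.
Proof. by rewrite /Ei mxE eqxx. Qed.

Lemma XeB y j i : Xe (y - Ei j) i = Xe y i - (A j i)%:Z.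
Proof.
rewrite /Xe -addrA; congr (_ + _).
rewrite (bigD1 j) //= [in RHS](bigD1 j) //= !mxE !eqxx /= mulrBl mul1r.
rewrite -!addrA; congr (_ + _); rewrite addrC; congr (_ - _).
by apply: eq_bigr => l lj; rewrite !mxE eqxx /= (negbTE lj) subr0.
Qed.

Lemma XeBm y j m i : Xe (y - Ei j *+ m) i = Xe y i - m%:Z * (A j i)%:Z.
Proof.
elim: m => [|m IH]; first by rewrite mulr0n subr0 mul0r subr0.
by rewrite mulrSr opprD addrA XeB IH -addn1 PoszD mulrDl mul1r opprD addrA.
Qed.

Lemma XeDm y j m i : Xe (y + Ei j *+ m) i = Xe y i + m%:Z * (A j i)%:Z.
Proof.
have := XeBm (y + Ei j *+ m) j m i; rewrite addrK => ->.
by rewrite subrK.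
Qed.

Lemma Xe_ratr y i : ((Xe y i)%:~R : K) = \sum_j (A j i)%:R * Uc y j.
Proof.
have -> : ((Xe y i)%:~R : K) = ratr ((Xe y i)%:~R) by rewrite ratr_int.
have -> : (Xe y i)%:~R = \sum_j (A j i)%:R * (u0 0 j + (y 0 j)%:~R) :> rat.
  rewrite /Xe intrD x0E rmorph_sum /= -big_split /=; apply: eq_bigr => j _.
  by rewrite intrM mulrDr [X in X + _]mulrC; congr (_ + _); rewrite mulrC.
rewrite ratrK_sum; apply: eq_bigr => j _.
by rewrite ratrKM ratrKD ratr_int ratr_nat.
Qed.

Lemma zp_rationalD_int a (z : int) : zp_rational (a : K) -> zp_rational (a + z%:~R).
Proof.
move=> [N [d [cd ->]]]; exists (N + z * d%:Z), d; split=> //.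
have d0 : (d%:R : K) != 0.
  rewrite natK_eq0; apply/eqP => h.
  by move: cd; rewrite h /coprime gcdn0 => /eqP e1; move: p_gt1; rewrite e1.
by rewrite intrD mulrDl intrM mulfK.
Qed.

Lemma zp_le1 (a : K) : zp_rational a -> v a <= 1.
Proof. by move=> [N [d [cd ->]]]; rewrite vM vV (v_coprime cd) invr1 mulr1 v_int_le1. Qed.

Lemma zp_Uc y j : zp_rational (Uc y j).
Proof. exact/zp_rationalD_int/u0_zp. Qed.

Lemma zp_Sc k i : zp_rational (Sc k i).
Proof. exact/zp_rationalD_int/s0_zp. Qed.

Lemma goodP y k : reflect (forall i, [/\ 0 <= Xe y i, 0 <= k 0 i &
   Xe y i = 0 \/ s0 0 i = 0 /\ k 0 i = 0]) (good y k).
Proof.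
apply: (iffP forallP) => h i; have := h i.
  by case/and3P => h1 h2 /orP[/eqP|/andP[/eqP ? /eqP ?]]; split=> //; [left|right].
by case=> -> -> [->|[-> ->]]; rewrite eqxx ?orbT.
Qed.

Lemma vog_X i f y k : vanishes_off_good f -> Xe y i < 0 -> f y k = 0.
Proof.
by move=> hf h; apply: hf; apply/negP => /goodP/(_ i)[h1 _ _]; move: h; rewrite ltNge h1.
Qed.

Lemma vog_k i f y k : vanishes_off_good f -> k 0 i < 0 -> f y k = 0.
Proof.
by move=> hf h; apply: hf; apply/negP => /goodP/(_ i)[_ h1 _]; move: h; rewrite ltNge h1.
Qed.

Lemma NopE j f y k : Nop j f y k = Uc y j *: f y k + pi *: f (y - Ei j) k.
Proof using Type. by []. Qed.

Lemma delE i f y k : del i f y k = Sc k i *: f y k + pi *: f y (k - Ei i).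
Proof using Type. by []. Qed.

Lemma dfullE f y k : dfull f y k =
  \sum_i Th i (nab i f y k) + pi^-1 *: \sum_i Dt i (del i f y k).
Proof using Type. by []. Qed.

Lemma NopD j f g y k : Nop j (f + g) y k = Nop j f y k + Nop j g y k.
Proof using Type. by rewrite /Nop !chD !scalerDr addrACA. Qed.

Lemma NopZ j a f y k : Nop j (a *: f) y k = a *: Nop j f y k.
Proof using Type. by rewrite /Nop !chZ scalerDr !scalerA ![a * _]mulrC. Qed.

Lemma nab_linear i a f g y k : nab i (a *: f + g) y k = a *: nab i f y k + nab i g y k.
Proof using Type.
rewrite /nab scaler_sumr -big_split; apply: eq_bigr => j _ /=.
by rewrite NopD NopZ scalerDr !scalerA mulrC.
Qed.

Lemma del_linear i a f g y k : del i (a *: f + g) y k = a *: del i f y k + del i g y k.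
Proof using Type.
by rewrite /del !chD !chZ !scalerDr !scalerA ![a * _]mulrC addrACA.
Qed.

Lemma dfull_linear a f g y k : dfull (a *: f + g) y k = a *: dfull f y k + dfull g y k.
Proof using Type.
have e1 : \sum_i Th i (nab i (a *: f + g) y k) =
    a *: \sum_i Th i (nab i f y k) + \sum_i Th i (nab i g y k).
  by rewrite scaler_sumr -big_split; apply: eq_bigr => i _; rewrite nab_linear linearP.
have e2 : \sum_i Dt i (del i (a *: f + g) y k) =
    a *: \sum_i Dt i (del i f y k) + \sum_i Dt i (del i g y k).
  by rewrite scaler_sumr -big_split; apply: eq_bigr => i _; rewrite del_linear linearP.
by rewrite /dfull e1 e2 !scalerDr !scalerA [pi^-1 * a]mulrC addrACA.
Qed.

Lemma Dg_is_linear : linear Dg.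
Proof using Type.
move=> a f g; apply/funext => y; apply/funext => k; rewrite !chD !chZ /Dg.
by case: ifP => _; rewrite ?dfull_linear // scaler0 addr0.
Qed.

HB.instance Definition _ := GRing.isLinear.Build K chain chain _ Dg Dg_is_linear.

Lemma ext_v (B : R) (g : ext) i : 0 <= B -> (forall E, v (g E) <= B) ->
  forall E, v (Th i g E) <= B.
Proof.
move=> B0 h E; rewrite /Th; case: ifP => _; last by rewrite v0.
by rewrite vM /eps vsign mul1r.
Qed.

Lemma ext_vD (B : R) (g : ext) i : 0 <= B -> (forall E, v (g E) <= B) ->
  forall E, v (Dt i g E) <= B.
Proof.
move=> B0 h E; rewrite /Dt; case: ifP => _; first by rewrite v0.
by rewrite vM /eps vsign mul1r.
Qed.

Lemma decays_le f (g : chain) : decays f ->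
  (forall y k (B : R), 0 <= B -> (forall E, v (f y k E) <= B) -> forall E, v (g y k E) <= B) ->
  decays g.
Proof.
move=> [C [r [C0 r0 r1 h]]] hg; exists C, r; split=> // y k E.
by apply: hg => [|E']; rewrite ?mulr_ge0 ?exprn_ge0 ?h // ltW.
Qed.

Lemma decaysD f g : decays f -> decays g -> decays (f + g).
Proof.
move=> [C [r [C0 r0 r1 h]]] [C' [r' [C'0 r'0 r'1 h']]].
exists (Num.max C C'), (Num.max r r'); split.
- by rewrite le_max C0.
- by rewrite lt_max r0.
- by rewrite gt_max r1.
move=> y k E; apply: vD.
  apply: le_trans (h y k E) _; apply: ler_pM => //; first by rewrite exprn_ge0 // ltW.
    by rewrite le_max lexx.
  by rewrite lerXn2r ?nnegrE ?(ltW r0) // le_max ?lexx // ltW.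
apply: le_trans (h' y k E) _; apply: ler_pM => //; first by rewrite exprn_ge0 // ltW.
  by rewrite le_max lexx orbT.
by rewrite lerXn2r ?nnegrE ?(ltW r'0) // le_max ?lexx ?orbT // (ltW r0).
Qed.

Lemma decays_scale (a : 'rV[int]_n -> 'rV[int]_n -> K) (B : R) f : 0 <= B ->
  (forall y k, v (a y k) <= B) -> decays f ->
  decays (fun y k => a y k *: f y k).
Proof.
move=> B0 ha [C [r [C0 r0 r1 h]]]; exists (B * C), r; split=> //; first exact: mulr_ge0.
by move=> y k E; rewrite exZ vM -mulrA ler_pM.
Qed.

Lemma decays0 : decays 0.
Proof.
exists 0, 2^-1; split=> //; rewrite ?invr_gt0 ?invf_lt1 ?ltr1n //.
by move=> y k E; rewrite v0 mul0r.
Qed.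

Lemma decays_sum (F : 'I_n -> chain) : (forall i, decays (F i)) ->
  decays (fun y k => \sum_i F i y k).
Proof.
move=> h; have -> : (fun y k => \sum_i F i y k) = \sum_i F i :> chain.
  by apply/funext => y; apply/funext => k; rewrite !fct_sumE.
by apply: (big_ind decays) => //; [exact: decays0|exact: decaysD].
Qed.

Lemma decays_pull (f : chain) (py pk : 'rV[int]_n -> 'rV[int]_n) (a : nat) :
  (forall y k, sz y k <= sz (py y) (pk k) + a)%N -> decays f ->
  decays (fun y k => f (py y) (pk k)).
Proof.
move=> ha [C [r [C0 r0 r1 h]]]; exists (C / r ^+ a), r; split=> //.
  by rewrite divr_ge0 // exprn_ge0 // ltW.
move=> y k E; apply: le_trans (h _ _ _) _; rewrite -mulrA ler_wpM2l //.
rewrite ler_pdivlMl ?exprn_gt0 // -exprD addnC.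
by rewrite ler_wiXn2l // ltW.
Qed.

Lemma sz_y j y k : (sz y k <= sz (y - Ei j) k + \sum_i A j i)%N.
Proof.
rewrite /sz -big_split /=; apply: leq_sum => i _; rewrite XeB.
rewrite addnAC leq_add2r; set X := Xe y i; set a := A j i; lia.
Qed.

Lemma sz_k i y k : (sz y k <= sz y (k - Ei i) + 1)%N.
Proof.
rewrite /sz (bigD1 i) //= [X in (_ <= X + _)%N](bigD1 i) //= !mxE !eqxx /=.
set T1 := (\sum_(_ < _ | _) _)%N; set T2 := (\sum_(_ < _ | _) _)%N.
have hT : (T1 <= T2)%N by apply: leq_sum => l li; rewrite !mxE eqxx (negbTE li) subr0.
by move: hT; set a := `|Xe y i|%N; move: T1 T2 (k 0 i) a; clear => T1 T2 z a; lia.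
Qed.

Lemma decays_Nop j f : decays f -> decays (Nop j f).
Proof.
move=> hf; apply: decaysD.
  apply: (@decays_scale (fun y k => Uc y j) 1) => // y k; exact/zp_le1/zp_Uc.
apply: (@decays_scale (fun y k => pi) 1) => // [y k|]; first exact: vpi_le1.
exact: (decays_pull (py := fun y => y - Ei j) (pk := id) (sz_y j)).
Qed.

Lemma decays_nab i f : decays f -> decays (nab i f).
Proof.
move=> hf; apply: decays_sum => j; apply: (@decays_scale (fun _ _ => (A j i)%:R) 1) => //.
  by move=> _ _; exact: v_nat_le1.
exact: decays_Nop.
Qed.

Lemma decays_del i f : decays f -> decays (del i f).
Proof.
move=> hf; apply: decaysD.
  apply: (@decays_scale (fun y k => Sc k i) 1) => // y k; exact/zp_le1/zp_Sc.
apply: (@decays_scale (fun y k => pi) 1) => // [y k|]; first exact: vpi_le1.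
exact: (decays_pull (py := id) (pk := fun k => k - Ei i) (fun y => sz_k i y)).
Qed.

Lemma decays_dfull f : decays f -> decays (dfull f).
Proof.
move=> hf; apply: decaysD.
  apply: decays_sum => i; apply: decays_le (decays_nab i hf) _ => y k B B0 h.
  exact: ext_v.
apply: (@decays_scale (fun y k => pi^-1) (v pi^-1)) => //.
apply: decays_sum => i; apply: decays_le (decays_del i hf) _ => y k B B0 h.
exact: ext_vD.
Qed.

Lemma inX_Dg f : decays f -> inX (Dg f).
Proof.
move=> hf; split; last by move=> y k /negbTE h; rewrite /Dg h.
apply: decays_le (decays_dfull hf) _ => y k B B0 h E.
by rewrite /Dg; case: ifP => // _; rewrite v0.
Qed.

Lemma inX_lin a f g : inX f -> inX g -> inX (a *: f + g).
Proof.
move=> [hf1 hf2] [hg1 hg2]; split.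
  apply: decaysD => //; exact: (@decays_scale (fun _ _ => a) (v a)).
by move=> y k h; rewrite chD chZ hf2 // hg2 // scaler0 addr0.
Qed.

Lemma inX0 : inX 0.
Proof. by split=> //; exact: decays0. Qed.

Lemma inXD f g : inX f -> inX g -> inX (f + g).
Proof. by move=> hf hg; rewrite -[f]scale1r; exact: inX_lin. Qed.

Lemma inXB f g : inX f -> inX g -> inX (f - g).
Proof. by move=> hf hg; rewrite addrC -scaleN1r; exact: inX_lin. Qed.

Lemma inXZ a f : inX f -> inX (a *: f).
Proof. by move=> hf; rewrite -[_ *: _]addr0; apply: inX_lin => //; exact: inX0. Qed.

Lemma nabE i f y k : nab i f y k =
  (Xe y i)%:~R *: f y k + pi *: \sum_j (A j i)%:R *: f (y - Ei j) k.
Proof.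
rewrite Xe_ratr scaler_suml scaler_sumr -big_split /=; apply: eq_bigr => j _.
by rewrite /Nop scalerDr !scalerA [pi * _]mulrC.
Qed.

Lemma nab_eq0 i f y k : (forall y', Xe y' i < 0 -> f y' k = 0) -> Xe y i = 0 ->
  nab i f y k = 0.
Proof.
move=> hf h; rewrite nabE h scale0r add0r big1 ?scaler0 // => j _.
have [->|a0] := eqVneq (A j i) 0%N; first by rewrite scale0r.
by rewrite hf ?scaler0 // XeB h sub0r oppr_lt0 ltz_nat lt0n.
Qed.

Lemma del_eq0 i f y k : (forall k', k' 0 i < 0 -> f y k' = 0) ->
  s0 0 i = 0 -> k 0 i = 0 -> del i f y k = 0.
Proof.
move=> hf h1 h2; rewrite /del /Sc h1 h2 ratrK0 addr0 scale0r add0r hf ?scaler0 //.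
by rewrite !mxE !eqxx h2.
Qed.

Lemma dfull_X i f y k : vanishes_off_good f -> Xe y i < 0 -> dfull f y k = 0.
Proof.
move=> hf h; have h2 y' k' : Xe y' i <= Xe y i -> f y' k' = 0.
  by move=> le; apply: (vog_X (i := i)) => //; exact: le_lt_trans le h.
have hB j : Xe (y - Ei j) i <= Xe y i by rewrite XeB gerBl.
rewrite /dfull !big1 ?scaler0 ?addr0 // => l _; rewrite ?/nab ?/del /Nop.
  by rewrite !h2 // !scaler0 addr0 linear0.
by rewrite big1 ?linear0 // => j _; rewrite !h2 // !scaler0 addr0 scaler0.
Qed.

Lemma dfull_k i f y k : vanishes_off_good f -> k 0 i < 0 -> dfull f y k = 0.
Proof.
move=> hf h; have h2 y' k' : k' 0 i <= k 0 i -> f y' k' = 0.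
  by move=> le; apply: (vog_k (i := i)) => //; exact: le_lt_trans le h.
have hB j : (k - Ei j) 0 i <= k 0 i by rewrite !mxE eqxx /= gerBl ler0n.
rewrite /dfull !big1 ?scaler0 ?addr0 // => l _; rewrite ?/nab ?/del /Nop.
  by rewrite !h2 // !scaler0 addr0 linear0.
by rewrite big1 ?linear0 // => j _; rewrite !h2 // !scaler0 addr0 scaler0.
Qed.

Lemma good_lowX y k j : good y k -> (forall i, 0 <= Xe (y - Ei j) i) -> good (y - Ei j) k.
Proof.
move=> /goodP h h2; apply/goodP => i; have [h3 h4 h5] := h i; split=> //.
case: h5 => [h5|]; [left|by right].
by apply/eqP; rewrite eq_le h2 andbT XeB h5 sub0r oppr_le0.
Qed.

Lemma good_lowk y k j : good y k -> 0 <= (k - Ei j) 0 j -> good y (k - Ei j).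
Proof.
move=> /goodP h h2; apply/goodP => i; have [h3 h4 h5] := h i.
have [->|ij] := eqVneq i j; last by rewrite !mxE eqxx (negbTE ij) subr0; split.
have [h6 h7 h8] := h j; split=> //; case: h8 => [|[h8 h9]]; [by left|].
by move: h2; rewrite !mxE !eqxx h9.
Qed.

(** A lower neighbour of a good point is good unless an exponent becomes negative, and there the
    unrestricted differential vanishes as well. *)
Lemma Dg_lowX f y k j : vanishes_off_good f -> good y k ->
  Dg f (y - Ei j) k = dfull f (y - Ei j) k.
Proof.
move=> hf h; rewrite /Dg; case: ifP => // /negP h2.
have [h3|] := pselect (forall i, 0 <= Xe (y - Ei j) i); first by case: h2; exact: good_lowX.
move=> /existsNP[i /negP]; rewrite -ltNge => h3.
by rewrite (dfull_X _ hf h3).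
Qed.

Lemma Dg_lowk f y k j : vanishes_off_good f -> good y k ->
  Dg f y (k - Ei j) = dfull f y (k - Ei j).
Proof.
move=> hf h; rewrite /Dg; case: ifP => // /negP h2.
have [h3|h3] := leP 0 ((k - Ei j) 0 j); first by case: h2; exact: good_lowk.
by rewrite (dfull_k _ hf h3).
Qed.

(** * The differential squares to zero *)

Lemma ext_sum_anti (F : 'I_n -> 'I_n -> ext) : (forall i j, F i j = - F j i) ->
  \sum_i \sum_j F i j = 0.
Proof.
move=> h; set S := \sum_i _.
have hS : S = - S.
  rewrite {1}/S exchange_big /= -sumrN; apply: eq_bigr => i _; rewrite -sumrN.
  by apply: eq_bigr => j _.
have : S + S = 0 by rewrite {2}hS subrr.
by rewrite -mulr2n -scaler_nat => /eqP; rewrite scaler_eq0 natK_eq0 /= => /eqP.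
Qed.

Lemma NopC i j f y k : Nop i (Nop j f) y k = Nop j (Nop i f) y k.
Proof.
have [->//|ij] := eqVneq i j.
rewrite /Nop !scalerDr !scalerA.
have e1 l m : l != m -> Uc (y - Ei l) m = Uc y m.
  by move=> lm; rewrite /Uc !mxE eqxx [m == l]eq_sym (negbTE lm) subr0.
rewrite !e1 // 1?eq_sym // -!scalerA [y - Ei i - Ei j]addrAC.
rewrite !scalerA [Uc y j * Uc y i]mulrC [pi * Uc y j]mulrC [pi * Uc y i]mulrC -!addrA.
by congr (_ + _); exact: addrCA.
Qed.

Lemma nabC i j f y k : nab i (nab j f) y k = nab j (nab i f) y k.
Proof.
have h i' j' : nab i' (nab j' f) y k =
   \sum_l \sum_m (A l i' * A m j')%:R *: Nop l (Nop m f) y k.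
  rewrite {1}/nab; apply: eq_bigr => l _.
  have -> : Nop l (nab j' f) y k = \sum_m (A m j')%:R *: Nop l (Nop m f) y k.
    rewrite {1}/Nop /nab !scaler_sumr -big_split /=; apply: eq_bigr => m _.
    by rewrite (NopE l (Nop m f)) [RHS]scalerDr !scalerA [Uc y l * _]mulrC [pi * _]mulrC.
  by rewrite scaler_sumr; apply: eq_bigr => m _; rewrite scalerA natrM.
rewrite !h exchange_big /=; apply: eq_bigr => l _; apply: eq_bigr => m _.
by rewrite NopC mulnC.
Qed.

Lemma delC i j f y k : del i (del j f) y k = del j (del i f) y k.
Proof.
have [->//|ij] := eqVneq i j.
rewrite /del !scalerDr !scalerA.
have e1 l m : l != m -> Sc (k - Ei l) m = Sc k m.
  by move=> lm; rewrite /Sc !mxE eqxx [m == l]eq_sym (negbTE lm) subr0.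
rewrite !e1 // 1?eq_sym // [k - Ei i - Ei j]addrAC.
rewrite [Sc k j * Sc k i]mulrC [pi * Sc k j]mulrC [pi * Sc k i]mulrC -!addrA.
by congr (_ + _); exact: addrCA.
Qed.

Lemma Nop_del i j f y k : Nop i (del j f) y k = del j (Nop i f) y k.
Proof.
rewrite /Nop /del !scalerDr !scalerA [Sc k j * Uc y i]mulrC [pi * Sc k j]mulrC.
by rewrite [pi * Uc y i]mulrC -!addrA; congr (_ + _); exact: addrCA.
Qed.

Lemma nab_del i j f y k : nab i (del j f) y k = del j (nab i f) y k.
Proof.
rewrite /nab [in RHS]/del !scaler_sumr -big_split /=; apply: eq_bigr => l _.
by rewrite Nop_del /del scalerDr !scalerA ![_ * (A l i)%:R]mulrC.
Qed.

Lemma nab_Th i l f y k : nab i (fun y k => Th l (f y k)) y k = Th l (nab i f y k).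
Proof.
rewrite /nab linear_sum; apply: eq_bigr => j _.
by rewrite [RHS]linearZ /=; congr (_ *: _); rewrite !NopE linearD !linearZ.
Qed.

Lemma nab_Dt i l f y k : nab i (fun y k => Dt l (f y k)) y k = Dt l (nab i f y k).
Proof.
rewrite /nab linear_sum; apply: eq_bigr => j _.
by rewrite [RHS]linearZ /=; congr (_ *: _); rewrite !NopE linearD !linearZ.
Qed.

Lemma del_Th i l f y k : del i (fun y k => Th l (f y k)) y k = Th l (del i f y k).
Proof. by rewrite /del linearD !linearZ. Qed.

Lemma del_Dt i l f y k : del i (fun y k => Dt l (f y k)) y k = Dt l (del i f y k).
Proof. by rewrite /del linearD !linearZ. Qed.

Lemma nab_sum i (F : 'I_n -> chain) y k :
  nab i (fun y k => \sum_l F l y k) y k = \sum_l nab i (F l) y k.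
Proof.
rewrite /nab exchange_big /=; apply: eq_bigr => j _.
by rewrite -scaler_sumr /Nop big_split /= !scaler_sumr.
Qed.

Lemma del_sum i (F : 'I_n -> chain) y k :
  del i (fun y k => \sum_l F l y k) y k = \sum_l del i (F l) y k.
Proof. by rewrite /del big_split /= !scaler_sumr. Qed.

Definition dx (f : chain) : chain := fun y k => \sum_i Th i (nab i f y k).
Definition dy (f : chain) : chain := fun y k => \sum_i Dt i (del i f y k).

Lemma dx_dx f y k : dx (dx f) y k = 0.
Proof.
rewrite {1}/dx (eq_bigr (fun i => \sum_j Th i (Th j (nab i (nab j f) y k)))); last first.
  move=> i _; rewrite /dx nab_sum linear_sum; apply: eq_bigr => j _.
  by rewrite nab_Th.
by apply: ext_sum_anti => i j; rewrite ThTh nabC.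
Qed.

Lemma dy_dy f y k : dy (dy f) y k = 0.
Proof.
rewrite {1}/dy (eq_bigr (fun i => \sum_j Dt i (Dt j (del i (del j f) y k)))); last first.
  move=> i _; rewrite /dy del_sum linear_sum; apply: eq_bigr => j _.
  by rewrite del_Dt.
by apply: ext_sum_anti => i j; rewrite DtDt delC.
Qed.

(** The anticommutators leave the sum of nab_i del_i. At a good point either X_i = 0, and [nab i]
    sees only points with X_i < 0, or s_i and k_i vanish, and [del i] sees only points with k_i <
    0. *)
Lemma dx_dy f y k : vanishes_off_good f -> good y k -> dx (dy f) y k + dy (dx f) y k = 0.
Proof.
move=> hf hg.
have -> : dy (dx f) y k = \sum_i \sum_j Dt i (Th j (nab j (del i f) y k)).
  apply: eq_bigr => i _; rewrite /dx del_sum linear_sum; apply: eq_bigr => j _.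
  by rewrite del_Th nab_del.
have -> : dx (dy f) y k = \sum_i \sum_j Th j (Dt i (nab j (del i f) y k)).
  rewrite /dx exchange_big /=; apply: eq_bigr => i _; rewrite /dy nab_sum linear_sum.
  by apply: eq_bigr => j _; rewrite nab_Dt.
rewrite -big_split /= big1 // => i _; rewrite -big_split /= (bigD1 i) //= big1 ?addr0.
  rewrite DtTh eqxx scale1r addrC subrK.
  have /goodP/(_ i)[h1 h2 [h3|[h3 h4]]] := hg.
    apply: nab_eq0 => // y' hy'; rewrite /del !(vog_X (i := i) _ _) //.
    by rewrite !scaler0 addr0.
  rewrite nab_del; apply: del_eq0 => // k' hk'.
  rewrite /nab big1 // => j _; rewrite /Nop !(vog_k (i := i) _ _) //.
  by rewrite !scaler0 addr0 scaler0.
by move=> j ji; rewrite DtTh eq_sym (negbTE ji) scale0r sub0r subrr.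
Qed.

Lemma dfull_dxdy f y k : dfull f y k = dx f y k + pi^-1 *: dy f y k.
Proof. by []. Qed.

Lemma Dg_Dg f : vanishes_off_good f -> Dg (Dg f) = 0.
Proof.
move=> hf; apply/funext => y; apply/funext => k; rewrite {1}/Dg; case: ifP => // hg.
have -> : dfull (Dg f) y k = dfull (dfull f) y k.
  have h0 : Dg f y k = dfull f y k by rewrite /Dg hg.
  rewrite (dfullE (Dg f)) (dfullE (dfull f)); congr (_ + _ *: _); apply: eq_bigr => i _.
    by congr (Th i _); apply: eq_bigr => j _; rewrite !NopE h0 Dg_lowX.
  by congr (Dt i _); rewrite !delE h0 Dg_lowk.
have lx g h a : dx (fun y k => g y k + a *: h y k) y k = dx g y k + a *: dx h y k.
  rewrite /dx scaler_sumr -big_split; apply: eq_bigr => i _ /=.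
  have -> : (fun y k => g y k + a *: h y k) = a *: h + g :> chain.
    by apply/funext => y'; apply/funext => k'; rewrite chD chZ addrC.
  by rewrite nab_linear linearP addrC.
have ly g h a : dy (fun y k => g y k + a *: h y k) y k = dy g y k + a *: dy h y k.
  rewrite /dy scaler_sumr -big_split; apply: eq_bigr => i _ /=.
  have -> : (fun y k => g y k + a *: h y k) = a *: h + g :> chain.
    by apply/funext => y'; apply/funext => k'; rewrite chD chZ addrC.
  by rewrite del_linear linearP addrC.
rewrite dfull_dxdy lx ly dx_dx dy_dy add0r scaler0 addr0 -scalerDr.
by rewrite dx_dy // scaler0.
Qed.

Lemma inX_DgX f : inX f -> inX (Dg f). Proof. by move=> [h _]; exact: inX_Dg. Qed.

(** * Geometrically decaying sequences and the linearity of [Tser] *)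

Definition geo (phi : nat -> K) : Prop := exists C r : R,
  [/\ 0 <= C, 0 <= r, r < 1 & forall m, v (phi m) <= C * r ^+ m].

Lemma geoS phi : geo phi -> geo (fun m => phi m.+1).
Proof.
move=> [C [r [C0 r0 r1 h]]]; exists C, r; split=> // m.
apply: le_trans (h m.+1) _; rewrite ler_wpM2l // exprS ler_piMl ?exprn_ge0 //.
exact: ltW.
Qed.

Lemma geoD phi psi : geo phi -> geo psi -> geo (fun m => phi m + psi m).
Proof.
move=> [C [r [C0 r0 r1 h]]] [C' [r' [C'0 r'0 r'1 h']]].
exists (Num.max C C'), (Num.max r r'); split.
- by rewrite le_max C0.
- by rewrite le_max r0.
- by rewrite gt_max r1.
move=> m; apply: vD.
  apply: le_trans (h m) _; apply: ler_pM => //; first by rewrite exprn_ge0.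
    by rewrite le_max lexx.
  by rewrite lerXn2r ?nnegrE // le_max ?lexx ?r0.
apply: le_trans (h' m) _; apply: ler_pM => //; first by rewrite exprn_ge0.
  by rewrite le_max lexx orbT.
by rewrite lerXn2r ?nnegrE // le_max ?lexx ?orbT ?r0.
Qed.

Lemma geoZ a phi : geo phi -> geo (fun m => a * phi m).
Proof.
move=> [C [r [C0 r0 r1 h]]]; exists (v a * C), r; split=> //; first exact: mulr_ge0.
by move=> m; rewrite vM -mulrA ler_wpM2l.
Qed.

Lemma geo0 : geo (fun=> 0).
Proof. by exists 0, 0; split=> // m; rewrite v0 mul0r. Qed.

Lemma geo_sum (I : Type) (r : seq I) (F : I -> nat -> K) : (forall i, geo (F i)) ->
  geo (fun m => \sum_(i <- r) F i m).
Proof.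
move=> h; elim: r => [|i r IH].
  by rewrite (_ : (fun _ => _) = fun=> 0); [exact: geo0|apply/funext => m; rewrite big_nil].
rewrite (_ : (fun _ => _) = fun m => F i m + \sum_(j <- r) F j m); first exact: geoD.
by apply/funext => m; rewrite big_cons.
Qed.

Lemma geo_summable a phi : zp_rational (a : K) -> geo phi ->
  summable (fun m => Tcoef a m * phi m).
Proof. by move=> ha [C [r [C0 r0 r1 h]]]; exact: (Tsummable 0 ha C0 r0 r1 h). Qed.

Lemma geo_Tsummable a phi : zp_rational (a : K) -> geo phi ->
  summable (fun m => Tcoef (a + 1) m * phi m.+1).
Proof.
move=> ha /geoS hphi; apply: geo_summable hphi.
by have := zp_rationalD_int 1 ha.
Qed.

Lemma TserD a phi psi : zp_rational (a : K) -> geo phi -> geo psi ->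
  Tser a (fun m => phi m + psi m) = Tser a phi + Tser a psi.
Proof.
move=> ha h1 h2; rewrite /Tser -mulrDr -ksumD; try exact: geo_Tsummable.
by congr (_ * _); apply: eq_ksum => m; rewrite mulrDr.
Qed.

Lemma TserZ a b phi : zp_rational (a : K) -> geo phi ->
  Tser a (fun m => b * phi m) = b * Tser a phi.
Proof.
move=> ha h1; rewrite /Tser mulrCA -(ksumZ _ (geo_Tsummable ha h1)).
by congr (_ * _); apply: eq_ksum => m; rewrite mulrCA.
Qed.

Lemma Tser0 a : Tser a (fun=> 0) = 0.
Proof.
rewrite /Tser (_ : (fun m => _) = fun=> 0) ?ksum0 ?mulr0 //.
by apply/funext => m; rewrite mulr0.
Qed.

Lemma Tser_sum (I : Type) (r : seq I) a (F : I -> nat -> K) :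
  zp_rational (a : K) -> (forall i, geo (F i)) ->
  Tser a (fun m => \sum_(i <- r) F i m) = \sum_(i <- r) Tser a (F i).
Proof.
move=> ha h; elim: r => [|i r IH].
  by rewrite big_nil -[RHS](Tser0 a); congr (Tser _ _); apply/funext => m; rewrite big_nil.
rewrite big_cons -IH -TserD //; last exact: geo_sum.
by congr (Tser _ _); apply/funext => m; rewrite big_cons.
Qed.

Lemma eq_Tser a phi psi : phi =1 psi -> Tser a phi = Tser a psi.
Proof. by move=> /funext ->. Qed.

(** * Eliminating the [y]-variables *)

(** The inverse of [del i], summed over larger k_i: a left inverse by [Ty_deli], and a right inverse
    up to the defect [Ry i] where k_i = 0. *)
Definition Ty (i : 'I_n) (f : chain) : chain := fun y k E =>
  Tser (Sc k i) (fun m => f y (k + Ei i *+ m) E).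

Definition Ry (i : 'I_n) (f : chain) : chain := fun y k E =>
  Rser (Sc k i) (fun m => f y (k + Ei i *+ m) E).

Lemma EimE i m (k : 'rV[int]_n) l : (k + Ei i *+ m) 0 l = k 0 l + (if l == i then m%:Z else 0).
Proof.
rewrite mxE; congr (_ + _); elim: m => [|m IH]; first by rewrite mulr0n mxE if_same.
by rewrite mulrS mxE IH EiE; case: eqP => _; rewrite ?addr0 //= intS.
Qed.

Lemma sz_ge y k i : (`|k 0%R i| <= sz y k)%N.
Proof. by rewrite /sz (bigD1 i) //= -addnA addnCA leq_addr. Qed.

Lemma sz_geX y k i : (`|Xe y i| <= sz y k)%N.
Proof. by rewrite /sz (bigD1 i) //= -addnA leq_addr. Qed.

Lemma decays_geo f y k E i : decays f -> geo (fun m => f y (k + Ei i *+ m) E).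
Proof.
move=> [C [r [C0 r0 r1 h]]]; exists (C / r ^+ `|k 0%R i|%N), r.
have rn : 0 < r ^+ `|k 0%R i|%N by rewrite exprn_gt0.
split=> //; [by rewrite divr_ge0 // ltW|exact: ltW|].
move=> m; apply: le_trans (h _ _ _) _; rewrite -mulrA ler_wpM2l //.
rewrite ler_pdivlMl // -exprD ler_wiXn2l ?(ltW r0) ?(ltW r1) //.
have := sz_ge y (k + Ei i *+ m) i; rewrite EimE eqxx.
move: (sz _ _) (k 0 i) => a b; clear => h; lia.
Qed.

Lemma ScEi i l m k : l != i -> Sc (k + Ei i *+ m) l = Sc k l.
Proof. by move=> li; rewrite /Sc EimE (negbTE li) addr0. Qed.

Lemma ScEii i m k : Sc (k + Ei i *+ m) i = Sc k i + m%:R.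
Proof. by rewrite /Sc EimE eqxx intrD addrA. Qed.

Lemma Ty_lin i (J : Type) (r : seq J) (a : J -> K) (F : J -> chain) f y k :
  (forall j, decays (F j)) ->
  (forall m, f y (k + Ei i *+ m) = \sum_(j <- r) a j *: F j y (k + Ei i *+ m)) ->
  Ty i f y k = \sum_(j <- r) a j *: Ty i (F j) y k.
Proof.
move=> hF hf; apply/funext => E; rewrite fct_sumE /Ty.
rewrite (eq_Tser _ (psi := fun m => \sum_(j <- r) a j * F j y (k + Ei i *+ m) E)); last first.
  by move=> m; rewrite hf fct_sumE.
rewrite Tser_sum => [|//|j]; last exact/geoZ/decays_geo.
  by apply: eq_bigr => j _; rewrite exZ TserZ //; [exact: zp_Sc|exact: decays_geo].
exact: zp_Sc.
Qed.

Lemma Ty_lin2 i a b f g h y k : decays g -> decays h ->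
  (forall m, f y (k + Ei i *+ m) = a *: g y (k + Ei i *+ m) + b *: h y (k + Ei i *+ m)) ->
  Ty i f y k = a *: Ty i g y k + b *: Ty i h y k.
Proof.
move=> hg hh hf.
rewrite (@Ty_lin i bool [:: true; false] (fun j => if j then a else b) (fun j => if j then g else h)) //.
- by rewrite !big_cons big_nil addr0.
- by case.
by move=> m; rewrite hf !big_cons big_nil addr0.
Qed.

Lemma Ty_Th i l f y k : decays f -> Ty i (fun y k => Th l (f y k)) y k = Th l (Ty i f y k).
Proof.
move=> hf; apply/funext => E; rewrite /Ty /Th; case: ifP => _; last exact: Tser0.
by rewrite TserZ //; [exact: zp_Sc|exact: decays_geo].
Qed.

Lemma Ty_Dt i l f y k : decays f -> Ty i (fun y k => Dt l (f y k)) y k = Dt l (Ty i f y k).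
Proof.
move=> hf; apply/funext => E; rewrite /Ty /Dt; case: ifP => _; first exact: Tser0.
by rewrite TserZ //; [exact: zp_Sc|exact: decays_geo].
Qed.

Lemma decays_pully f j : decays f -> decays (fun y k => f (y - Ei j) k).
Proof. exact: (decays_pull (py := fun y => y - Ei j) (pk := id) (sz_y j)). Qed.

Lemma decays_pullk f i : decays f -> decays (fun y k => f y (k - Ei i)).
Proof. exact: (decays_pull (py := id) (pk := fun k => k - Ei i) (fun y => sz_k i y)). Qed.

Lemma Ty_nab i l f y k : decays f -> Ty i (nab l f) y k = nab l (Ty i f) y k.
Proof.
move=> hf; rewrite (Ty_lin (r := index_enum 'I_n) (a := fun j => (A j l)%:R) (F := fun j => Nop j f)) //.
  apply: eq_bigr => j _; congr (_ *: _).
  by rewrite (Ty_lin2 (a := Uc y j) (b := pi) hf (decays_pully j hf)).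
by move=> j; exact: decays_Nop.
Qed.

Lemma Ty_del i l f y k : decays f -> l != i -> Ty i (del l f) y k = del l (Ty i f) y k.
Proof.
move=> hf li; rewrite (Ty_lin2 (a := Sc k l) (b := pi) hf (decays_pullk l hf)); last first.
  by move=> m; rewrite delE ScEi.
congr (_ + _ *: _); apply/funext => E; rewrite /Ty.
have -> : Sc (k - Ei l) i = Sc k i.
  by rewrite /Sc !mxE eqxx eq_sym (negbTE li) subr0.
by apply: eq_Tser => m; rewrite addrAC.
Qed.

Lemma Ty_deli i f y k : decays f -> Ty i (del i f) y k = f y k.
Proof.
move=> hf; apply/funext => E; rewrite /Ty.
pose phi m := f y (k + Ei i *+ m) E.
rewrite (_ : f y k E = phi 0%N); last by rewrite /phi mulr0n addr0.
rewrite -(@Tser_inj (Sc k i) phi); last first.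
  apply: geo_summable; last exact: decays_geo.
  by have := zp_rationalD_int 1 (zp_Sc k i).
rewrite /Tser; congr (_ * _); apply: eq_ksum => m; congr (_ * _).
rewrite delE exD !exZ ScEii /phi /=; congr (_ * _ + _ * f _ _ _).
by rewrite mulrSr addrA addrK.
Qed.

Lemma del_Ty i f y k : decays f ->
  Sc k i *: Ty i f y k + Ry i f y k = f y k.
Proof.
move=> hf; apply/funext => E; rewrite exD exZ /Ty /Ry Tser_sol.
- by rewrite mulr0n addr0.
- exact: zp_Sc.
- by apply: geo_summable; [exact: zp_Sc|exact: decays_geo].
exact: (geo_Tsummable (zp_Sc k i) (decays_geo y k E i hf)).
Qed.

Lemma Ty_prev i f y k : pi *: Ty i f y (k - Ei i) = Ry i f y k.
Proof.
apply/funext => E; rewrite exZ /Ty /Ry /Tser /Rser mulrA mulfV ?pi_neq0 // mul1r.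
have -> : Sc (k - Ei i) i + 1 = Sc k i.
  by rewrite /Sc !mxE !eqxx intrB /= addrA subrK.
apply: eq_ksum => m; congr (_ * f _ _ _).
by rewrite mulrS addrA subrK.
Qed.

(** The contracting homotopy of the part without x_i; the factor [pi] cancels the inverse of [pi] in
    front of the [Dt] part of the differential. *)
Definition hy (i : 'I_n) (g : chain) : chain := fun y k =>
  if good y k && (Xe y i == 0) then pi *: Th i (Ty i g y k) else 0.

Lemma Ty_eq0 i g y k : (forall m, g y (k + Ei i *+ m.+1) = 0) -> Ty i g y k = 0.
Proof.
move=> h; apply/funext => E; rewrite /Ty -[RHS](Tser0 (Sc k i)) /Tser.
by congr (_ * _); apply: eq_ksum => m; rewrite h.
Qed.

Lemma good_up i y k m : good y k -> Xe y i = 0 -> good y (k + Ei i *+ m).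
Proof.
move=> /goodP h hX; apply/goodP => l; have [h1 h2 h3] := h l.
rewrite EimE; case: eqP => [->|_]; last by rewrite addr0; split.
by have [_ h5 _] := h i; rewrite hX addr_ge0 //; split=> //; left.
Qed.

Lemma good_down i y k m : good y (k + Ei i *+ m) -> Xe y i = 0 -> 0 <= k 0 i -> good y k.
Proof.
move=> /goodP h hX hk; apply/goodP => l; have [h1 h2 h3] := h l.
move: h2 h3; rewrite EimE; case: eqP => [->|_]; last by rewrite addr0; split.
by rewrite hX; split=> //; left.
Qed.

Lemma hy_low i g y k : vanishes_off_good g -> Xe y i = 0 -> 0 <= k 0 i ->
  hy i g y k = pi *: Th i (Ty i g y k).
Proof.
move=> hg hX hk; rewrite /hy hX eqxx andbT; case: ifP => // /negP hgd.
rewrite Ty_eq0 ?linear0 ?scaler0 // => m; apply: hg; apply/negP => h; apply: hgd.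
exact: good_down h hX hk.
Qed.

Lemma vog_hy i g : vanishes_off_good (hy i g).
Proof. by move=> y k /negbTE h; rewrite /hy h. Qed.

Lemma decays_hy i g : decays g -> decays (hy i g).
Proof.
move=> [C [r [C0 r0 r1 h]]].
have [B B0 hB] := v_Tser (ltW r0) r1.
exists (v pi * (B * C)), r; split=> //; first by rewrite !mulr_ge0 // ltW.
move=> y k E; rewrite /hy; case: ifP => [/andP[hg _]|_]; last first.
  by rewrite v0 !mulr_ge0 ?exprn_ge0 // ltW.
rewrite exZ vM -!mulrA; apply: ler_wpM2l => //.
apply: ext_v => [|E']; first by rewrite !mulr_ge0 ?exprn_ge0 // ltW.
apply: hB; [exact: zp_Sc|by rewrite mulr_ge0 // exprn_ge0 // ltW|].
move=> m; apply: le_trans (h _ _ _) _; rewrite -mulrA ler_wpM2l // -exprD.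
rewrite ler_wiXn2l ?(ltW r0) ?(ltW r1) // /sz.
rewrite (bigD1 i) //= [X in (_ <= X)%N](bigD1 i) //= EimE eqxx.
set T1 := (\sum_(_ < _ | _) _)%N; set T2 := (\sum_(_ < _ | _) _)%N.
have hT : (T1 <= T2)%N by apply: leq_sum => l li; rewrite EimE (negbTE li) addr0.
have /goodP/(_ i)[_ hk _] := hg.
move: hT hk; set a := `|Xe y i|%N; move: T1 T2 (k 0 i) a; clear => T1 T2 z a; lia.
Qed.

Lemma hy_lowX i j g y k : vanishes_off_good g -> Xe y i = 0 -> 0 <= k 0 i ->
  hy i g (y - Ei j) k = pi *: Th i (Ty i g (y - Ei j) k).
Proof.
move=> hg hX hk; have [a0|a0] := eqVneq (A j i) 0%N.
  by apply: hy_low => //; rewrite XeB a0 subr0.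
have hneg : Xe (y - Ei j) i < 0 by rewrite XeB hX sub0r oppr_lt0 ltz_nat lt0n.
rewrite /hy (lt_eqF hneg) andbF Ty_eq0 ?linear0 ?scaler0 // => m.
exact: (vog_X (i := i) _ hg).
Qed.

Lemma Th_op i (c d : K) (a b : ext) :
  c *: (d *: Th i a) + d *: (d *: Th i b) = d *: Th i (c *: a + d *: b).
Proof.
have -> : Th i (c *: a + d *: b) = c *: Th i a + d *: Th i b by rewrite linearD !linearZ.
by rewrite scalerDr !scalerA [d * c]mulrC.
Qed.

Lemma Dt_Th_scale i (c : K) (a b : ext) :
  Dt i (c *: Th i (a - b)) = c *: (a - Dt i (Th i b)) - Th i (c *: Dt i a).
Proof.
rewrite linearZ /= linearB linearB /= {1}DtTh eqxx scale1r [in RHS]linearZ /= -scalerBr.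
by rewrite addrAC.
Qed.

(* Homotopy formula: the part of the complex where [x_i] does not occur is a
   tensor product with a two-term complex that [Ty i] contracts. *)
Lemma hy_homotopy i g y k : inX g -> good y k -> Xe y i = 0 ->
  Dg (hy i g) y k = g y k - (if k 0 i == 0 then Dt i (Th i (Ry i g y k)) else 0)
    - Th i (pi *: Ty i (Dg g) y k).
Proof.
move=> [hd hv] hgd hX; have hk : 0 <= k 0 i by have /goodP/(_ i)[] := hgd.
rewrite {1}/Dg hgd dfullE.
have en l : nab l (hy i g) y k = pi *: Th i (Ty i (nab l g) y k).
  rewrite Ty_nab // /nab linear_sum scaler_sumr; apply: eq_bigr => j _.
  rewrite linearZ /= scalerA [pi * _]mulrC -scalerA; congr (_ *: _).
  rewrite !NopE hy_low // hy_lowX //.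
  move: (Ty i g y k) (Ty i g (y - Ei j) k) => a b.
  exact: Th_op.
have ed l : l != i -> del l (hy i g) y k = pi *: Th i (Ty i (del l g) y k).
  move=> li; rewrite Ty_del // !delE hy_low // hy_low //; last first.
    by rewrite !mxE eqxx eq_sym (negbTE li) subr0.
  move: (Ty i g y k) (Ty i g y (k - Ei l)) => a b.
  exact: Th_op.
(* At k_i = 0 the value of the homotopy at k_i = -1 is cut off; this leaves the defect [Ry]. *)
have edi : del i (hy i g) y k =
    pi *: Th i (g y k - (if k 0 i == 0 then Ry i g y k else 0)).
  rewrite delE hy_low //; case: eqP => k0.
    rewrite (vog_k (i := i) _ (@vog_hy i g)) ?scaler0 ?addr0; last first.
      by rewrite !mxE !eqxx k0.
    rewrite -[g y k](del_Ty i y k hd); move: (Ty i g y k) (Ry i g y k) => a b.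
    by rewrite addrK [in RHS]linearZ /= !scalerA mulrC.
  rewrite hy_low //; last first.
    by rewrite !mxE !eqxx /=; move: hk k0; move: (k 0 i) => z; clear; lia.
  rewrite subr0 -[g y k](del_Ty i y k hd) -(Ty_prev i g y k).
  move: (Ty i g y k) (Ty i g y (k - Ei i)) => a b.
  exact: Th_op.
have eT : Ty i (Dg g) y k = \sum_l Th l (Ty i (nab l g) y k)
     + pi^-1 *: \sum_l Dt l (Ty i (del l g) y k).
  have hx : decays (dx g) by apply: decays_sum => l; apply: decays_le (decays_nab l hd) _ => y' k' B B0 h; exact: ext_v.
  have hy' : decays (dy g) by apply: decays_sum => l; apply: decays_le (decays_del l hd) _ => y' k' B B0 h; exact: ext_vD.
  rewrite (Ty_lin2 (a := 1) (b := pi^-1) hx hy'); last first.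
    by move=> m; rewrite /Dg good_up // scale1r.
  rewrite scale1r; congr (_ + _ *: _).
    rewrite (Ty_lin (r := index_enum 'I_n) (a := fun=> 1) (F := fun l y k => Th l (nab l g y k))).
    - by apply: eq_bigr => l _; rewrite scale1r Ty_Th //; exact: decays_nab.
    - by move=> l; apply: decays_le (decays_nab l hd) _ => y' k' B B0 h; exact: ext_v.
    by move=> m; rewrite /dx; apply: eq_bigr => l _; rewrite scale1r.
  rewrite (Ty_lin (r := index_enum 'I_n) (a := fun=> 1) (F := fun l y k => Dt l (del l g y k))).
  - by apply: eq_bigr => l _; rewrite scale1r Ty_Dt //; exact: decays_del.
  - by move=> l; apply: decays_le (decays_del l hd) _ => y' k' B B0 h; exact: ext_vD.
  by move=> m; rewrite /dy; apply: eq_bigr => l _; rewrite scale1r.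
have e1 : \sum_l Th l (nab l (hy i g) y k) = - Th i (pi *: \sum_l Th l (Ty i (nab l g) y k)).
  rewrite linearZ linear_sum /= scaler_sumr -sumrN; apply: eq_bigr => l _.
  by rewrite en linearZ /= ThTh scalerN.
have e2 : \sum_l Dt l (del l (hy i g) y k) =
   pi *: (g y k - (if k 0 i == 0 then Dt i (Th i (Ry i g y k)) else 0))
   - Th i (pi *: \sum_l Dt l (Ty i (del l g) y k)).
  have h1 l : l != i -> Dt l (del l (hy i g) y k) = - Th i (pi *: Dt l (Ty i (del l g) y k)).
    move=> li; rewrite ed // [LHS]linearZ /= DtTh (negbTE li) scale0r sub0r scalerN.
    by congr (- _); rewrite [RHS]linearZ.
  rewrite (bigD1 i) //= (eq_bigr _ h1) sumrN edi.
  have -> : \sum_(l | l != i) Th i (pi *: Dt l (Ty i (del l g) y k)) =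
      Th i (pi *: \sum_(l | l != i) Dt l (Ty i (del l g) y k)).
    by rewrite scaler_sumr linear_sum.
  rewrite [in RHS](bigD1 i) //= Ty_deli //.
  set S := \sum_(l | l != i) _; set r := (if _ then Ry _ _ _ _ else 0).
  have -> : (if k 0 i == 0 then Dt i (Th i (Ry i g y k)) else 0) = Dt i (Th i r).
    by rewrite /r; case: ifP => // _; rewrite !linear0.
  by rewrite Dt_Th_scale [pi *: (_ + S)]scalerDr [Th i (_ + _)]linearD opprD addrA.
rewrite e1 e2 eT; set P := \sum_l Th l _; set Q := \sum_l Dt l _; set G := (g y k - _).
have e3 : Th i (pi *: (P + pi^-1 *: Q)) = Th i (pi *: P) + Th i Q.
  by rewrite scalerDr scalerA mulfV ?pi_neq0 // scale1r linearD.
have e4 : pi^-1 *: (pi *: G - Th i (pi *: Q)) = G - Th i Q.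
  rewrite scalerBr scalerA mulVf ?pi_neq0 // scale1r.
  by rewrite -[pi^-1 *: _]linearZ /= scalerA mulVf ?pi_neq0 // scale1r.
by rewrite e3 e4 opprD addrCA.
Qed.

(** * Reduction to the subcomplex [Om] *)

(* The complement of this condition describes the de Rham complex in the [i]-th variable. *)
Definition offstate (i : 'I_n) y k (E : {set 'I_n}) : bool :=
  (Xe y i == 0) && ((i \in E) || (k 0 i != 0)).

Definition clean (i : 'I_n) (f : chain) : Prop := forall y k E, offstate i y k E -> f y k E = 0.

Definition Om (f : chain) : Prop := inX f /\ forall i, clean i f.

Lemma clean_lin i a f g : clean i f -> clean i g -> clean i (a *: f + g).
Proof. by move=> hf hg y k E h; rewrite chD chZ exD exZ hf // hg // mulr0 addr0. Qed.

Lemma cleanB i f g : clean i f -> clean i g -> clean i (f - g).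
Proof. by move=> hf hg; rewrite addrC -scaleN1r; exact: clean_lin. Qed.

(** Where X_i = 0, [nab i] vanishes and [Dt i] reads values containing theta_i, which are zero by
    cleanness. The operators of other indices neither remove theta_i nor change k_i. *)
Lemma clean_Dg i f : inX f -> clean i f -> clean i (Dg f).
Proof.
move=> [_ hv] hc y k E /andP[/eqP hX hE]; rewrite /Dg; case: ifP => // hg.
have hcy y' k' (E' : {set 'I_n}) : Xe y' i <= 0 -> (i \in E') || (k' 0 i != 0) -> f y' k' E' = 0.
  rewrite le_eqVlt => /orP[/eqP h1 h2|h1 _]; first by apply: hc; rewrite /offstate h1 eqxx.
  by rewrite (vog_X (i := i) _ hv).
have hB j : Xe (y - Ei j) i <= 0 by rewrite XeB hX sub0r oppr_le0.
rewrite dfullE exD exZ !fct_sumE !big1 ?mulr0 ?addr0 // => l _.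
  rewrite /Dt; case: ifP => // lE; rewrite delE exD !exZ.
  have [->|li] := eqVneq l i.
    by rewrite !hcy ?hX ?finset.setU11 // !mulr0 addr0 mulr0.
  rewrite !hcy ?hX // ?mulr0 ?addr0 ?mulr0 //.
    by case/orP: hE => [iE|ki]; [rewrite finset.setU1r|rewrite !mxE eqxx [i == l]eq_sym (negbTE li) subr0 ki orbT].
  by case/orP: hE => [iE|ki]; [rewrite finset.setU1r|rewrite ki orbT].
rewrite /Th; case: ifP => // lE.
have [->|li] := eqVneq l i.
  rewrite nab_eq0 ?mulr0 // => y' hy'; exact: (vog_X (i := i) _ hv).
have hE' : (i \in (E :\ l)%SET) || (k 0 i != 0) by rewrite !inE eq_sym li.
by rewrite /nab fct_sumE big1 ?mulr0 // => j _; rewrite exZ NopE exD !exZ !hcy ?hX // !mulr0 addr0 mulr0.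
Qed.

(** By the homotopy formula nothing remains at X_i = 0 except a term at k_i = 0 without theta_i; the
    term [Ty] of [Dg g] is zero since it involves only k_i + 1 and above, where [Dg g] is clean. The
    homotopy acts in direction [i] only, so it keeps cleanness for other indices. *)
Lemma step_y i g : inX g -> clean i (Dg g) ->
  exists h, [/\ inX h, clean i (g - Dg h) & forall l, l != i -> clean l g -> clean l h].
Proof.
move=> gX hc; exists (hy i g); split.
- by split; [exact/decays_hy/(proj1 gX)|exact: vog_hy].
- move=> y k E hoff; have /andP[/eqP hX hE] := hoff.
  rewrite chD chN exD exN.
  have [hg|hg] := boolP (good y k); last first.
    by rewrite (proj2 gX) // /Dg (negbTE hg) subrr.
  rewrite hy_homotopy // !exD !exN opprB opprD !opprK.
  have -> : Ty i (Dg g) y k = 0.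
    apply: Ty_eq0 => m; apply/funext => E'; apply: hc; rewrite /offstate hX eqxx /=.
    have /goodP/(_ i)[_ hk _] := hg; rewrite EimE eqxx.
    by rewrite (_ : _ != 0) ?orbT //; move: hk; move: (k 0 i) => z; clear; lia.
  rewrite scaler0 linear0 add0r addrA subrr add0r.
  by case/orP: hE => [iE|ki]; [case: ifP => // _; rewrite /Dt iE|rewrite (negbTE ki)].
move=> l li hl y k E /andP[/eqP hX hE]; rewrite /hy; case: ifP => // /andP[hg /eqP hXi].
rewrite exZ /Th; case: ifP => iE; last by rewrite mulr0.
rewrite /Ty (eq_Tser _ (psi := fun=> 0)) ?Tser0 ?mulr0 // => m; apply: hl.
by rewrite /offstate hX eqxx /= !inE li EimE (negbTE li) addr0.
Qed.

(** Normalization index by index. Subtracting a coboundary leaves [Dg g] unchanged, so the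
    hypothesis on it persists, and the correction at [i] respects the indices already treated. It is
    applied to the conditions [clean], [nonneg] and [Pfix]. *)
Lemma reduce_gen (V : chain -> Prop) (P : 'I_n -> chain -> Prop) :
  V 0 -> (forall f g, V f -> V g -> V (f - g)) -> (forall f, V f -> V (Dg f)) ->
  (forall f, V f -> vanishes_off_good f) ->
  (forall i f g, P i f -> P i g -> P i (f - g)) ->
  (forall i f, V f -> P i f -> P i (Dg f)) ->
  (forall (i : 'I_n) g, V g -> (forall l : 'I_n, (l < i)%N -> P l g) -> P i (Dg g) ->
     exists h, [/\ V h, P i (g - Dg h) & forall l : 'I_n, (l < i)%N -> P l h]) ->
  forall g, V g -> (forall i, P i (Dg g)) ->
  exists h, V h /\ forall i, P i (g - Dg h).
Proof.
move=> V0 VB VD Vv PB PD step g gV hP.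
suff red m : exists h, V h /\ forall i : 'I_n, (i < m)%N -> P i (g - Dg h).
  by have [h [hV hcl]] := red n; exists h; split=> // i; apply: hcl; exact: ltn_ord.
elim: m => [|m [h [hV IH]]]; first by exists 0; split=> // i.
have [mn|mn] := ltnP m n; last first.
  by exists h; split=> // i _; apply: IH; exact: leq_trans (ltn_ord i) mn.
pose i := Ordinal mn; pose g' := g - Dg h.
have g'V : V g' by apply: VB => //; exact: VD.
have eD : Dg g' = Dg g.
  by rewrite /g' linearB /= Dg_Dg ?subr0 //; exact: Vv.
have hc' : P i (Dg g') by rewrite eD.
have [h' [h'V h1 h2]] := step i g' g'V IH hc'.
exists (h + h'); split=> [|l].
  by rewrite -[h']opprK; apply: (VB) => //; rewrite -sub0r; apply: (VB).
rewrite ltnS linearD /= opprD addrA -/g' leq_eqVlt => /orP[/eqP lm|lm].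
  by have -> : l = i by exact/val_inj.
by apply: PB; [exact: IH|apply: PD => //; exact: h2].
Qed.

Lemma reduce_y g : inX g -> (forall i, clean i (Dg g)) ->
  exists h, inX h /\ Om (g - Dg h).
Proof.
move=> gX hc; have [|||||||h [hX hP]] := @reduce_gen inX clean _ _ _ _ _ _ _ g gX hc.
- exact: inX0.
- exact: inXB.
- exact: inX_DgX.
- by move=> f [].
- exact: cleanB.
- exact: clean_Dg.
- move=> i f fX hl hD; have [h [hX h1 h2]] := step_y fX hD.
  by exists h; split=> // l li; apply: h2 (hl l li); rewrite neq_ltn li.
by exists h; split=> //; split=> //; apply: inXB => //; exact: inX_DgX.
Qed.

Lemma Om_Dg f : Om f -> Om (Dg f).
Proof. by move=> [fX fc]; split=> [|i]; [exact: inX_DgX|exact: clean_Dg]. Qed.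

Lemma OmP f : Om f -> forall y k E, f y k E != 0 ->
  [/\ k = 0, forall i, 0 <= Xe y i, forall i, i \in E -> 0 < Xe y i
    & forall i, Xe y i = 0 \/ s0 0 i = 0].
Proof.
move=> [[fd fv] fc] y k E hf.
have hg : good y k.
  by apply/negPn/negP => h; move: hf; rewrite fv ?eqxx.
have hoff i : ~~ offstate i y k E by apply/negP => /fc h; rewrite h eqxx in hf.
have hk i : k 0 i = 0.
  have := hoff i; rewrite /offstate; have /goodP/(_ i)[_ _ [->|[_ ->]]//] := hg.
  by rewrite eqxx negb_or negbK => /andP[_ /eqP].
split=> [|i|i iE|i].
- by apply/matrixP => a i; rewrite ord1 hk mxE.
- by have /goodP/(_ i)[] := hg.
- have /goodP/(_ i)[h _ _] := hg; rewrite lt_neqAle h andbT eq_sym.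
  by have := hoff i; rewrite /offstate iE andbT.
by have /goodP/(_ i)[_ _ [?|[? _]]] := hg; [left|right].
Qed.
Variables (cF : 'rV[int]_n -> K) (wt : 'I_n -> rat) (bF : 'rV[int]_n).
Hypothesis c_rec : is_frobenius_coef p cF.
Hypothesis w_gt0 : forall i, 0 < wt i.
Hypothesis Aw : forall j, \sum_i (A j i)%:R * wt i = 1.
Hypothesis bE : forall j, (bF 0 j)%:~R = (p.-1)%:R * u0 0 j.
Hypothesis s0_ge0 : forall i, 0 <= s0 0 i.
Hypothesis p_ge5 : (5 <= p)%N.

Implicit Types (z kap : 'rV[int]_n).

(** By Bernoulli's inequality. It trades a linear change of the exponent for a slower rate of decay,
    still below 1. *)
Lemma root_lt1 (r : R) N : 0 <= r -> r < 1 ->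
  exists r' : R, [/\ 0 < r', r' < 1 & r <= r' ^+ N].
Proof using Type.
move=> r0 r1; pose x := (1 - r) / N.+1%:R.
have n0 : (0 : R) < N.+1%:R by rewrite ltr0n.
have x0' : 0 < x by rewrite divr_gt0 // subr_gt0.
have xN : N.+1%:R * x = 1 - r by rewrite mulrC divfK // gt_eqF.
have x1 : x <= 1 - r by rewrite ler_pdivrMr // ler_peMr ?ler1n // subr_ge0 ltW.
have bern m : 1 - m%:R * x <= (1 - x) ^+ m.
  elim: m => [|m IH]; first by rewrite mul0r subr0 expr0.
  have p1 : 0 <= 1 - x by lra.
  rewrite exprS; apply: le_trans (_ : (1 - x) * (1 - m%:R * x) <= _); last exact: ler_wpM2l.
  by rewrite -natr1; have := mulr_ge0 (mulr_ge0 (ler0n R m) (ltW x0')) (ltW x0'); lra.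
have [rp|r0'] := ltP 0 r; last first.
  exists 2^-1; split; rewrite ?invr_gt0 ?invf_lt1 ?ltr1n //.
  by apply: le_trans r0' _; rewrite exprn_ge0 // invr_ge0.
exists (1 - x); split; [lra|lra|].
apply: le_trans (bern N); move: xN; rewrite -natr1 mulrDl mul1r; lra.
Qed.

(** * The Frobenius operator *)

Lemma A_row j : exists i, (0 < A j i)%N.
Proof.
apply: contrapT => /forallNP h; have /eqP := Aw j; rewrite big1 => [|i _].
  by rewrite eq_sym oner_eq0.
by move: (h i) => /negP; rewrite -eqn0Ngt => /eqP ->; rewrite mul0r.
Qed.

(** By [hj_rec] these are the coefficients of exp(t + t^p/p), and by [c_prod] they determine [cF] at
    nonnegative vectors. *)
Definition hj (j : 'I_n) (m : nat) : K := cF (Ei j *+ m).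

Lemma Eim i m (l : 'I_n) : (Ei i *+ m : 'rV[int]_n) 0 l = if l == i then m%:Z else 0.
Proof. by have := EimE i m 0 l; rewrite add0r mxE add0r. Qed.

Lemma hj_0 j : hj j 0 = 1.
Proof. by rewrite /hj mulr0n; case: c_rec. Qed.

Lemma c_neg k j : k 0 j < 0 -> cF k = 0.
Proof. by move=> h; case: c_rec => _ h2 _; apply: h2; exists j. Qed.

Lemma c_step k j : (forall l, 0 <= k 0 l) ->
  (k 0 j)%:~R * cF k = cF (k - Ei j) + cF (k - Ei j *+ p).
Proof. by move=> h; case: c_rec => _ _; apply. Qed.

Lemma hj_rec j m : m.+1%:R * hj j m.+1 = hj j m + (if (p <= m.+1)%N then hj j (m.+1 - p)%N else 0).
Proof.
have := @c_step (Ei j *+ m.+1) j; rewrite Eim eqxx => ->; last first.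
  by move=> l; rewrite Eim; case: eqP.
congr (_ + _); first by rewrite mulrS addrAC subrr add0r.
case: leqP => h; first by rewrite -mulrnBr.
rewrite (@c_neg _ j) // mxE mxE !Eim eqxx; lia.
Qed.

Lemma c_prod k : (forall l, 0 <= k 0 l) -> cF k = \prod_j hj j `|k 0%R j|%N.
Proof.
have [N] := ubnP (\sum_j `|k 0%R j|)%N; elim: N k => // N IH k hN hk.
have [k0|[j hj0]] : k = 0 \/ exists j, (0 < `|k 0%R j|)%N.
  have [|/existsNP[j hj']] := pselect (forall j, k 0 j = 0).
    by move=> h; left; apply/rowP => j; rewrite h mxE.
  by right; exists j; rewrite absz_gt0; apply/eqP.
  by rewrite k0 big1 => [|j _]; [case: c_rec|rewrite mxE hj_0].
have key q : (0 < q)%N -> cF (k - Ei j *+ q) =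
    (if (q <= `|k 0%R j|)%N then hj j (`|k 0%R j| - q)%N else 0) * \prod_(l | l != j) hj l `|k 0%R l|%N.
  move=> q0; case: leqP => hq; last first.
    rewrite mul0r (@c_neg _ j) // !mxE Eim eqxx; move: hq (hk j); move: (k 0 j) => z; clear; lia.
  rewrite IH.
  - rewrite (bigD1 j) //= !mxE Eim eqxx; congr (hj j _ * _).
      by move: hq (hk j); move: (k 0 j) => z; clear; lia.
    by apply: eq_bigr => l lj; rewrite !mxE Eim (negbTE lj) subr0.
  - move: hN; rewrite (bigD1 j) //= [X in (X < N)%N](bigD1 j) //= !mxE Eim eqxx.
    rewrite [X in ((_ + X) < N)%N](eq_bigr (fun l => `|k 0%R l|%N)); last first.
      by move=> l lj; rewrite !mxE Eim (negbTE lj) subr0.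
    by move: hq (hk j) q0; move: (k 0 j) (\sum_(_ < _ | _) _)%N => z S; clear; lia.
  move=> l; rewrite !mxE Eim; case: eqP => [->|_]; last by rewrite subr0.
  by move: hq (hk j); move: (k 0 j) => z; clear; lia.
have e1 : (`|k 0%R j|%N%:R : K) = (k 0 j)%:~R.
  by rewrite -[in RHS](gez0_abs (hk j)).
apply: (@mulfI K (`|k 0%R j|%N)%:R); first by rewrite natK_eq0 -lt0n.
rewrite [in RHS](bigD1 j) //= mulrA {1}e1 c_step //.
have := key 1%N isT; rewrite mulr1n => ->.
rewrite (key p p_gt0) hj0 -mulrDl; congr (_ * _).
by move: hj0; case: (`|k 0%R j|%N) => // m _; rewrite hj_rec subn1.
Qed.

Lemma v_c k : v (cF k) <= p%:R ^+ (\sum_j gap `|k 0%R j|)%N.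
Proof.
have [h|/existsNP[j /negP]] := pselect (forall l, 0 <= k 0 l); last first.
  by rewrite -ltNge => h; rewrite (c_neg h) v0 exprn_ge0 // ltW // pR_gt0.
rewrite c_prod //; have -> (s : seq 'I_n) : v (\prod_(j <- s) hj j `|k 0%R j|%N) = \prod_(j <- s) v (hj j `|k 0%R j|%N).
  by elim: s => [|j s IH]; rewrite ?big_nil ?v1 // !big_cons vM IH.
rewrite expr_sum; apply: ler_prod => j _; rewrite v_ge0 /=.
exact: (v_h_le (hj_0 j) (hj_rec j)).
Qed.

Definition vs k : nat := (\sum_j `|k 0%R j|)%N.

(** Coefficient of the product of the Dwork exponentials exp(pi (t_j - t_j^p)), since pi^p / p =
    -pi. *)
Definition Cf k : K := cF k * pi ^+ vs k.

Lemma vs_shift k j m : (forall l, 0 <= k 0 l) -> vs (k + Ei j *+ m) = (vs k + m)%N.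
Proof.
move=> h; rewrite /vs (bigD1 j) //= [in RHS](bigD1 j) //= EimE eqxx.
rewrite (eq_bigr (fun l => `|k 0%R l|%N)); last by move=> l lj; rewrite EimE (negbTE lj) addr0.
by move: (h j); move: (k 0 j) (\sum_(_ < _ | _) _)%N => z S; clear; lia.
Qed.

Lemma Cf_neg k j : k 0 j < 0 -> Cf k = 0.
Proof. by move=> h; rewrite /Cf (c_neg h) mul0r. Qed.

Lemma Cf_rec k j : (k 0 j)%:~R * Cf k = pi * Cf (k - Ei j) - p%:R * pi * Cf (k - Ei j *+ p).
Proof.
have [h|/existsNP[l /negP]] := pselect (forall l, 0 <= k 0 l); last first.
  rewrite -ltNge => h.
  have hm m : (k - Ei j *+ m) 0 l < 0.
    by rewrite !mxE Eim; apply: le_lt_trans h; rewrite gerBl; case: ifP.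
  rewrite (Cf_neg h) (Cf_neg (hm p)) -[Ei j]mulr1n (Cf_neg (hm 1%N)).
  by rewrite !mulr0 subr0.
have key m : Cf (k - Ei j *+ m) * pi ^+ m = cF (k - Ei j *+ m) * pi ^+ vs k.
  have [h2|/existsNP[l /negP]] := pselect (forall l, 0 <= (k - Ei j *+ m) 0 l).
    rewrite /Cf -mulrA -exprD; congr (_ * _ ^+ _).
    by rewrite -(vs_shift j m h2) subrK.
  by rewrite -ltNge => h2; rewrite (Cf_neg h2) (c_neg h2) !mul0r.
rewrite {1}/Cf mulrA c_step // mulrDl -key -{1}[Ei j]mulr1n -key mulr1n expr1 mulrC; congr (_ + _).
have -> : pi ^+ p = - (p%:R * pi).
  by rewrite -(prednK p_gt0) exprSr pi_root mulNr prednK // p_gt0.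
by rewrite mulrN mulrC.
Qed.

Definition Npts y : nat := (\sum_l `|Xe y l|)%N.

Lemma XeBk y k i : Xe (y - k) i = Xe y i - \sum_j k 0 j * (A j i)%:Z.
Proof.
rewrite /Xe -addrA; congr (_ + _); rewrite -sumrB; apply: eq_bigr => j _.
by rewrite !mxE mulrBl.
Qed.

Lemma XebpE y i : Xe (bF + y *+ p) i = Xe y i *+ p.
Proof.
have hp : (p = p.-1.+1)%N by rewrite prednK // p_gt0.
have e j : (bF + y *+ p) 0 j = bF 0 j + y 0 j *+ p.
  rewrite mxE; congr (_ + _); elim: {hp}p => [|m IH]; first by rewrite !mulr0n mxE.
  by rewrite !mulrS mxE IH.
have hb : \sum_j bF 0 j * (A j i)%:Z = x0 0 i *+ p.-1.
  apply/eqP; rewrite -(@eqr_int rat) rmorph_sum /= rmorphMn /= x0E -mulr_natl mulr_sumr.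
  by apply/eqP/eq_bigr => j _; rewrite intrM bE mulrA.
rewrite /Xe mulrnDl -sumrMnl (eq_bigr (fun j => bF 0 j * (A j i)%:Z + (y 0 j * (A j i)%:Z) *+ p)).
  by rewrite big_split /= hb addrA -mulrS -hp.
by move=> j _; rewrite e mulrDl mulrnAl.
Qed.

Lemma Xe_src y k i : (forall l, 0 <= k 0 l) -> Xe (bF + y *+ p - k) i <= Xe y i *+ p.
Proof.
move=> h; rewrite XeBk XebpE gerBl; apply: sumr_ge0 => j _; exact: mulr_ge0.
Qed.

(** The Frobenius sum without its power of [p], in lattice coordinates. Solving x0 + z A + kap A = p
    (x0 + y A) for the source gives z = bF + p y - kap, because bF A = (p - 1) x0. *)
Definition psi (f : chain) : chain := fun y k E =>
  \sum_(kap \in [set: 'rV[int]_n]) Cf kap * f (bF + y *+ p - kap) k E.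

Definition lowX (f : chain) : Prop := forall y k i, Xe y i < 0 -> f y k = 0.

(** Since [A] has no zero row, nonnegative exponents at the source bound each entry of [kap] by an
    exponent at [z]. *)
Lemma lowX_fin f z k E : lowX f -> finsupp (fun kap => Cf kap * f (z - kap) k E).
Proof.
move=> hf; pose N := Npts z.
pose G (a : {ffun 'I_n -> 'I_N.+1}) : 'rV[int]_n := \row_j (a j : nat)%:Z.
apply: sub_finite_set (finite_image G (@finite_finset _ setT)) => kap /= h.
have k0 j : 0 <= kap 0 j.
  by rewrite leNgt; apply/negP => hk; rewrite (Cf_neg hk) mul0r eqxx in h.
have hX i : 0 <= Xe (z - kap) i.
  by rewrite leNgt; apply/negP => hx; rewrite (hf _ _ _ hx) mulr0 eqxx in h.
have kN j : (`|kap 0%R j| < N.+1)%N.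
  have [i hi] := A_row j; have := hX i; rewrite XeBk subr_ge0 => h1.
  rewrite ltnS /N /Npts (bigD1 i) //=; apply: leq_trans (leq_addr _ _).
  have : kap 0 j * (A j i)%:Z <= Xe z i.
    apply: le_trans h1; rewrite (bigD1 j) //= lerDl; apply: sumr_ge0 => l _; exact: mulr_ge0.
  by move: hi (k0 j); move: (kap 0 j) (A j i) (Xe z i) => a m x; clear; nia.
exists [ffun j => Ordinal (kN j)] => //; apply/rowP => j; rewrite mxE ffunE /=.
by rewrite gez0_abs.
Qed.

Lemma vog_lowX f : vanishes_off_good f -> lowX f.
Proof. by move=> hf y k i h; exact: (vog_X (i := i)). Qed.

Lemma eq_psi f g y k : (forall kap, (forall l, 0 <= kap 0 l) ->
  f (bF + y *+ p - kap) k = g (bF + y *+ p - kap) k) -> psi f y k = psi g y k.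
Proof.
move=> h; apply/funext => E; apply: eq_fsbigr => kap _.
have [h2|/existsNP[l /negP]] := pselect (forall l, 0 <= kap 0 l); first by rewrite h.
by rewrite -ltNge => h2; rewrite (Cf_neg h2) !mul0r.
Qed.

Lemma psi_lin (J : Type) (r : seq J) (a : J -> K) (F : J -> chain) f y k :
  (forall j, lowX (F j)) ->
  (forall kap, (forall l, 0 <= kap 0 l) ->
     f (bF + y *+ p - kap) k = \sum_(j <- r) a j *: F j (bF + y *+ p - kap) k) ->
  psi f y k = \sum_(j <- r) a j *: psi (F j) y k.
Proof.
move=> hF hf; rewrite (@eq_psi f (fun y k => \sum_(j <- r) a j *: F j y k)) //.
apply/funext => E; rewrite fct_sumE /psi -[RHS](@fsum_lin _ J r a); last first.
  by move=> j; exact: lowX_fin.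
apply: eq_fsbigr => kap _; rewrite fct_sumE mulr_sumr.
by apply: eq_bigr => j _; rewrite exZ mulrCA.
Qed.

Lemma psi_low f : lowX f -> lowX (psi f).
Proof.
move=> hf y k i h; apply/funext => E; apply: fsbig1 => kap _.
have [h2|/existsNP[l /negP]] := pselect (forall l, 0 <= kap 0 l); last first.
  by rewrite -ltNge => h2; rewrite (Cf_neg h2) !mul0r.
rewrite (hf _ _ i) ?mulr0 //; apply: le_lt_trans (Xe_src _ _ h2) _.
by rewrite pmulrn_llt0 // p_gt0.
Qed.

Lemma psi_Th l f y k : lowX f -> psi (fun y k => Th l (f y k)) y k = Th l (psi f y k).
Proof.
move=> hf; apply/funext => E; rewrite /psi /Th; case: ifP => lE.
  rewrite mulr_fsumr; apply: eq_fsbigr => kap _; by rewrite mulrCA.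
by rewrite fsbig1 // => kap _; rewrite mulr0.
Qed.

Lemma psi_Dt l f y k : lowX f -> psi (fun y k => Dt l (f y k)) y k = Dt l (psi f y k).
Proof.
move=> hf; apply/funext => E; rewrite /psi /Dt; case: ifP => lE.
  by rewrite fsbig1 // => kap _; rewrite mulr0.
rewrite mulr_fsumr; apply: eq_fsbigr => kap _; by rewrite mulrCA.
Qed.

Lemma lowXS j f : lowX f -> lowX (fun y k => f (y - Ei j) k).
Proof.
move=> hf y k i h; apply: (hf _ _ i); apply: le_lt_trans h.
by rewrite XeB gerBl.
Qed.

Lemma lowX_Nop j f : lowX f -> lowX (Nop j f).
Proof.
move=> hf y k i h; rewrite NopE (hf _ _ i h) (@lowXS j f hf _ _ _ h).
by rewrite !scaler0 addr0.
Qed.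

Lemma psi_shift f z k E m j : 
  \sum_(kap \in [set: 'rV[int]_n]) Cf kap * f (z - Ei j *+ m - kap) k E =
  \sum_(kap \in [set: 'rV[int]_n]) Cf (kap - Ei j *+ m) * f (z - kap) k E.
Proof.
rewrite [RHS](@reindex_fsbigT _ _ _ _ _ (fun kap => kap + Ei j *+ m)).
  by apply: eq_fsbigr => kap _; rewrite addrK opprD addrA addrAC.
by exists (fun kap => kap - Ei j *+ m) => kap; rewrite ?addrK ?subrK.
Qed.

Lemma Uc_src y kap j : Uc (bF + y *+ p - kap) j = p%:R * Uc y j - (kap 0 j)%:~R.
Proof.
have e : (y *+ p) 0 j = y 0 j *+ p.
  by elim: p => [|m IH]; rewrite ?mulr0n ?mxE // !mulrS mxE IH.
rewrite /Uc !mxE e intrB addrA; congr (_ - _).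
have hb : ((bF 0 j)%:~R : K) = p.-1%:R * ratr (u0 0 j).
  by rewrite -(@ratr_int K) bE ratrKM ratr_nat.
have hp : (p%:R : K) = p.-1%:R + 1 by rewrite natr1 prednK // p_gt0.
rewrite intrD hb rmorphMn /= -[(y 0 j)%:~R *+ p]mulr_natl mulrDr hp; ring.
Qed.

(** Dwork's commutation relation. At the source U_j equals p U_j(y) - kap_j. The recursion for [Cf]
    turns the term in kap_j into a shift by e_j, which cancels the shift in [Nop], and a shift by p
    e_j, which is the shift by e_j at the target. *)
Lemma psi_Nop j f y k : lowX f -> psi (Nop j f) y k = p%:R *: Nop j (psi f) y k.
Proof.
move=> hf; apply/funext => E; rewrite exZ NopE exD !exZ.
rewrite {1}/psi (eq_fsbigr (fun kap => (p%:R * Uc y j) * (Cf kap * f (bF + y *+ p - kap) k E)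
   + (- p%:R * - pi) * (Cf (kap - Ei j *+ p) * f (bF + y *+ p - kap) k E)
   + pi * (Cf kap * f (bF + y *+ p - Ei j *+ 1 - kap) k E)
   + (- pi) * (Cf (kap - Ei j *+ 1) * f (bF + y *+ p - kap) k E))); last first.
  move=> kap _; rewrite NopE exD !exZ Uc_src mulr1n [bF + _ - Ei j - kap]addrAC.
  have key (C C1 C2 u x F1 F2 : K) : x * C = pi * C1 - p%:R * pi * C2 ->
      C * ((p%:R * u - x) * F1 + pi * F2) =
      p%:R * u * (C * F1) + - p%:R * - pi * (C2 * F1) + pi * (C * F2) + - pi * (C1 * F1).
    move=> h; transitivity (p%:R * u * (C * F1) - x * C * F1 + pi * (C * F2)); first by ring.
    by rewrite h; ring.
  exact: key (Cf_rec kap j).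
have fs z : finsupp (fun kap => Cf kap * f (z - kap) k E) by exact: lowX_fin.
have fs2 m : finsupp (fun kap => Cf (kap - Ei j *+ m) * f (bF + y *+ p - kap) k E).
  have /finsupp_seq[r ur hr] := fs (bF + y *+ p - Ei j *+ m).
  apply: (@finsupp_sub _ (map (fun x => x + Ei j *+ m) r)) => kap hk.
  have := hr (kap - Ei j *+ m); rewrite opprB addrA subrK; apply.
  by apply: contraNN hk => h; apply/mapP; exists (kap - Ei j *+ m); rewrite ?subrK.
pose G1 kap := Cf kap * f (bF + y *+ p - kap) k E.
pose G2 m kap := Cf (kap - Ei j *+ m) * f (bF + y *+ p - kap) k E.
pose G3 kap := Cf kap * f (bF + y *+ p - Ei j *+ 1 - kap) k E.
have sh m : \sum_(kap \in [set: 'rV[int]_n]) G2 m kap =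
    \sum_(kap \in [set: 'rV[int]_n]) Cf kap * f (bF + y *+ p - Ei j *+ m - kap) k E.
  by rewrite psi_shift.
transitivity (\sum_(kap \in [set: 'rV[int]_n])
   \sum_(a <- [:: (p%:R * Uc y j, G1); (- p%:R * - pi, G2 p); (pi, G3); (- pi, G2 1%N)]) a.1 * a.2 kap).
  by apply: eq_fsbigr => kap _; rewrite !big_cons big_nil addr0 !addrA.
pose s4 := [:: (p%:R * Uc y j, G1); (- p%:R * - pi, G2 p); (pi, G3); (- pi, G2 1%N)].
have hs : forall i : 'I_4, finsupp (nth (0, G1) s4 i).2.
  by case=> -[|[|[|[|//]]]] hi; [exact: fs|exact: fs2|exact: fs|exact: fs2].
rewrite -/s4; under eq_fsbigr do rewrite (big_nth (0, G1)) big_mkord.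
rewrite (@fsum_lin _ _ _ (fun i : 'I_4 => (nth (0, G1) s4 i).1) (fun i : 'I_4 => (nth (0, G1) s4 i).2)) //.
rewrite !big_ord_recl big_ord0 addr0 /= (sh p) (sh 1%N).
have -> : \sum_(kap \in [set: 'rV[int]_n]) Cf kap * f (bF + y *+ p - Ei j *+ p - kap) k E = psi f (y - Ei j) k E.
  by apply: eq_fsbigr => kap _; rewrite mulrnBl addrA.
rewrite -/(\sum_(kap \in _) G3 kap) -[\sum_(kap \in _) G1 kap]/(psi f y k E).
move: (\sum_(kap \in _) G3 kap) (psi f y k E) (psi f (y - Ei j) k E) => a1 a2 a3.
ring.
Qed.

Lemma psi_nab i f y k : lowX f -> psi (nab i f) y k = p%:R *: nab i (psi f) y k.
Proof.
move=> hf; rewrite (@psi_lin _ (index_enum 'I_n) (fun j => (A j i)%:R) (fun j => Nop j f)) //.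
  rewrite /nab scaler_sumr; apply: eq_bigr => j _; rewrite psi_Nop //.
  by rewrite !scalerA mulrC.
by move=> j; exact: lowX_Nop.
Qed.

Lemma psi_del i f y k : lowX f -> psi (del i f) y k = del i (psi f) y k.
Proof.
move=> hf; rewrite (@psi_lin bool [:: true; false] (fun j => if j then Sc k i else pi)
  (fun j => if j then f else fun y k => f y (k - Ei i))).
- by rewrite !big_cons big_nil addr0 delE; congr (_ + _ *: _).
- by case=> // y' k' l h; exact: (hf _ _ l h).
by move=> kap _; rewrite delE !big_cons big_nil addr0.
Qed.

(** * Compatibility of Frobenius with the differential *)

Definition qE k (E : {set 'I_n}) : nat :=
  (#|E| + #|[set i | (i \notin E) && (0 < s0 0 i + (k 0 i)%:~R)%R]%SET|)%N.

Definition Fr (f : chain) : chain := fun y k E =>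
  if good y k then p%:R ^- qE k E * psi f y k E else 0.

Lemma qE_add i k (E : {set 'I_n}) : i \notin E ->
  qE k (i |: E)%SET = (qE k E + ~~ (0 < s0 0 i + (k 0 i)%:~R)%R)%N.
Proof.
move=> iE; rewrite /qE cardsU1 iE add1n.
set S := [set j | _ & _]%SET; set S' := [set j | _ & _]%SET.
have eS : S = (S' :\ i)%SET.
  by apply/setP => j; rewrite !inE negb_or andbA.
rewrite eS (cardsD1 i S') inE iE /=; case: (_ < _) => /=; lia.
Qed.

Lemma good_src y k kap f : vanishes_off_good f -> good y k -> (forall l, 0 <= kap 0 l) ->
  Dg f (bF + y *+ p - kap) k = dfull f (bF + y *+ p - kap) k.
Proof.
move=> hf hg hk; rewrite /Dg; case: ifP => // /negP h.
have [h3|] := pselect (forall i, 0 <= Xe (bF + y *+ p - kap) i); last first.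
  by move=> /existsNP[i /negP]; rewrite -ltNge => h3; rewrite (dfull_X _ hf h3).
case: h; apply/goodP => i; have /goodP/(_ i)[h1 h2 h4] := hg; split=> //.
case: h4 => [h4|]; [left|by right]; apply/eqP; rewrite eq_le h3 andbT.
by have := Xe_src y i hk; rewrite h4 mul0rn.
Qed.

Lemma Sc_gt0 y k i : good y k -> ~~ (0 < s0 0 i + (k 0 i)%:~R) -> s0 0 i = 0 /\ k 0 i = 0.
Proof.
move=> /goodP/(_ i)[_ hk _]; rewrite -leNgt => h.
have h1 := s0_ge0 i; have h2 : 0 <= (k 0 i)%:~R :> rat by rewrite ler0z.
have e1 : s0 0 i = 0 by apply/eqP; rewrite eq_le h1 andbT; apply: le_trans h; rewrite lerDl.
by split=> //; apply/eqP; rewrite -(intr_eq0 rat) eq_le h2 andbT; move: h; rewrite e1 add0r.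
Qed.

Lemma vog_Fr f : vanishes_off_good (Fr f).
Proof. by move=> y k /negbTE h; apply/funext => E; rewrite /Fr h. Qed.

Lemma pK_neq0 : (p%:R : K) != 0.
Proof. by rewrite natK_eq0 -lt0n p_gt0. Qed.

(** [psi] commutes with [nab] up to a factor [p] and with [del] exactly; the exponents [qE]
    compensate for this. Adding theta_i raises [qE] by one exactly when s_i + k_i = 0, where the
    [Dt] term of index [i] vanishes. When s_i + k_i > 0 it leaves [qE] unchanged, but then X_i = 0
    and the [Th] term vanishes. *)
Lemma Fr_Dg f : vanishes_off_good f -> Fr (Dg f) = Dg (Fr f).
Proof.
move=> hf; have hl := vog_lowX hf; apply/funext => y; apply/funext => k; apply/funext => E.
rewrite {1}/Fr [in RHS]/Dg; case: ifP => // hg.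
rewrite (@eq_psi _ (dfull f)); last by move=> kap hk; exact: good_src.
have lN i : lowX (nab i f) by move=> y' k' l h; rewrite /nab big1 // => j _; rewrite (@lowX_Nop j f hl _ _ _ h) scaler0.
have lD i : lowX (del i f) by move=> y' k' l h; rewrite delE !(hl _ _ l h) !scaler0 addr0.
have lTh (F : 'I_n -> chain) l : lowX (F l) -> lowX (fun y k => Th l (F l y k)).
  by move=> h y' k' m h'; rewrite (h _ _ m) // linear0.
have lDt (F : 'I_n -> chain) l : lowX (F l) -> lowX (fun y k => Dt l (F l y k)).
  by move=> h y' k' m h'; rewrite (h _ _ m) // linear0.
have e1 : psi (dfull f) y k = \sum_i Th i (p%:R *: nab i (psi f) y k) + pi^-1 *: \sum_i Dt i (del i (psi f) y k).
  rewrite (@psi_lin bool [:: true; false] (fun j => if j then 1 else pi^-1)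
     (fun j => if j then dx f else dy f)).
  - rewrite !big_cons big_nil addr0 scale1r; congr (_ + _ *: _).
      rewrite (@psi_lin _ (index_enum 'I_n) (fun=> 1) (fun i y k => Th i (nab i f y k))).
      + by apply: eq_bigr => i _; rewrite scale1r psi_Th // psi_nab.
      + by move=> i; exact: (lTh (fun i => nab i f)).
      by move=> kap _; rewrite /dx; apply: eq_bigr => i _; rewrite scale1r.
    rewrite (@psi_lin _ (index_enum 'I_n) (fun=> 1) (fun i y k => Dt i (del i f y k))).
    + by apply: eq_bigr => i _; rewrite scale1r psi_Dt // psi_del.
    + by move=> i; exact: (lDt (fun i => del i f)).
    by move=> kap _; rewrite /dy; apply: eq_bigr => i _; rewrite scale1r.
  - case=> y' k' l h.
      by rewrite /dx big1 // => i _; exact: (lTh (fun i => nab i f) i (lN i) _ _ _ h).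
    by rewrite /dy big1 // => i _; exact: (lDt (fun i => del i f) i (lD i) _ _ _ h).
  by move=> kap _; rewrite !big_cons big_nil addr0 scale1r.
have F1 j E' : Fr f (y - Ei j) k E' = p%:R ^- qE k E' * psi f (y - Ei j) k E'.
  rewrite /Fr; case: ifP => // /negP h.
  have [h3|] := pselect (forall i, 0 <= Xe (y - Ei j) i); first by case: h; exact: good_lowX.
  move=> /existsNP[i /negP]; rewrite -ltNge => h3.
  by rewrite (psi_low hl _ h3) mulr0.
have F2 i E' : Fr f y (k - Ei i) E' = p%:R ^- qE (k - Ei i) E' * psi f y (k - Ei i) E'.
  rewrite /Fr; case: ifP => // /negP h.
  have [h3|h3] := leP 0 ((k - Ei i) 0 i); first by case: h; exact: good_lowk.
  by rewrite /psi fsbig1 ?mulr0 // => kap _; rewrite (vog_k (i := i) _ hf) ?mulr0.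
have F0 E' : Fr f y k E' = p%:R ^- qE k E' * psi f y k E' by rewrite /Fr hg.
rewrite e1 dfullE !exD !exZ !fct_sumE mulrDr [X in _ + X]mulrCA !mulr_sumr.
congr (_ + _); apply: eq_bigr => i _; last congr (_ * _).
  rewrite /Th; case: ifP => iE; last by rewrite mulr0.
  have enab : nab i (Fr f) y k (E :\ i)%SET = p%:R ^- qE k (E :\ i)%SET * nab i (psi f) y k (E :\ i)%SET.
    rewrite /nab !fct_sumE mulr_sumr; apply: eq_bigr => j _.
    by rewrite !exZ !NopE !exD !exZ F0 F1 mulrDr !mulrDr; congr (_ + _); rewrite ?mulrA; congr (_ * _); ring.
  rewrite enab exZ.
  have := @qE_add i k (E :\ i)%SET; rewrite finset.setD1K // !inE eqxx /= => -> //.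
  case: (boolP (0 < _)) => hS /=.
    have hX : Xe y i = 0.
      have /goodP/(_ i)[_ _ [//|[s1 k1]]] := hg.
      by move: hS; rewrite s1 k1 addr0 ltxx.
    rewrite nab_eq0 ?mulr0 // => y' h'; exact: psi_low hl _ _ _ h'.
  rewrite addn1 exprSr invfM [_ * p%:R^-1]mulrC -!mulrA; have hp := pK_neq0.
  move: (p%:R ^- _) (nab _ _ _ _ _) (eps i E) hp; move: (p%:R : K) => q0 a1 a2 a3 hp.
  by field.
rewrite /Dt; case: ifP => iE; first by rewrite mulr0.
rewrite !delE !exD !exZ F0 F2.
have qk : qE (k - Ei i) (i |: E)%SET = qE k (i |: E)%SET.
  congr (_ + #|pred_of_set _|)%N; apply/setP => j; rewrite !inE.
  by have [//|ji] := eqVneq j i; rewrite !mxE eqxx (negbTE ji) subr0.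
rewrite qk qE_add ?iE //; case: (boolP (0 < _)) => hS /=.
  rewrite addn0; move: (psi f y k _) (psi f y (k - Ei i) _) => a1 a2; ring.
have [s1 k1] := Sc_gt0 hg hS.
have z1 : Sc k i = 0 by rewrite /Sc s1 k1 ratrK0 addr0.
have z2 : psi f y (k - Ei i) = 0.
  apply/funext => E'; rewrite /psi fsbig1 // => kap _; rewrite (vog_k (i := i) _ hf) ?mulr0 //.
  by rewrite !mxE !eqxx k1.
by rewrite z1 z2 !(mul0r, mulr0, addr0).
Qed.

Lemma Fr_linear a f g : vanishes_off_good f -> vanishes_off_good g ->
  Fr (a *: f + g) = a *: Fr f + Fr g.
Proof.
move=> hf hg; apply/funext => y; apply/funext => k; apply/funext => E.
rewrite chD chZ exD exZ /Fr; case: ifP => _; last by rewrite mulr0 addr0.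
rewrite (@psi_lin bool [:: true; false] (fun j => if j then a else 1) (fun j => if j then f else g)).
- by rewrite !big_cons big_nil addr0 exD !exZ mul1r mulrDr mulrCA.
- by case; exact: vog_lowX.
by move=> kap _; rewrite !big_cons big_nil addr0 scale1r.
Qed.

(** * Growth under Frobenius *)

Lemma vpi_half m : v pi ^+ (p.-1 * m) = p%:R^-1 ^+ m.
Proof. by rewrite exprM vpi_pow. Qed.

Lemma gap_p m : (p * gap m <= m)%N.
Proof.
rewrite /gap; have : (p ^ 2 * (m %/ p ^ 2) <= m)%N by rewrite mulnC leq_trunc_div.
move=> h; apply: leq_trans (leq_mul (leqnn p) (leq_pred _)) (leq_trans _ h).
by rewrite expnS expn1 -mulnA leq_mul2l leq_mul2r (leq_trans _ p_ge5) ?orbT.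
Qed.

Lemma pRX_mono i j : (i <= j)%N -> (p%:R : R) ^+ i <= p%:R ^+ j.
Proof. by apply: ler_weXn2l; rewrite ler1n p_gt0. Qed.

Lemma v_Cf kap : v (Cf kap) <= p%:R ^+ (\sum_j gap `|kap 0%R j|)%N * v pi ^+ vs kap.
Proof. by rewrite /Cf vM vX ler_wpM2r ?exprn_ge0 // v_c. Qed.

(** Each gap is at most 1/p times the entry of [kap], and |pi|^((p-1) |kap|) = p^-|kap|; so raising
    to the p-th power leaves exactly enough to absorb the denominators. *)
Lemma v_Cf_pow kap : v (Cf kap) ^+ p <= v pi ^+ vs kap.
Proof.
have pR := pR_gt0; set G := (\sum_j gap `|kap 0%R j|)%N.
have hG : (p * G <= vs kap)%N by rewrite /G big_distrr; apply: leq_sum => j _; exact: gap_p.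
apply: le_trans (_ : (p%:R ^+ G * v pi ^+ vs kap) ^+ p <= _).
  by apply: lerXn2r; rewrite ?nnegrE ?mulr_ge0 ?exprn_ge0 //; exact: v_Cf.
have e : v pi ^+ (p.-1 * vs kap) = p%:R^-1 ^+ vs kap by exact: vpi_half.
rewrite exprMn -!exprM.
have -> : (vs kap * p = p.-1 * vs kap + vs kap)%N.
  by rewrite -{1}(prednK p_gt0) mulnC mulSn addnC.
rewrite exprD mulrA e ler_piMl ?exprn_ge0 // exprVn ler_pdivrMr ?exprn_gt0 // mul1r.
by rewrite pRX_mono // mulnC.
Qed.

Lemma v_Cf_geom : exists rho : R, [/\ 0 < rho, rho < 1 & forall kap, v (Cf kap) <= rho ^+ vs kap].
Proof.
have [rho [r0 r1 hr]] := root_lt1 p (vpi_ge0) vpi_lt1.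
exists rho; split=> // kap; rewrite -(@ler_pXn2r _ p) ?nnegrE ?exprn_ge0 ?(ltW r0) ?p_gt0 //.
apply: le_trans (v_Cf_pow kap) _; rewrite -exprM mulnC exprM.
by apply: lerXn2r; rewrite ?nnegrE ?exprn_ge0 // ltW.
Qed.

Lemma src_neq0 f y k kap E : lowX f -> Cf kap * f (bF + y *+ p - kap) k E != 0 ->
  (forall l, 0 <= kap 0 l) /\ (forall i, 0 <= Xe (bF + y *+ p - kap) i).
Proof.
move=> hf h; split=> [l|i].
  by rewrite leNgt; apply/negP => hk; rewrite (Cf_neg hk) mul0r eqxx in h.
by rewrite leNgt; apply/negP => hx; rewrite (hf _ _ _ hx) mulr0 eqxx in h.
Qed.

Lemma v_psi (B : R) f y k E : lowX f -> 0 <= B ->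
  (forall kap, (forall l, 0 <= kap 0 l) -> (forall i, 0 <= Xe (bF + y *+ p - kap) i) ->
     v (Cf kap * f (bF + y *+ p - kap) k E) <= B) ->
  v (psi f y k E) <= B.
Proof.
move=> hf B0 h; apply: v_fsum => // kap.
have [->|h0] := eqVneq (Cf kap * f (bF + y *+ p - kap) k E) 0; first by rewrite v0.
by have [h1 h2] := src_neq0 hf h0; exact: h.
Qed.

Lemma v_Fr (B : R) f y k E : 0 <= B -> (good y k -> v (psi f y k E) <= B) ->
  v (Fr f y k E) <= p%:R ^+ (n + n) * B.
Proof.
move=> B0 h; have pR := pR_gt0.
rewrite /Fr; case: ifP => [hg|_]; last by rewrite v0 mulr_ge0 // exprn_ge0 // ltW.
rewrite vM; apply: ler_pM => //; last exact: h.
rewrite vV vX vp -exprVn invrK pRX_mono // /qE leq_add //.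
  by rewrite -[X in (_ <= X)%N]card_ord max_card.
by rewrite -[X in (_ <= X)%N]card_ord max_card.
Qed.

(** The exponents at the source plus kap A are [p] times those at the target, so the size at the
    target is bounded linearly by the size at the source plus |kap|. Decay in these two gives decay
    in [sz]. *)
Lemma psi_decays f : decays f -> lowX f -> exists C r : R, [/\ 0 <= C, 0 < r, r < 1 &
  forall y k E, (forall i, 0 <= Xe y i) -> v (psi f y k E) <= C * r ^+ sz y k].
Proof.
move=> [C [r [C0 r0 r1 h]]] hv.
have [rho [h0 h1 hrho]] := v_Cf_geom.
pose a := (\sum_i \sum_j A j i).+1.
have t1 : Num.max r rho < 1 by rewrite gt_max r1.
have t0 : 0 < Num.max r rho by rewrite lt_max r0.
have [tau [tau0 tau1 htau]] := root_lt1 a (ltW t0) t1.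
exists C, tau; split=> // y k E hg.
apply: v_psi => // [|kap k0 hgs]; first by rewrite mulr_ge0 // exprn_ge0 // ltW.
rewrite vM mulrC.
apply: le_trans (_ : C * (r ^+ sz (bF + y *+ p - kap) k * rho ^+ vs kap) <= _).
  by rewrite mulrA; apply: ler_pM.
rewrite ler_wpM2l //; set y' := bF + _ - _.
have hsz : (sz y k <= a * (sz y' k + vs kap))%N.
  have hle i : (`|Xe y i| <= `|Xe y' i| + (\sum_j A j i) * vs kap)%N.
    have hX : Xe y' i = Xe y i *+ p - \sum_j kap 0 j * (A j i)%:Z by rewrite XeBk XebpE.
    have x0' := hg i; have x1' := hgs i.
    have hS : \sum_j kap 0 j * (A j i)%:Z <= ((\sum_j A j i) * vs kap)%N%:Z.
      rewrite PoszM [(\sum_j A j i)%N%:Z](@big_morph _ _ Posz 0 (+%R)) // mulr_suml.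
      apply: ler_sum => j _; rewrite mulrC ler_wpM2l // /vs (bigD1 j) //=.
      by rewrite PoszD gez0_abs ?k0 // lerDl.
    move: hX hS x0' x1' p_gt0; rewrite -/y' -mulr_natl; move: (\sum_j _) ((\sum_j A j i) * _)%N.
    move: (Xe y i) (Xe y' i) p; rewrite /= => xx xx' q S m; clear => e hS h1 h2 q0.
    have : q%:R * xx = xx' + S by rewrite e subrK.
    have : xx <= q%:R * xx by rewrite ler_peMl // ler1n.
    move: (q%:R * xx) => t; lia.
  rewrite /sz /a; apply: leq_trans (_ : \sum_i ((`|Xe y' i| + `|k 0%R i|) + (\sum_j A j i) * vs kap)%N <= _)%N.
    by apply: leq_sum => i _; rewrite addnAC leq_add2r hle.
  rewrite big_split /= -big_distrl /= mulSn mulnDr.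
  move: (\sum_i \sum_j A j i)%N (\sum_i _)%N (vs kap); clear; nia.
apply: le_trans (_ : tau ^+ (a * (sz y' k + vs kap)) <= _); last first.
  by rewrite ler_wiXn2l // ltW.
rewrite exprM exprD; apply: ler_pM; rewrite ?exprn_ge0 ?(ltW r0) ?(ltW h0) //.
  apply: lerXn2r; rewrite ?nnegrE ?exprn_ge0 ?(ltW r0) ?(ltW tau0) //.
  by apply: le_trans htau; rewrite le_max lexx.
apply: lerXn2r; rewrite ?nnegrE ?exprn_ge0 ?(ltW h0) ?(ltW tau0) //.
by apply: le_trans htau; rewrite le_max lexx orbT.
Qed.

Lemma inX_Fr f : inX f -> inX (Fr f).
Proof.
move=> [hd hv]; split; last exact: vog_Fr.
have [C [r [C0 r0 r1 h]]] := psi_decays hd (vog_lowX hv); have pR := pR_gt0.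
exists (p%:R ^+ (n + n) * C), r; split=> //; first by rewrite mulr_ge0 // exprn_ge0 // ltW.
move=> y k E; rewrite -mulrA; apply: v_Fr; first by rewrite mulr_ge0 // exprn_ge0 // ltW.
by move=> hg; apply: h => i; have /goodP/(_ i)[] := hg.
Qed.

Lemma Om_Fr f : Om f -> Om (Fr f).
Proof.
move=> hf; have hv := proj2 (proj1 hf); split=> [|i]; first exact: inX_Fr (proj1 hf).
move=> y k E /andP[/eqP hX hE]; rewrite /Fr; case: ifP => // hg.
rewrite /psi fsbig1 ?mulr0 // => kap _; apply/eqP/negPn/negP => h.
have [k0 hgs] := src_neq0 (vog_lowX hv) h.
have hX' : Xe (bF + y *+ p - kap) i = 0.
  apply/eqP; rewrite eq_le hgs andbT.
  by have := Xe_src y i k0; rewrite hX mul0rn.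
by move/eqP: h; apply; rewrite (proj2 hf i) ?mulr0 // /offstate hX' eqxx.
Qed.
Variables (L0 : int) (ag : nat).
Hypothesis L0E : \sum_j u0 0 j = L0%:~R.
Hypothesis n_gt0 : (0 < n)%N.

(** * Frobenius is a contraction away from the minimal level *)

(** The weighted degree of the monomial: by [lev_int] it is the sum of the X_i w_i wherever all X_i
    are nonnegative, and there the absolute value changes nothing. *)
Definition lev y : nat := `|(L0 + \sum_j y 0 j)%R|%N.

Lemma lev_int y : (forall i, 0 <= Xe y i) ->
  L0 + \sum_j y 0 j = (lev y)%:Z /\ (lev y)%:R = \sum_i (Xe y i)%:~R * wt i :> rat.
Proof.
move=> hX; have e : (L0 + \sum_j y 0 j)%:~R = \sum_i (Xe y i)%:~R * wt i :> rat.
  have e1 i : (Xe y i)%:~R * wt i = \sum_j (u0 0 j + (y 0 j)%:~R) * ((A j i)%:R * wt i) :> rat.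
    rewrite /Xe intrD x0E rmorph_sum /= -big_split /= mulr_suml; apply: eq_bigr => j _.
    by rewrite intrM mulrA -mulrDl.
  rewrite (eq_bigr _ (fun i _ => e1 i)) exchange_big /= intrD -L0E rmorph_sum -big_split /=.
  by apply: eq_bigr => j _; rewrite -mulr_sumr Aw mulr1.
have h0 : 0 <= L0 + \sum_j y 0 j.
  by rewrite -(@ler0z rat) e; apply: sumr_ge0 => i _; rewrite mulr_ge0 ?ler0z // ltW.
have h1 : L0 + \sum_j y 0 j = (lev y)%:Z by rewrite /lev gez0_abs.
by split=> //; rewrite -e h1.
Qed.

Lemma lev_src y kap : (forall i, 0 <= Xe y i) -> (forall l, 0 <= kap 0 l) ->
  (forall i, 0 <= Xe (bF + y *+ p - kap) i) ->
  (lev (bF + y *+ p - kap) + vs kap = p * lev y)%N.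
Proof.
move=> h1 h2 h3; apply/eqP; rewrite -eqz_nat PoszD PoszM.
rewrite -(proj1 (lev_int h1)) -(proj1 (lev_int h3)).
have eb : \sum_j bF 0 j = p.-1%:R * L0.
  apply/eqP; rewrite -(@eqr_int rat) rmorph_sum /= intrM -L0E mulr_sumr.
  by apply/eqP/eq_bigr => j _; rewrite bE rmorph_nat.
have evs : (vs kap)%:Z = \sum_j kap 0 j.
  rewrite /vs (@big_morph _ _ Posz 0 (+%R)) //; apply: eq_bigr => j _.
  by rewrite gez0_abs.
have ep (q : nat) (j : 'I_n) : (y *+ q) 0 j = y 0 j *+ q.
  by elim: q => [|m IH]; rewrite ?mulr0n ?mxE // !mulrS mxE IH.
rewrite (eq_bigr (fun j => bF 0 j + p%:R * y 0 j - kap 0 j)); last first.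
  by move=> j _; rewrite !mxE ep mulr_natl.
rewrite !big_split /= sumrN -mulr_sumr eb evs.
have -> : p%:Z = p.-1%:R + 1 by rewrite natr1 prednK ?p_gt0 // natz.
have -> : (p%:R : int) = p.-1%:R + 1 by rewrite natr1 prednK ?p_gt0.
by apply/eqP; move: (\sum_j y 0 j) (\sum_j kap 0 j) (p.-1%:R : int); clear; move=> S T q; ring.
Qed.

(** Let S be the sum of the integral quotients of the entries by p^2. A positive gap forces S >= 1,
    and then G < 3 S and p S <= N, so that p >= 5 leaves room for the extra 2. *)
Lemma gap_sum kap N : (vs kap <= p * N)%N -> (0 < \sum_j gap `|kap 0%R j|)%N ->
  (\sum_j gap `|kap 0%R j| + 2 <= N)%N.
Proof.
move=> hN hG; pose m j := (`|kap 0%R j| %/ p ^ 2)%N.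
have [j hj] : exists j, (0 < gap `|kap 0%R j|)%N.
  apply: contrapT => /forallNP h; move: hG; rewrite big1 // => j _.
  by apply/eqP; rewrite -leqn0 leqNgt; apply/negP; exact: h.
have h1 : (\sum_j gap `|kap 0%R j| < 3 * \sum_j m j)%N.
  rewrite big_distrr /= (bigD1 j) //= [X in (_ < X)%N](bigD1 j) //= -addSn; apply: leq_add.
    by move: hj; rewrite /gap -/(m j); case: (m j).
  by apply: leq_sum => i _; rewrite /gap leq_pred.
have h2 : (p * \sum_j m j <= N)%N.
  rewrite -(leq_pmul2l p_gt0) (leq_trans _ hN) // mulnA mulnn big_distrr /=.
  by apply: leq_sum => i _; rewrite mulnC leq_trunc_div.
move: h1 h2; move: (\sum_j gap _)%N (\sum_j m j)%N hG => G S hG h1 h2.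
have : (5 * S <= N)%N by apply: leq_trans h2; rewrite leq_mul2r p_ge5 orbT.
by move: hG h1; clear; lia.
Qed.

Definition nfix : nat := #|[set i | s0 0 i == 0]%SET|.

Definition Fra (f : chain) : chain := p%:R ^+ (ag + n - 1) *: Fr f.

(** The ball of a Banach norm in which level l is weighted by |pi|^l; this is the norm that
    Frobenius contracts. *)
Definition normb (M : R) f := forall y k E, v (f y k E) <= M * v pi ^+ lev y.

Lemma Om_Fra f : Om f -> Om (Fra f).
Proof.
move=> /Om_Fr h; rewrite /Fra; split=> [|i]; first exact: inXZ (proj1 h).
by move=> y k E hE; rewrite chZ exZ (proj2 h i) // mulr0.
Qed.

Lemma inX_Fra f : inX f -> inX (Fra f). Proof. by move=> h; exact/inXZ/inX_Fr. Qed.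

Lemma Fra_Dg f : inX f -> Fra (Dg f) = Dg (Fra f).
Proof. by move=> [_ h]; rewrite /Fra Fr_Dg // [RHS]linearZ. Qed.

Lemma Fra_linear d f g : inX f -> inX g -> Fra (d *: f + g) = d *: Fra f + Fra g.
Proof. by move=> [_ hf] [_ hg]; rewrite /Fra Fr_linear // scalerDr !scalerA mulrC. Qed.

(** On the support of [Om] theta_i occurs only where s_i = 0, so the two parts of [qE] count
    disjoint sets: it is n - nfix + |E|. *)
Lemma qE_fix y (E : {set 'I_n}) : good y 0 -> (forall i, i \in E -> 0 < Xe y i) ->
  (qE 0 E + nfix = n + #|E|)%N /\ (#|E| <= nfix)%N.
Proof.
move=> /goodP hg hE.
have sub : E \subset [set i | s0 0 i == 0]%SET.
  apply/fintype.subsetP => i iE; rewrite inE; have [_ _ [h|[-> //]]] := hg i.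
  by have := hE i iE; rewrite h ltxx.
split; last exact: subset_leq_card.
rewrite /qE (_ : [set i | _ & _]%SET = ~: [set i | s0 0 i == 0]%SET)%SET.
  by rewrite -addnA addnC [(_ + nfix)%N]addnC /nfix cardsC card_ord.
apply/setP => i; rewrite !inE mxE addr0 lt0r s0_ge0 andbT.
case: (boolP (i \in E)) => //= /(fintype.subsetP sub); rewrite inE => ->.
by [].
Qed.

Lemma v_fsum_pow (T : choiceType) (F : T -> K) (B : R) m : (0 < m)%N -> 0 <= B ->
  (forall x, v (F x) ^+ m <= B) -> v (\sum_(x \in [set: T]) F x) ^+ m <= B.
Proof.
move=> m0 B0 h; apply: (big_ind (fun x => v x ^+ m <= B)) => //.
  by rewrite v0 expr0n eqn0Ngt m0.
move=> x y hx hy; have [hxy|hxy] := leP (v x) (v y).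
  by apply: le_trans hy; apply: lerXn2r; rewrite ?nnegrE //; apply: vD.
by apply: le_trans hx; apply: lerXn2r; rewrite ?nnegrE //; apply: vD => //; exact: ltW.
Qed.

(** Decay like |pi|^(lev / p^N): the number [N] of Frobenius steps separates the chain from a bound
    of type [normb]. *)
Definition tame N (C : R) f := forall y k E, v (f y k E) ^+ (p ^ N) <= C * v pi ^+ lev y.

Lemma tame_up N C f : 0 <= C -> tame N C f -> tame N.+1 (C ^+ p) f.
Proof.
move=> C0 h y k E; rewrite expnSr exprM.
apply: le_trans (_ : (C * v pi ^+ lev y) ^+ p <= _).
  by apply: lerXn2r; rewrite ?nnegrE ?mulr_ge0 ?exprn_ge0.
rewrite exprMn ler_wpM2l ?exprn_ge0 // -exprM vpi_mono //.
by rewrite leq_pmulr // p_gt0.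
Qed.

Lemma tame_ge M N f C : 0 <= C -> tame N C f -> (N <= M)%N -> exists2 C', 0 <= C' & tame M C' f.
Proof.
move=> C0 h; elim: M => [|M IH]; first by rewrite leqn0 => /eqP <-; exists C.
rewrite leq_eqVlt => /orP[/eqP <-|]; first by exists C.
by rewrite ltnS => /IH[C' C'0 h']; exists (C' ^+ p); [exact: exprn_ge0|exact: tame_up].
Qed.

(** The level at the source is p lev(y) - |kap|, and |C_kap|^p <= |pi|^|kap| makes up for the
    missing |kap|. Taking a p-th root turns the factor [p] in front of the level into one step of
    [N]. *)
Lemma tame_Fra N C f : Om f -> 0 <= C -> tame N.+1 C f -> exists2 C', 0 <= C' & tame N C' (Fra f).
Proof.
move=> hf C0 h; have pR := pR_gt0; have hf' := Om_Fra hf.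
pose D := (p%:R ^+ (n + n)) ^+ (p ^ N.+1) * C.
have D0 : 0 <= D by rewrite mulr_ge0 // !exprn_ge0 // ltW.
exists (D + 1); first by rewrite addr_ge0.
move=> y k E; have [->|h0] := eqVneq (Fra f y k E) 0.
  by rewrite v0 expr0n eqn0Ngt expn_gt0 p_gt0 /= mulr_ge0 ?exprn_ge0 // addr_ge0.
have [k0 hX hE _] := OmP hf' h0.
have hg : good y k by apply/negPn/negP => hh; move: h0; rewrite (proj2 (proj1 hf')) ?eqxx.
rewrite -(@ler_pXn2r _ p) ?nnegrE ?p_gt0 ?mulr_ge0 ?exprn_ge0 ?addr_ge0 // -exprM -expnSr exprMn.
have hpsi : v (psi f y k E) ^+ (p ^ N.+1) <= C * v pi ^+ (p * lev y).
  apply: v_fsum_pow => [||kap]; first by rewrite expn_gt0 p_gt0.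
    by rewrite mulr_ge0 // exprn_ge0.
  have [->|h1] := eqVneq (Cf kap * f (bF + y *+ p - kap) k E) 0.
    by rewrite v0 expr0n eqn0Ngt expn_gt0 p_gt0 /= mulr_ge0 ?exprn_ge0.
  have [hk hgs] := src_neq0 (vog_lowX (proj2 (proj1 hf))) h1.
  have e : (lev (bF + y *+ p - kap) + vs kap = p * lev y)%N.
    exact: lev_src.
  rewrite -e addnC exprD vM exprMn mulrCA; apply: ler_pM; rewrite ?exprn_ge0 //.
  rewrite expnS exprM; apply: le_trans (_ : (v pi ^+ vs kap) ^+ (p ^ N) <= _).
    by apply: lerXn2r; rewrite ?nnegrE ?exprn_ge0 //; exact: v_Cf_pow.
  by rewrite -exprM vpi_mono // leq_pmulr // expn_gt0 p_gt0.
have hF : v (Fra f y k E) <= p%:R ^+ (n + n) * v (psi f y k E).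
  rewrite /Fra chZ exZ vM -[leRHS]mul1r; apply: ler_pM => //; last exact: v_Fr.
  by rewrite vX exprn_ile1 // v_nat_le1.
apply: le_trans (_ : (p%:R ^+ (n + n) * v (psi f y k E)) ^+ (p ^ N.+1) <= _).
  by apply: lerXn2r; rewrite ?nnegrE ?mulr_ge0 ?exprn_ge0 // ltW.
rewrite exprMn; apply: le_trans (_ : D * v pi ^+ (p * lev y) <= _).
  by rewrite /D -mulrA ler_wpM2l // !exprn_ge0 // ltW.
rewrite mulnC exprM ler_wpM2r ?exprn_ge0 //.
apply: le_trans (_ : D + 1 <= _); first by rewrite lerDl.
by rewrite -{1}[D + 1]expr1 ler_weXn2l ?p_gt0 // lerDr.
Qed.

(** The weights are positive and k = 0, so size and level bound each other linearly. *)
Lemma Om_size_lev : exists e : nat, (0 < e)%N /\ forall y, (forall i, 0 <= Xe y i) ->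
  (sz y 0 <= e * lev y)%N /\ (lev y <= e * sz y 0)%N.
Proof.
pose e := (\sum_i (Num.bound (wt i) + Num.bound (wt i)^-1)%N).+1; exists e; split=> // y hX.
have [_ hl] := lev_int hX.
have hs : ((sz y 0)%:R : rat) = \sum_i (Xe y i)%:~R.
  rewrite /sz natr_sum; apply: eq_bigr => i _.
  by rewrite mxE addn0 -[in RHS](gez0_abs (hX i)).
have hb i : (Num.bound (wt i) + Num.bound (wt i)^-1 <= e)%N.
  by rewrite /e leqW // (bigD1 i) //= leq_addr.
have w1 i : wt i <= e%:R.
  apply: le_trans (ltW (archi_boundP (ltW (w_gt0 i)))) _; rewrite ler_nat.
  exact: leq_trans (leq_addr _ _) (hb i).
have w2 i : 1 <= e%:R * wt i.
  have h : (wt i)^-1 <= e%:R.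
    have wv : 0 <= (wt i)^-1 by rewrite invr_ge0 ltW.
    apply: le_trans (ltW (archi_boundP wv)) _; rewrite ler_nat.
    exact: leq_trans (leq_addl _ _) (hb i).
  by have := ler_wpM2r (ltW (w_gt0 i)) h; rewrite mulVf ?lt0r_neq0.
split; rewrite -(ler_nat rat) natrM hl hs mulr_sumr; apply: ler_sum => i _.
  by rewrite mulrCA -{1}[(Xe y i)%:~R]mulr1 ler_wpM2l ?ler0z.
by rewrite mulrC ler_wpM2r ?ler0z.
Qed.

(** The p^N-th powers of a rate below 1 eventually fall below |pi|^e, with [e] the constant
    comparing level and size. *)
Lemma Om_tame f : Om f -> exists N C, 0 <= C /\ tame N C f.
Proof.
move=> hf; have [[[C [r [C0 r0 r1 h]]] hv] _] := hf.
have [e [e0 he]] := Om_size_lev.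
have [N hN] : exists N, r ^+ (p ^ N) <= v pi ^+ e.
  have [N hN] := geom_to0 1 (ltW r0) r1 (exprn_gt0 e vpi_gt0).
  exists N; have := hN (p ^ N)%N; rewrite mul1r => h1; apply/ltW/h1.
  by apply: ltnW; apply: ltn_expl; exact: p_gt1.
exists N, (C ^+ (p ^ N)); split; first exact: exprn_ge0.
move=> y k E; have [->|h0] := eqVneq (f y k E) 0.
  by rewrite v0 expr0n eqn0Ngt expn_gt0 p_gt0 /= mulr_ge0 ?exprn_ge0.
have [k0 hX _ _] := OmP hf h0; rewrite k0 in h0 *.
apply: le_trans (_ : (C * r ^+ sz y 0) ^+ (p ^ N) <= _).
  by apply: lerXn2r; rewrite ?nnegrE ?mulr_ge0 ?exprn_ge0 // ltW.
rewrite exprMn ler_wpM2l ?exprn_ge0 // -exprM mulnC exprM.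
apply: le_trans (_ : (v pi ^+ e) ^+ sz y 0 <= _).
  by apply: lerXn2r; rewrite ?nnegrE ?exprn_ge0 // ltW.
by rewrite -exprM vpi_mono //; have [] := he y hX.
Qed.

Lemma normb_decays M f : 0 <= M -> (forall y k E, f y k E != 0 -> k = 0 /\ forall i, 0 <= Xe y i) ->
  normb M f -> decays f.
Proof.
move=> M0 hs hM; have [e [e0 he]] := Om_size_lev.
have [tau [t0 t1 ht]] := root_lt1 e vpi_ge0 vpi_lt1.
exists M, tau; split=> // y k E.
have [->|h0] := eqVneq (f y k E) 0; first by rewrite v0 mulr_ge0 // exprn_ge0 // ltW.
have [k0 hX] := hs _ _ _ h0; rewrite k0 in h0 *.
apply: le_trans (hM _ _ _) _; rewrite ler_wpM2l //.
apply: le_trans (_ : (tau ^+ e) ^+ lev y <= _).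
  by apply: lerXn2r; rewrite ?nnegrE ?exprn_ge0 // ltW.
by rewrite -exprM ler_wiXn2l ?(ltW t0) ?(ltW t1) //; have [] := he y hX.
Qed.

Lemma v_Dg (B : R) f : 0 <= B -> (forall y k E, v (f y k E) <= B) ->
  forall y k E, v (Dg f y k E) <= v pi^-1 * B.
Proof.
move=> B0 h y k E; have h1 : 1 <= v pi^-1 by rewrite vV invf_ge1 ?vpi_gt0 // vpi_le1.
have B1 : B <= v pi^-1 * B by rewrite ler_peMl.
rewrite /Dg; case: ifP => _; last by rewrite v0 mulr_ge0.
have hM (x t : K) : v x <= 1 -> v t <= B -> v (x * t) <= B.
  by move=> hx ht; rewrite vM -[B]mul1r ler_pM.
rewrite dfullE exD exZ !fct_sumE; apply: vD.
  apply: le_trans B1; apply: v_sum => // i _; apply: ext_v => // E'.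
  rewrite /nab fct_sumE; apply: v_sum => // j _; rewrite exZ NopE exD !exZ.
  by apply: v_natM_le; apply: vD; apply: hM => //; [exact/zp_le1/zp_Uc|exact: vpi_le1].
rewrite vM ler_wpM2l //; apply: v_sum => // i _; apply: ext_vD => // E'.
by rewrite delE exD !exZ; apply: vD; apply: hM => //; [exact/zp_le1/zp_Sc|exact: vpi_le1].
Qed.

Lemma ksum_split u M : summable u ->
  summable (fun i => u (M + i)%N) /\ ksum u = \sum_(i < M) u i + ksum (fun i => u (M + i)%N).
Proof.
move=> hu; elim: M => [|M [hs IH]].
  by rewrite big_ord0 add0r; split.
have e : (fun i => u (M.+1 + i)%N) = fun i => u (M + i.+1)%N.
  by apply/funext => i; rewrite addnS.
rewrite e; split; first exact: (summableS hs).
by rewrite IH (ksum_recl hs) big_ord_recr /= addrA addn0.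
Qed.

Section Contraction.

(* The exponent of [p] gained by the operator at [(y, E)]. *)
Hypothesis contr : forall y (E : {set 'I_n}), good y 0 -> (forall i, i \in E -> 0 < Xe y i) ->
  (2 + #|E| <= ag + nfix + lev y)%N.

(** Count the powers of [p]. The scalar and [qE] give 1 - ag - nfix + |E|. The level at the source
    and |kap| add up to p lev(y), which yields |pi|^lev(y) p^(-lev(y)), and [Cf] loses p^G. If G = 0
    the total is at most -1 by hypothesis; if G > 0, then G + 2 <= lev(y) and |E| <= nfix give the
    same. *)
Lemma Fra_contr M f : Om f -> 0 <= M -> normb M f -> normb (M / p%:R) (Fra f).
Proof.
move=> hf M0 hM y k E; have pR := pR_gt0; have hf' := Om_Fra hf.
have [->|h0] := eqVneq (Fra f y k E) 0.
  by rewrite v0 mulr_ge0 ?exprn_ge0 // divr_ge0 // ltW.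
have [k0 hX hE _] := OmP hf' h0.
have hg : good y k by apply/negPn/negP => h; move: h0; rewrite (proj2 (proj1 hf')) ?eqxx.
rewrite k0 in hg *; have [hq hle] := qE_fix hg hE; have hc := contr hg hE.
rewrite /Fra chZ exZ /Fr hg vM vX vp vM vV vX vp -exprVn invrK.
(* The largest loss that still leaves a gain of one factor [p]. *)
pose X := (ag + nfix + lev y - #|E| - 2)%N.
have hpsi : v (psi f y 0 E) <= M * v pi ^+ lev y * (p%:R ^+ X / p%:R ^+ lev y).
  have B0 : 0 <= M * v pi ^+ lev y * (p%:R ^+ X / p%:R ^+ lev y).
    by rewrite !mulr_ge0 // ?invr_ge0 exprn_ge0.
  apply: v_psi => // [|kap hk hgs]; first exact/vog_lowX/(proj2 (proj1 hf)).
  rewrite vM; apply: le_trans (ler_pM _ _ (v_Cf kap) (hM _ _ _)) _ => //.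
  have e : (lev (bF + y *+ p - kap) + vs kap = p * lev y)%N.
    exact: lev_src.
  rewrite mulrCA -[_ * _ * v pi ^+ lev _]mulrA -exprD [(vs kap + _)%N]addnC e.
  set G := (\sum_j gap _)%N; rewrite -mulrA ler_wpM2l //.
  have -> : (p * lev y = p.-1 * lev y + lev y)%N by rewrite -{1}(prednK p_gt0) mulSn addnC.
  rewrite exprD vpi_half mulrA mulrC ler_wpM2l ?exprn_ge0 // exprVn.
  rewrite ler_wpM2r ?invr_ge0 ?exprn_ge0 // pRX_mono //.
  have [->//|G0] := posnP G.
  have hvs : (vs kap <= p * lev y)%N by rewrite -e leq_addl.
  have := gap_sum hvs G0; rewrite -/G /X; move: hc hle G0.
  by move: G #|E| nfix (lev y) ag; clear; lia.
apply: le_trans (_ : p%:R^-1 ^+ (ag + n - 1) * (p%:R ^+ qE 0 E * (M * v pi ^+ lev y * (p%:R ^+ X / p%:R ^+ lev y))) <= _).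
  by rewrite ler_wpM2l ?exprn_ge0 ?invr_ge0 // ler_wpM2l // exprn_ge0.
have eX : (qE 0 E + X + 1 = ag + n - 1 + lev y)%N.
  move: hq hc hle n_gt0; rewrite /X; move: (qE 0 E) #|E| nfix (lev y) ag; clear; lia.
have hP : (p%:R : R) ^+ qE 0 E * p%:R ^+ X * p%:R = p%:R ^+ (ag + n - 1) * p%:R ^+ lev y.
  by rewrite -!exprD -exprSr -addn1 eX.
rewrite exprVn.
have u1 : (p%:R : R) ^+ (ag + n - 1) != 0 by rewrite expf_neq0 // gt_eqF.
have u2 : (p%:R : R) ^+ lev y != 0 by rewrite expf_neq0 // gt_eqF.
have u3 : (p%:R : R) != 0 by rewrite gt_eqF.
have key (t1 t2 t3 t4 t5 t6 : R) : t4 * t5 * t3 = t1 * t2 -> t1 != 0 -> t2 != 0 -> t3 != 0 ->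
    t1^-1 * (t4 * (M * t6 * (t5 / t2))) = M / t3 * t6.
  move=> e1 n1 n2 n3; transitivity (M * t6 * (t4 * t5 * t3) / (t1 * t2) / t3).
    by field; rewrite n1 n2 n3.
  by rewrite e1; field; rewrite n1 n2 n3.
by rewrite (key _ _ _ _ _ _ hP).
Qed.

Lemma iter_Om f m : Om f -> Om (iter m Fra f).
Proof. by move=> hf; elim: m => // m IH; exact: Om_Fra. Qed.

Lemma iter_normb M f m : Om f -> 0 <= M -> normb M f -> normb (M / p%:R ^+ m) (iter m Fra f).
Proof.
move=> hf M0 hM; elim: m => [|m IH]; first by rewrite expr0 divr1.
have := Fra_contr (iter_Om m hf) (divr_ge0 M0 (exprn_ge0 m (ltW pR_gt0))) IH.
by rewrite -mulrA -invfM -exprSr.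
Qed.

Lemma iter_chain (beta : K) (z g : chain) m : Om z -> Om g -> Fra z = beta *: z + Dg g ->
  iter m.+1 Fra z = beta *: iter m Fra z + Dg (iter m Fra g).
Proof.
move=> hz hg e; elim: m => [|m IH]; first exact: e.
have hz' := proj1 (iter_Om m hz); have hg' := proj1 (iter_Om m hg).
transitivity (Fra (beta *: iter m Fra z + Dg (iter m Fra g))); first exact: (congr1 Fra IH).
rewrite (Fra_linear _ hz' (inX_DgX hg')) (Fra_Dg hg'); reflexivity.
Qed.

(** The solution is the series of the - beta^-(m+1) Fra^m g, whose partial sums are mapped by [Dg]
    to z - beta^-m Fra^m z. The tails and the last term decay like (p |beta|)^-m, and [Dg] is
    bounded, so the identity passes to the limit. *)
Lemma contraction_core (beta : K) (z g : chain) M : p%:R^-1 < v beta -> Om z -> Om g -> 0 <= M ->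
  normb M z -> normb M g -> Fra z = beta *: z + Dg g -> exists G, inX G /\ Dg G = z.
Proof.
move=> hb hz hg M0 nz ng e; have pR := pR_gt0.
have vb : 0 < v beta by apply: lt_trans hb; rewrite invr_gt0.
have b0 : beta != 0 by rewrite -v_gt0.
pose rr := (p%:R * v beta)^-1.
have r0 : 0 <= rr by rewrite invr_ge0 mulr_ge0 // ltW.
have r1 : rr < 1 by rewrite invf_lt1 ?mulr_gt0 // -ltr_pdivrMl // mulr1.
pose u y k E m := - beta ^- m.+1 * iter m Fra g y k E.
have hrr m : (v beta)^-1 ^+ m / p%:R ^+ m = rr ^+ m.
  by rewrite /rr invfM mulrC -exprVn -exprMn.
have vl y : v pi ^+ lev y <= 1 by rewrite exprn_ile1 // vpi_le1.
have hu y k E m : v (u y k E m) <= (v beta)^-1 * M * v pi ^+ lev y * rr ^+ m.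
  rewrite /u vM vN vV vX -exprVn exprS -hrr.
  have key (t1 t2 t3 t4 t5 : R) : t1 * t2 * t3 * (t4 * t5) = t1 * t4 * (t2 * t5 * t3) by ring.
  have -> : (v beta)^-1 * M * v pi ^+ lev y * ((v beta)^-1 ^+ m / p%:R ^+ m) =
    (v beta)^-1 * (v beta)^-1 ^+ m * (M / p%:R ^+ m * v pi ^+ lev y).
    exact: key.
  by rewrite ler_wpM2l ?mulr_ge0 ?exprn_ge0 ?invr_ge0 //; exact: iter_normb.
have hu1 y k E m : v (u y k E m) <= (v beta)^-1 * M * rr ^+ m.
  apply: le_trans (hu y k E m) _; rewrite ler_wpM2r ?exprn_ge0 // ler_piMr //.
  by rewrite mulr_ge0 // invr_ge0.
have su y k E : summable (u y k E) by apply: summable_geom r0 r1 (hu1 y k E).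
pose G : chain := fun y k E => ksum (u y k E).
have G0 y k E : (forall m, iter m Fra g y k E = 0) -> G y k E = 0.
  move=> h; rewrite /G (_ : u y k E = fun=> 0) ?ksum0 //.
  by apply/funext => m; rewrite /u h mulr0.
have GX : inX G.
  split; last first.
    move=> y k hgd; apply/funext => E; apply: G0 => m.
    by rewrite (proj2 (proj1 (iter_Om m hg))).
  apply: (@normb_decays ((v beta)^-1 * M)); first by rewrite mulr_ge0 // invr_ge0.
    move=> y k E h; have [m hm] : exists m, iter m Fra g y k E != 0.
      apply: contrapT => /forallNP hn; case/eqP: h; apply: G0 => m.
      by apply/eqP/negPn/negP/hn.
    by have [k0 hX _ _] := OmP (iter_Om m hg) hm.
  move=> y k E; apply: v_ksum; rewrite ?mulr_ge0 ?exprn_ge0 ?invr_ge0 // => m.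
  apply: le_trans (hu y k E m) _; rewrite ler_piMr ?exprn_ile1 ?(ltW r1) //.
  by rewrite !mulr_ge0 ?exprn_ge0 ?invr_ge0.
exists G; split=> //.
pose P m : chain := \sum_(i < m) (- beta ^- i.+1) *: iter i Fra g.
have DP m : Dg (P m) = z - beta ^- m *: iter m Fra z.
  elim: m => [|m IH]; first by rewrite /P big_ord0 linear0 expr0 invr1 scale1r subrr.
  have -> : P m.+1 = P m + (- beta ^- m.+1) *: iter m Fra g by rewrite /P big_ord_recr.
  have -> : Dg (P m + (- beta ^- m.+1) *: iter m Fra g) =
      Dg (P m) + (- beta ^- m.+1) *: Dg (iter m Fra g) by rewrite linearD linearZ.
  have -> : Dg (iter m Fra g) = iter m.+1 Fra z - beta *: iter m Fra z.
    by rewrite (iter_chain m hz hg e) addrC addKr.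
  rewrite IH.
  have -> : beta ^- m = beta ^- m.+1 * beta by rewrite exprSr invfM -mulrA mulVf // mulr1.
  move: (iter m.+1 Fra z) (iter m Fra z) (beta ^- m.+1) => t1 t2 q.
  by rewrite scaleNr scalerBr scalerA opprB addrA subrK.
have tail m y k E : v ((G - P m) y k E) <= (v beta)^-1 * M * rr ^+ m.
  have [s1 s2] := ksum_split m (su y k E).
  have -> : (G - P m) y k E = ksum (fun i => u y k E (m + i)%N).
    rewrite chD chN exD exN /G s2 /P !fct_sumE addrAC -sumrB big1 ?add0r // => i _.
    by rewrite /u subrr.
  have B0 : 0 <= (v beta)^-1 * M * rr ^+ m by rewrite mulr_ge0 ?exprn_ge0 // mulr_ge0 ?invr_ge0.
  apply: v_ksum => // i.
  apply: le_trans (hu1 y k E _) _; rewrite exprD mulrA ler_piMr ?exprn_ile1 ?(ltW r1) //.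
apply/eqP; rewrite -subr_eq0; apply/eqP.
apply/funext => y; apply/funext => k; apply/funext => E.
set D := (_ - _).
pose C := v pi^-1 * ((v beta)^-1 * M) + M.
have C0 : 0 <= C by rewrite addr_ge0 // !mulr_ge0 // invr_ge0.
have hD m : v (D y k E) <= C * rr ^+ m.
  have -> : D y k E = Dg (G - P m) y k E - beta ^- m * iter m Fra z y k E.
    have eD : D = Dg (G - P m) - beta ^- m *: iter m Fra z.
      by rewrite /D linearB /= DP opprB addrA addrAC addrK.
    by rewrite eD chD chN chZ exD exN exZ.
  rewrite /C mulrDl; apply: vB.
    apply: le_trans (@v_Dg ((v beta)^-1 * M * rr ^+ m) _ _ (tail m) y k E) _.
      by rewrite mulr_ge0 ?exprn_ge0 // mulr_ge0 ?invr_ge0.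
    by rewrite !mulrA lerDl mulr_ge0 ?exprn_ge0.
  rewrite vM vV vX -exprVn; apply: le_trans (_ : M * rr ^+ m <= _); last first.
    by rewrite lerDr mulr_ge0 ?exprn_ge0 // mulr_ge0 // mulr_ge0 ?invr_ge0.
  rewrite -hrr mulrCA ler_wpM2l ?exprn_ge0 ?invr_ge0 //.
  by apply: le_trans (iter_normb m hz M0 nz y k E) _; rewrite ler_piMr // divr_ge0 // exprn_ge0 // ltW.
apply/eqP; rewrite -v_eq0 eq_le v_ge0 andbT; apply/ler_addgt0Pl => eps e0.
have [N hN] := geom_to0 C r0 r1 e0.
by rewrite addr0; apply: le_trans (hD N) (ltW (hN N (leqnn N))).
Qed.

Lemma tame_iter N C f : Om f -> 0 <= C -> tame N C f ->
  exists2 M, 0 <= M & normb M (iter N Fra f).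
Proof.
elim: N C f => [|N IH] C f hf C0 h.
  by exists C => // y k E; have := h y k E; rewrite expn0 expr1.
have [C' C'0 h'] := tame_Fra hf C0 h.
by have [M M0 hM] := IH _ _ (Om_Fra hf) C'0 h'; exists M; rewrite // iterSr.
Qed.

(** After enough Frobenius steps both chains are bounded in the contracted norm, and Fra^N z =
    beta^N z + Dg h with beta nonzero, so exactness of the iterate gives that of [z]. *)
Lemma contraction_exact (beta : K) (z g : chain) : p%:R^-1 < v beta -> Om z -> inX g ->
  Fra z = beta *: z + Dg g -> exists G, inX G /\ Dg G = z.
Proof.
move=> hb hz gX0 e0.
have b0 : beta != 0 by rewrite -v_gt0; apply: lt_trans hb; rewrite invr_gt0 pR_gt0.
(* [Dg g] is a combination of clean chains, so [g] can be replaced by a clean chain with the same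
   differential. *)
have [g' [hg e]] : exists g', Om g' /\ Fra z = beta *: z + Dg g'.
  have hD i : clean i (Dg g).
    have -> : Dg g = Fra z - beta *: z by rewrite e0 addrC addKr.
    by rewrite addrC -scaleNr; apply: clean_lin; [exact: (proj2 hz)|exact: (proj2 (Om_Fra hz))].
  have [h [hX hO]] := reduce_y gX0 hD.
  by exists (g - Dg h); split=> //; rewrite linearB /= Dg_Dg ?subr0 //; exact: (proj2 hX).
have [N1 [C1 [C10 t1]]] := Om_tame hz; have [N2 [C2 [C20 t2]]] := Om_tame hg.
have [C1' C1'0 t1'] := tame_ge C10 t1 (leq_maxl N1 N2).
have [C2' C2'0 t2'] := tame_ge C20 t2 (leq_maxr N1 N2).
set N := maxn N1 N2 in t1' t2'.
have [M1 M10 n1] := tame_iter hz C1'0 t1'; have [M2 M20 n2] := tame_iter hg C2'0 t2'.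
have nm M M' f : M <= M' -> normb M f -> normb M' f.
  by move=> le h y k E; apply: le_trans (h y k E) _; rewrite ler_wpM2r ?exprn_ge0.
have eN : Fra (iter N Fra z) = beta *: iter N Fra z + Dg (iter N Fra g').
  exact: (iter_chain N hz hg e).
have [|||G [GX hG]] := @contraction_core beta (iter N Fra z) (iter N Fra g') (Num.max M1 M2) hb
  (iter_Om N hz) (iter_Om N hg) _ _ _ eN.
- by rewrite le_max M10.
- by apply: nm n1; rewrite le_max lexx.
- by apply: nm n2; rewrite le_max lexx orbT.
have [h [hX hh]] : exists h, inX h /\ iter N Fra z = beta ^+ N *: z + Dg h.
  elim: {t1' t2' n1 n2 eN hG} N => [|m [h [hX IH]]].
    exists 0; split; [exact: inX0|rewrite expr0 scale1r linear0 addr0; reflexivity].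
  exists (beta *: h + iter m Fra g'); split.
    by apply: inX_lin => //; exact: proj1 (iter_Om m hg).
  rewrite (iter_chain m hz hg e) IH.
  have -> : Dg (beta *: h + iter m Fra g') = beta *: Dg h + Dg (iter m Fra g') by rewrite linearD linearZ.
  by rewrite scalerDr scalerA -exprS addrA.
exists (beta ^- N *: (G - h)); split; first exact/inXZ/inXB.
rewrite linearZ /= linearB /= hG hh addrK scalerA mulVf ?scale1r //.
exact: expf_neq0.
Qed.

End Contraction.

(** * Traces on the cohomology of the model *)

Definition Zm : set chain := [set f | inX f /\ Dg f = 0].
Definition Bm : set chain := [set f | exists2 g, inX g & f = Dg g].

Lemma subspace_Zm : subspace Zm.
Proof.
split=> [|c f g [hf Df] [hg Dg0]]; first by split; [exact: inX0|exact: linear0].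
split; first exact: inX_lin.
have -> : Dg (c *: f + g) = c *: Dg f + Dg g by rewrite linearD linearZ.
by rewrite Df Dg0 scaler0 addr0.
Qed.

Lemma subspace_Bm : subspace Bm.
Proof.
split=> [|c _ _ [f hf ->] [g hg ->]]; first by exists 0; [exact: inX0|rewrite linear0].
by exists (c *: f + g); [exact: inX_lin|rewrite linearD linearZ].
Qed.

Lemma Bm_Zm f : Bm f -> Zm f.
Proof. by move=> [g hg ->]; split; [exact: inX_DgX|apply: Dg_Dg; exact: (proj2 hg)]. Qed.

Lemma Fr_linear_Zm : linear_on Zm Fr.
Proof. by move=> c f g [[_ hf] _] [[_ hg] _]; exact: Fr_linear. Qed.

Lemma Fr_Bm f : Bm f -> Bm (Fr f).
Proof. by move=> [g hg ->]; exists (Fr g); [exact: inX_Fr|apply: Fr_Dg; exact: (proj2 hg)]. Qed.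

Lemma model_trace_unique t t' : is_subquotient_trace Zm Bm Fr t ->
  is_subquotient_trace Zm Bm Fr t' -> t = t'.
Proof.
exact: (trace_unique subspace_Zm subspace_Bm Bm_Zm Fr_linear_Zm Fr_Bm).
Qed.

Lemma trace_contraction t :
  (forall y (E : {set 'I_n}), good y 0 -> (forall i, i \in E -> 0 < Xe y i) ->
     (2 + #|E| <= ag + nfix + lev y)%N) ->
  is_subquotient_trace Zm Bm Fr t -> v (p%:R ^+ (ag + n - 1) * t) <= p%:R^-1.
Proof.
move=> contr; apply: (trace_bound subspace_Zm subspace_Bm Fr_linear_Zm).
- by rewrite invr_ge0 ltW // pR_gt0.
- by rewrite expf_neq0 // pK_neq0.
move=> beta z hb [hz Dz] [g hg e].
have hD i : clean i (Dg z) by rewrite Dz.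
have [h [hX hO]] := reduce_y hz hD.
have e1 : Fra z = beta *: z + Dg g by rewrite -e addrC subrK.
have e2 : Fra (z - Dg h) = beta *: (z - Dg h) + Dg (beta *: h + g - Fra h).
  have -> : z - Dg h = (-1) *: Dg h + z by rewrite scaleN1r addrC.
  rewrite (Fra_linear _ (inX_DgX hX) hz) e1 (Fra_Dg hX).
  have -> : Dg (beta *: h + g - Fra h) = beta *: Dg h + Dg g - Dg (Fra h).
    by rewrite linearB linearD linearZ.
  rewrite scalerDr scalerA mulrN1 !scaleN1r scaleNr.
  move: (beta *: Dg h) (beta *: z) (Dg g) (Dg (Fra h)) => a1 a2 a3 a4.
  by rewrite addrC -[- a1 + a2]addrC -!addrA; congr (_ + _); rewrite addrA addNKr || rewrite addrA addNr add0r.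
have gX : inX (beta *: h + g - Fra h) by apply: inXB; [exact: inX_lin|exact: inX_Fra].
have [G [GX hG]] := contraction_exact contr hb hO gX e2.
exists (G + h); first exact: inXD.
by rewrite linearD /= hG subrK.
Qed.

(** * The sector with all s_i positive and gamma = 0 *)

Definition point : chain := fun y k E => ((y == 0) && (k == 0) && (E == finset.set0))%:R.

Section Point.
Hypothesis s_gt0 : forall i, 0 < s0 0 i.
Hypothesis u00 : forall j, u0 0 j = 0.
Hypothesis x00 : x0 = 0.
Hypothesis Xe_inj : forall y, (forall i, Xe y i = 0) -> y = 0.

(** Positive s_i force all X_i to vanish; hence y = 0, and no theta_i is left. *)
Lemma Om_point f : Om f -> f = f 0 0 finset.set0 *: point.
Proof.
move=> hf; apply/funext => y; apply/funext => k; apply/funext => E; rewrite chZ exZ /point.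
have [h|h] := eqVneq (f y k E) 0.
  rewrite h; case: eqP => [y0|] /=; last by rewrite mulr0.
  case: eqP => [k0|] /=; last by rewrite mulr0.
  by case: eqP => [E0|] /=; rewrite ?mulr0 // mulr1 -h y0 k0 E0.
have [k0 hX hE hs] := OmP hf h.
have X0 i : Xe y i = 0 by have [//|e] := hs i; have := s_gt0 i; rewrite e ltxx.
have y0 := Xe_inj X0.
have E0 : E = finset.set0.
  by apply/setP => i; rewrite inE; apply/negP => /hE; rewrite X0 ltxx.
by rewrite y0 k0 E0 !eqxx mulr1.
Qed.

Lemma point_Om : Om point.
Proof.
split=> [|i y k E]; last first.
  rewrite /offstate /point => /andP[_ /orP[iE|k0]].
    2: by have /negbTE -> : k != 0; [apply: contraNneq k0 => ->; rewrite mxE|rewrite andbF].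
  by case: (E =P _) => [E0|]; rewrite ?andbF //; rewrite E0 inE in iE.
split.
  exists (2 ^+ sz 0 0), 2^-1; split; rewrite ?exprn_ge0 ?invr_gt0 ?invf_lt1 ?ltr1n //.
  move=> y k E; rewrite /point; case: andP => [[/andP[/eqP-> /eqP->] _]|_].
    by rewrite v1 -exprMn mulfV ?expr1n // pnatr_eq0.
  by rewrite v0 mulr_ge0 ?exprn_ge0 ?invr_ge0.
move=> y k hg; apply/funext => E; rewrite /point; case: eqP => [y0|//]; case: eqP => [k0|//].
case/negP: hg; rewrite y0 k0; apply/goodP => i.
have -> : Xe 0 i = 0 by rewrite /Xe x00 mxE add0r big1 // => j _; rewrite mxE mul0r.
by split; rewrite ?mxE //; left.
Qed.

Lemma Om_Dg0 f : Om f -> Dg f = 0.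
Proof.
move=> hf; rewrite (Om_point (Om_Dg hf)); set x := Dg _ _ _ _.
suff -> : x = 0 by rewrite scale0r.
rewrite /x /Dg; case: ifP => // _; rewrite dfullE exD exZ !fct_sumE !big1 ?mulr0 ?addr0 // => i _.
  rewrite /Dt inE delE exD !exZ (Om_point hf) !chZ !exZ /point finset.setU0.
  have -> : ([set i]%SET == finset.set0) = false.
    by apply/negbTE/eqP => /setP/(_ i); rewrite !inE eqxx.
  by rewrite !andbF !mulr0 addr0 mulr0.
by rewrite /Th inE.
Qed.

Lemma trace_point : is_subquotient_trace Zm Bm Fr (p%:R ^- n).
Proof.
have D0 := Om_Dg0 point_Om.
have red g : inX g -> Om (Dg g) -> exists2 h, inX h & Om (g - Dg h).
  by move=> hg hO; have [h [hX hh]] := reduce_y hg (proj2 hO); exists h.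
apply: (trace_line (b := point) subspace_Bm).
- by split; [exact: (proj1 point_Om)|].
- move=> [g hg e]; have hO : Om (Dg g) by rewrite -e; exact: point_Om.
  have [h hX hh] := red g hg hO.
  have := Om_Dg0 hh; rewrite linearB /= Dg_Dg ?subr0 -?e; last exact: (proj2 hX).
  move=> /(congr1 (fun f : chain => f 0 0 finset.set0)) /eqP.
  by rewrite /point !eqxx /= oner_eq0.
- move=> z [hz Dz]; have hO : Om (Dg z) by rewrite Dz; split; [exact: inX0|].
  have [h hX hh] := red z hz hO; exists ((z - Dg h) 0 0 finset.set0).
  by exists h => //; rewrite -(Om_point hh) opprB addrC subrK.
exists 0; first exact: inX0.
rewrite linear0 (Om_point (Om_Fr point_Om)); set x := Fr _ _ _ _.
suff -> : x = p%:R ^- n by rewrite subrr.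
have b0 : bF = 0.
  by apply/rowP => j; apply/eqP; rewrite mxE -(intr_eq0 rat) bE u00 mulr0.
have X0 i : Xe 0 i = 0 by rewrite /Xe x00 mxE add0r big1 // => j _; rewrite mxE mul0r.
rewrite /x /Fr ifT; last by apply/goodP => i; rewrite X0 mxE; split=> //; left.
have -> : qE 0 finset.set0 = n.
  rewrite /qE cards0 add0n (_ : [set i | _ & _]%SET = [set: 'I_n]%SET) ?cardsT ?card_ord //.
  by apply/setP => i; rewrite !inE mxE addr0 s_gt0.
rewrite /psi (fsumE (r := [:: 0])) // => [|kap].
  rewrite big_cons big_nil addr0 b0 mul0rn addr0 subr0 /point !eqxx mulr1 /Cf.
  have -> : cF 0 = 1 by case: c_rec.
  by rewrite /vs big1 ?expr0 ?mulr1 // => j _; rewrite mxE.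
rewrite inE => k0; rewrite b0 mul0rn addr0 sub0r /point oppr_eq0 (negbTE k0) mulr0 //.
Qed.

End Point.

Section Untwisted.
Variable (B : 'M[rat]_n).
Hypothesis AB : forall l j, \sum_i (A l i)%:R * B i j = (l == j)%:R.
Hypothesis BA : forall i l, \sum_j B i j * (A j l)%:R = (i == l)%:R.
Hypothesis u0_int : forall j, 0 < u0 0 j < 1.
Hypothesis u0_den : exists d : nat, (0 < d)%N /\ coprime p d /\
  forall j, exists z : int, d%:R * u0 0 j = z%:~R.
Hypothesis s00 : forall i, s0 0 i = 0.
Hypothesis x0_gt0 : forall i, 0 < x0 0 i.

(** * The de Rham complex of the untwisted sector *)

(** The logarithmic differential of the monomial x^(e_l A); the [io j] are the dual contractions. In
    this basis the differential separates into the one-variable operators [Nop l]. *)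
Definition th (l : 'I_n) (g : ext) : ext := \sum_i (A l i)%:R *: Th i g.
Definition io (j : 'I_n) (g : ext) : ext := \sum_i ratr (B i j) *: Dt i g.

Lemma th_is_linear l : linear (th l).
Proof using Type.
move=> a g h; rewrite /th scaler_sumr -big_split; apply: eq_bigr => i _ /=.
by rewrite linearP scalerDr !scalerA mulrC.
Qed.

Lemma io_is_linear j : linear (io j).
Proof using Type.
move=> a g h; rewrite /io scaler_sumr -big_split; apply: eq_bigr => i _ /=.
by rewrite linearP scalerDr !scalerA mulrC.
Qed.

HB.instance Definition _ l := GRing.isLinear.Build K ext ext _ (th l) (th_is_linear l).
HB.instance Definition _ j := GRing.isLinear.Build K ext ext _ (io j) (io_is_linear j).

Lemma th_th l m (g : ext) : th l (th m g) = - th m (th l g).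
Proof.
have h a b : th a (th b g) = \sum_i \sum_j ((A a i)%:R * (A b j)%:R) *: Th i (Th j g).
  rewrite {1}/th; apply: eq_bigr => i _; rewrite /th linear_sum scaler_sumr.
  by apply: eq_bigr => j _; rewrite linearZ /= scalerA.
rewrite !h exchange_big -sumrN /=; apply: eq_bigr => i _; rewrite -sumrN.
by apply: eq_bigr => j _; rewrite ThTh scalerN mulrC.
Qed.

Lemma io_th j l (g : ext) : io j (th l g) = (l == j)%:R *: g - th l (io j g).
Proof.
have -> : io j (th l g) = \sum_i \sum_m (ratr (B i j) * (A l m)%:R) *: Dt i (Th m g).
  rewrite {1}/io; apply: eq_bigr => i _; rewrite /th linear_sum scaler_sumr.
  by apply: eq_bigr => m _; rewrite linearZ /= scalerA.
have -> : th l (io j g) = \sum_i \sum_m (ratr (B i j) * (A l m)%:R) *: Th m (Dt i g).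
  rewrite {1}/th exchange_big /=; apply: eq_bigr => m _; rewrite /io linear_sum scaler_sumr.
  by apply: eq_bigr => i _; rewrite linearZ /= scalerA mulrC.
have -> : ((l == j)%:R : K) = \sum_i ratr (B i j) * (A l i)%:R.
  rewrite -(@ratr_nat K) -AB ratrK_sum; apply: eq_bigr => i _.
  by rewrite ratrKM ratr_nat mulrC.
rewrite scaler_suml -sumrB; apply: eq_bigr => i _.
rewrite [in RHS](bigD1 i) //= opprD addrA -scalerBr (bigD1 i) //= DtTh eqxx scale1r.
congr (_ + _); rewrite -sumrN; apply: eq_bigr => m mi.
by rewrite DtTh eq_sym (negbTE mi) scale0r sub0r scalerN.
Qed.

Definition dOm (f : chain) : chain := fun y k => \sum_l th l (Nop l f y k).

Lemma dx_dOm f y k : dx f y k = dOm f y k.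
Proof.
rewrite /dx /dOm.
rewrite (eq_bigr (fun i => \sum_j (A j i)%:R *: Th i (Nop j f y k))).
  by rewrite exchange_big.
by move=> i _; rewrite /nab linear_sum; apply: eq_bigr => j _; rewrite linearZ.
Qed.

Lemma Om0 : Om 0. Proof. by split=> //; exact: inX0. Qed.

Lemma OmB f g : Om f -> Om g -> Om (f - g).
Proof. by move=> [h1 h2] [h3 h4]; split=> [|i]; [exact: inXB|exact: cleanB]. Qed.

Lemma Om_k f y k : Om f -> k != 0 -> f y k = 0.
Proof.
move=> hf k0; apply/funext => E; apply/eqP/negPn/negP => /(OmP hf)[e _ _ _].
by rewrite e eqxx in k0.
Qed.

Lemma Om_X i f y k : Om f -> Xe y i < 0 -> f y k = 0.
Proof. by move=> [[_ hv] _]; exact: vog_X. Qed.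

Lemma Dg_dOm f : Om f -> Dg f = dOm f.
Proof.
move=> hf; apply/funext => y; apply/funext => k.
have [->|k0] := eqVneq k 0; last first.
  rewrite (Om_k _ (Om_Dg hf) k0) /dOm big1 // => l _.
  by rewrite NopE !(Om_k _ hf k0) !scaler0 addr0 linear0.
have [hX|] := pselect (forall i, 0 <= Xe y i).
  have hg : good y 0 by apply/goodP => i; split; rewrite ?mxE //; right.
  rewrite /Dg hg dfull_dxdy dx_dOm /dy big1 ?scaler0 ?addr0 // => l _.
  rewrite del_eq0 ?linear0 ?mxE // => k' hk'.
  by apply: (vog_k (i := l)) => //; exact: (proj2 (proj1 hf)).
move=> /existsNP[i /negP]; rewrite -ltNge => hX.
rewrite (Om_X _ (Om_Dg hf) hX) /dOm big1 // => l _.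
rewrite NopE !(Om_X (i := i) _ hf) ?scaler0 ?addr0 ?linear0 // XeB.
by apply: le_lt_trans hX; rewrite gerBl.
Qed.

Lemma Om_fin f y k i : Om f -> exists N, forall m, (N <= m)%N -> f (y - Ei i *+ m) k = 0.
Proof.
move=> hf; have [l hl] := A_row i; exists (`|Xe y l|%N).+1 => m hm.
apply: (Om_X (i := l)) => //; rewrite XeBm; move: hm hl; move: (Xe y l) (A i l) => x a.
clear; nia.
Qed.

(** * Removal of the region y_i < 0 *)

Definition Sx (i : 'I_n) (f : chain) : chain := fun y k E =>
  if y 0 i < 0 then Sser (- Uc y i) (fun m => f (y - Ei i *+ m) k E) else 0.

Lemma UcB i m y : Uc (y - Ei i *+ m) i = Uc y i - m%:R.
Proof.
rewrite /Uc mxE mxE.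
have -> : (Ei i *+ m) 0 i = m%:Z by have := EimE i m 0 i; rewrite add0r mxE add0r eqxx.
by rewrite intrB addrA.
Qed.

Lemma UcB_neq i l m y : l != i -> Uc (y - Ei i *+ m) l = Uc y l.
Proof.
move=> li; rewrite /Uc mxE mxE.
have -> : (Ei i *+ m) 0 l = 0 by have := EimE i m 0 l; rewrite add0r mxE add0r (negbTE li).
by rewrite subr0.
Qed.

Lemma EiB i m y l : (y - Ei i *+ m) 0 l = y 0 l - (if l == i then m%:Z else 0).
Proof.
by rewrite mxE mxE; congr (_ - _); have := EimE i m 0 l; rewrite add0r mxE add0r.
Qed.

Lemma Uc_neq0 y j : Uc y j != 0.
Proof.
rewrite /Uc -(@ratr_int K) -ratrKD ratrK_eq0.
have /andP[h1 h2] := u0_int j; move: (y 0 j) => z.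
case: (lerP 0 z) => hz; first by rewrite gt_eqF // ltr_wpDr // ler0z.
rewrite lt_eqF // -ltrBrDr sub0r; apply: lt_le_trans h2 _; rewrite -mulrNz ler1z; lia.
Qed.

(** d (u_j + y_j) is a nonzero integer M, and its p-adic absolute value is at least 1 / |M|: the
    inverses of U_j grow only linearly in y_j. *)
Lemma v_UcV (d : nat) : (0 < d)%N -> coprime p d ->
  (forall j, exists z : int, d%:R * u0 0 j = z%:~R) ->
  forall y j, v (Uc y j)^-1 <= d%:R * (`|y 0 j|.+1)%:R.
Proof.
move=> d0 cd hd y j; have [z hz] := hd j.
have dK : (d%:R : K) != 0 by rewrite natK_eq0 -lt0n.
have eU : (d%:R : K) * Uc y j = (z + d%:Z * y 0 j)%:~R.
  rewrite /Uc -(@ratr_nat K) -(@ratr_int K (y 0 j)) -ratrKD -ratrKM mulrDr hz.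
  by rewrite -(@ratr_int K) intrD intrM.
have hN : z + d%:Z * y 0 j != 0.
  by rewrite -intK_eq0 -eU mulf_neq0 // Uc_neq0.
have -> : v (Uc y j)^-1 = (v (z + d%:Z * y 0 j)%:~R)^-1.
  by rewrite -eU !vM vV (v_coprime cd) mul1r.
have zd : (`|z| <= d)%N.
  have /andP[h1 h2] := u0_int j.
  have dQ : (0 : rat) < d%:R by rewrite ltr0n.
  have : z%:~R < d%:R :> rat by rewrite -hz gtr_pMr.
  have : 0 < z%:~R :> rat by rewrite -hz mulr_gt0.
  by rewrite ltr0z -[d%:R]/((d%:Z)%:~R) ltr_int; clear; lia.
set M := (z + _) in hN *.
have vMabs : v M%:~R = v (`|M|%N)%:R by case: (M) => a //=; rewrite NegzE mulrNz vN.
have aM : (0 < `|M|)%N by rewrite absz_gt0.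
apply: le_trans (_ : (`|M|%N)%:R <= _).
  rewrite vMabs -[leRHS]invrK lef_pV2 ?posrE ?invr_gt0 ?ltr0n //; last first.
    by rewrite v_gt0 natK_eq0 -lt0n.
  exact: v_nat_ge.
rewrite -natrM ler_nat mulnS; apply: leq_trans (_ : (`|z| + d * `|y 0%R j|)%N <= _)%N.
  have e2 : (`|(d%:Z * y 0 j)%R| = d * `|y 0%R j|)%N by rewrite abszM.
  by rewrite /M -e2; move: (d%:Z * _) => t; clear; lia.
by rewrite leq_add2r.
Qed.

(** y = X A^-1 - u0 is an affine function of the exponents. *)
Lemma y_bound : exists c : nat, forall y i, (forall l, 0 <= Xe y l) ->
  forall k, (`|y 0%R i| <= c * sz y k + 1)%N.
Proof.
pose c := (\sum_i \sum_l Num.bound `|B l i|%R)%N.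
exists c => y i hX k.
have hU : u0 0 i + (y 0 i)%:~R = \sum_l (Xe y l)%:~R * B l i :> rat.
  have e1 l : (Xe y l)%:~R = \sum_j (u0 0 j + (y 0 j)%:~R) * (A j l)%:R :> rat.
    rewrite /Xe intrD x0E rmorph_sum /= -big_split /=; apply: eq_bigr => j _.
    by rewrite intrM mulrDl.
  rewrite (eq_bigr (fun l => \sum_j (u0 0 j + (y 0 j)%:~R) * ((A j l)%:R * B l i))); last first.
    by move=> l _; rewrite e1 mulr_suml; apply: eq_bigr => j _; rewrite mulrA.
  rewrite exchange_big /= (bigD1 i) //= -mulr_sumr AB eqxx mulr1 big1 ?addr0 // => j ji.
  by rewrite -mulr_sumr AB (negbTE ji) mulr0.
have hle : `|u0 0 i + (y 0 i)%:~R| <= (c * sz y k)%:R :> rat.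
  rewrite hU; apply: le_trans (ler_norm_sum _ _ _) _.
  apply: le_trans (_ : \sum_l ((Num.bound `|B l i|%R * sz y k)%N)%:R <= _).
    apply: ler_sum => l _; rewrite normrM natrM mulrC; apply: ler_pM => //.
      exact/ltW/archi_boundP.
    rewrite ger0_norm ?ler0z // -[leRHS]/((_%:Z)%:~R) ler_int.
    by have := sz_geX y k l; have := hX l; move: (Xe y l) (sz y k) => x s1; clear; lia.
  rewrite -natr_sum ler_nat -big_distrl leq_mul2r /= /c.
  by rewrite [X in (_ <= X)%N](bigD1 i) //= leq_addr orbT.
have /andP[h1 h2] := u0_int i.
have : `|(y 0 i)%:~R| <= (c * sz y k)%:R + 1 :> rat.
  have -> : (y 0 i)%:~R = (u0 0 i + (y 0 i)%:~R) - u0 0 i by rewrite addrAC subrr add0r.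
  apply: le_trans (ler_normB _ _) _; apply: lerD => //.
  by rewrite ger0_norm ltW.
rewrite -intr_norm -[_ + 1]/(_%:R + 1%:R) -natrD -[(_ + _)%:R]/((_ %:Z)%:~R) ler_int.
by rewrite -abszE.
Qed.

Definition ev0 (phi : nat -> K) : Prop := exists N, forall m, (N <= m)%N -> phi m = 0.

Lemma Sser_lin (J : Type) (r : seq J) b (a : J -> K) (F : J -> nat -> K) phi :
  (forall j, ev0 (F j)) -> (forall m, phi m = \sum_(j <- r) a j * F j m) ->
  Sser b phi = \sum_(j <- r) a j * Sser b (F j).
Proof.
move=> hF hphi; have hs (psi : nat -> K) : ev0 psi -> summable (fun m => Scoef b m * psi m).
  by move=> [N hN]; apply: (summable_ev0 (N := N)) => m Nm; rewrite hN // mulr0.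
have -> : Sser b phi = - ksum (fun m => \sum_(j <- r) a j * (Scoef b m * F j m)).
  congr (- _); apply: eq_ksum => m; rewrite hphi mulr_sumr; apply: eq_bigr => j _.
  by rewrite mulrCA.
rewrite ksum_sum => [|j]; last exact/summableZ/hs.
rewrite -sumrN; apply: eq_bigr => j _; rewrite ksumZ; last exact: hs.
by rewrite mulrN.
Qed.

Lemma Om_ev0 f y k i E : Om f -> ev0 (fun m => f (y - Ei i *+ m) k E).
Proof. by move=> hf; have [N hN] := Om_fin y k i hf; exists N => m /hN ->. Qed.

Lemma Sx_lin i (J : Type) (r : seq J) (a : J -> K) (F : J -> chain) f y k :
  (forall j E, ev0 (fun m => F j (y - Ei i *+ m) k E)) ->
  (forall m, f (y - Ei i *+ m) k = \sum_(j <- r) a j *: F j (y - Ei i *+ m) k) ->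
  Sx i f y k = \sum_(j <- r) a j *: Sx i (F j) y k.
Proof.
move=> hF hf; apply/funext => E; rewrite fct_sumE /Sx.
case: (y 0 i < 0); last by rewrite big1 // => j _; rewrite exZ; exact: mulr0.
rewrite (@Sser_lin J r _ a (fun j m => F j (y - Ei i *+ m) k E)) //.
by move=> m; rewrite hf fct_sumE.
Qed.

Lemma Sx_lin2 i (a b : K) f g (h : chain) y k :
  (forall E, ev0 (fun m => g (y - Ei i *+ m) k E)) ->
  (forall E, ev0 (fun m => h (y - Ei i *+ m) k E)) ->
  (forall m, f (y - Ei i *+ m) k = a *: g (y - Ei i *+ m) k + b *: h (y - Ei i *+ m) k) ->
  Sx i f y k = a *: Sx i g y k + b *: Sx i h y k.
Proof.
move=> hg hh hf.
rewrite (@Sx_lin i bool [:: true; false] (fun j => if j then a else b) (fun j => if j then g else h)) //.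
- by rewrite !big_cons big_nil addr0.
- by case.
by move=> m; rewrite hf !big_cons big_nil addr0.
Qed.

Lemma Sx_Th i l f y k : (forall E, ev0 (fun m => f (y - Ei i *+ m) k E)) ->
  Sx i (fun y k => Th l (f y k)) y k = Th l (Sx i f y k).
Proof.
move=> hf; apply/funext => E; rewrite /Sx /Th.
case: ifP => hy; last by case: ifP; rewrite ?mulr0.
case: ifP => lE; last first.
  rewrite /Sser (_ : (fun m => _) = fun=> 0) ?ksum0 ?oppr0 //.
  by apply/funext => m; rewrite mulr0.
rewrite (@Sser_lin unit [:: tt] _ (fun=> eps l E) (fun _ m => f (y - Ei i *+ m) k (E :\ l)%SET)) //.
  by rewrite big_cons big_nil addr0.
by move=> m; rewrite big_cons big_nil addr0.
Qed.

Lemma ev0_Th l (F : nat -> ext) : (forall E, ev0 (fun m => F m E)) -> forall E, ev0 (fun m => Th l (F m) E).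
Proof.
by move=> h E; have [N hN] := h (E :\ l)%SET; exists N => m /hN e; rewrite /Th e mulr0 if_same.
Qed.

Lemma ev0_sum (F : 'I_n -> nat -> ext) (a : 'I_n -> K) :
  (forall i E, ev0 (fun m => F i m E)) ->
  forall E, ev0 (fun m => (\sum_i a i *: F i m) E).
Proof.
move=> h E; have /choice[N hN] : forall i, exists N, forall m, (N <= m)%N -> F i m E = 0.
  by move=> i; exact: h.
exists (\max_i N i)%N => m hm; rewrite fct_sumE big1 // => i _.
by rewrite exZ hN ?mulr0 // (leq_trans _ hm) // leq_bigmax.
Qed.

Lemma Sx_th i l f y k : (forall E, ev0 (fun m => f (y - Ei i *+ m) k E)) ->
  Sx i (fun y k => th l (f y k)) y k = th l (Sx i f y k).
Proof.
move=> hf; rewrite (@Sx_lin i _ (index_enum 'I_n) (fun m => (A l m)%:R) (fun m y k => Th m (f y k))) //.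
  by apply: eq_bigr => m _; rewrite Sx_Th.
by move=> m; exact: ev0_Th.
Qed.

Lemma Sx_sol i f y k : (forall E, ev0 (fun m => f (y - Ei i *+ m) k E)) -> y 0 i < 0 ->
  Nop i (Sx i f) y k = f y k.
Proof.
move=> hf hy; apply/funext => E; have [N hN] := hf E.
have hy1 : (y - Ei i) 0 i < 0 by rewrite !mxE !eqxx; move: hy; move: (y 0 i) => z; clear; lia.
rewrite NopE exD !exZ /Sx hy hy1.
have := @Sser_sol (- Uc y i) (fun m => f (y - Ei i *+ m) k E) N _ hN.
rewrite opprK mulr0n subr0 => <-; last by rewrite oppr_eq0 Uc_neq0.
congr (_ + _ * _); congr (Sser _ _).
  by have := UcB i 1 y; rewrite mulr1n => ->; rewrite opprB addrC.
by apply/funext => m; rewrite mulrS opprD addrA.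
Qed.

Lemma Sx_inj i f y k : (forall E, ev0 (fun m => f (y - Ei i *+ m) k E)) -> y 0 i < 0 ->
  Sx i (Nop i f) y k = f y k.
Proof.
move=> hf hy; apply/funext => E; have [N hN] := hf E; rewrite /Sx hy.
have := @Sser_inj (- Uc y i) (fun m => f (y - Ei i *+ m) k E) N _ hN.
rewrite opprK mulr0n subr0 => <-; last first.
  by move=> m; rewrite -oppr_eq0 opprD opprK -UcB Uc_neq0.
congr (Sser _ _); apply/funext => m; rewrite NopE exD !exZ UcB.
by rewrite mulrSr opprD addrA.
Qed.

Lemma Sx_Nop i l f y k : l != i -> Om f -> y 0 i < 0 ->
  Sx i (Nop l f) y k = Nop l (Sx i f) y k.
Proof.
move=> li hf hy.
rewrite (@Sx_lin2 i (Uc y l) pi _ f (fun y k => f (y - Ei l) k)).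
- rewrite NopE; congr (_ + _ *: _); apply/funext => E; rewrite /Sx.
  have -> : (y - Ei l) 0 i = y 0 i by have := EiB l 1 y i; rewrite mulr1n eq_sym (negbTE li) subr0.
  rewrite hy; have -> : Uc (y - Ei l) i = Uc y i.
    by have := @UcB_neq l i 1 y; rewrite mulr1n => -> //; rewrite eq_sym.
  by congr (Sser _ _); apply/funext => m; rewrite addrAC.
- by move=> E; exact: Om_ev0.
- move=> E; have [N hN] := Om_fin (y - Ei l) k i hf; exists N => m /hN h.
  by rewrite addrAC h.
by move=> m; rewrite NopE UcB_neq.
Qed.

Lemma io_v (c : R) (g : ext) j : 0 <= c -> (forall E, v (g E) <= c) ->
  forall E, v (io j g E) <= (\sum_i v (ratr (B i j))) * c.
Proof.
move=> c0 hg E; rewrite /io fct_sumE.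
have b0 : 0 <= \sum_i v (ratr (B i j)) by apply: sumr_ge0 => i _.
apply: v_sum => [|i _]; first by rewrite mulr_ge0.
rewrite exZ vM; apply: ler_pM => //; last exact: ext_vD.
by rewrite (bigD1 i) //= lerDl sumr_ge0.
Qed.

Lemma decays_io j f : decays f -> decays (fun y k => io j (f y k)).
Proof.
move=> [C [r [C0 r0 r1 h]]]; exists ((\sum_i v (ratr (B i j))) * C), r; split=> //.
  by rewrite mulr_ge0 // sumr_ge0.
by move=> y k E; rewrite -mulrA; apply: io_v => //; rewrite mulr_ge0 // exprn_ge0 // ltW.
Qed.

Lemma Om_io j f : Om f -> Om (fun y k => io j (f y k)).
Proof.
move=> [[hd hv] hc]; split=> [|i].
  by split; [exact: decays_io|move=> y k h; rewrite hv // linear0].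
move=> y k E /andP[hX hE]; rewrite /io fct_sumE big1 // => l _.
rewrite exZ /Dt; case: ifP => lE; rewrite ?mulr0 // (hc i) ?mulr0 // /offstate hX /=.
by case/orP: hE => [iE|->]; rewrite ?orbT // finset.setU1r.
Qed.

Lemma sz_ym i m y k : (sz y k <= sz (y - Ei i *+ m) k + m * \sum_l A i l)%N.
Proof.
elim: m => [|m IH]; first by rewrite mulr0n subr0 mul0n addn0.
apply: leq_trans IH _; rewrite mulSn addnA leq_add2r.
by rewrite mulrSr opprD addrA; exact: sz_y.
Qed.

(** The number of shifts and the entries y_i - j are bounded linearly by the size at the shifted
    point where the chain is nonzero. The resulting linear loss is absorbed into a slower rate of
    decay. *)
Lemma decays_Sx i f : Om f -> decays (Sx i f).
Proof.
move=> hf; have [[[C [r [C0 r0 r1 h]]] hv] _] := hf.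
have [d [d0 [cd hd]]] := u0_den; have [c hc] := y_bound.
have [Bg [rg [B0 rg0 rg1 hB]]] := lin_geom (ltW r0) r1.
pose a := (\sum_l A i l)%N.
have [r2 [r20 r21 hr2]] := root_lt1 (1 + a * c) rg0 rg1.
pose C' := d%:R * (c + 2)%:R * C * Bg / r2 ^+ a.
have C'0 : 0 <= C' by rewrite /C' !mulr_ge0 ?invr_ge0 ?exprn_ge0 // ltW.
exists C', r2; split=> // y k E; rewrite /Sx; case: ifP => hy; last first.
  by rewrite v0 mulr_ge0 // exprn_ge0 // ltW.
have [N hN] := Om_ev0 y k i E hf.
apply: (v_Sser _ _ hN) => [|m|m j jm].
- by rewrite mulr_ge0 // exprn_ge0 // ltW.
- by rewrite -oppr_eq0 opprD opprK -UcB Uc_neq0.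
have [f0|f0] := eqVneq (f (y - Ei i *+ m) k E) 0.
  by rewrite f0 v0 mulr0 mulr_ge0 // exprn_ge0 // ltW.
have [k0 hX _ _] := OmP hf f0.
set s1 := sz (y - Ei i *+ m) k.
have -> : v (- Uc y i + j%:R)^-1 = v (Uc (y - Ei i *+ j) i)^-1.
  by rewrite UcB -vN -invrN opprD opprK.
have hb := hc _ i hX k; rewrite -/s1 EiB eqxx in hb.
apply: le_trans (ler_pM _ _ (v_UcV d0 cd hd _ _) (h _ _ _)) _ => //.
rewrite EiB eqxx -/s1.
have e1 : (`|(y 0 i - j%:Z)%R|.+1 <= (c + 2) * s1.+1)%N.
  by move: hb hy jm; move: (y 0 i) => z; clear; nia.
have e2 : (sz y k <= (1 + a * c) * s1 + a)%N.
  have := sz_ym i m y k; rewrite -/s1 -/a; have : (m <= c * s1 + 1)%N.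
    by move: hb hy; move: (y 0 i) => z; clear; lia.
  by clear; nia.
apply: le_trans (_ : d%:R * (c + 2)%:R * C * (s1.+1%:R * r ^+ s1) <= _).
  have -> : d%:R * (c + 2)%:R * C * (s1.+1%:R * r ^+ s1) =
    d%:R * ((c + 2)%:R * s1.+1%:R) * (C * r ^+ s1).
    by rewrite mulrACA -!mulrA.
  apply: ler_wpM2r; first by rewrite mulr_ge0 // exprn_ge0 // ltW.
  by rewrite ler_wpM2l // -natrM ler_nat.
rewrite /C' -!mulrA ler_wpM2l // ler_wpM2l // ler_wpM2l //.
apply: le_trans (hB s1) _; rewrite ler_wpM2l ?(ltW B0) //.
rewrite ler_pdivlMl ?exprn_gt0 //.
apply: le_trans (_ : r2 ^+ a * r2 ^+ ((1 + a * c) * s1) <= _).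
  rewrite ler_wpM2l ?exprn_ge0 ?(ltW r20) // exprM.
  by apply: lerXn2r; rewrite ?nnegrE // exprn_ge0 // ltW.
by rewrite -exprD addnC ler_wiXn2l // ltW.
Qed.

Lemma Om_Sx i f : Om f -> Om (Sx i f).
Proof.
move=> hf.
have key y k E : (forall m, f (y - Ei i *+ m) k E = 0) -> Sx i f y k E = 0.
  move=> h; rewrite /Sx; case: ifP => // _.
  rewrite /Sser (_ : (fun m => _) = fun=> 0) ?ksum0 ?oppr0 //.
  by apply/funext => m; rewrite h mulr0.
have hX0 y m l : 0 <= Xe (y - Ei i *+ m) l -> Xe (y - Ei i *+ m) l <= Xe y l.
  by move=> _; rewrite XeBm gerBl mulr_ge0.
split=> [|l]; first split; first exact: decays_Sx.
  move=> y k hg; apply/funext => E; apply: key => m; apply/eqP/negPn/negP => h.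
  have [k0 hX _ _] := OmP hf h; apply: (negP hg); apply/goodP => l.
  split; [exact: le_trans (hX l) (hX0 _ _ _ (hX l))|by rewrite k0 mxE|].
  by right; split; [exact: s00|rewrite k0 mxE].
move=> y k E /andP[/eqP hX hE]; apply: key => m; apply/eqP/negPn/negP => h.
have [k0 hX1 hE1 _] := OmP hf h.
case/orP: hE => [lE|]; last by rewrite k0 mxE eqxx.
have := lt_le_trans (hE1 l lE) (hX0 _ _ _ (hX1 l)).
by rewrite hX ltxx.
Qed.

Definition nonneg (i : 'I_n) (f : chain) : Prop := forall y k, y 0 i < 0 -> f y k = 0.

Lemma nonneg_Dg i f : Om f -> nonneg i f -> nonneg i (Dg f).
Proof.
move=> hf hn y k hy; rewrite Dg_dOm // /dOm big1 // => l _.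
rewrite NopE !hn // ?scaler0 ?addr0 ?linear0 // -[Ei l]mulr1n EiB.
by apply: le_lt_trans hy; rewrite gerBl; case: ifP.
Qed.

Lemma Om_Nop j f : Om f -> forall y k i E, ev0 (fun m => Nop j f (y - Ei i *+ m) k E).
Proof.
move=> hf y k i E; have [N hN] := Om_fin y k i hf; have [N' hN'] := Om_fin (y - Ei j) k i hf.
exists (maxn N N') => m; rewrite geq_max => /andP[m1 m2].
by rewrite NopE hN // addrAC hN' // !scaler0 addr0.
Qed.

(** For y_i < 0 the operator [Nop i] is invertible on [Om]: U_i never vanishes, and finitely many
    shifts down lead out of the support. Contraction by [io i] followed by this inverse is a
    homotopy there; its second term vanishes by the hypothesis on [Dg g]. *)
Lemma step_x i g : Om g -> nonneg i (Dg g) ->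
  exists h, [/\ Om h, nonneg i (g - Dg h) & forall l, l != i -> nonneg l g -> nonneg l h].
Proof.
move=> hg hD; pose ig : chain := fun y k => io i (g y k).
have hig : Om ig by exact: Om_io.
exists (Sx i ig); split; first exact: Om_Sx.
- move=> y k hy; rewrite chD chN Dg_dOm; last exact: Om_Sx.
  have -> : dOm (Sx i ig) y k = \sum_l Sx i (fun y k => th l (Nop l ig y k)) y k.
    apply: eq_bigr => l _; rewrite Sx_th; last by move=> E; exact: Om_Nop.
    congr (th l _); have [->|li] := eqVneq l i.
      by rewrite Sx_sol ?Sx_inj // => E; exact: Om_ev0.
    by rewrite Sx_Nop.
  have evg E : ev0 (fun m => Nop i g (y - Ei i *+ m) k E) by exact: Om_Nop.
  have -> : \sum_l Sx i (fun y k => th l (Nop l ig y k)) y k =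
    Sx i (fun y k => \sum_l 1 *: th l (Nop l ig y k)) y k.
    rewrite [RHS](@Sx_lin i _ (index_enum 'I_n) (fun=> 1) (fun l y k => th l (Nop l ig y k))) //.
      by apply: eq_bigr => l _; rewrite scale1r.
    by move=> l; apply: ev0_sum => i0; apply: ev0_Th => E; exact: Om_Nop.
  have eN l y' : Nop l ig y' k = io i (Nop l g y' k).
    by rewrite NopE /ig NopE linearD !linearZ.
  (* The anticommutators of [io i] with the [th l] turn the sum over [l] into Nop_i g minus io_i of
     the differential of g. *)
  have eS : forall y', \sum_l 1 *: th l (Nop l ig y' k) = Nop i g y' k - io i (dOm g y' k).
    move=> y'; have -> : io i (dOm g y' k) = \sum_l io i (th l (Nop l g y' k)) by exact: linear_sum.
    rewrite (bigD1 i) //= [X in _ = _ - X](bigD1 i) //= opprD addrA; congr (_ + _).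
      by rewrite scale1r eN io_th eqxx scale1r opprB addrC subrK.
    by rewrite -sumrN; apply: eq_bigr => l li; rewrite scale1r eN io_th (negbTE li) scale0r sub0r opprK.
  rewrite (@Sx_lin2 i 1 (-1) _ (Nop i g) (fun y k => io i (dOm g y k))) //.
  + rewrite Sx_inj // => [|E]; last exact: Om_ev0.
    rewrite scale1r scaleN1r opprB addrC.
    rewrite [X in X - _ + _](_ : _ = 0) ?sub0r ?addNr //.
    apply/funext => E; rewrite /Sx hy /Sser (_ : (fun m => _) = fun=> 0) ?ksum0 ?oppr0 //.
    apply/funext => m; rewrite -Dg_dOm // hD ?linear0 ?mulr0 // EiB eqxx.
    by apply: le_lt_trans hy; rewrite gerBl.
  + move=> E; have := Om_ev0 y k i E (Om_io i (Om_Dg hg)).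
    by rewrite Dg_dOm.
  by move=> m; rewrite eS scale1r scaleN1r.
move=> l li hl y k hy; apply/funext => E; rewrite /Sx; case: ifP => // hyi.
rewrite /Sser (_ : (fun m => _) = fun=> 0) ?ksum0 ?oppr0 //.
by apply/funext => m; rewrite /ig hl ?linear0 ?mulr0 // EiB (negbTE li) subr0.
Qed.

Definition Pos (f : chain) : Prop := Om f /\ forall i, nonneg i f.

Lemma reduce_x g : Om g -> (forall i, nonneg i (Dg g)) ->
  exists h, Om h /\ Pos (g - Dg h).
Proof.
move=> hg hD; have [|||||||h [hO hP]] := @reduce_gen Om nonneg _ _ _ _ _ _ _ g hg hD.
- exact: Om0.
- exact: OmB.
- exact: Om_Dg.
- by move=> f [[]].
- by move=> i f f' h h' y k hy; rewrite chD chN h // h' // subr0.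
- exact: nonneg_Dg.
- move=> i f fO hl hDf; have [h [h0 h1 h2]] := step_x fO hDf.
  by exists h; split=> // l li; apply: h2 (hl l li); rewrite neq_ltn li.
by exists h; split=> //; split=> //; apply: OmB => //; exact: Om_Dg.
Qed.

(** * Concentration at y = 0 *)

Definition Tx (j : 'I_n) (f : chain) : chain := fun y k E =>
  Tser (Uc y j) (fun m => f (y + Ei j *+ m) k E).

Definition Rx (j : 'I_n) (f : chain) : chain := fun y k E =>
  Rser (Uc y j) (fun m => f (y + Ei j *+ m) k E).

Definition ypos y : bool := [forall l, 0 <= y 0 l].

Lemma Xe_ypos y l : ypos y -> x0 0 l <= Xe y l.
Proof.
move=> /forallP h; rewrite /Xe lerDl; apply: sumr_ge0 => j _.
by rewrite mulr_ge0.
Qed.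

(** For y >= 0 all X_i are positive because x0 is; so such points with k = 0 are good and cleanness
    holds automatically. *)
Lemma PosP f : Pos f <-> decays f /\ (forall y k, ~~ (ypos y && (k == 0)) -> f y k = 0).
Proof.
split=> [[hO hp]|[hd hs]].
  split=> [|y k]; first by have [[]] := hO.
  rewrite negb_and => /orP[/forallPn[i]|/(Om_k _ hO)//].
  by rewrite -ltNge; exact: hp.
have hX y l : ypos y -> Xe y l != 0.
  by move=> hy; rewrite gt_eqF //; apply: lt_le_trans (x0_gt0 l) (Xe_ypos l hy).
split; last first.
  move=> i y k hy; apply: hs; apply/negP => /andP[/forallP/(_ i)].
  by rewrite leNgt hy.
split; first split => // y k hg.
  apply: hs; apply/negP => /andP[hy /eqP k0]; apply: (negP hg); apply/goodP => l.
  split; rewrite ?k0 ?mxE //; last by right.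
  exact: le_trans (ltW (x0_gt0 l)) (Xe_ypos l hy).
move=> i y k E /andP[/eqP hE _]; rewrite hs //; apply/negP => /andP[hy _].
by have := hX y i hy; rewrite hE eqxx.
Qed.

Lemma Pos_eq0 f y k : Pos f -> ~~ (ypos y && (k == 0)) -> f y k = 0.
Proof. by move=> /PosP[_]; apply. Qed.

Lemma Pos0 : Pos 0. Proof. by split; [exact: Om0|]. Qed.

Lemma PosB f g : Pos f -> Pos g -> Pos (f - g).
Proof.
move=> [h1 h2] [h3 h4]; split=> [|i y k hy]; first exact: OmB.
by rewrite chD chN (h2 i) // (h4 i) // subr0.
Qed.

Lemma Pos_Dg f : Pos f -> Pos (Dg f).
Proof. by move=> [h1 h2]; split=> [|i]; [exact: Om_Dg|exact: nonneg_Dg]. Qed.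

Lemma decays_geox f y k E i : Pos f -> geo (fun m => f (y + Ei i *+ m) k E).
Proof.
move=> /PosP[[C [r [C0 r0 r1 h]]] _]; have [l hl] := A_row i.
exists (C / r ^+ `|Xe y l|%N), r.
have rn : 0 < r ^+ `|Xe y l|%N by rewrite exprn_gt0.
split=> //; [by rewrite divr_ge0 // ltW|exact: ltW|].
move=> m; apply: le_trans (h _ _ _) _; rewrite -mulrA ler_wpM2l //.
rewrite ler_pdivlMl // -exprD ler_wiXn2l ?(ltW r0) ?(ltW r1) //.
have := sz_geX (y + Ei i *+ m) k l; rewrite XeDm.
move: hl; move: (sz _ _) (Xe y l) (A i l) => a b c; clear => hl h; nia.
Qed.

Lemma UcD i m y : Uc (y + Ei i *+ m) i = Uc y i + m%:R.
Proof. by rewrite /Uc EimE eqxx intrD addrA. Qed.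

Lemma UcD_neq i l m y : l != i -> Uc (y + Ei i *+ m) l = Uc y l.
Proof. by move=> li; rewrite /Uc EimE (negbTE li) addr0. Qed.

Lemma Tx_lin i (J : Type) (r : seq J) (a : J -> K) (F : J -> chain) f y k :
  (forall j E, geo (fun m => F j (y + Ei i *+ m) k E)) ->
  (forall m, f (y + Ei i *+ m) k = \sum_(j <- r) a j *: F j (y + Ei i *+ m) k) ->
  Tx i f y k = \sum_(j <- r) a j *: Tx i (F j) y k.
Proof.
move=> hF hf; apply/funext => E; rewrite fct_sumE /Tx.
rewrite (eq_Tser _ (psi := fun m => \sum_(j <- r) a j * F j (y + Ei i *+ m) k E)); last first.
  by move=> m; rewrite hf fct_sumE.
rewrite Tser_sum => [|//|j]; last exact/geoZ/hF.
  by apply: eq_bigr => j _; rewrite exZ TserZ //; exact: zp_Uc.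
exact: zp_Uc.
Qed.

Lemma geo_Th l (F : nat -> ext) : (forall E, geo (fun m => F m E)) -> forall E, geo (fun m => Th l (F m) E).
Proof.
move=> h E; rewrite /Th; case: (l \in E); [by apply: geoZ; exact: h|exact: geo0].
Qed.

Lemma Tx_Th i l f y k : (forall E, geo (fun m => f (y + Ei i *+ m) k E)) ->
  Tx i (fun y k => Th l (f y k)) y k = Th l (Tx i f y k).
Proof.
move=> hf; apply/funext => E; rewrite /Tx /Th; case: ifP => _; last exact: Tser0.
by rewrite TserZ //; exact: zp_Uc.
Qed.

Lemma Tx_th i l f y k : (forall E, geo (fun m => f (y + Ei i *+ m) k E)) ->
  Tx i (fun y k => th l (f y k)) y k = th l (Tx i f y k).
Proof.
move=> hf; rewrite (@Tx_lin i _ (index_enum 'I_n) (fun m => (A l m)%:R) (fun m y k => Th m (f y k))) //.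
  by apply: eq_bigr => m _; rewrite Tx_Th.
by move=> m; exact: geo_Th.
Qed.

Lemma Pos_Nop l f y k i E : Pos f -> geo (fun m => Nop l f (y + Ei i *+ m) k E).
Proof.
move=> hf; suff h : decays (Nop l f) /\ forall y k, ~~ (ypos y && (k == 0)) -> Nop l f y k = 0.
  exact/decays_geox/PosP.
split; first exact/decays_Nop/(proj1 (proj1 (proj1 hf))).
move=> y' k' h; rewrite NopE !(Pos_eq0 hf) ?scaler0 ?addr0 //.
apply: contra h => /andP[/forallP h ->]; rewrite andbT; apply/forallP => m.
by apply: le_trans (h m) _; rewrite -[Ei l]mulr1n EiB gerBl; case: ifP.
Qed.

Lemma Tx_Nop i l f y k : l != i -> Pos f -> Tx i (Nop l f) y k = Nop l (Tx i f) y k.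
Proof.
move=> li hf.
rewrite (@Tx_lin i bool [:: true; false] (fun j => if j then Uc y l else pi)
  (fun j => if j then f else fun y k => f (y - Ei l) k)).
- rewrite !big_cons big_nil addr0 NopE; congr (_ + _ *: _); apply/funext => E; rewrite /Tx.
  have -> : Uc (y - Ei l) i = Uc y i by rewrite -[Ei l]mulr1n UcB_neq // eq_sym.
  by congr (Tser _ _); apply/funext => m; rewrite addrAC.
- case=> E; first exact: decays_geox.
  rewrite (_ : (fun m => _) = fun m => f (y - Ei l + Ei i *+ m) k E); first exact: decays_geox.
  by apply/funext => m; rewrite addrAC.
by move=> m; rewrite NopE UcD_neq // !big_cons big_nil addr0.
Qed.

Lemma Tx_Nopi i f y k : Pos f -> Tx i (Nop i f) y k = f y k.
Proof.
move=> hf; apply/funext => E; rewrite /Tx.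
pose phi m := f (y + Ei i *+ m) k E.
rewrite (_ : f y k E = phi 0%N); last by rewrite /phi mulr0n addr0.
rewrite -(@Tser_inj (Uc y i) phi); last first.
  apply: geo_summable; last exact: decays_geox.
  by have := zp_rationalD_int 1 (zp_Uc y i).
rewrite /Tser; congr (_ * _); apply: eq_ksum => m; congr (_ * _).
rewrite NopE exD !exZ UcD /phi /=; congr (_ * _ + _ * f _ _ _).
by rewrite mulrSr addrA addrK.
Qed.

Lemma Nop_Tx i f y k : Pos f -> Uc y i *: Tx i f y k + Rx i f y k = f y k.
Proof.
move=> hf; apply/funext => E; rewrite exD exZ /Tx /Rx Tser_sol.
- by rewrite mulr0n addr0.
- exact: zp_Uc.
- by apply: geo_summable; [exact: zp_Uc|exact: decays_geox].
exact: (geo_Tsummable (zp_Uc y i) (decays_geox y k E i hf)).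
Qed.

Lemma Tx_prev i f y k : pi *: Tx i f (y - Ei i) k = Rx i f y k.
Proof.
apply/funext => E; rewrite exZ /Tx /Rx /Tser /Rser mulrA mulfV ?pi_neq0 // mul1r.
have -> : Uc (y - Ei i) i + 1 = Uc y i by rewrite -[Ei i]mulr1n UcB subrK.
apply: eq_ksum => m; congr (_ * f _ _ _).
by rewrite mulrS addrA subrK.
Qed.

(** For y_j >= 0 the operator [Nop j] is inverted from above as [del] was, with the defect [Rx] at
    y_j = 0, where the value at y_j = -1 is cut off. *)
Definition hx (j : 'I_n) (g : chain) : chain := fun y k =>
  if ypos y && (k == 0) then io j (Tx j g y k) else 0.

Lemma Tx_eq0 i g y k : (forall m, g (y + Ei i *+ m.+1) k = 0) -> Tx i g y k = 0.
Proof.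
move=> h; apply/funext => E; rewrite /Tx -[RHS](Tser0 (Uc y i)) /Tser.
by congr (_ * _); apply: eq_ksum => m; rewrite h.
Qed.

Lemma sz_yp j m y k : ypos y -> (sz y k + m <= sz (y + Ei j *+ m) k)%N.
Proof.
move=> hy; have [l hl] := A_row j; rewrite /sz (bigD1 l) //= [X in (_ <= X)%N](bigD1 l) //= XeDm.
set T1 := (\sum_(_ < _ | _) _)%N; set T2 := (\sum_(_ < _ | _) _)%N.
have hX i : 0 <= Xe y i by exact: le_trans (ltW (x0_gt0 i)) (Xe_ypos i hy).
have hT : (T1 <= T2)%N.
  apply: leq_sum => i _; rewrite XeDm leq_add2r.
  by move: (hX i); move: (Xe y i) (A j i) => x a; clear; nia.
by move: hT (hX l) hl; move: T1 T2 (k 0 l) (Xe y l) (A j l); clear => T1 T2 z x a; nia.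
Qed.

Lemma Pos_hx j g : Pos g -> Pos (hx j g).
Proof.
move=> /PosP[[C [r [C0 r0 r1 h]]] hs]; apply/PosP; split; last first.
  by move=> y k /negbTE e; rewrite /hx e.
have [Bt B0 hB] := v_Tser (ltW r0) r1.
exists ((\sum_i v (ratr (B i j))) * (Bt * C)), r; split=> //.
  by rewrite mulr_ge0 ?sumr_ge0 // mulr_ge0 // ltW.
move=> y k E; rewrite /hx; case: ifP => [/andP[hy _]|_]; last first.
  by rewrite v0 !mulr_ge0 ?exprn_ge0 ?sumr_ge0 // ltW.
rewrite -mulrA; apply: io_v => [|E']; first by rewrite !mulr_ge0 ?exprn_ge0 // ltW.
rewrite -mulrA; apply: hB; [exact: zp_Uc|by rewrite mulr_ge0 ?exprn_ge0 // ltW|].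
move=> m; apply: le_trans (h _ _ _) _; rewrite -mulrA ler_wpM2l // -exprD.
by rewrite ler_wiXn2l ?(ltW r0) ?(ltW r1) // sz_yp.
Qed.

Lemma hxE j g y k : Pos g -> 0 <= y 0 j -> hx j g y k = io j (Tx j g y k).
Proof.
move=> hg hy; rewrite /hx; case: ifP => // /negP h.
rewrite Tx_eq0 ?linear0 // => m; apply: (Pos_eq0 hg); apply/negP => /andP[/forallP hp k0].
apply: h; rewrite k0 andbT; apply/forallP => l; have := hp l; rewrite EimE.
by case: eqP => [->|_]; rewrite ?addr0.
Qed.

Lemma hx_homotopy j g y k : Pos g -> 0 <= y 0 j ->
  Dg (hx j g) y k = g y k - (if y 0 j == 0 then th j (io j (Rx j g y k)) else 0)
    - io j (Tx j (Dg g) y k).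
Proof.
move=> hg hy; have hh := Pos_hx j hg.
rewrite !Dg_dOm; [|exact: (proj1 hg)|exact: (proj1 hh)].
have eN l : l != j -> Nop l (hx j g) y k = io j (Tx j (Nop l g) y k).
  move=> lj; rewrite Tx_Nop // !NopE hxE // hxE //; last first.
    by rewrite -[Ei l]mulr1n EiB eq_sym (negbTE lj) subr0.
  move: (Tx j g y k) (Tx j g (y - Ei l) k) => a b.
  by rewrite linearD !linearZ.
have eNj : Nop j (hx j g) y k = io j (g y k) - (if y 0 j == 0 then io j (Rx j g y k) else 0).
  rewrite NopE hxE //; case: eqP => y0.
    rewrite (proj2 hh j) ?scaler0 ?addr0; last by rewrite -[Ei j]mulr1n EiB eqxx y0.
    rewrite -[in RHS](Nop_Tx j y k hg); move: (Tx j g y k) (Rx j g y k) => a b.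
    by rewrite linearD addrK linearZ.
  rewrite hxE //; last first.
    by rewrite -[Ei j]mulr1n EiB eqxx; move: hy y0; move: (y 0 j) => z; clear; lia.
  rewrite subr0 -[in RHS](Nop_Tx j y k hg) -(Tx_prev j g y k).
  move: (Tx j g y k) (Tx j g (y - Ei j) k) => a b.
  by rewrite linearD !linearZ.
have eT : Tx j (dOm g) y k = \sum_l th l (Tx j (Nop l g) y k).
  rewrite (@Tx_lin j _ (index_enum 'I_n) (fun=> 1) (fun l y k => th l (Nop l g y k))).
  - by apply: eq_bigr => l _; rewrite scale1r Tx_th // => E; exact: Pos_Nop.
  - move=> l E; rewrite /th.
    rewrite (_ : (fun m => _) = fun m => \sum_i (A l i)%:R * Th i (Nop l g (y + Ei j *+ m) k) E).
      apply: geo_sum => i; apply: geoZ; apply: geo_Th => E'; exact: Pos_Nop.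
    by apply/funext => m; rewrite fct_sumE.
  by move=> m; rewrite /dOm; apply: eq_bigr => l _; rewrite scale1r.
have -> : io j (Tx j (dOm g) y k) = \sum_l io j (th l (Tx j (Nop l g) y k)).
  by rewrite eT; exact: linear_sum.
rewrite /dOm (bigD1 j) //= [in RHS](bigD1 j) //= eNj Tx_Nopi //.
rewrite io_th eqxx scale1r [th j (_ - _)]linearB /= opprD addrA.
have -> : \sum_(l | l != j) th l (Nop l (hx j g) y k) =
   - \sum_(l | l != j) io j (th l (Tx j (Nop l g) y k)).
  rewrite -sumrN; apply: eq_bigr => l lj; rewrite eN //.
  by rewrite io_th (negbTE lj) scale0r sub0r opprK.
have key (a b c : ext) : a - c = b - c - (b - a) by rewrite opprB [RHS]addrC addrA subrK.
congr (_ + _); rewrite (key (th j (io j (g y k))) (g y k)); congr (_ - _ - _).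
by case: eqP => _ //; rewrite linear0.
Qed.

(** What the contraction in direction [j] leaves: chains at y_j = 0 divisible by th_j, divisibility
    being expressed as annihilation by th_j. *)
Definition Pfix (j : 'I_n) (f : chain) : Prop :=
  forall y k, (y 0 j != 0 -> f y k = 0) /\ th j (f y k) = 0.

Lemma Pfix_Dg j f : Pos f -> Pfix j f -> Pfix j (Dg f).
Proof.
move=> hf hp y k; rewrite Dg_dOm /dOm; last exact: (proj1 hf).
have e : th j (Nop j f y k) = 0.
  by rewrite NopE linearD !linearZ /= !(proj2 (hp _ _)) !scaler0 addr0.
split=> [yj|].
  rewrite (bigD1 j) //= e add0r big1 // => l lj; rewrite NopE (proj1 (hp y k)) //.
  rewrite (proj1 (hp (y - Ei l) k)) ?scaler0 ?addr0 ?linear0 //.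
  by rewrite -[Ei l]mulr1n EiB [j == l]eq_sym (negbTE lj) subr0.
rewrite linear_sum big1 //= => l _; rewrite th_th.
by rewrite NopE linearD !linearZ /= !(proj2 (hp _ _)) !scaler0 addr0 linear0 oppr0.
Qed.

Lemma step_fix (j : 'I_n) g : Pos g -> (forall l : 'I_n, (l < j)%N -> Pfix l g) -> Pfix j (Dg g) ->
  exists h, [/\ Pos h, Pfix j (g - Dg h) & forall l : 'I_n, (l < j)%N -> Pfix l h].
Proof.
move=> hg hl hD; exists (hx j g); split; first exact: Pos_hx.
- have hneg y k : y 0 j < 0 -> (g - Dg (hx j g)) y k = 0.
    move=> yj; rewrite chD chN (proj2 hg j) // (proj2 (Pos_Dg (Pos_hx j hg)) j) //.
    by rewrite subrr.
  have key y k : 0 <= y 0 j -> (g - Dg (hx j g)) y k =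
      if y 0 j == 0 then th j (io j (Rx j g y k)) else 0.
    move=> yj; rewrite chD chN hx_homotopy // Tx_eq0 ?linear0 ?oppr0 ?addr0; last first.
      move=> m; apply: (proj1 (hD _ _)); rewrite EimE eqxx.
      by move: yj; move: (y 0 j) => z; clear; lia.
    by rewrite opprB addrC subrK.
  move=> y k; have [yj|yj] := ltP (y 0 j) 0; first by rewrite hneg // linear0.
  rewrite key //; case: eqP => y0; last by rewrite linear0.
  split=> //; have := th_th j j (io j (Rx j g y k)); move: (th j (th j _)) => a.
  move=> /eqP; rewrite -addr_eq0 -mulr2n -scaler_nat scaler_eq0 natK_eq0 /=.
  by move=> /eqP.
move=> l lj y k; have lj' : l != j by rewrite neq_ltn lj.
split=> [yl|].
  rewrite /hx; case: ifP => // _; rewrite Tx_eq0 ?linear0 // => m.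
  by apply: (proj1 (hl l lj _ _)); rewrite EimE (negbTE lj') addr0.
rewrite /hx; case: ifP => _; last by rewrite linear0.
have e : th l (Tx j g y k) = 0.
  rewrite -Tx_th => [|E]; last exact: decays_geox.
  by apply: Tx_eq0 => m; exact: (proj2 (hl l lj _ _)).
by have := io_th j l (Tx j g y k); rewrite e linear0 (negbTE lj') scale0r sub0r => /esym/eqP; rewrite oppr_eq0 => /eqP.
Qed.

Definition top : chain := fun y k E => ((y == 0) && (k == 0) && (E == [set: 'I_n]%SET))%:R.

Lemma th_Th_eq0 (g : ext) : (forall j, th j g = 0) -> forall i, Th i g = 0.
Proof.
move=> h i; have : \sum_j ratr (B i j) *: th j g = 0 by rewrite big1 // => j _; rewrite h scaler0.
rewrite /th (eq_bigr (fun j => \sum_l (ratr (B i j) * (A j l)%:R) *: Th l g)); last first.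
  by move=> j _; rewrite scaler_sumr; apply: eq_bigr => l _; rewrite scalerA.
rewrite exchange_big /= (bigD1 i) //= -scaler_suml.
have e l : \sum_j ratr (B i j) * (A j l)%:R = (i == l)%:R :> K.
  by rewrite -(@ratr_nat K) -BA ratrK_sum; apply: eq_bigr => j _; rewrite ratrKM ratr_nat.
rewrite e eqxx scale1r big1 ?addr0 // => l li.
by rewrite -scaler_suml e eq_sym (negbTE li) scale0r.
Qed.

Lemma Pos_top : Pos top.
Proof.
apply/PosP; split; last first.
  move=> y k h; apply/funext => E; rewrite /top; case: andP => // -[/andP[/eqP y0 k0] _].
  case/negP: h; rewrite k0 andbT; apply/forallP => l; by rewrite y0 mxE.
exists (2 ^+ sz 0 0), 2^-1; split; rewrite ?exprn_ge0 ?invr_gt0 ?invf_lt1 ?ltr1n //.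
move=> y k E; rewrite /top; case: andP => [[/andP[/eqP-> /eqP->] _]|_].
  by rewrite v1 -exprMn mulfV ?expr1n // pnatr_eq0.
by rewrite v0 mulr_ge0 ?exprn_ge0 ?invr_ge0.
Qed.

Lemma Pfix_top f : Pos f -> (forall j, Pfix j f) <-> exists a, f = a *: top.
Proof.
move=> hf; split=> [hp|[a ->]].
  exists (f 0 0 [set: 'I_n]%SET); apply/funext => y; apply/funext => k; apply/funext => E.
  rewrite chZ exZ /top.
  have [->|y0] /= := eqVneq y 0; last first.
    have [j hj] : exists j, y 0 j != 0.
      apply: contrapT => /forallNP h; case/eqP: y0; apply/matrixP => a j.
      by rewrite ord1 mxE; apply: contrapT => /eqP e; exact: (h j).
    by rewrite (proj1 (hp j y k) hj) mulr0.
  have [->|k0] /= := eqVneq k 0; last by rewrite (Om_k _ (proj1 hf) k0) mulr0.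
  have [->|/eqP E0] := eqVneq E [set: 'I_n]%SET; first by rewrite mulr1.
  have [i iE] : exists i, i \notin E.
    apply: contrapT => /forallNP h; case: E0; apply/setP => i; rewrite inE.
    by apply: contrapT => /negP e; exact: (h i).
  have := th_Th_eq0 (fun j => proj2 (hp j 0 0)) i.
  move/(congr1 (fun g : ext => g (i |: E)%SET)); rewrite /Th finset.setU11 finset.setU1K // => /eqP.
  rewrite mulf_eq0 /eps signr_eq0 /= => /eqP ->; by rewrite mulr0.
move=> j y k; split=> [yj|].
  apply/funext => E; rewrite chZ exZ /top; case: eqP => [y0|_]; last by rewrite mulr0.
  by rewrite y0 mxE eqxx in yj.
rewrite chZ linearZ /= (_ : th j (top y k) = 0) ?scaler0 //.
rewrite /th big1 // => i _; apply/funext => E; rewrite exZ /Th; case: ifP => iE; last by rewrite mulr0.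
rewrite /top (_ : (E :\ i == _)%SET = false) ?andbF ?mulr0 //.
by apply/negbTE/eqP => /setP/(_ i); rewrite !inE eqxx.
Qed.

Lemma Dg_top : Dg top = 0.
Proof.
have [hp _] := Pfix_top Pos_top; have {}hp := (proj2 (Pfix_top Pos_top) (ex_intro _ 1 (esym (scale1r top)))).
apply/funext => y; apply/funext => k; rewrite Dg_dOm; last exact: (proj1 Pos_top).
by rewrite /dOm big1 // => l _; rewrite NopE linearD !linearZ /= !(proj2 (hp l _ _)) !scaler0 addr0.
Qed.

(** The three normalizations in succession. With a = 0 it shows that [top] spans the cohomology,
    with a = 1 that [top] is not a coboundary. *)
Lemma reduce_top g a : inX g -> Dg g = a *: top ->
  exists b h, [/\ inX h & g - Dg h = b *: top].
Proof.
move=> gX ea.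
have Ptop : Pos (a *: top).
  move: Pos_top => /PosP[h1 h2]; apply/PosP; split=> [|y k h]; last by rewrite chZ h2 ?scaler0.
  exact: (@decays_scale (fun _ _ => a) (v a)).
have Pt j : Pfix j (a *: top) by have [_ h] := Pfix_top Ptop; apply: h; exists a.
have [h1 [h1X hO]] := reduce_y gX (fun i => ltac:(rewrite ea; exact: (proj2 (proj1 Ptop) i))).
have eD h f : inX h -> Dg (f - Dg h) = Dg f.
  by move=> [_ hv]; rewrite linearB /= Dg_Dg // subr0.
have [h2 [h2O hP]] := reduce_x hO (fun i => ltac:(rewrite eD // ea; exact: (proj2 Ptop i))).
have h2X := proj1 h2O.
have [||||||||h3 [h3P hf]] := @reduce_gen Pos Pfix _ _ _ _ _ _ _ (g - Dg h1 - Dg h2) hP.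
- exact: Pos0.
- exact: PosB.
- exact: Pos_Dg.
- by move=> f [[[]]].
- move=> i f f' hf hf' y k; rewrite chD chN linearB /= (proj2 (hf _ _)) (proj2 (hf' _ _)) subr0.
  by split=> // yi; rewrite (proj1 (hf _ _)) // (proj1 (hf' _ _)) // subr0.
- exact: Pfix_Dg.
- exact: step_fix.
- by move=> i; rewrite !eD // ea.
have h3X := proj1 (proj1 h3P).
have [b hb] := (proj1 (Pfix_top (PosB hP (Pos_Dg h3P)))) hf.
exists b, (h1 + h2 + h3); split; first by apply: inXD => //; exact: inXD.
have -> : Dg (h1 + h2 + h3) = Dg h1 + Dg h2 + Dg h3 by rewrite !linearD.
by rewrite -hb !opprD !addrA.
Qed.

Lemma top_nonzero g : inX g -> Dg g <> top.
Proof.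
move=> gX e; have [|b [h [hX hb]]] := @reduce_top g 1 gX; first by rewrite scale1r.
have : Dg (g - Dg h) = top by rewrite linearB /= Dg_Dg ?subr0 //; exact: (proj2 hX).
rewrite hb linearZ /= Dg_top scaler0 => /(congr1 (fun f : chain => f 0 0 [set: 'I_n]%SET)).
by rewrite /top !eqxx /= => /eqP; rewrite eq_sym oner_eq0.
Qed.
Hypothesis L0_1 : L0 = 1.

(** * The Frobenius on the class of [top] *)

Lemma bF_range j : 0 < bF 0 j /\ (`|bF 0%R j| < p)%N.
Proof.
have hp1 : (0 : rat) < p.-1%:R by rewrite ltr0n -subn1 subn_gt0 p_gt1.
have /andP[h1 h2] := u0_int j; have e := bE j.
have b0 : 0 < bF 0 j by rewrite -(@ltr0z rat) e mulr_gt0.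
have b1 : bF 0 j < p.-1%:Z.
  by rewrite -(@ltr_int rat) e -[X in _ < X]mulr1 ltr_pM2l.
split=> //; rewrite -ltz_nat gtz0_abs //; apply: lt_le_trans b1 _.
by rewrite lez_nat leq_pred.
Qed.

(** The factor in direction [j] of the coefficient of Fr [top]. Since 0 < bF_j < p, a negative [t]
    would make the index bF_j + p t negative, hence the value 0. *)
Definition phi (j : 'I_n) (t : int) : K :=
  if 0 <= t then hj j (`|bF 0%R j| + p * `|t|)%N * pi ^+ (`|bF 0%R j| + p * `|t|)%N else 0.

Lemma mxEmul y m (j : 'I_n) : (y *+ m) 0 j = y 0 j *+ m.
Proof. by elim: m => [|m IH]; rewrite ?mulr0n ?mxE // !mulrS mxE IH. Qed.

Lemma Cf_phi y : Cf (bF + y *+ p) = \prod_j phi j (y 0 j).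
Proof.
have [h|/existsNP[l /negP]] := pselect (forall l, 0 <= y 0 l); last first.
  rewrite -ltNge => h; rewrite (bigD1 l) //= /phi leNgt h /= mul0r.
  apply: (@Cf_neg _ l); rewrite mxE mxEmul; have [_ h2] := bF_range l.
  have h3 : y 0 l *+ p <= - p%:Z.
    have -> : - p%:Z = (-1) *+ p by rewrite mulNrn natz.
    by apply: ler_wMn2r; move: h; move: (y 0 l) => z; clear; lia.
  by move: h2 h3; move: (y 0 l *+ p) (bF 0 l); clear; lia.
have hb j : `|(bF + y *+ p)%R 0%R j|%N = (`|bF 0%R j| + p * `|y 0%R j|)%N.
  rewrite mxE mxEmul -mulr_natl natz; have [h1 _] := bF_range j.
  rewrite -[y 0 j in LHS]gez0_abs // -[bF 0 j in LHS]gtz0_abs // -PoszM -PoszD absz_nat.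
have hp j : 0 <= (bF + y *+ p) 0 j.
  by rewrite mxE mxEmul; have [h1 _] := bF_range j; rewrite addr_ge0 ?(ltW h1) // mulrn_wge0.
rewrite /Cf c_prod // /vs -prodrXr -big_split /=; apply: eq_bigr => j _.
by rewrite /phi h hb.
Qed.

(** The defect left by the contraction in direction [j], applied to the values [phi j]: the share of
    this direction in the Frobenius eigenvalue. *)
Definition Mj (j : 'I_n) : K := Rser (ratr (u0 0 j)) (fun m => phi j m%:Z).

(** A representative of the class of Fr [top] in which the first [m] directions are already
    concentrated at 0. *)
Definition gm (m : nat) : chain := fun y k E =>
  ((k == 0) && (E == [set: 'I_n]%SET))%:R * (p%:R ^- n *
   \prod_(j : 'I_n) (if (j < m)%N then (y 0 j == 0)%:R * Mj j else phi j (y 0 j))).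

Lemma qE_full : qE 0 [set: 'I_n]%SET = n.
Proof.
rewrite /qE cardsT card_ord (_ : [set i | _ & _]%SET = finset.set0) ?cards0 ?addn0 //.
by apply/setP => i; rewrite !inE.
Qed.

Lemma Fr_top : Fr top = gm 0.
Proof.
apply/funext => y; apply/funext => k; apply/funext => E; rewrite /gm -Cf_phi.
have e : psi top y k E = ((k == 0) && (E == [set: 'I_n]%SET))%:R * Cf (bF + y *+ p).
  rewrite /psi (fsumE (r := [:: bF + y *+ p])) // => [|kap]; last first.
    rewrite inE => hk; rewrite /top subr_eq0 eq_sym (negbTE hk) /= mulr0 //.
  by rewrite big_cons big_nil addr0 /top subrr eqxx /= mulrC.
rewrite /Fr e; case: (boolP (k == 0)) => [/eqP ->|_] /=; last by rewrite !mul0r mulr0 if_same.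
case: (eqVneq E _) => [->|_] /=; last by rewrite !mul0r mulr0 if_same.
rewrite !mul1r qE_full; case: ifP => // /negP hg.
have [|/existsNP[l /negP]] := pselect (forall l, 0 <= y 0 l).
  move=> hy; case: hg; apply/goodP => i; split; rewrite ?mxE //; last by right.
  by apply: le_trans (ltW (x0_gt0 i)) (Xe_ypos i _); apply/forallP.
rewrite -ltNge => h; rewrite Cf_phi (bigD1 l) //= /phi leNgt h /= mul0r mulr0 //.
Qed.

(** In top degree th_j acts as zero, so the relation between io_j and th_j reduces to th_j io_j =
    1. *)
Lemma th_full j (g : ext) : (forall E, E != [set: 'I_n]%SET -> g E = 0) -> th j (io j g) = g.
Proof.
move=> h; have := io_th j j g; have -> : th j g = 0.
  rewrite /th big1 // => i _; apply/funext => E; rewrite exZ /Th; case: ifP => iE; last by rewrite mulr0.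
  rewrite h ?mulr0 //; apply/eqP => /setP/(_ i); by rewrite !inE eqxx.
by rewrite linear0 eqxx scale1r => /esym/eqP; rewrite subr_eq0 => /eqP.
Qed.

Lemma Dg_full g : Pos g -> (forall y k E, E != [set: 'I_n]%SET -> g y k E = 0) -> Dg g = 0.
Proof.
move=> hg h; rewrite Dg_dOm; last exact: (proj1 hg).
apply/funext => y; apply/funext => k; rewrite /dOm big1 // => l _.
rewrite /th big1 // => i _; apply/funext => E; rewrite exZ /Th; case: ifP => iE; last by rewrite mulr0.
have hE : (E :\ i)%SET != [set: 'I_n]%SET by apply/eqP => /setP/(_ i); rewrite !inE eqxx.
by rewrite NopE exD !exZ !h // !mulr0 addr0 !mulr0.
Qed.

Lemma gm_full m y k E : E != [set: 'I_n]%SET -> gm m y k E = 0.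
Proof. by move=> /negbTE h; rewrite /gm h andbF mul0r. Qed.

Lemma phi_geo j : geo (fun m => phi j m%:Z).
Proof.
have [rho [r0 r1 hr]] := v_Cf_geom; exists 1, rho; split=> //; first exact: ltW.
move=> m; rewrite mul1r /phi /=; set N := (_ + _)%N.
have -> : hj j N * pi ^+ N = Cf (Ei j *+ N).
  rewrite /Cf /hj; congr (_ * _ ^+ _); rewrite /vs (bigD1 j) //= Eim eqxx big1 ?addn0 // => l lj.
  by rewrite Eim (negbTE lj).
apply: le_trans (hr _) _; rewrite ler_wiXn2l ?(ltW r0) ?(ltW r1) //.
rewrite /vs (bigD1 j) //= Eim eqxx; apply: leq_trans (leq_addr _ _).
by rewrite /N; apply: leq_trans (leq_addl _ _); rewrite leq_pmull // p_gt0.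
Qed.

Lemma gm_step (j : 'I_n) : Pos (gm j) -> gm j - Dg (hx j (gm j)) = gm j.+1.
Proof.
move=> hP; apply/funext => y; apply/funext => k; rewrite chD chN.
have hn (g : chain) : Pos g -> y 0 j < 0 -> g y k = 0 by move=> [_ h] hy; exact: (h j).
have [yj|yj] := ltP (y 0 j) 0.
  rewrite (hn _ hP yj) (hn _ (Pos_Dg (Pos_hx j hP)) yj) subrr.
  apply/funext => E; rewrite /gm (bigD1 j) //= ltnSn lt_eqF // !mul0r !mulr0 //.
rewrite hx_homotopy // (Dg_full hP (@gm_full j)) Tx_eq0 ?linear0 ?oppr0 ?addr0 //.
rewrite opprB addrC subrK.
case: eqP => y0; last first.
  by apply/funext => E; rewrite /gm (bigD1 j) //= ltnSn (introF eqP y0) !mul0r !mulr0.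
rewrite th_full; last first.
  move=> E hE; rewrite /Rx /Rser (_ : (fun m => _) = fun=> 0) ?ksum0 //.
  by apply/funext => m; rewrite gm_full ?mulr0.
apply/funext => E; rewrite /Rx /gm.
set P := \prod_(i | i != j) (if (i < j)%N then (y 0 i == 0)%:R * Mj i else phi i (y 0 i)).
rewrite (bigD1 j) //= ltnSn y0 eqxx mul1r.
have eP (F : nat -> 'I_n -> K) : \prod_(i | i != j) (if (i < j.+1)%N then (y 0 i == 0)%:R * Mj i else phi i (y 0 i)) = P.
  apply: eq_bigr => i ij; rewrite ltnS leq_eqVlt.
  by have -> : (i == j :> nat) = false by apply/negbTE; apply: contra ij => /eqP/val_inj ->.
rewrite (eP (fun _ _ => 0)); set cc := (_)%:R.
have hU : Uc y j = ratr (u0 0 j) by rewrite /Uc y0 addr0.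
have -> : cc * (p%:R ^- n * (Mj j * P)) = (cc * (p%:R ^- n * P)) * Mj j.
  by rewrite [Mj j * P]mulrC !mulrA.
have eM : Mj j = ksum (fun m => Tcoef (ratr (u0 0 j)) m * phi j m%:Z) by [].
rewrite hU /Rser eM -ksumZ; last exact/geo_summable/phi_geo/u0_zp.
apply: eq_ksum => m.
set Q := \prod_(i < n) _; have -> : Q = phi j m%:Z * P.
  rewrite /Q (bigD1 j) //= ltnn EimE eqxx y0 add0r; congr (_ * _).
  by apply: eq_bigr => i ij; rewrite EimE (negbTE ij) addr0.
move: (Tcoef _ _) (phi _ _) P cc (p%:R ^- n : K) {eP} => t1 t2 t3 t4 t5; ring.
Qed.

Lemma Fr_top_class : exists h, inX h /\ Fr top - Dg h = (p%:R ^- n * \prod_j Mj j) *: top.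
Proof.
have [h0 h00] : exists h, Pos h /\ Fr top - Dg h = gm n.
  suff key m : (m <= n)%N -> Pos (gm m) /\ exists h, Pos h /\ Fr top - Dg h = gm m.
    by have [_] := key n (leqnn n).
  elim: m => [_|m IH mn].
    rewrite -Fr_top; split; last by exists 0; split; [exact: Pos0|rewrite linear0 subr0].
    split; first exact: Om_Fr (proj1 Pos_top).
    move=> i y k hy; apply/funext => E; rewrite Fr_top /gm (bigD1 i) //= /phi leNgt hy /=.
    by rewrite mul0r !mulr0.
  have [hP [h [hh e]]] := IH (ltnW mn); pose j := Ordinal mn.
  have e2 := @gm_step j hP; have hP2 := Pos_hx j hP.
  split; first by rewrite -e2; apply: PosB => //; exact: Pos_Dg.
  exists (h + hx j (gm m)); split.
    by rewrite -[hx _ _]opprK; apply: PosB => //; rewrite -sub0r; apply: PosB => //; exact: Pos0.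
  have -> : Dg (h + hx j (gm m)) = Dg h + Dg (hx j (gm m)) by rewrite linearD.
  by rewrite opprD addrA e e2.
have [hP e] := h00; exists h0; split; first exact: (proj1 (proj1 hP)).
rewrite e; apply/funext => y; apply/funext => k; apply/funext => E; rewrite chZ exZ /gm /top.
rewrite (eq_bigr (fun j => (y 0 j == 0)%:R * Mj j)); last by move=> j _; rewrite ltn_ord.
have -> : ((y == 0) && (k == 0) && (E == [set: 'I_n]%SET))%:R =
    ((k == 0) && (E == [set: 'I_n]%SET))%:R * (y == 0)%:R :> K.
  by case: (y == 0); case: (k == 0); case: (E == _); rewrite ?mulr1 ?mulr0.
rewrite big_split /= [RHS]mulrC -!mulrA; congr (_ * _); rewrite mulrCA; congr (_ * _).
have [->|y0] := eqVneq y 0.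
  by rewrite big1 // => j _; rewrite mxE eqxx.
have [j hj'] : exists j, y 0 j != 0.
  apply: contrapT => /forallNP h; case/eqP: y0; apply/rowP => j; rewrite mxE.
  by apply: contrapT => /eqP hh; exact: (h j).
by rewrite (bigD1 j) //= (negbTE hj') mul0r.
Qed.

(** As pi^((p-1) m) = (-p)^m, the term of index m is pi^b (-1)^m (u)_m h_(b + p m) (-p)^m with b =
    bF_j. For m >= 1 the loss gap(b + p m) is less than m, so only h_b is left modulo [p]. *)
Lemma v_Mj j : v (hj j `|bF 0%R j|%N) <= 1 /\
  exists x, [/\ Mj j = pi ^+ `|bF 0%R j|%N * x, v x <= 1 & v (x - hj j `|bF 0%R j|%N) <= p%:R^-1].
Proof.
have pR := pR_gt0; set N0 := `|bF 0%R j|%N; have [_ hN] := bF_range j.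
have gap0 m : (m < p ^ 2)%N -> gap m = 0%N by move=> h; rewrite /gap divn_small.
have N0p : (N0 < p ^ 2)%N by apply: leq_trans hN _; rewrite expnS expn1 leq_pmulr // p_gt0.
have h1 : v (hj j N0) <= 1.
  by have := v_h_le (hj_0 j) (hj_rec j) N0; rewrite gap0 // expr0.
split=> //.
have u_zp : zp_rational (ratr (u0 0 j) : K) by exact: u0_zp.
have hs := geo_summable u_zp (phi_geo j).
pose x := pi ^- N0 * Mj j; exists x.
have eM : Mj j = pi ^+ N0 * x by rewrite /x mulVKf // expf_neq0 // pi_neq0.
have hd : v (x - hj j N0) <= p%:R^-1.
  rewrite /x /Mj /Rser (ksum_recl hs) mulrDr /Tcoef expr0 poch0 !mul1r /phi /= muln0 addn0.
  rewrite [X in X + _ - _]mulrCA mulVf ?mulr1 ?expf_neq0 ?pi_neq0 // addrAC subrr add0r.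
  rewrite -(ksumZ _ (summableS hs)); apply: v_ksum; first by rewrite invr_ge0 ltW.
    exact: summableZ (summableS hs).
  move=> m; set m1 := m.+1; rewrite /= -/N0.
  have -> : pi ^- N0 * ((- pi^-1) ^+ m1 * poch (ratr (u0 0 j)) m1 * (hj j (N0 + p * m1) * pi ^+ (N0 + p * m1))) =
    (-1) ^+ m1 * poch (ratr (u0 0 j)) m1 * hj j (N0 + p * m1) * (- p%:R) ^+ m1.
    have -> : (p * m1 = m1 + p.-1 * m1)%N by rewrite -mulSn prednK // p_gt0.
    have e1 : (- pi^-1) ^+ m1 = (-1) ^+ m1 * pi ^- m1 by rewrite (exprNn pi^-1) (exprVn pi).
    have e2 : pi ^+ (N0 + (m1 + p.-1 * m1)) = pi ^+ N0 * (pi ^+ m1 * (- p%:R) ^+ m1).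
      by rewrite !exprD exprM pi_root.
    rewrite e1 e2.
    have n1 : pi ^+ N0 != 0 by rewrite expf_neq0 // pi_neq0.
    have n2 : pi ^+ m1 != 0 by rewrite expf_neq0 // pi_neq0.
    move: (pi ^+ N0) (pi ^+ m1) n1 n2 (poch _ _) (hj _ _) ((-1) ^+ m1) ((- p%:R) ^+ m1).
    by move=> a1 a2 n1 n2 a3 a4 a5 a6; field; rewrite n1 n2.
  rewrite !vM vsign mul1r vX vN vp.
  apply: le_trans (_ : 1 * p%:R ^+ gap (N0 + p * m1) * p%:R^-1 ^+ m1 <= _).
    apply: ler_wpM2r; first by rewrite exprn_ge0 // invr_ge0 ltW.
    apply: ler_pM => //; last exact: (v_h_le (hj_0 j) (hj_rec j)).
    exact: le_trans (v_poch_le _ u_zp) (v_nat_le1 _).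
  rewrite mul1r exprVn ler_pdivrMr ?exprn_gt0 // ler_pdivlMl // -exprS pRX_mono //.
  rewrite /gap; have -> : ((N0 + p * m1) %/ p ^ 2 = m1 %/ p)%N.
    by rewrite expnS expn1 divnMA addnC mulnC divnMDl ?p_gt0 // (@divn_small N0 p hN) addn0.
  have := leq_trunc_div m1 p; have m10 : (0 < m1)%N by [].
  move: (m1 %/ p)%N => [|q] hq; first exact: m10.
  apply: leq_trans hq; move: p_ge5; clear; nia.
split=> //; rewrite -[x](subrK (hj j N0)); apply: vD => //.
by apply: le_trans hd _; rewrite ltW // pV_lt1.
Qed.

(** The bF_j add up to p - 1 because the u_j add up to 1. So the product of the pi^(bF_j) is -p,
    which cancels one of the [n] factors of p^-n and is the origin of the sign. *)
Lemma Fr_top_trace : exists h t, [/\ inX h, Fr top - Dg h = t *: top &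
  v (p%:R ^+ (n - 1) * t + \prod_j hj j `|bF 0%R j|%N) <= p%:R^-1].
Proof.
have [h [hX e]] := Fr_top_class; exists h, (p%:R ^- n * \prod_j Mj j); split=> //.
have /choice[x hx'] := fun j => proj2 (v_Mj j).
rewrite (eq_bigr (fun j => pi ^+ `|bF 0%R j|%N * x j)); last by move=> j _; have [] := hx' j.
rewrite big_split /= prodrXr.
have -> : (\sum_j `|bF 0%R j| = p.-1)%N.
  apply/eqP; rewrite -eqz_nat (@big_morph _ _ Posz 0 (+%R)) // -(@eqr_int rat) rmorph_sum /=.
  rewrite (eq_bigr (fun j => p.-1%:R * u0 0 j)); last first.
    by move=> j _; have [h1 _] := bF_range j; rewrite gtz0_abs.
  by rewrite -mulr_sumr L0E L0_1 mulr1.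
rewrite pi_root; have -> : p%:R ^+ (n - 1) * (p%:R ^- n * (- p%:R * \prod_i x i)) = - \prod_i x i.
  rewrite -{2}(subnK n_gt0) exprD expr1; have hp := pK_neq0.
  have hp2 : (p%:R : K) ^+ (n - 1) != 0 by exact: expf_neq0.
  move: hp hp2; move: ((p%:R : K) ^+ (n - 1)) (p%:R : K) (\prod_i x i) => a2 a3 a1 hp hp2.
  by field; rewrite hp hp2.
rewrite addrC -vN opprB; apply: v_prod_sub => [|j|j|j].
- by rewrite invr_ge0 ltW // pR_gt0.
- by have [] := hx' j.
- exact: (proj1 (v_Mj j)).
by have [] := hx' j.
Qed.

Lemma trace_top : exists2 t, is_subquotient_trace Zm Bm Fr t &
  v (p%:R ^+ (n - 1) * t + \prod_j hj j `|bF 0%R j|%N) <= p%:R^-1.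
Proof.
have [h [t [hX e ht]]] := Fr_top_trace; exists t => //.
apply: (trace_line (b := top) subspace_Bm).
- by split; [exact: (proj1 (proj1 Pos_top))|exact: Dg_top].
- by move=> [g hg /esym]; exact: top_nonzero.
- move=> z [hz Dz]; have [|b [g [hg eg]]] := @reduce_top z 0 hz; first by rewrite Dz scale0r.
  by exists b; exists g => //; rewrite -eg opprB addrC subrK.
by exists h => //; rewrite -e opprB addrC subrK.
Qed.

End Untwisted.

End Model.

(** * Lattice coordinates *)

Lemma ratmxM a (u : 'rV[int]_a) (M : 'M[int]_(a, n)) : ratmx (u *m M) = ratmx u *m ratmx M.
Proof. exact: map_mxM. Qed.

Section Coker.
Variables (A : 'M[nat]_n).
Hypothesis A_unit : ratmx (intmx A) \in unitmx.

Lemma cls_eqP (M : 'M[nat]_n) (x y : 'rV[int]_n) :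
  cls M x = cls M y <-> exists u, x = y + u *m intmx M.
Proof using Type.
rewrite /cls; split=> [/eqP|[u ->]].
  rewrite -Quotient.idealrBE => /asboolP[u hu]; exists u.
  by rewrite -hu addrC subrK.
by apply/eqP; rewrite -Quotient.idealrBE addrC addKr; apply/asboolP; exists u.
Qed.

Lemma cls_rep (M : 'M[nat]_n) (g : coker M) : cls M (rep g) = g.
Proof using Type. by rewrite /cls /rep reprK. Qed.

Lemma AinvE i l : \sum_j invA A i j * (A j l)%:R = (i == l)%:R.
Proof.
have := mulVmx A_unit => /matrixP/(_ i l); rewrite !mxE => <-.
by apply: eq_bigr => j _; rewrite !mxE.
Qed.

Lemma invA_den : exists2 N : 'M[int]_n, forall i j, (\det (intmx A))%:~R * invA A i j = (N i j)%:~R &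
  (`|\det (intmx A)| != 0)%N.
Proof.
have dE : \det (ratmx (intmx A)) = (\det (intmx A))%:~R by exact: det_map_mx.
have d0 : \det (ratmx (intmx A)) != 0 by rewrite -unitfE -unitmxE.
exists (\adj (intmx A)) => [i j|]; last first.
  by rewrite absz_eq0 -(intr_eq0 rat) -dE.
rewrite /invA /invmx A_unit mxE -dE mulVKf //.
by rewrite /ratmx -map_mx_adj mxE.
Qed.

Lemma dvd_p_coprime d : (d%:Z %| p%:Z - 1)%Z -> coprime p d.
Proof.
move=> h; have : (d %| p.-1)%N.
  have e : p%:Z - 1 = p.-1%:Z by have := p_gt0; lia.
  by rewrite e in h.
move=> /dvdnP[q hq]; rewrite /coprime -dvdn1; have <- : (p - p.-1 = 1)%N.
  by rewrite -[X in (X - _)%N](prednK p_gt0) subSnn.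
by apply: dvdn_sub; rewrite ?dvdn_gcdl // hq dvdn_mull // dvdn_gcdr.
Qed.

Hypothesis A_det : (\det (intmx A) %| p%:Z - 1)%Z.

Lemma det_coprime : coprime p `|\det (intmx A)|%N.
Proof. by apply: dvd_p_coprime; rewrite dvdzE absz_nat -dvdzE. Qed.

Lemma zp_of_den (x : rat) (z : int) : (\det (intmx A))%:~R * x = z%:~R -> zp_rational (ratr x : K).
Proof.
move=> h; have [N hN d0] := invA_den.
have cd := det_coprime; set D := `|_|%N in cd d0.
have hD : (D%:R : rat) * x = ((-1) ^+ (\det (intmx A) < 0)%R * z)%:~R.
  rewrite intrM -h mulrA -intrM; congr (_ * _).
  by rewrite /D -[LHS]/((`|_|%N%:Z)%:~R) abszE normrEsign.
exists ((-1) ^+ (\det (intmx A) < 0)%R * z), D; split=> //.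
apply: (@mulIf K D%:R); first by rewrite natK_eq0.
by rewrite mulfVK ?natK_eq0 // mulrC -(@ratr_int K) -hD ratrKM ratr_nat.
Qed.

End Coker.

Section Transfer.
Variables (A : 'M[nat]_n) (x0 l0 : 'rV[int]_n).
Hypothesis A_unit : ratmx (intmx A) \in unitmx.
Hypothesis A_det : (\det (intmx A) %| p%:Z - 1)%Z.
Hypothesis s_range : forall i, 0 <= mulAmT A l0 0 i < 1.

Implicit Types (y k : 'rV[int]_n) (f h : series K n) (m : mono n).

(** * Series and chains *)

Definition u0 : 'rV[rat]_n := ratmx x0 *m invA A.
Definition s0 : 'rV[rat]_n := mulAmT A l0.
Definition Xv y : 'rV[int]_n := x0 + y *m intmx A.
Definition Le k : 'rV[int]_n := l0 + k *m intmx A^T.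

Lemma XvE y i : Xv y 0 i = Xe A x0 y i.
Proof.
rewrite /Xv /Xe mxE mxE; congr (_ + _); apply: eq_bigr => j _; by rewrite mxE.
Qed.

Lemma ratmxD (u t : 'rV[int]_n) : ratmx (u + t) = ratmx u + ratmx t.
Proof. exact: map_mxD. Qed.

Lemma x0_u0 i : (x0 0 i)%:~R = \sum_j u0 0 j * (A j i)%:R.
Proof.
have : u0 *m ratmx (intmx A) = ratmx x0 by rewrite /u0 mulmxKV.
move=> /rowP/(_ i); rewrite !mxE => <-; apply: eq_bigr => j _; by rewrite !mxE.
Qed.

Lemma mulAmT_Le k i : mulAmT A (Le k) 0 i = s0 0 i + (k 0 i)%:~R.
Proof.
rewrite /mulAmT /Le ratmxD mulmxDl mxE -/(mulAmT A l0) -/s0; congr (_ + _).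
rewrite ratmxM -mulmxA.
have -> : ratmx (intmx A^T) *m (invA A)^T = 1%:M.
  have -> : ratmx (intmx A^T) = (ratmx (intmx A))^T by apply/matrixP => a b; rewrite !mxE.
  by rewrite -trmx_mul mulVmx // trmx1.
by rewrite mulmx1 mxE.
Qed.

Lemma Le_entry k j : (Le k 0 j)%:~R = \sum_i (s0 0 i + (k 0 i)%:~R) * (A j i)%:R.
Proof.
have : mulAmT A (Le k) *m (ratmx (intmx A))^T = ratmx (Le k).
  by rewrite /mulAmT -mulmxA -trmx_mul mulmxV // trmx1 mulmx1.
move=> /rowP/(_ j); rewrite [in RHS]mxE => <-; rewrite mxE; apply: eq_bigr => i _.
by rewrite mulAmT_Le !mxE.
Qed.

Lemma s0_zp i : zp_rational (ratr (s0 0 i) : K).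
Proof.
have [N hN _] := invA_den A_unit.
apply: (zp_of_den A_unit A_det (z := \sum_j l0 0 j * N i j)).
rewrite /s0 /mulAmT mxE mulr_sumr [RHS]rmorph_sum; apply: eq_bigr => j _ /=.
by rewrite !mxE mulrCA hN intrM.
Qed.

Lemma u0_zp i : zp_rational (ratr (u0 0 i) : K).
Proof.
have [N hN _] := invA_den A_unit.
apply: (zp_of_den A_unit A_det (z := \sum_j x0 0 j * N j i)).
rewrite /u0 mxE mulr_sumr [RHS]rmorph_sum; apply: eq_bigr => j _ /=.
by rewrite !mxE mulrCA hN intrM.
Qed.

Definition natv (u : 'rV[int]_n) : 'rV[nat]_n := map_mx absz u.

Lemma natvK (u : 'rV[int]_n) : (forall i, 0 <= u 0 i) -> intmx (natv u) = u.
Proof. by move=> h; apply/rowP => i; rewrite !mxE gez0_abs. Qed.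

Lemma intmxK (u : 'rV[nat]_n) : natv (intmx u) = u.
Proof. by apply/rowP => i; rewrite !mxE. Qed.

Lemma Le_ge0 k : (forall i, 0 <= k 0 i) -> forall j, 0 <= Le k 0 j.
Proof.
move=> hk j; rewrite -(@ler0z rat) Le_entry; apply: sumr_ge0 => i _.
have /andP[h _] := s_range i; rewrite mulr_ge0 // addr_ge0 // ler0z //.
Qed.

Lemma lamt_Le k : (forall i, 0 <= k 0 i) -> forall i, lamt A (natv (Le k)) 0 i = s0 0 i + (k 0 i)%:~R.
Proof. by move=> hk i; rewrite /lamt natvK ?mulAmT_Le //; exact: Le_ge0. Qed.

Definition admissible y k : bool := [forall i, (0 <= Xe A x0 y i) && (0 <= k 0 i)].

Lemma admP y k : reflect ((forall i, 0 <= Xe A x0 y i) /\ (forall i, 0 <= k 0 i)) (admissible y k).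
Proof.
apply: (iffP forallP) => [h|[h1 h2] i]; last by rewrite h1 h2.
by split=> i; have /andP[] := h i.
Qed.

Definition pt y k (E : {set 'I_n}) : mono n := (natv (Xv y), natv (Le k), E).

(** The coefficients of [f] at the monomials of the piece, before division by the ideal; [md]
    restricts them to good points. *)
Definition raw f : chain := fun y k E => if admissible y k then f (pt y k E) else 0.

Definition md f : chain := fun y k => if good A s0 x0 y k then raw f y k else 0.

Lemma md_is_linear : linear md.
Proof using Type.
move=> a f g; apply/funext => y; apply/funext => k; apply/funext => E.
rewrite /md /raw !fctE; case: ifP => _; last by rewrite scaler0 addr0.
by case: ifP => _ //; rewrite scaler0 addr0.
Qed.
HB.instance Definition _ := GRing.isLinear.Build K (series K n) chain _ md md_is_linear.

Lemma good_adm y k : good A s0 x0 y k -> admissible y k.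
Proof. by move=> /(goodP x0_u0 u0_zp s0_zp) h; apply/admP; split=> i; have [] := h i. Qed.

Lemma raw_low f : lowX A x0 (raw f).
Proof.
move=> y k i h; apply/funext => E; rewrite /raw; case: ifP => // /admP[h1 _].
by have := h1 i; rewrite leNgt h.
Qed.

Lemma raw_klow f y k i : k 0 i < 0 -> raw f y k = 0.
Proof.
move=> h; apply/funext => E; rewrite /raw; case: ifP => // /admP[_ h1].
by have := h1 i; rewrite leNgt h.
Qed.

Lemma md_vog f : vanishes_off_good A s0 x0 (md f).
Proof. by move=> y k /negbTE h; rewrite /md h. Qed.

Lemma A_col i : exists j, (0 < A j i)%N.
Proof.
apply: contrapT => /forallNP h.
have := AinvE A_unit i i; rewrite eqxx big1 => [/esym/eqP|j _]; first by rewrite oner_eq0.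
by move: (h j) => /negP; rewrite -eqn0Ngt => /eqP ->; rewrite mulr0.
Qed.

(** lambda = (s + k) A^T with s >= 0, and no column of [A] is zero, so the entries of lambda add up
    to at least the sum of the k_i. *)
Lemma sz_deg y k E : admissible y k -> (sz A x0 y k <= total_degree (pt y k E))%N.
Proof.
move=> /admP[hX hk]; rewrite /total_degree /sz big_split /=; apply: leq_trans (leq_addr _ _).
apply: leq_add; first by apply: leq_sum => i _; rewrite mxE XvE.
rewrite /vsum -(ler_nat rat) !natr_sum.
rewrite [X in _ <= X](eq_bigr (fun j => (Le k 0 j)%:~R)) => [|j _]; last first.
  by rewrite mxE -[in RHS](gez0_abs (Le_ge0 hk j)).
rewrite [X in _ <= X](eq_bigr (fun j => \sum_i (s0 0 i + (k 0 i)%:~R) * (A j i)%:R)); last by move=> j _; exact: Le_entry.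
rewrite exchange_big /=; apply: ler_sum => i _; have [j hj] := A_col i.
have /andP[s1 _] := s_range i; have k1 : 0 <= (k 0 i)%:~R :> rat by rewrite ler0z.
rewrite (bigD1 j) //= -[X in X <= _]addr0; apply: lerD; last first.
  by apply: sumr_ge0 => l _; rewrite mulr_ge0 // addr_ge0.
have -> : (`|k 0%R i|%N%:R : rat) = (k 0 i)%:~R by rewrite -[in RHS](gez0_abs (hk i)).
apply: le_trans (_ : s0 0 i + (k 0 i)%:~R <= _); first by rewrite lerDr.
by rewrite ler_peMr ?addr_ge0 // ler1n.
Qed.

Lemma raw_decays f : overconvergent v A f -> decays A x0 (raw f).
Proof.
move=> [_ [C [r [C0 r0 r1 h]]]]; exists C, (Num.max r 2^-1); split; first exact: ltW.
- by rewrite lt_max invr_gt0 ltr0n orbT.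
- by rewrite gt_max r1 invf_lt1 ?ltr1n.
have m0 : 0 <= Num.max r 2^-1 by rewrite le_max r0.
have m1 : Num.max r 2^-1 <= 1 by rewrite ge_max (ltW r1) invf_le1 ?ler1n.
move=> y k E; rewrite /raw; case: ifP => [ha|_]; last first.
  by rewrite v0 mulr_ge0 ?exprn_ge0 // ltW.
apply: le_trans (h _) _; rewrite ler_wpM2l ?(ltW C0) //.
apply: le_trans (_ : Num.max r 2^-1 ^+ total_degree (pt y k E) <= _).
  by apply: lerXn2r; rewrite ?nnegrE // le_max lexx.
by rewrite ler_wiXn2l // sz_deg.
Qed.

Lemma inX_md f : overconvergent v A f -> inX A s0 x0 (md f).
Proof.
move=> /raw_decays [C [r [C0 r0 r1 h]]]; split; last exact: md_vog.
exists C, r; split=> // y k E; rewrite /md; case: ifP => _; first exact: h.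
by rewrite v0 mulr_ge0 ?exprn_ge0 // ltW.
Qed.

(** ** Coefficients of the differentials *)

Lemma theta_sign1 i (E : {set 'I_n}) : theta_sign K [set i]%SET E = if i \in E then 0 else eps i E.
Proof.
rewrite /theta_sign; case: (boolP (i \in E)) => iE.
  rewrite (_ : (_ == _) = false) //; apply/negbTE/eqP => /setP/(_ i).
  by rewrite !inE eqxx iE.
rewrite (_ : (_ == _)); last first.
  by apply/eqP/setP => j; rewrite !inE; case: eqP => [->|//]; rewrite (negbTE iE).
rewrite /eps; congr (_ ^+ _).
have -> : [set ij : 'I_n * 'I_n | [&& ij.1 \in [set i]%SET, ij.2 \in E & (ij.2 < ij.1)%N]]%SET =
    ((fun q => (i, q)) @: [set q in E | (q < i)%N])%SET.
  apply/setP => -[a b]; rewrite !inE /=; apply/and3P/imsetP => [[/eqP -> bE ba]|[q]].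
    by exists b; rewrite // !inE bE.
  by rewrite !inE => /andP[qE qi] [-> ->]; rewrite eqxx qE.
by rewrite card_imset // => a b [].
Qed.

(** The differentials send a monomial to a finite sum of scaled monomials [tau t m], and [src t] is
    the only source that can reach m' through the term [t]. This replaces the sum over all monomials
    by a finite sum over terms. *)
Lemma lin_ext_terms (T : finType) (D : mono n -> series K n) (a : T -> mono n -> K)
    (tau : T -> mono n -> mono n) (src : T -> option (mono n)) f m' :
  (forall m, D m m' = \sum_t a t m * (m' == tau t m)%:R) ->
  (forall t m, a t m != 0 -> m' = tau t m -> src t = Some m) ->
  (forall t m, src t = Some m -> m' = tau t m) ->
  lin_ext D f m' = \sum_t (if src t is Some m then f m * a t m else 0).
Proof.
move=> hD h1 h2; rewrite /lin_ext.
have hz t m : (forall m0, src t = Some m0 -> m != m0) -> f m * (a t m * (m' == tau t m)%:R) = 0.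
  move=> h; have [->|a0] := eqVneq (a t m) 0; first by rewrite mul0r mulr0.
  case: eqP => [e|_]; last by rewrite !mulr0.
  by have := h _ (h1 _ _ a0 e); rewrite eqxx.
rewrite (eq_fsbigr (fun m => \sum_t 1 * (f m * (a t m * (m' == tau t m)%:R)))); last first.
  by move=> m _; rewrite hD mulr_sumr; apply: eq_bigr => t _; rewrite mul1r.
pose r t := if src t is Some m then [:: m] else [::].
have hr t m : m \notin r t -> f m * (a t m * (m' == tau t m)%:R) = 0.
  move=> hm; apply: hz => m0 e; move: hm; rewrite /r e inE //.
rewrite (@fsum_lin _ T _ (fun=> 1) (fun t m => f m * (a t m * (m' == tau t m)%:R))); last first.
  by move=> t; exact: (finsupp_sub (hr t)).
apply: eq_bigr => t _; rewrite mul1r (fsumE (r := r t)) //; last first.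
- exact: hr.
- by rewrite /r; case: (src t).
rewrite /r; case e: (src t) => [m|]; last by rewrite big_nil.
by rewrite big_cons big_nil addr0 -(h2 _ _ e) eqxx mulr1.
Qed.

Lemma raw_pt f y k E : admissible y k -> raw f y k E = f (pt y k E).
Proof. by rewrite /raw => ->. Qed.

Lemma serD f h m : (f + h) m = f m + h m. Proof. by []. Qed.
Lemma serZ a f m : (a *: f) m = a * f m. Proof. by []. Qed.

Definition subv (a g : 'rV[nat]_n) : 'rV[nat]_n := \row_l (a 0%R l - g 0%R l)%N.

Lemma subvK (a g : 'rV[nat]_n) : (forall l, (g 0%R l <= a 0%R l)%N) -> subv a g + g = a.
Proof. by move=> h; apply/rowP => l; rewrite !mxE; exact: subnK. Qed.

Lemma addvK (a g : 'rV[nat]_n) : subv (a + g) g = a.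
Proof. by apply/rowP => l; rewrite !mxE; exact: addnK. Qed.

Definition leqv (g a : 'rV[nat]_n) : bool := [forall l, (g 0%R l <= a 0%R l)%N].

Lemma leqv_add (a g : 'rV[nat]_n) : leqv g (a + g).
Proof. by apply/forallP => l; rewrite mxE; exact: leq_addl. Qed.

Lemma natvB (t : 'rV[int]_n) (g : 'rV[nat]_n) : (forall l, 0 <= t 0 l) ->
  [forall l, 0 <= (t - intmx g) 0 l] = leqv g (natv t).
Proof.
by move=> ht; apply: eq_forallb => l; rewrite !mxE; move: (ht l); move: (t 0 l) (g 0 l); clear; lia.
Qed.

Lemma natv_subE (t : 'rV[int]_n) (g : 'rV[nat]_n) : (forall l, 0 <= t 0 l) -> leqv g (natv t) ->
  natv (t - intmx g) = subv (natv t) g.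
Proof.
move=> ht /forallP h; apply/rowP => l; have := h l; rewrite !mxE.
by move: (ht l); move: (t 0 l) (g 0 l); clear; lia.
Qed.

Lemma XvB y j : Xv (y - Ei j) = Xv y - intmx (row j A).
Proof.
apply/rowP => i; rewrite XvE (XeB x0_u0 u0_zp s0_zp) [RHS]mxE -XvE; congr (_ + _); by rewrite !mxE.
Qed.

Lemma LeB k i : Le (k - Ei i) = Le k - intmx (row i A^T).
Proof.
apply/rowP => j; rewrite !mxE -addrA; congr (_ + _); rewrite [RHS]addrC.
rewrite (bigD1 i) //= [in RHS](bigD1 i) //= !mxE !eqxx /= addrA; congr (_ + _); first ring.
by apply: eq_bigr => l li; rewrite !mxE eqxx (negbTE li) subr0.
Qed.

Lemma raw_subx f y k j E : admissible y k ->
  raw f (y - Ei j) k E = if leqv (row j A) (natv (Xv y))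
    then f (subv (natv (Xv y)) (row j A), natv (Le k), E) else 0.
Proof.
move=> /admP[hX hk]; have hX' i : 0 <= Xv y 0 i by rewrite XvE.
rewrite -(natvB _ hX') /raw; case: ifP => [/admP[h1 _]|/negP h1].
  have h2 : [forall l, 0 <= (Xv y - intmx (row j A)) 0 l].
    by apply/forallP => l; rewrite -XvB XvE.
  by rewrite h2 /pt XvB natv_subE // -natvB.
case: ifP => // /forallP h2; case: h1; apply/admP; split=> // i.
by rewrite -XvE XvB.
Qed.

(** Subtracting a row of A^T may leave natural numbers although k_i becomes negative. Then s_i + k_i
    < 0, and the support condition on [f] makes the coefficient zero. *)
Lemma raw_suby f y k i E : (forall m, f m != 0 -> forall i, 0 <= lamt A m.1.2 0 i) ->
  admissible y k ->
  raw f y (k - Ei i) E = if leqv (row i A^T) (natv (Le k))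
    then f (natv (Xv y), subv (natv (Le k)) (row i A^T), E) else 0.
Proof.
move=> hf /admP[hX hk]; have hL := Le_ge0 hk.
rewrite /raw; case: ifP => [/admP[_ h1]|/negP h1].
  have hL1 := Le_ge0 h1; rewrite -(natvB _ hL).
  have h2 : [forall l, 0 <= (Le k - intmx (row i A^T)) 0 l].
    by apply/forallP => l; rewrite -LeB.
  by rewrite h2 /pt LeB natv_subE // -natvB.
case: ifP => // hl; symmetry; apply/eqP/negPn/negP => /hf h; case: h1; apply/admP; split=> // j.
have [->|ji] := eqVneq j i; last by rewrite !mxE eqxx (negbTE ji) subr0.
have := h i; rewrite /= /lamt -natv_subE // natvK; last first.
  by move=> l; have := natvB (row i A^T) hL; rewrite hl => /forallP.
rewrite -LeB mulAmT_Le; have /andP[_] := s_range i; rewrite -/s0; set z := (k - Ei i) 0 i => s1 h0.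
rewrite leNgt; apply/negP => z0; have z1 : z%:~R <= -1 :> rat.
  by rewrite -[-1]/((-1)%:~R) ler_int; move: z0; clear; lia.
by have := lt_le_trans (ltr_leD s1 z1) (lexx _); rewrite subrr ltNge h0.
Qed.

Lemma dA_coef f y k (E : {set 'I_n}) : admissible y k ->
  dA pi A f (pt y k E) = dx A u0 (raw f) y k E.
Proof.
move=> ha; have /admP[hX hk] := ha; set g := natv (Xv y).
pose T := ('I_n + 'I_n * 'I_n)%type.
pose a (t : T) (m : mono n) : K := match t with
  | inl i => (m.1.1 0 i)%:R * theta_sign K [set i]%SET m.2
  | inr ij => pi * (A ij.2 ij.1)%:R * theta_sign K [set ij.1]%SET m.2 end.
pose tau (t : T) (m : mono n) : mono n := match t with
  | inl i => (m.1.1, m.1.2, i |: m.2)%SET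
  | inr ij => (m.1.1 + row ij.2 A, m.1.2, ij.1 |: m.2)%SET end.
pose src (t : T) : option (mono n) := match t with
  | inl i => if i \in E then Some (g, natv (Le k), E :\ i)%SET else None
  | inr ij => if (ij.1 \in E) && leqv (row ij.2 A) g
      then Some (subv g (row ij.2 A), natv (Le k), E :\ ij.1)%SET else None end.
have sgn i (E0 : {set 'I_n}) : theta_sign K [set i]%SET E0 != 0 -> i \notin E0.
  by rewrite theta_sign1; case: ifP => //; rewrite eqxx.
rewrite /dA (@lin_ext_terms T _ a tau src).
- rewrite big_sumType -(pair_bigA _ (fun i j => if src (inr (i, j)) is Some m then f m * a (inr (i, j)) m else 0)) /=.
  rewrite -big_split /dx fct_sumE; apply: eq_bigr => i _ /=.
  rewrite /Th; case: ifP => iE /=; last by rewrite big1 // addr0.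
  rewrite (nabE x0_u0 u0_zp s0_zp) exD !exZ fct_sumE raw_pt // mulrDr; congr (_ + _).
    rewrite theta_sign1 !inE eqxx /= eps_rem // ltnn mul1r -XvE.
    have -> : (g 0 i)%:R = (Xv y 0 i)%:~R :> K.
      by rewrite /g mxE -[in RHS](gez0_abs (_ : 0 <= Xv y 0 i)) // XvE.
    by rewrite /pt -/g; ring.
  rewrite !mulr_sumr; apply: eq_bigr => j _; rewrite exZ raw_subx // -/g.
  case: ifP => _; last by rewrite !mulr0.
  rewrite theta_sign1 !inE eqxx /= eps_rem // ltnn mul1r; ring.
- move=> [[g0 l1] E0]; rewrite serD serZ !fct_sumE big_sumType; congr (_ + _).
    by apply: eq_bigr => i _; rewrite serZ /mon_theta serZ /mon /= mulrA.
  rewrite -(pair_bigA _ (fun i j => a (inr (i, j)) (g0, l1, E0) * (pt y k E == tau (inr (i, j)) (g0, l1, E0))%:R)).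
  rewrite mulr_sumr; apply: eq_bigr => i _; rewrite fct_sumE mulr_sumr; apply: eq_bigr => j _.
  by rewrite serZ /mon_theta serZ /mon /= !mulrA.
- move=> [i|[i j]] [[g0 l2] E0] /= h0 [e1 e2 eE]; rewrite /g e1 e2.
    have iE0 : i \notin E0 by apply: sgn; apply: contraNneq h0 => ->; rewrite mulr0.
    by rewrite eE finset.setU11 finset.setU1K.
  have iE0 : i \notin E0 by apply: sgn; apply: contraNneq h0 => ->; rewrite mulr0.
  by rewrite eE finset.setU11 leqv_add /= finset.setU1K // addvK.
move=> [i|[i j]] m /=.
  by case: ifP => // iE [<-]; rewrite /= finset.setD1K.
case: ifP => // /andP[iE /forallP hl] [<-] /=; rewrite finset.setD1K // subvK // => l.
Qed.

Lemma dAv_coef f y k (E : {set 'I_n}) : (forall m, f m != 0 -> forall i, 0 <= lamt A m.1.2 0 i) ->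
  admissible y k ->
  dAv pi A f (pt y k E) = pi^-1 * dy s0 (raw f) y k E.
Proof.
move=> hf ha; have /admP[hX hk] := ha; set g := natv (Xv y); set l1 := natv (Le k).
pose T := ('I_n + 'I_n)%type.
pose sg i (E0 : {set 'I_n}) : K := if i \in E0 then theta_sign K [set i]%SET (E0 :\ i)%SET else 0.
pose a (t : T) (m : mono n) : K := match t with
  | inl i => pi^-1 * ratr (lamt A m.1.2 0 i) * sg i m.2
  | inr i => sg i m.2 end.
pose tau (t : T) (m : mono n) : mono n := match t with
  | inl i => (m.1.1, m.1.2, m.2 :\ i)%SET
  | inr i => (m.1.1, m.1.2 + row i A^T, m.2 :\ i)%SET end.
pose src (t : T) : option (mono n) := match t with
  | inl i => if i \notin E then Some (g, l1, i |: E)%SET else None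
  | inr i => if (i \notin E) && leqv (row i A^T) l1
      then Some (g, subv l1 (row i A^T), i |: E)%SET else None end.
have sgn i E0 : sg i E0 != 0 -> i \in E0 by rewrite /sg; case: ifP => //; rewrite eqxx.
have sgE i : i \notin E -> sg i (i |: E)%SET = eps i E.
  by move=> iE; rewrite /sg finset.setU11 finset.setU1K // theta_sign1 (negbTE iE).
rewrite /dAv (@lin_ext_terms T _ a tau src).
- rewrite big_sumType /= -big_split /dy fct_sumE mulr_sumr; apply: eq_bigr => i _ /=.
  rewrite /Dt; case: (boolP (i \in E)) => iE /=; first by rewrite addr0 mulr0.
  rewrite delE exD !exZ raw_pt // raw_suby // -/g -/l1 /pt -/g -/l1 sgE ?iE //.
  have -> : ratr (lamt A l1 0 i) = Sc s0 k i by rewrite /l1 lamt_Le // ratrKD ratr_int.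
  have hp := pi_neq0; case: ifP => _; last by rewrite mulr0 !addr0; ring.
  by rewrite /= sgE //; field.
- move=> [[g0 l2] E0]; rewrite serD !fct_sumE big_sumType; congr (_ + _); apply: eq_bigr => i _ /=.
    rewrite serZ /mon_dtheta /sg; case: ifP => _; last by rewrite !mulr0 mul0r.
    by rewrite serZ /mon /= mulrA.
  rewrite /mon_dtheta /sg; case: ifP => _; last by rewrite mul0r.
  by rewrite serZ /mon /=.
- move=> [i|i] [[g0 l2] E0] /= h0 [e1 e2 eE]; rewrite /g /l1 e1 e2.
    have iE0 : i \in E0 by apply: sgn; apply: contraNneq h0 => ->; rewrite mulr0.
    by rewrite eE !inE eqxx /= finset.setD1K.
  have iE0 := sgn _ _ h0.
  by rewrite eE !inE eqxx /= leqv_add /= finset.setD1K // addvK.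
move=> [i|i] m /=.
  by case: ifP => // iE [<-]; rewrite /= finset.setU1K.
by case: ifP => // /andP[iE /forallP hl] [<-] /=; rewrite finset.setU1K // subvK.
Qed.

Lemma dtot_coef f y k (E : {set 'I_n}) : (forall m, f m != 0 -> forall i, 0 <= lamt A m.1.2 0 i) ->
  admissible y k ->
  dtot pi A f (pt y k E) = dfull A u0 s0 (raw f) y k E.
Proof. by move=> hf ha; rewrite /dtot serD dA_coef // dAv_coef. Qed.

Lemma md_dtot f : (forall m, f m != 0 -> forall i, 0 <= lamt A m.1.2 0 i) ->
  md (dtot pi A f) = Dg A u0 s0 x0 (md f).
Proof.
move=> hf; apply/funext => y; apply/funext => k; rewrite {1}/md /Dg; case: ifP => // hg.
have ha := good_adm hg; apply/funext => E; rewrite raw_pt // dtot_coef //.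
have e0 : md f y k = raw f y k by rewrite /md hg.
have e1 j : md f (y - Ei j) k = raw f (y - Ei j) k.
  rewrite /md; case: ifP => // /negP h.
  have [h3|] := pselect (forall i, 0 <= Xe A x0 (y - Ei j) i).
    by case: h; exact: (good_lowX x0_u0 u0_zp s0_zp hg).
  by move=> /existsNP[i /negP]; rewrite -ltNge => /raw_low ->.
have e2 i : md f y (k - Ei i) = raw f y (k - Ei i).
  rewrite /md; case: ifP => // /negP h.
  have [h3|h3] := leP 0 ((k - Ei i) 0 i); first by case: h; exact: (good_lowk x0_u0 u0_zp s0_zp hg).
  by rewrite (raw_klow _ _ h3).
rewrite !dfullE; congr ((_ + _ *: _) E); apply: eq_bigr => i _.
  by congr (Th i _); rewrite /nab; apply: eq_bigr => j _; rewrite !NopE e0 e1.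
by congr (Dt i _); rewrite !delE e0 e2.
Qed.

(** * Monomials of a piece as lattice points *)

Lemma Xv_inj y y' : Xv y = Xv y' -> y = y'.
Proof.
move=> /addrI e; have /(congr1 (fun M => M *m invA A)) : ratmx (y *m intmx A) = ratmx (y' *m intmx A) by rewrite e.
rewrite !ratmxM !mulmxK // => /rowP e1; apply/rowP => j; have /eqP := e1 j.
by rewrite !mxE eqr_int => /eqP.
Qed.

Lemma Le_inj k k' : Le k = Le k' -> k = k'.
Proof.
move=> e; apply/rowP => i; have := mulAmT_Le k i; rewrite e mulAmT_Le => /addrI /eqP.
by rewrite eqr_int => /eqP.
Qed.

Lemma pt_inj y k y' k' E E' : admissible y k -> admissible y' k' ->
  pt y k E = pt y' k' E' -> [/\ y = y', k = k' & E = E'].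
Proof.
move=> /admP[hX hk] /admP[hX' hk'] [/(congr1 (@intmx 1 n)) e1 /(congr1 (@intmx 1 n)) e2 ->]; split=> //.
  by move: e1; rewrite !natvK; [exact: Xv_inj|move=> i; rewrite XvE|move=> i; rewrite XvE].
by move: e2; rewrite !natvK; [exact: Le_inj|exact: Le_ge0|exact: Le_ge0].
Qed.

(** The entries of [k] are nonnegative because s_i + k_i >= 0 while s_i < 1. *)
Lemma pt_coord m : cls A (intmx m.1.1) = cls A x0 -> cls A^T (intmx m.1.2) = cls A^T l0 ->
  (forall i, 0 <= lamt A m.1.2 0 i) -> exists y k, admissible y k /\ m = pt y k m.2.
Proof.
case: m => [[g l] E] /= /cls_eqP[y ey] /cls_eqP[k ek] hl; exists y, k; split; last first.
  by rewrite /pt /Xv /Le -ey -ek !intmxK.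
apply/admP; split=> i; first by rewrite -XvE /Xv -ey mxE.
have := hl i; rewrite /lamt ek -/(Le k) mulAmT_Le => h; have /andP[_ s1] := s_range i.
rewrite leNgt; apply/negP => k0; have k1 : (k 0 i)%:~R <= -1 :> rat.
  by rewrite -[-1]/((-1)%:~R) ler_int; move: (k 0 i) k0 => z; clear; lia.
by have := ltr_leD s1 k1; rewrite subrr ltNge h.
Qed.

Lemma pt_cls y k E : admissible y k ->
  [/\ cls A (intmx (pt y k E).1.1) = cls A x0, cls A^T (intmx (pt y k E).1.2) = cls A^T l0 &
      forall i, 0 <= lamt A (pt y k E).1.2 0 i].
Proof.
move=> /admP[hX hk]; split=> /=.
- by rewrite natvK => [|i]; [apply/cls_eqP; exists y|rewrite XvE].
- by rewrite natvK; [apply/cls_eqP; exists k|exact: Le_ge0].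
by move=> i; rewrite lamt_Le // addr_ge0 ?ler0z //; have /andP[] := s_range i.
Qed.

Definition deg_slope : nat := (\sum_j \sum_i A j i).+1.

Lemma deg_sz y k E : admissible y k ->
  (total_degree (pt y k E) <= deg_slope * sz A x0 y k + deg_slope * n + n)%N.
Proof.
move=> /admP[hX hk]; rewrite /total_degree.
have hE : (#|E| <= n)%N by rewrite -[X in (_ <= X)%N]card_ord; exact: max_card.
apply: leq_add => //; rewrite /sz big_split /=.
have -> : vsum (natv (Xv y)) = (\sum_i `|Xe A x0 y i|)%N.
  by apply: eq_bigr => i _; rewrite mxE XvE.
suff h : (vsum (natv (Le k)) <= (deg_slope.-1) * (\sum_i `|k 0%R i| + n))%N.
  apply: leq_trans (leq_add (leqnn _) h) _; rewrite /deg_slope /=.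
  by move: (\sum_j \sum_i A j i)%N (\sum_i `|Xe A x0 y i|)%N (\sum_i `|k 0%R i|)%N => a b c; clear; nia.
rewrite /vsum /deg_slope /= big_distrl /=; apply: leq_sum => j _.
rewrite mxE big_distrl /= -(ler_nat rat).
have -> : (`|Le k 0%R j|%N%:R : rat) = (Le k 0 j)%:~R by rewrite -[in RHS](gez0_abs (Le_ge0 hk j)).
rewrite Le_entry natr_sum; apply: ler_sum => i _; rewrite natrM mulrC ler_wpM2l //.
have n1 : (1 <= n)%N by case: (n) i => // -[].
have /andP[_ s1] := s_range i; rewrite natrD addrC; apply: lerD.
  rewrite (bigD1 i) //= natrD -[(k 0 i)%:~R]addr0 lerD //.
  by rewrite -[in X in X <= _](gez0_abs (hk i)).
by apply: le_trans (ltW s1) _; rewrite ler1n.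
Qed.

(* [h] represents an element of the piece, up to the growth condition. *)
Definition class_supp h : Prop := forall m, h m != 0 ->
  [/\ cls A (intmx m.1.1) = cls A x0, cls A^T (intmx m.1.2) = cls A^T l0 &
      forall i, 0 <= lamt A m.1.2 0 i].

Lemma piece_of_decay h : class_supp h ->
  (exists C r : R, [/\ 0 <= C, 0 < r, r < 1 &
    forall y k E, admissible y k -> v (h (pt y k E)) <= C * r ^+ sz A x0 y k]) ->
  in_piece v (cls A x0) (cls A^T l0) h.
Proof.
move=> hs [C [r [C0 r0 r1 hd]]]; split; last by move=> m /hs[].
split; first by move=> m /hs[].
have [r' [r'0 r'1 hr]] := root_lt1 deg_slope (ltW r0) r1.
set B := (deg_slope * n + n)%N.
have rB : 0 < r' ^+ B by rewrite exprn_gt0.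
exists ((C + 1) / r' ^+ B), r'; split; [|exact: ltW|by []|].
  by rewrite divr_gt0 // ltr_wpDl.
move=> m; have [->|/hs[h1 h2 h3]] := eqVneq (h m) 0.
  by rewrite v0 mulr_ge0 ?exprn_ge0 ?(ltW r'0) // divr_ge0 ?(ltW rB) // addr_ge0.
have [y [k [ha ->]]] := pt_coord h1 h2 h3; apply: le_trans (hd _ _ _ ha) _.
rewrite mulrAC ler_pdivlMr // -mulrA; apply: ler_pM => //.
- by rewrite mulr_ge0 ?exprn_ge0 // ltW.
- by rewrite lerDl.
apply: le_trans (_ : r' ^+ (deg_slope * sz A x0 y k) * r' ^+ B <= _).
  by rewrite exprM ler_wpM2r ?(ltW rB) // lerXn2r ?nnegrE ?(ltW r0) // exprn_ge0 // ltW.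
rewrite -exprD ler_wiXn2l ?(ltW r'0) ?(ltW r'1) //.
by rewrite /B addnA; exact: deg_sz.
Qed.

Lemma piece_supp h : in_piece v (cls A x0) (cls A^T l0) h -> class_supp h.
Proof. by move=> [[h1 _] h2] m h0; have [] := h2 _ h0; split=> // i; exact: h1. Qed.

(** The series with the coefficients of [g] at the monomials of the piece and 0 elsewhere; [xget]
    recovers the lattice coordinates, which are unique by [pt_inj]. *)
Definition re (g : chain) : series K n := fun m =>
  let S := [set yk : 'rV[int]_n * 'rV[int]_n | admissible yk.1 yk.2 /\ m = pt yk.1 yk.2 m.2] in
  if `[< S !=set0 >] then g (xget (0, 0) S).1 (xget (0, 0) S).2 m.2 else 0.

Lemma re_pt g y k E : admissible y k -> re g (pt y k E) = g y k E.
Proof.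
move=> ha; rewrite /re asboolT; last by exists (y, k).
case: xgetP => [[y' k'] _ /= [ha' e]|/(_ (y, k)) h]; last by case: h.
by have [-> ->] := pt_inj ha ha' e.
Qed.

Lemma re_supp g : class_supp (re g).
Proof.
move=> m; rewrite /re; case: asboolP => [[[y k] /= [ha ->]] _|]; last by rewrite eqxx.
exact: pt_cls.
Qed.

Lemma re_spec g : inX A s0 x0 g -> in_piece v (cls A x0) (cls A^T l0) (re g) /\ md (re g) = g.
Proof.
move=> [[C [r [C0 r0 r1 hd]]] hv]; split.
  apply: piece_of_decay; first exact: re_supp.
  by exists C, r; split=> // y k E ha; rewrite re_pt.
apply/funext => y; apply/funext => k; rewrite /md; case: ifP => [hg|/negbT hg].
  by apply/funext => E; have ha := good_adm hg; rewrite raw_pt // re_pt.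
by rewrite hv.
Qed.

Lemma lin_ext_neq0 (D : mono n -> series K n) f m' : lin_ext D f m' != 0 ->
  exists m, f m != 0 /\ D m m' != 0.
Proof using Type.
move=> h; apply: contrapT => /forallNP h1; move: h; rewrite /lin_ext fsbig1 ?eqxx // => m _.
apply/eqP/negPn/negP; rewrite mulf_eq0 negb_or => /andP[h2 h3]; by case: (h1 m).
Qed.

Lemma sum_neq0 (T : finType) (F : T -> K) : \sum_t F t != 0 -> exists t, F t != 0.
Proof using Type.
move=> h; apply: contrapT => /forallNP h1; move: h; rewrite big1 ?eqxx // => t _.
by apply/eqP/negPn/negP => /h1.
Qed.

Lemma mon_neq0 (m m' : mono n) : (mon K m : series K n) m' != 0 -> m' = m.
Proof using Type. by rewrite /mon; have [//|_] := eqVneq m' m; rewrite eqxx. Qed.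

Lemma addr_neq0 (a b : K) : a + b != 0 -> a != 0 \/ b != 0.
Proof using Type. by have [->|] := eqVneq a 0; [rewrite add0r; right|left]. Qed.

Lemma cls_row (M : 'M[nat]_n) (g : 'rV[nat]_n) j : cls M (intmx (g + row j M)) = cls M (intmx g).
Proof using Type.
apply/cls_eqP; exists (Ei j); apply/rowP => i; rewrite !mxE PoszD; congr (_ + _).
rewrite (bigD1 j) //= !mxE !eqxx mul1r big1 ?addr0 // => l lj.
by rewrite !mxE (negbTE lj) mul0r.
Qed.

Lemma lamt_row (l : 'rV[nat]_n) i j : lamt A (l + row i A^T) 0 j = lamt A l 0 j + (j == i)%:R.
Proof.
rewrite /lamt /mulAmT.
have -> : intmx (l + row i A^T) = intmx l + Ei i *m intmx A^T.
  apply/rowP => t; rewrite !mxE PoszD; congr (_ + _).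
  rewrite (bigD1 i) //= !mxE !eqxx mul1r big1 ?addr0 // => a ai.
  by rewrite !mxE (negbTE ai) mul0r.
rewrite ratmxD mulmxDl mxE; congr (_ + _); rewrite ratmxM -mulmxA.
have -> : ratmx (intmx A^T) *m (invA A)^T = 1%:M.
  have -> : ratmx (intmx A^T) = (ratmx (intmx A))^T by apply/matrixP => a b; rewrite !mxE.
  by rewrite -trmx_mul mulVmx // trmx1.
by rewrite mulmx1 !mxE eqxx; case: (j == i).
Qed.

Lemma dtot_supp f : class_supp f -> class_supp (dtot pi A f).
Proof.
move=> hf m'; rewrite /dtot serD => /addr_neq0[] /lin_ext_neq0[[[g l] E]] [/hf /= [h1 h2 h3]].
  rewrite serD serZ !fct_sumE => /addr_neq0[/sum_neq0[i]|].
    by rewrite serZ /mon_theta serZ !mulf_eq0 !negb_or => /andP[_ /andP[_ /mon_neq0 ->]].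
  rewrite mulf_eq0 negb_or => /andP[_ /sum_neq0[i]]; rewrite fct_sumE => /sum_neq0[j].
  rewrite serZ /mon_theta serZ !mulf_eq0 !negb_or => /andP[_ /andP[_ /mon_neq0 ->]] /=.
  by rewrite cls_row.
rewrite serD !fct_sumE => /addr_neq0[] /sum_neq0[i]; rewrite ?serZ /mon_dtheta; case: ifP => _.
- by rewrite serZ !mulf_eq0 !negb_or => /andP[_ /andP[_ /mon_neq0 ->]].
- by rewrite mulr0 eqxx.
- rewrite serZ !mulf_eq0 !negb_or => /andP[_ /mon_neq0 ->] /=; rewrite cls_row; split=> // j.
  by rewrite lamt_row addr_ge0.
by rewrite eqxx.
Qed.

Lemma dtot_piece f : in_piece v (cls A x0) (cls A^T l0) f ->
  in_piece v (cls A x0) (cls A^T l0) (dtot pi A f).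
Proof.
move=> hf; apply: piece_of_decay; first by apply: dtot_supp; exact: piece_supp.
have [C [r [C0 r0 r1 h]]] := decays_dfull x0_u0 u0_zp s0_zp (raw_decays (proj1 hf)).
exists C, r; split=> // y k E ha; rewrite dtot_coef //; exact: (proj1 (proj1 hf)).
Qed.

(** * The ideal generated by monomials of positive pairing *)

Lemma pairingE (g l : 'rV[int]_n) : pairing A g l = \sum_i (g 0 i)%:~R * mulAmT A l 0 i.
Proof using Type.
rewrite /pairing -mulmxA mxE; apply: eq_bigr => i _; rewrite mxE; congr (_ * _).
by rewrite !mxE; apply: eq_bigr => j _; rewrite !mxE mulrC.
Qed.

Lemma lamtD (a b : 'rV[nat]_n) i : lamt A (a + b) 0 i = lamt A a 0 i + lamt A b 0 i.
Proof using Type.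
rewrite /lamt /mulAmT.
have -> : intmx (a + b) = intmx a + intmx b by apply/rowP => j; rewrite !mxE PoszD.
have -> : ratmx (intmx a + intmx b) = ratmx (intmx a) + ratmx (intmx b) by exact: map_mxD.
by rewrite mulmxDl mxE.
Qed.

Lemma intmxE (g : 'rV[nat]_n) i : intmx g 0 i = (g 0 i)%:Z.
Proof using Type. by rewrite mxE. Qed.

Lemma mono_mul_coef (g l : 'rV[nat]_n) f m' :
  lin_ext (mono_mul K (g, l, finset.set0)) f m' = if leqv g m'.1.1 && leqv l m'.1.2
    then f (subv m'.1.1 g, subv m'.1.2 l, m'.2) else 0.
Proof.
have ts (E : {set 'I_n}) : theta_sign K finset.set0 E = 1.
  rewrite /theta_sign finset.set0I eqxx (_ : [set _ | _]%SET = finset.set0) ?cards0 //.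
  by apply/setP => ij; rewrite !inE.
rewrite (@lin_ext_terms unit _ (fun _ _ => 1) (fun _ m => (g + m.1.1, l + m.1.2, m.2))
  (fun _ => if leqv g m'.1.1 && leqv l m'.1.2 then Some (subv m'.1.1 g, subv m'.1.2 l, m'.2) else None)).
- rewrite (big_pred1 tt) => [|[] //]; case: ifP => // _; by rewrite mulr1.
- move=> m; rewrite (big_pred1 tt) => [|[] //]; rewrite mul1r /mono_mul serZ ts mul1r /mon.
  by rewrite finset.set0U.
- move=> _ [[a b] E] /= _ -> /=; rewrite ![g + _]addrC ![l + _]addrC !leqv_add /=.
  by rewrite !addvK.
move=> _ [[a b] E] /=; case: ifP => // /andP[/forallP h1 /forallP h2] [<- <- <-].
rewrite ![_ + subv _ _]addrC !subvK //; by case: (m') => -[].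
Qed.

Lemma pairing_good y k : good A s0 x0 y k -> forall E,
  pairing A (intmx (pt y k E).1.1) (intmx (pt y k E).1.2) = 0.
Proof.
move=> hg E; have /admP[hX hk] := good_adm hg; rewrite pairingE big1 // => i _.
rewrite -/(lamt A (pt y k E).1.2) lamt_Le // /pt /= natvK => [|l]; last by rewrite XvE.
have [_ _ [e|[e1 e2]]] := goodP x0_u0 u0_zp s0_zp _ _ hg i; first by rewrite XvE e mul0r.
by rewrite e1 e2 addr0 mulr0.
Qed.

(** All entries of gamma and of lambda A^-T are nonnegative, so every multiple of a monomial of
    positive pairing has positive pairing, whereas good points have pairing zero. *)
Lemma md_ideal h : in_ideal v A h -> md h = 0.
Proof.
move=> [d [mm [g [h1 h2 h3 ->]]]]; rewrite linear_sum big1 // => t _; rewrite -[LHS]/(md _).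
apply/funext => y; apply/funext => k; rewrite /md; case: ifP => // hg; apply/funext => E.
have ha := good_adm hg; rewrite raw_pt //; apply/eqP/negPn/negP => /lin_ext_neq0[m0 [g0]].
rewrite /mono_mul serZ mulf_eq0 negb_or => /andP[_ /mon_neq0 e].
have := h2 t; have := pairing_good hg E; rewrite e !pairingE /=.
move=> e0; apply/negP; rewrite -leNgt -[X in _ <= X]e0; apply: ler_sum => i _.
rewrite -/(lamt A (mm t).1.2) -/(lamt A (_ + _)) lamtD !intmxE; apply: ler_pM.
- by rewrite ler0z.
- exact: h1.
- by rewrite ler_int lez_nat [X in (_ <= X)%N]mxE leq_addr.
by rewrite lerDl; exact: (proj1 (h3 t)).
Qed.

(* A monomial of positive pairing has some [i] with [x_i] in its support and
   [s_i > 0]; it is then divisible by [gen i]. *)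
Definition gen i : mono n :=
  (\row_l (l == i : nat), if s0 0 i == 0 then row i A^T else natv l0, finset.set0).

Lemma lamt0 i : lamt A 0 0 i = 0.
Proof using Type.
by have /eqP := lamtD 0 0 i; rewrite addr0 -subr_eq0 opprD addNKr oppr_eq0 => /eqP.
Qed.

Lemma lamt_gen i j : lamt A (gen i).1.2 0 j = if s0 0 i == 0 then (j == i)%:R else s0 0 j.
Proof.
rewrite /gen /=; case: ifP => _.
  by have := lamt_row 0 i j; rewrite add0r lamt0 add0r.
have e : Le 0 = l0 by rewrite /Le mul0mx addr0.
have h0 (l : 'I_n) : 0 <= (0 : 'rV[int]_n) 0 l by rewrite mxE.
by have := lamt_Le h0 j; rewrite e => ->; rewrite [X in _ + X%:~R]mxE addr0.
Qed.

Definition idx m := [pick i | (0 < m.1.1 0%R i)%N && (0 < lamt A m.1.2 0 i)].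

Lemma genE i l : (gen i).1.1 0 l = (l == i). Proof. by rewrite mxE. Qed.

Lemma idx_pt y k E i : admissible y k -> idx (pt y k E) = Some i ->
  0 < Xv y 0 i /\ 0 < s0 0 i + (k 0 i)%:~R.
Proof.
move=> /admP[hX hk]; rewrite /idx; case: pickP => // l /andP[h1 h2] [<-].
by rewrite -lamt_Le //; split=> //; move: h1; rewrite mxE absz_gt0 lt_def XvE hX andbT.
Qed.

Lemma gen_dvd y k E i : admissible y k -> idx (pt y k E) = Some i ->
  leqv (gen i).1.1 (pt y k E).1.1 && leqv (gen i).1.2 (pt y k E).1.2.
Proof.
move=> ha hi; have [X0 S0] := idx_pt ha hi; have /admP[hX hk] := ha.
apply/andP; split.
  apply/forallP => l; rewrite genE; case: eqP => [->|//].
  by rewrite mxE absz_gt0 gt_eqF.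
have hL := Le_ge0 hk; rewrite /pt /= /gen /= -natvB //; case: eqP => [s1|_].
  rewrite -LeB; apply/forallP; apply: Le_ge0 => l; rewrite !mxE eqxx /=.
  have [->|_] := eqVneq l i; last by rewrite subr0.
  by move: S0; rewrite s1 add0r ltr0z; move: (k 0 i) => z; clear; lia.
have l0_ge0 l : 0 <= l0 0 l.
  have := @Le_ge0 0 (fun i => _) l; rewrite /Le mul0mx addr0; apply=> j.
  by rewrite mxE.
apply/forallP => l; rewrite natvK // /Le addrAC subrr add0r mxE.
by apply: sumr_ge0 => j _; rewrite !mxE mulr_ge0.
Qed.

Lemma lamt_sub_gen y k E i : admissible y k -> idx (pt y k E) = Some i ->
  forall j, 0 <= lamt A (subv (pt y k E).1.2 (gen i).1.2) 0 j.
Proof.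
move=> ha hi j; have [_ S0] := idx_pt ha hi; have /admP[hX hk] := ha.
have /andP[_ /forallP hd] := gen_dvd ha hi.
have := lamtD (subv (pt y k E).1.2 (gen i).1.2) (gen i).1.2 j; rewrite subvK // lamt_gen.
rewrite [lamt _ _ _ _]lamt_Le // => e.
suff : (if s0 0 i == 0 then (j == i)%:R else s0 0 j) <= s0 0 j + (k 0 j)%:~R by rewrite e lerDr.
have /andP[sj _] : 0 <= s0 0 j < 1 := s_range j.
case: eqP => [s1|_]; last by rewrite lerDl ler0z.
have [->|_] := eqVneq j i; last by rewrite addr_ge0 // ler0z.
by move: S0; rewrite s1 !add0r ltr0z -[X in X <= _]/(1%:~R) ler_int; move: (k 0 i) => z; clear; lia.
Qed.

(** Split [h] according to [idx]. The part of index [i] is divisible by [gen i], and the quotient is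
    a shift of [h], which satisfies the same growth bound; so [n] generators suffice for all of
    [h]. *)
Lemma ideal_of_md h : in_piece v (cls A x0) (cls A^T l0) h -> md h = 0 -> in_ideal v A h.
Proof.
move=> hp h0; have hs := piece_supp hp.
pose up i m : mono n := (m.1.1 + (gen i).1.1, m.1.2 + (gen i).1.2, m.2).
pose g i : series K n := fun m => if idx (up i m) == Some i then h (up i m) else 0.
have gs i m : g i m != 0 -> exists y k, [/\ admissible y k, up i m = pt y k m.2,
    idx (pt y k m.2) = Some i & h (pt y k m.2) != 0].
  rewrite /g; have [e1 e2|_] := eqVneq (idx (up i m)) (Some i); last by rewrite eqxx.
  have [a1 a2 a3] := hs _ e2; have [y [k [ha e]]] := pt_coord a1 a2 a3.
  have e' : up i m = pt y k m.2 by rewrite e.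
  by exists y, k; rewrite -e'.
exists n, gen, g; split.
- by move=> i j; rewrite lamt_gen; case: ifP => // _; have /andP[] := s_range j.
- move=> i; rewrite pairingE (bigD1 i) //= big1 ?addr0 => [|l li].
    rewrite intmxE genE eqxx mul1r -/(lamt A (gen i).1.2) lamt_gen; have [_|s1] := eqVneq (s0 0 i) 0.
      by rewrite eqxx.
    by rewrite lt_def s1; have /andP[] := s_range i.
  by rewrite intmxE genE (negbTE li) mul0r.
- move=> i; split.
    move=> m /gs[y [k [ha e hi _]]] j; have := lamt_sub_gen ha hi j.
    by rewrite -e /up /= addvK.
  have [_ [C [r [C0 r0 r1 hd]]]] := proj1 hp; exists C, r; split=> // m.
  rewrite /g; case: ifP => _; last by rewrite v0 mulr_ge0 ?exprn_ge0 // ltW.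
  apply: le_trans (hd _) _; rewrite ler_wpM2l ?(ltW C0) // ler_wiXn2l ?(ltW r1) //.
  rewrite /total_degree leq_add2r; apply: leq_add; apply: leq_sum => l _; rewrite [X in (_ <= X)%N]mxE; exact: leq_addr.
apply/funext => m; rewrite fct_sumE.
have e i : lin_ext (mono_mul K (gen i)) (g i) m = if idx m == Some i then h m else 0.
  have -> : gen i = ((gen i).1.1, (gen i).1.2, finset.set0) by [].
  rewrite mono_mul_coef; case: ifP => [/andP[/forallP d1 /forallP d2]|hd].
    by rewrite /g /up /= !subvK //; case: (m) => -[].
  case: eqP => // hi; symmetry; apply/eqP/negPn/negP => hm.
  have [a1 a2 a3] := hs _ hm; have [y [k [ha em]]] := pt_coord a1 a2 a3.
  by rewrite em in hi hd; rewrite gen_dvd in hd.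
rewrite (eq_bigr _ (fun i _ => e i)); case hi : (idx m) => [i|].
  by rewrite (bigD1 i) //= eqxx big1 ?addr0 // => j ji; case: eqP => // -[/eqP]; rewrite eq_sym (negbTE ji).
rewrite big1 //; apply/eqP/negPn/negP => hm.
have [a1 a2 a3] := hs _ hm; have [y [k [ha em]]] := pt_coord a1 a2 a3.
have /admP[hX hk] := ha.
have hg : good A s0 x0 y k.
  apply/(goodP x0_u0 u0_zp s0_zp) => i; split=> //.
  move: hi; rewrite /idx; case: pickP => // /(_ i); rewrite em /pt /= lamt_Le // mxE absz_gt0 XvE => hi _.
  have [|X0] := eqVneq (Xe A x0 y i) 0; [by left|right].
  move: hi; rewrite X0 /= => /negbT; rewrite -leNgt => h1.
  have /andP[s1 _] : 0 <= s0 0 i < 1 := s_range i.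
  have k1 : 0 <= (k 0 i)%:~R :> rat by rewrite ler0z.
  have s2 : s0 0 i = 0 by apply/eqP; rewrite eq_le s1 andbT; apply: le_trans h1; rewrite lerDl.
  split=> //; move: h1; rewrite s2 add0r lerz0 => h1; apply/eqP; by rewrite eq_le h1 hk.
have := congr1 (fun f : chain => f y k m.2) h0; rewrite /md hg raw_pt // -em => /eqP.
by apply/negP.
Qed.

(** * Frobenius on series and on chains *)

Variables (cF : 'rV[int]_n -> K) (wt : 'I_n -> rat) (bF : 'rV[int]_n).
Hypothesis c_rec : is_frobenius_coef p cF.
Hypothesis w_gt0 : forall i, 0 < wt i.
Hypothesis Aw : forall j, \sum_i (A j i)%:R * wt i = 1.
Hypothesis bE : forall j, (bF 0 j)%:~R = (p.-1)%:R * u0 0 j.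
Hypothesis p_ge5 : (5 <= p)%N.

Implicit Types (kap : 'rV[int]_n).

Lemma s0_ge0 i : 0 <= s0 0 i.
Proof. by have /andP[] := s_range i. Qed.

Lemma XvD y k : Xv (y + k) = Xv y + k *m intmx A.
Proof using Type. by rewrite /Xv mulmxDl addrA. Qed.

Lemma Xv_bp y : Xv (bF + y *+ p) = Xv y *+ p.
Proof.
apply/rowP => i; rewrite XvE (XebpE x0_u0 u0_zp s0_zp c_rec w_gt0 Aw bE s0_ge0 p_ge5) -XvE.
elim: (p) => [|d IH]; first by rewrite !mulr0n [RHS]mxE.
by rewrite !mulrS [RHS]mxE IH.
Qed.

Lemma intmx_sum (g : 'rV[nat]_n) (k : 'rV[nat]_n) (M : 'M[nat]_n) :
  intmx (g + k *m M) = intmx g + intmx k *m intmx M.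
Proof using Type.
apply/rowP => i; rewrite !mxE PoszD; congr (_ + _); rewrite -natz natr_sum.
by apply: eq_bigr => j _; rewrite !mxE natrM !natz.
Qed.

Lemma intmxMn (g : 'rV[nat]_n) (m : nat) : intmx (g *+ m) = intmx g *+ m.
Proof using Type.
apply/rowP => i; rewrite mxE; elim: m => [|m IH]; first by rewrite !mulr0n !mxE.
by rewrite !mulrS [in LHS]mxE PoszD IH [RHS]mxE mxE.
Qed.

Lemma intmx_inj (g g' : 'rV[nat]_n) : intmx g = intmx g' -> g = g'.
Proof. by move=> /(congr1 (fun u : 'rV[int]_n => natv u)); rewrite !intmxK. Qed.

Lemma src_eq z y k' E E' (kap : 'rV[nat]_n) : admissible z k' -> admissible y k' ->
  ((pt z k' E).1.1 + kap *m A = (pt y k' E').1.1 *+ p) <-> intmx kap = bF + y *+ p - z.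
Proof.
move=> /admP[hz _] /admP[hy _]; rewrite /pt /=.
have hz' l : 0 <= Xv z 0 l by rewrite XvE.
have hy' l : 0 <= Xv y 0 l by rewrite XvE.
split=> [/(congr1 (@intmx 1 n))|e].
  rewrite intmx_sum intmxMn !natvK // -XvD -Xv_bp => /Xv_inj <-.
  by rewrite addrAC subrr add0r.
apply: intmx_inj; rewrite intmx_sum intmxMn !natvK // -XvD -Xv_bp e addrCA subrr addr0 //.
Qed.

Lemma q_qE k E : (forall l, 0 <= k 0 l) -> q A (natv (Le k)) E = qE s0 k E.
Proof.
move=> hk; rewrite /q /qE; congr (_ + _)%N; apply: eq_card => i; rewrite !inE lamt_Le //.
by case: (i \in E); rewrite ?mulr1 ?ltxx ?mulr0.
Qed.

(** For a fixed target the source monomial and [kap] determine each other by [src_eq], so the sum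
    over sources is a sum over [kap]. *)
Lemma raw_FrA f y k E : class_supp f -> admissible y k ->
  FrA p pi cF A f (pt y k E) = p%:R ^- qE s0 k E * psi cF bF (raw f) y k E.
Proof.
move=> hf ha; have /admP[hX hk] := ha; rewrite /psi.
pose S := [set kap : 'rV[int]_n | admissible (bF + y *+ p - kap) k].
pose h (kap : 'rV[int]_n) : mono n := pt (bF + y *+ p - kap) k E.
have /esym := @fsum_lin _ unit [:: tt] (fun=> p%:R ^- qE s0 k E)
  (fun _ kap => Cf cF kap * raw f (bF + y *+ p - kap) k E) (fun=> lowX_fin x0_u0 u0_zp s0_zp c_rec w_gt0 Aw bE s0_ge0 p_ge5 (bF + y *+ p) k E (raw_low f)).
rewrite big_cons big_nil addr0 => ->.
rewrite -(@fsbig_widen _ _ _ _ S setT) //; last first.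
  move=> kap [_ hS] /=; rewrite big_cons big_nil /raw; case: ifP => [ha'|_]; first by case: hS.
  by rewrite !mulr0 addr0.
rewrite /FrA /lin_ext -(@fsbig_widen _ _ _ _ (h @` S) setT) //; last first.
  move=> [[g l] E'] [_ hS] /=; apply/eqP/negPn/negP; rewrite !mulf_eq0 !negb_or -andbA => /and4P[h1 _ h2 h3].
  have [a1 a2 a3] := hf _ h1; have [z [k' [hz ez]]] := pt_coord a1 a2 a3.
  have /andP[/eqP el /eqP eE] : (natv (Le k) == l) && (E == E').
    by move: h3; case: (_ && _); rewrite ?eqxx.
  have ek : k = k'.
    apply: Le_inj; have /admP[_ hk'] := hz.
    move: el; rewrite (congr1 (fun m : mono n => m.1.2) ez : l = natv (Le k')) => /(congr1 (@intmx 1 n)).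
    by rewrite (natvK (Le_ge0 hk)) (natvK (Le_ge0 hk')).
  subst k' E'; apply: hS; move: h2; have -> : g = (pt z k E).1.1 by exact: (congr1 (fun m : mono n => m.1.1) ez).
  move=> h2; have [kap /(src_eq E E kap hz ha) hkap] : exists kap : 'rV[nat]_n, (pt z k E).1.1 + kap *m A = (pt y k E).1.1 *+ p.
    by apply: contrapT => /forallNP hn; move: h2; rewrite fsbig1 ?eqxx // => kap /= /hn.
  have ezz : z = bF + y *+ p - intmx kap by rewrite hkap opprB addrCA subrr addr0.
  exists (intmx kap); first by rewrite /S /= -ezz.
  by rewrite /h -ezz -ez.
have hbij : set_bij S (h @` S) h.
  apply: inj_bij => a b /set_mem ha1 /set_mem hb1 /(pt_inj ha1 hb1)[/addrI /oppr_inj //].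
rewrite (reindex_fsbig _ _ _ _ hbij).
apply: eq_fsbigr => kap /set_mem hz; rewrite big_cons big_nil addr0.
rewrite raw_pt // -/(h kap) /= !eqxx mulr1 (q_qE E hk).
suff -> : \sum_(x \in [set x | natv (Xv (bF + y *+ p - kap)) + x *m A = natv (Xv y) *+ p])
   cF (intmx x) * pi ^+ vsum x = Cf cF kap by ring.
have hs (x : 'rV[nat]_n) : natv (Xv (bF + y *+ p - kap)) + x *m A = natv (Xv y) *+ p <-> intmx x = kap.
  have := src_eq E E x hz ha; rewrite /pt /= => ->; rewrite opprB addrCA subrr addr0 //.
have [kp|/existsNP[l /negP]] := pselect (forall l, 0 <= kap 0 l); last first.
  rewrite -ltNge => hl; rewrite (Cf_neg x0_u0 u0_zp s0_zp c_rec w_gt0 Aw bE s0_ge0 p_ge5 hl) fsbig1 // => x /= /hs ex.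
  by move: hl; rewrite -ex mxE.
have -> : [set x | natv (Xv (bF + y *+ p - kap)) + x *m A = natv (Xv y) *+ p] = [set natv kap].
  by apply/seteqP; split=> x /=; rewrite hs; [move=> <-; rewrite intmxK|move=> ->; rewrite natvK].
rewrite fsbig_set1 natvK // /Cf; congr (_ * pi ^+ _).
by apply: eq_bigr => j _; rewrite mxE.
Qed.

Lemma pm1_lattice (x : 'rV[int]_n) : exists u, x *+ p.-1 = u *m intmx A.
Proof.
have [z hz] : exists z : int, p.-1%:Z = z * \det (intmx A).
  have -> : p.-1%:Z = p%:Z - 1 by have := p_gt0; lia.
  by move: A_det => /dvdzP[z ->]; exists z.
exists (z *: (x *m \adj (intmx A))).
rewrite -scalemxAl -mulmxA mul_adj_mx mul_mx_scalar scalerA -hz -scaler_nat.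
by rewrite natz.
Qed.

(** From gamma + kap A = p gamma' the classes of gamma and p gamma' agree, and those of p gamma' and
    gamma' agree because det A divides p - 1. *)
Lemma FrA_supp f : class_supp f -> class_supp (FrA p pi cF A f).
Proof.
move=> hf [[g' l'] E'] /lin_ext_neq0[[[g l] E] [/hf /= [h1 h2 h3]]].
rewrite !mulf_eq0 !negb_or -andbA => /and3P[_ hs hb].
have /andP[/eqP -> _] : (l' == l) && (E' == E) by move: hb; case: (_ && _); rewrite ?eqxx.
split=> //; rewrite -h1.
have [kap hk] : exists kap : 'rV[nat]_n, g + kap *m A = g' *+ p.
  apply: contrapT => /forallNP hn; move: hs; rewrite fsbig1 ?eqxx // => kap /= /hn //.
apply/cls_eqP; have [u hu] := pm1_lattice (intmx g').
exists (intmx kap - u); rewrite mulmxBl -hu addrA -intmx_sum hk intmxMn.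
by rewrite -[in X in _ *+ X - _](prednK p_gt0) mulrS addrK.
Qed.

Lemma FrA_piece f : class_supp f -> overconvergent v A f ->
  in_piece v (cls A x0) (cls A^T l0) (FrA p pi cF A f).
Proof.
move=> hf hd; apply: piece_of_decay; first exact: FrA_supp.
have [C [r [C0 r0 r1 h]]] := psi_decays x0_u0 u0_zp s0_zp c_rec w_gt0 Aw bE s0_ge0 p_ge5 (raw_decays hd) (raw_low f).
have pR := pR_gt0.
exists (p%:R ^+ (n + n) * C), r; split=> //; first by rewrite mulr_ge0 // exprn_ge0 // ltW.
move=> y k E ha; rewrite raw_FrA // -mulrA vM; apply: ler_pM => //; last by apply: h; have /admP[] := ha.
rewrite vV vX vp -exprVn invrK (pRX_mono x0_u0 u0_zp s0_zp c_rec w_gt0 Aw bE s0_ge0 p_ge5) // /qE leq_add //.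
  by rewrite -[X in (_ <= X)%N]card_ord max_card.
by rewrite -[X in (_ <= X)%N]card_ord max_card.
Qed.

Lemma md_FrA f : class_supp f -> md (FrA p pi cF A f) = Fr A s0 x0 cF bF (md f).
Proof.
move=> hf; apply/funext => y; apply/funext => k; apply/funext => E.
rewrite /md /Fr; case: ifP => // hg; have ha := good_adm hg.
rewrite raw_pt // raw_FrA //; congr (_ * _); congr (_ E).
apply: (eq_psi x0_u0 u0_zp s0_zp c_rec w_gt0 Aw bE s0_ge0 p_ge5) => kap hk; case: ifP => // /negbT hb.
have [hX|/existsNP[l /negP]] := pselect (forall l, 0 <= Xe A x0 (bF + y *+ p - kap) l); last first.
  by rewrite -ltNge => hl; rewrite (raw_low _ _ hl).
case/negP: hb; apply/(goodP x0_u0 u0_zp s0_zp) => i.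
have [g1 g2 g3] := goodP x0_u0 u0_zp s0_zp _ _ hg i; split=> //.
case: g3 => [e|]; [left|by right].
have := Xe_src x0_u0 u0_zp s0_zp c_rec w_gt0 Aw bE s0_ge0 p_ge5 y i hk; rewrite e mul0rn => h; apply/eqP; by rewrite eq_le h hX.
Qed.

(** * Comparison of the traces *)

(** On the piece [md] is the quotient map by the ideal, with section [re]: its kernel is identified
    by [md_ideal] and [ideal_of_md]. It intertwines the differentials and the Frobenius
    operators. *)
Lemma trace_piece t :
  is_subquotient_trace (cocycle v pi (cls A x0) (cls A^T l0))
    (coboundary v pi (cls A x0) (cls A^T l0)) (FrA p pi cF A) t <->
  is_subquotient_trace (Zm A u0 s0 x0) (Bm A u0 s0 x0) (Fr A s0 x0 cF bF) t.
Proof.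
set P : set (series K n) := in_piece v (cls A x0) (cls A^T l0).
have md_dtot' f : P f -> md (dtot pi A f) = Dg A u0 s0 x0 (md f).
  by move=> [[hf _] _]; exact: md_dtot.
have hP : subspace P.
  split=> [|a f g Pf Pg]; last apply: piece_of_decay.
  - split=> [|m]; last by rewrite eqxx.
    split=> [m|]; first by rewrite eqxx.
    by exists 1, 0; split=> // m; rewrite v0 mul1r exprn_ge0.
  - move=> m; have [fm|fm _] := eqVneq (f m) 0; last exact: (piece_supp Pf fm).
    have [gm|gm _] := eqVneq (g m) 0; last exact: (piece_supp Pg gm).
    by rewrite serD serZ fm gm mulr0 addr0 eqxx.
  have df := raw_decays (proj1 Pf); have dg := raw_decays (proj1 Pg).
  have [C [r [C0 r0 r1 h]]] := decaysD x0_u0 u0_zp s0_zp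
    (decays_scale x0_u0 u0_zp s0_zp (a := fun _ _ => a) (v_ge0 a) (fun _ _ => lexx _) df) dg.
  exists C, r; split=> // y k E ha; apply: le_trans (h y k E).
  by rewrite serD serZ -!raw_pt.
have dP f : P f -> in_ideal v A (dtot pi A f) <-> Dg A u0 s0 x0 (md f) = 0.
  move=> Pf; rewrite -md_dtot'; last by [].
  by split; [exact: md_ideal|apply: ideal_of_md; exact: dtot_piece].
apply: (trace_transfer (phi := md) (rho := re) (P := P)) => //.
- move=> f; split=> [[Pf h]|[Pf [_ h]]]; split=> //; last exact/dP.
  by split; [exact: (inX_md (proj1 Pf))|exact/dP].
- move=> f; split=> [[Pf [g Pg h]]|[Pf [g hg h]]]; split=> //.
    exists (md g); first exact: (inX_md (proj1 Pg)).
    by have /eqP := md_ideal h; rewrite linearB subr_eq0 => /eqP ->; exact: md_dtot'.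
  have [Pg eg] := re_spec hg; exists (re g) => //; apply: ideal_of_md.
    by apply: (subspaceB hP Pf); exact: dtot_piece.
  have /= := linearB md f (dtot pi A (re g)); rewrite md_dtot' // eg => ->.
  by rewrite -[X in X - _]/(md f) h subrr.
- by move=> g [hg _]; exact: re_spec.
move=> f Pf; split; first exact: (FrA_piece (piece_supp Pf) (proj1 Pf)).
exact: (md_FrA (piece_supp Pf)).
Qed.

End Transfer.

Section Supertrace.
Variables (A : 'M[nat]_n) (cF : 'rV[int]_n -> K).
Hypothesis c_rec : is_frobenius_coef p cF.
Hypothesis A_BH : berglund_hubsch p A.
Hypothesis A_CY : pairing A (J n) (J n) = 1.
Hypothesis n_ge3 : (3 <= n)%N.

(** * The twisted sectors *)

Lemma n_gt0 : (0 < n)%N.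
Proof. exact: leq_trans n_ge3. Qed.

Lemma A_unit : ratmx (intmx A) \in unitmx.
Proof. exact: bh_invertible A_BH. Qed.

Lemma A_det : (\det (intmx A) %| p%:Z - 1)%Z.
Proof. exact: bh_det A_BH. Qed.

Lemma wt_gt0 i : 0 < mulAmT A (J n) 0 i.
Proof. exact: w_pos A_BH i. Qed.

Lemma A_wt j : \sum_i (A j i)%:R * mulAmT A (J n) 0 i = 1.
Proof. exact: Aw1 A_BH j. Qed.

Definition uJ : 'rV[rat]_n := u0 A (J n).

Lemma uJ_gt0 j : 0 < uJ 0 j.
Proof. exact: (V_pos p_prime A_BH A_CY n_ge3). Qed.

(** Each |det A| w_i is a positive integer and the w_i add up to 1, whence 3 <= n <= |det A| <= p -
    1; and 4 is not prime. *)
Lemma p_ge5 : (5 <= p)%N.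
Proof.
have [N hN d0] := invA_den A_unit; set D := `|_|%N in d0 *.
have h1 i : 1 <= D%:R * mulAmT A (J n) 0 i.
  have e : (\det (intmx A))%:~R * mulAmT A (J n) 0 i = (\sum_j N i j)%:~R.
    rewrite (wE A i) mulr_sumr [RHS]rmorph_sum; apply: eq_bigr => j _; exact: hN.
  have e' : D%:R * mulAmT A (J n) 0 i = `|(\sum_j N i j)%R|%N%:R :> rat.
    have := congr1 Num.norm e; rewrite normrM (gtr0_norm (wt_gt0 i)) -!intr_norm -!abszE.
    by [].
  by rewrite e' ler1n -(ltr0n rat) -e' mulr_gt0 ?wt_gt0 // ltr0n lt0n.
have h2 : (n <= D)%N.
  rewrite -(ler_nat rat) -[X in _ <= X]mulr1 -[X in _ <= _ * X](sum_w1 A_CY) mulr_sumr.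
  have -> : n%:R = \sum_(i < n) 1 :> rat by rewrite sumr_const card_ord.
  by apply: ler_sum => i _.
have h3 : (D <= p.-1)%N.
  apply: dvdn_leq; first by rewrite -ltnS prednK ?prime_gt1 // p_gt0.
  have := A_det; have -> : p%:Z - 1 = p.-1%:Z by have := p_gt0; lia.
  by rewrite dvdzE.
have h4 : (4 <= p)%N.
  have := leq_trans n_ge3 (leq_trans h2 h3); have := p_gt0; move: (p) => q; lia.
by rewrite ltn_neqAle h4 andbT; apply/eqP => e; have := p_prime; rewrite -e.
Qed.

(** det A clears the denominators of A^-1 and divides p - 1. *)
Lemma bF_ex (x0 : 'rV[int]_n) : exists bF : 'rV[int]_n,
  forall j, (bF 0 j)%:~R = p.-1%:R * u0 A x0 0 j :> rat.
Proof.
have [N hN _] := invA_den A_unit; have [z hz] := dvdzP A_det.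
have ez : p.-1%:R = z%:~R * (\det (intmx A))%:~R :> rat.
  rewrite -intrM -hz; have -> : p%:Z - 1 = p.-1%:Z by have := p_gt0; lia.
  by [].
exists (\row_j (z * \sum_i x0 0 i * N i j)) => j.
rewrite mxE ez intrM -mulrA; congr (_ * _); rewrite /u0 mxE mulr_sumr rmorph_sum.
by apply: eq_bigr => i _ /=; rewrite intrM -hN !mxE mulrCA.
Qed.

Lemma mulAmT_shift (l k : 'rV[int]_n) i :
  mulAmT A (l + k *m intmx A^T) 0 i = mulAmT A l 0 i + (k 0 i)%:~R.
Proof.
rewrite /mulAmT /ratmx map_mxD mulmxDl mxE -/(ratmx l); congr (_ + _).
rewrite -/(ratmx _) ratmxM -mulmxA.
have -> : ratmx (intmx A^T) *m (invA A)^T = 1%:M.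
  have -> : ratmx (intmx A^T) = (ratmx (intmx A))^T by apply/matrixP => a b; rewrite !mxE.
  by rewrite -trmx_mul mulVmx ?A_unit // trmx1.
by rewrite mulmx1 mxE.
Qed.

Lemma mulAmT_inv (l : 'rV[int]_n) j : (l 0 j)%:~R = \sum_i mulAmT A l 0 i * (A j i)%:R.
Proof.
have : mulAmT A l *m (ratmx (intmx A))^T = ratmx l.
  by rewrite /mulAmT -mulmxA -trmx_mul mulmxV ?A_unit // trmx1 mulmx1.
move=> /rowP/(_ j); rewrite [in RHS]mxE => <-; rewrite mxE; apply: eq_bigr => i _.
by rewrite !mxE.
Qed.

Lemma good_rep (lam : GA A) : exists l0 : 'rV[int]_n, [/\ cls A^T l0 = lam,
  forall i, 0 <= mulAmT A l0 0 i < 1, age lam = \sum_i mulAmT A l0 0 i &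
  dimn lam = #|[set i | mulAmT A l0 0 i == 0]%SET|].
Proof.
pose fl : 'rV[int]_n := \row_i Num.floor (mulAmT A (rep lam) 0 i).
pose l0 := rep lam + (- fl) *m intmx A^T.
have e i : mulAmT A l0 0 i = mulAmT A (rep lam) 0 i - (Num.floor (mulAmT A (rep lam) 0 i))%:~R.
  by rewrite mulAmT_shift !mxE rmorphN.
exists l0; split.
- by rewrite -(cls_rep lam); apply/cls_eqP; exists (- fl).
- by move=> i; rewrite e subr_ge0 Num.Theory.floor_le ltrBlDl -[1]/(1%:~R) -intrD Num.Theory.floorD1_gt.
- by apply: eq_bigr => i _; rewrite e.
apply: eq_card => i; rewrite !inE e Num.Theory.intrEfloor subr_eq0 eq_sym //.
Qed.

(** * Estimate of a single sector *)

Section Sector.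
Variables (x0 l0 bF : 'rV[int]_n) (L0 : int) (ag : nat).
Hypothesis s_range : forall i, 0 <= mulAmT A l0 0 i < 1.
Hypothesis bE : forall j, (bF 0 j)%:~R = p.-1%:R * u0 A x0 0 j :> rat.
Hypothesis L0E : \sum_j u0 A x0 0 j = L0%:~R.
Hypothesis agE : \sum_i mulAmT A l0 0 i = ag%:R.

Let T := trace_HFr p v pi cF (cls A x0) (cls A^T l0).
Let X0E := x0_u0 x0 A_unit A_det s_range.
Let U0Z := u0_zp x0 A_unit A_det s_range.
Let S0Z := s0_zp x0 A_unit A_det s_range.
Let S0P : forall i, 0 <= s0 A l0 0 i.
Proof. by move=> i; have /andP[] := s_range i. Qed.

Lemma trace_cases : T = 0 \/
  is_subquotient_trace (Zm A (u0 A x0) (s0 A l0) x0) (Bm A (u0 A x0) (s0 A l0) x0)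
    (Fr A (s0 A l0) x0 cF bF) T.
Proof.
rewrite /T /trace_HFr /subquotient_trace; case: xgetP => [t _ ht|]; last by left.
right; exact: (proj1 (trace_piece A_unit A_det s_range c_rec wt_gt0 A_wt bE p_ge5 t) ht).
Qed.

Lemma trace_eq t : is_subquotient_trace (Zm A (u0 A x0) (s0 A l0) x0) (Bm A (u0 A x0) (s0 A l0) x0)
    (Fr A (s0 A l0) x0 cF bF) t -> T = t.
Proof.
move=> ht; have ht' := proj2 (trace_piece A_unit A_det s_range c_rec wt_gt0 A_wt bE p_ge5 t) ht.
apply: (model_trace_unique X0E U0Z S0Z c_rec wt_gt0 A_wt bE S0P p_ge5 ag L0E n_gt0) ht.
apply: (proj1 (trace_piece A_unit A_det s_range c_rec wt_gt0 A_wt bE p_ge5 T)).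
rewrite /T /trace_HFr /subquotient_trace; case: xgetP => [//|h]; by case: (h t).
Qed.

Lemma good_cases y : good A (s0 A l0) x0 y 0 -> forall i, 0 <= Xe A x0 y i /\
  (Xe A x0 y i = 0 \/ mulAmT A l0 0 i = 0).
Proof.
move=> /(goodP X0E U0Z S0Z) h i; have [h1 _ h2] := h i; split=> //.
by case: h2 => [|[]]; [left|right].
Qed.

Lemma levE y : (forall i, 0 <= Xe A x0 y i) ->
  (lev L0 y)%:R = \sum_i (Xe A x0 y i)%:~R * mulAmT A (J n) 0 i :> rat.
Proof.
by move=> h; have [] := lev_int X0E U0Z S0Z c_rec wt_gt0 A_wt bE S0P p_ge5 ag L0E n_gt0 h.
Qed.

Lemma lev0 y : (forall i, 0 <= Xe A x0 y i) -> lev L0 y = 0%N -> forall i, Xe A x0 y i = 0.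
Proof.
move=> hX h0 i; have := levE hX; rewrite h0 => /esym h.
have hp (j : 'I_n) : 0 <= (Xe A x0 y j)%:~R * mulAmT A (J n) 0 j :> rat.
  by rewrite mulr_ge0 ?ler0z // ltW ?wt_gt0.
have /(_ i isT)/eqP := psumr_eq0P (fun j _ => hp j) h.
by rewrite mulf_eq0 intr_eq0 [X in _ || X]gt_eqF ?wt_gt0 // orbF => /eqP.
Qed.

Lemma Xe_cls (z : 'rV[int]_n) y : (forall i, Xe A x0 y i = z 0 i) -> cls A x0 = cls A z.
Proof.
move=> h; apply/cls_eqP; exists (- y); apply/rowP => i.
have <- : Xv A x0 y = z by apply/rowP => j; rewrite (XvE x0 A_unit A_det s_range) h.
by rewrite /Xv mulNmx addrK.
Qed.

Lemma l0_zero : ag = 0%N -> l0 = 0.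
Proof.
move=> a0; have h : \sum_i mulAmT A l0 0 i = 0 by rewrite agE a0.
have h0 i : mulAmT A l0 0 i = 0.
  by apply: (psumr_eq0P _ h) => // j _; have /andP[] := s_range j.
apply/rowP => j; apply/eqP; rewrite -(@eqr_int rat) mulAmT_inv big1 ?mxE // => i _.
by rewrite h0 mul0r.
Qed.

(* [l0 - J] is effective and orthogonal to the positive weights [uJ]. *)
Lemma l0_J : ag = 1%N -> (forall i, mulAmT A l0 0 i != 0) -> l0 = J n.
Proof.
move=> a1 hs; have s_gt0 i : 0 < mulAmT A l0 0 i.
  by rewrite lt_def hs; have /andP[] := s_range i.
have l1 j : 1 <= l0 0 j.
  rewrite -gtz0_ge1 -(ltr0z rat) mulAmT_inv.
  have [i Aji] : exists i, (0 < A j i)%N by exact: (A_row X0E U0Z S0Z c_rec wt_gt0 A_wt bE S0P p_ge5).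
  rewrite (bigD1 i) //= ltr_wpDr ?mulr_gt0 ?ltr0n //.
  by apply: sumr_ge0 => l _; rewrite mulr_ge0 // ltW.
have e1 : \sum_j uJ 0 j * (l0 0 j)%:~R = 1.
  rewrite (eq_bigr (fun j => \sum_i mulAmT A l0 0 i * (uJ 0 j * (A j i)%:R))) => [|j _]; last first.
    by rewrite mulAmT_inv mulr_sumr; apply: eq_bigr => i _; rewrite mulrCA.
  have e0 : \sum_i mulAmT A l0 0 i = 1 by rewrite agE a1.
  rewrite exchange_big /= -[RHS]e0; apply: eq_bigr => i _.
  by rewrite -mulr_sumr (VA1 A_BH) mulr1.
have e2 : \sum_j uJ 0 j = 1.
  by rewrite -A_CY /pairing mxE; apply: eq_bigr => j _; rewrite !mxE mulr1.
have e3 : \sum_j uJ 0 j * ((l0 0 j)%:~R - 1) = 0.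
  rewrite (eq_bigr (fun j => uJ 0 j * (l0 0 j)%:~R - uJ 0 j)) => [|j _]; last by rewrite mulrBr mulr1.
  by rewrite sumrB e1 e2 subrr.
have hp (j : 'I_n) : 0 <= uJ 0 j * ((l0 0 j)%:~R - 1).
  by apply: mulr_ge0; [exact: ltW (uJ_gt0 j)|rewrite subr_ge0 ler1z].
apply/rowP => j; have /(_ j isT)/eqP := psumr_eq0P (fun j _ => hp j) e3.
by rewrite mulf_eq0 [X in X || _]gt_eqF ?uJ_gt0 //= subr_eq0 -[1]/(1%:~R) eqr_int mxE => /eqP.
Qed.

(** The inequality 2 + |E| <= ag + nfix + lev is checked on the support, where |E| <= nfix and level
    0 forces X = 0 and E empty. For age 0, nfix is [n], and it fails only at level 1 with E full,
    where X = J. For age 1 it fails only at level 0 with nfix = 0, where X = 0 and l0 = J. *)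
Lemma sector_bound : ~ (cls A x0 = cls A (J n) /\ l0 = 0) -> ~ (cls A x0 = cls A 0 /\ l0 = J n) ->
  v (p%:R ^+ (ag + n - 1) * T) <= p%:R^-1.
Proof.
move=> ex1 ex2; have [->|hT] := trace_cases.
  by rewrite mulr0 v0 invr_ge0 ltW // pR_gt0.
apply: (trace_contraction X0E U0Z S0Z c_rec wt_gt0 A_wt bE S0P p_ge5 L0E n_gt0 _ hT) => y E hg hE.
have hX i : 0 <= Xe A x0 y i by have [] := good_cases hg i.
have hs i : Xe A x0 y i != 0 -> mulAmT A l0 0 i = 0.
  by have [_ [->|//]] := good_cases hg i; rewrite eqxx.
have hF : (#|E| <= nfix (s0 A l0))%N.
  apply: subset_leq_card; apply/fintype.subsetP => i iE; rewrite inE; apply/eqP/hs.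
  by rewrite gt_eqF // hE.
have E0 : lev L0 y = 0%N -> #|E| = 0%N.
  move=> /(lev0 hX) h; apply/eqP; rewrite cards_eq0; apply/eqP/setP => i; rewrite inE.
  by apply/negP => /hE; rewrite h ltxx.
have [a0|a0] := eqVneq ag 0%N.
  have l00 := l0_zero a0.
  have nE : nfix (s0 A l0) = n.
    rewrite /nfix -[RHS]card_ord; apply: eq_card => i; rewrite inE /s0.
    by have := mulAmT_shift 0 0 i; rewrite l00 /mulAmT /ratmx !map_mx0 !mul0mx addr0 map_mx0 mul0mx !mxE eqxx.
  rewrite nE in hF *; rewrite a0 add0n.
  have [l0y|ly] := eqVneq (lev L0 y) 0%N; first by rewrite (E0 l0y) l0y; have := n_ge3; lia.
  have [l1|l1] := eqVneq (lev L0 y) 1%N; last by move: hF ly l1; move: (lev L0 y) => t; lia.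
  suff : (#|E| < n)%N by rewrite l1; lia.
  rewrite ltn_neqAle hF andbT; apply/eqP => En; case: ex1; split=> //.
  have ET i : i \in E.
    have : E = [set: 'I_n]%SET by apply/eqP; rewrite eqEcard finset.subsetT cardsT card_ord En /=.
    by move=> ->; rewrite inE.
  apply: (@Xe_cls _ y) => i; rewrite [RHS]mxE.
  have := levE hX; rewrite l1 -[1%:R](sum_w1 A_CY) => /esym/eqP; rewrite -subr_eq0 -sumrB => /eqP h.
  have hp (j : 'I_n) : 0 <= (Xe A x0 y j)%:~R * mulAmT A (J n) 0 j - mulAmT A (J n) 0 j.
    rewrite -[X in _ - X]mul1r -mulrBl; apply: mulr_ge0; last exact: ltW (wt_gt0 j).
    by rewrite subr_ge0 ler1z -gtz0_ge1 hE ?ET.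
  have /(_ i isT)/eqP := psumr_eq0P (fun j _ => hp j) h.
  rewrite -[X in _ - X]mul1r -mulrBl mulf_eq0 [X in _ || X]gt_eqF ?wt_gt0 // orbF subr_eq0.
  by rewrite -[1]/(1%:~R) eqr_int => /eqP.
have [a1|a1] := eqVneq ag 1%N; last by move: hF a0 a1; clear; lia.
have [l0y|ly] := eqVneq (lev L0 y) 0%N; last by move: hF ly; rewrite a1; move: (lev L0 y) => t; lia.
rewrite a1 (E0 l0y) l0y; suff : (0 < nfix (s0 A l0))%N by lia.
rewrite lt0n; apply/eqP => n0; case: ex2; split.
  by apply: (@Xe_cls _ y) => i; rewrite (lev0 hX l0y) mxE.
apply: l0_J => // i; apply/negP => hi; move/eqP: n0; rewrite /nfix cards_eq0 => /eqP/setP/(_ i).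
by rewrite !inE /s0 hi.
Qed.

End Sector.

(** * The untwisted sectors *)

Lemma mulAmT0 i : mulAmT A 0 0 i = 0.
Proof. by rewrite /mulAmT /ratmx map_mx0 mul0mx mxE. Qed.

Lemma u00 j : u0 A 0 0 j = 0.
Proof. by rewrite /u0 /ratmx map_mx0 mul0mx mxE. Qed.

Lemma range_J i : 0 <= mulAmT A (J n) 0 i < 1.
Proof. by rewrite ltW ?wt_gt0 //= (w_lt1 A_BH A_CY n_ge3). Qed.

Lemma range_0 i : 0 <= mulAmT A 0 0 i < 1.
Proof. by rewrite mulAmT0 lexx ltr01. Qed.

Lemma sum_uJ : \sum_j uJ 0 j = 1.
Proof. by rewrite -A_CY /pairing mxE; apply: eq_bigr => j _; rewrite !mxE mulr1. Qed.

Lemma uJ_lt1 j : uJ 0 j < 1.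
Proof.
have [k kj] : exists k, k != j.
  have n2 : (1 < n)%N by exact: ltnW.
  apply/existsP; apply: contraTT n2 => /existsPn h; rewrite -leqNgt -[X in (X <= _)%N]card_ord -(cards1 j).
  by apply: subset_leq_card; apply/fintype.subsetP => k _; have := h k; rewrite negbK !inE.
rewrite -sum_uJ (bigD1 j) //= (bigD1 k) //= ltrDl ltr_wpDr ?uJ_gt0 //.
by apply: sumr_ge0 => l _; rewrite ltW ?uJ_gt0.
Qed.

Lemma sector_point : trace_HFr p v pi cF (cls A 0) (cls A^T (J n)) = p%:R ^- n.
Proof.
have bE0 j : ((0 : 'rV[int]_n) 0 j)%:~R = p.-1%:R * u0 A 0 0 j :> rat by rewrite u00 mxE mulr0.
have L0E0 : \sum_j u0 A 0 0 j = 0%:~R by rewrite big1 // => j _; rewrite u00.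
have S0P i : 0 <= s0 A (J n) 0 i by exact: ltW (wt_gt0 i).
have agE1 : \sum_i mulAmT A (J n) 0 i = 1%:R by exact: sum_w1 A_CY.
apply: (trace_eq range_J bE0 L0E0 agE1).
apply: (trace_point (x0_u0 0 A_unit A_det range_J) (u0_zp 0 A_unit A_det range_J)
  (s0_zp 0 A_unit A_det range_J) c_rec wt_gt0 A_wt bE0 S0P p_ge5 0%N L0E0 n_gt0).
- exact: wt_gt0.
- exact: u00.
- by [].
move=> y hy; apply: (Xv_inj (x0 := 0) A_unit A_det range_J); apply/rowP => i.
by rewrite !(XvE 0 A_unit A_det range_J) hy /Xe mxE add0r big1 // => j _; rewrite mxE mul0r.
Qed.

Section Top.
Variable bF : 'rV[int]_n.
Hypothesis bE : forall j, (bF 0 j)%:~R = p.-1%:R * uJ 0 j :> rat.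

Let L0E : \sum_j u0 A (J n) 0 j = 1%:~R.
Proof. exact: sum_uJ. Qed.
Let S0P i : 0 <= s0 A 0 0 i.
Proof. by rewrite /s0 mulAmT0. Qed.
Let X0E := x0_u0 (J n) A_unit A_det range_0.
Let U0Z := u0_zp (J n) A_unit A_det range_0.
Let S0Z := s0_zp (J n) A_unit A_det range_0.

Lemma sector_top : v (p%:R ^+ (n - 1) * trace_HFr p v pi cF (cls A (J n)) (cls A^T 0)
  + \prod_j hj cF j `|bF 0%R j|%N) <= p%:R^-1.
Proof.
have u_int j : 0 < u0 A (J n) 0 j < 1 by rewrite uJ_gt0 uJ_lt1.
have u_den : exists d : nat, (0 < d)%N /\ coprime p d /\
    forall j, exists z : int, d%:R * u0 A (J n) 0 j = z%:~R.
  have [N hN d0] := invA_den A_unit; exists `|\det (intmx A)|%N; split; first by rewrite lt0n.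
  split; first exact: (det_coprime A_unit A_det).
  move=> j; exists (((-1) ^+ (\det (intmx A) < 0)%R) * \sum_i N i j).
  have -> : `|\det (intmx A)|%N%:R = ((-1) ^+ (\det (intmx A) < 0)%R * \det (intmx A))%:~R :> rat.
    by rewrite -[LHS]/((`|_|%N%:Z)%:~R) abszE normrEsign.
  rewrite -[u0 A (J n) 0 j]/((ratmx (J n) *m invA A) 0 j) (VE A j) !intrM -mulrA; congr (_ * _).
  by rewrite mulr_sumr [RHS]rmorph_sum; apply: eq_bigr => i _; exact: hN.
have s00 i : s0 A 0 0 i = 0 by exact: mulAmT0.
have J_gt0 i : 0 < J n 0 i by rewrite mxE.
have [t ht hv] := trace_top X0E U0Z S0Z c_rec wt_gt0 A_wt bE S0P p_ge5 0%N L0E n_gt0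
  (bh_invAE A_BH) (bh_AinvE A_BH) u_int u_den s00 J_gt0 (erefl _).
have agE0 : \sum_i mulAmT A 0 0 i = 0%:R by rewrite big1 // => i _; exact: mulAmT0.
by rewrite (trace_eq range_0 bE L0E agE0 ht).
Qed.

Definition kJ j : nat := `|bF 0%R j|%N.

Lemma bF_ge0 j : 0 <= bF 0 j.
Proof. by rewrite -(@ler0z rat) bE mulr_ge0 // ltW ?uJ_gt0. Qed.

Lemma kJE j : (kJ j)%:R = p.-1%:R * uJ 0 j :> rat.
Proof. by rewrite -bE -[in RHS](gez0_abs (bF_ge0 j)). Qed.

Lemma kJ_lt j : (kJ j < p)%N.
Proof.
rewrite -(ltr_nat rat) kJE; apply: lt_trans (_ : (p.-1)%:R < _); last first.
  by rewrite ltr_nat ltn_predL p_gt0.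
rewrite gtr_pMr ?uJ_lt1 // ltr0n -ltnS prednK ?p_gt1 // p_gt0 //.
Qed.

(** Below [p] the second term of the recursion is absent, and what remains is the recursion of 1 /
    k!. *)
Lemma hj_fact j k : (k < p)%N -> hj cF j k * (k`!)%:R = 1.
Proof.
elim: k => [_|k IH hk].
  by rewrite (hj_0 X0E U0Z S0Z c_rec wt_gt0 A_wt bE S0P p_ge5) mul1r.
rewrite factS natrM mulrA [hj _ _ _ * _]mulrC.
rewrite (hj_rec X0E U0Z S0Z c_rec wt_gt0 A_wt bE S0P p_ge5) leqNgt hk addr0.
by apply: IH; exact: ltnW.
Qed.

Lemma Nk_hj : (Nk kJ)%:R = (p.-1)`!%:R * \prod_j hj cF j (kJ j).
Proof.
rewrite -(Nk_fact A_CY kJE) natrM -mulrA natr_prod -big_split /=.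
by rewrite big1 ?mulr1 // => j _; rewrite mulrC hj_fact ?kJ_lt.
Qed.

Lemma v_fact_unit k : (k < p)%N -> v (k`!)%:R = 1.
Proof.
elim: k => [|k IH] hk; first by rewrite v1.
rewrite factS natrM vM IH ?mulr1; last exact: ltnW.
by apply: v_coprime; rewrite prime_coprime ?p_prime // gtnNdvd.
Qed.

Lemma v_prod_hj : v (\prod_j hj cF j (kJ j)) = 1.
Proof.
apply: (big_ind (fun x => v x = 1)) => [|x y hx hy|j _]; first exact: v1.
  by rewrite vM hx hy mulr1.
by have := hj_fact j (kJ_lt j) => /(congr1 v); rewrite vM v_fact_unit ?kJ_lt // mulr1 v1.
Qed.

End Top.

(** * The supertrace modulo [p] *)

(** By the adjugate, the multiples of |det M| lie in the lattice, so vectors of remainders modulo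
    |det M| represent all classes. *)
Lemma coker_finite (M : 'M[nat]_n) (S : set (coker M)) :
  (`|\det (intmx M)| != 0)%N -> finite_set S.
Proof.
set D := `|_|%N => D0.
pose F (a : {ffun 'I_n -> 'I_D}) : coker M := cls M (\row_j (a j : nat)%:Z).
apply: sub_finite_set (finite_image F (@finite_finset _ setT)) => g _.
have DZ : D%:Z != 0 by rewrite -absz_eq0.
have hmod j : (`|(rep g 0%R j %% D%:Z)%Z|%N < D)%N.
  by rewrite -ltz_nat gez0_abs ?modz_ge0 // ltz_pmod // lt_def DZ.
exists [ffun j => Ordinal (hmod j)] => //; rewrite -[RHS]cls_rep; apply/cls_eqP.
pose q : 'rV[int]_n := \row_j (rep g 0%R j %/ D%:Z)%Z.
have [e he] : exists e : int, D%:Z = e * \det (intmx M).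
  by exists ((-1) ^+ (\det (intmx M) < 0)%R); rewrite /D abszE normrEsign.
exists (- (e *: (q *m \adj (intmx M)))).
rewrite mulNmx -scalemxAl -mulmxA mul_adj_mx mul_mx_scalar scalerA -he.
apply/rowP => j; rewrite !mxE ffunE /= gez0_abs ?modz_ge0 //.
by rewrite {2}(divz_eq (rep g 0 j) D%:Z) mulrC addrAC subrr add0r.
Qed.

Lemma cls0 (M : 'M[nat]_n) : cls M 0 = 0.
Proof. by rewrite /cls !piE. Qed.

Lemma range_uniq (l l' : 'rV[int]_n) : (forall i, 0 <= mulAmT A l 0 i < 1) ->
  (forall i, 0 <= mulAmT A l' 0 i < 1) -> cls A^T l = cls A^T l' -> l = l'.
Proof.
move=> h h' /cls_eqP[u e]; suff u0 : u = 0 by rewrite e u0 mul0mx addr0.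
apply/rowP => i; rewrite mxE; have := mulAmT_shift l' u i; rewrite -e => ei.
have /andP[a1 a2] := h i; have /andP[b1 b2] := h' i.
have c1 : (u 0 i)%:~R < 1%:~R :> rat by move: a2 b1; rewrite ei mulr1z; lra.
have c2 : (-1)%:~R < (u 0 i)%:~R :> rat by move: a1 b2; rewrite ei mulrNz mulr1z; lra.
by move: c1 c2; rewrite !ltr_int; move: (u 0 i) => z; clear; lia.
Qed.

Lemma age_cls (l : 'rV[int]_n) : (forall i, 0 <= mulAmT A l 0 i < 1) ->
  age (cls A^T l) = \sum_i mulAmT A l 0 i /\
  dimn (cls A^T l) = #|[set i | mulAmT A l 0 i == 0]%SET|.
Proof.
move=> h; have [l0 [e hl ha hd]] := good_rep (cls A^T l).
by have := range_uniq hl h e => e'; rewrite ha hd e'.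
Qed.

Lemma cls_J_neq0 : cls A (J n) != cls A 0.
Proof.
apply/eqP => /cls_eqP[u e]; have n0 := n_gt0; pose j := Ordinal n0.
have : uJ 0 j = (u 0 j)%:~R.
  have e' : u0 A (J n) = ratmx u.
    by rewrite /u0 e add0r ratmxM mulmxK ?A_unit.
  by rewrite /uJ e' mxE.
have := uJ_gt0 j; have := uJ_lt1 j => h1 h2 h3; move: h1 h2.
by rewrite h3 ltr0z -[1]/(1%:~R) ltr_int; move: (u 0 j) => z; clear; lia.
Qed.

Lemma sum_indicator (T : eqType) (s : seq T) x : uniq s -> x \in s ->
  \sum_(y <- s) (y == x)%:R = 1 :> K.
Proof.
move=> us xs; rewrite (bigD1_seq x) //= eqxx big1 ?addr0 // => y /negbTE ->.
by [].
Qed.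

Section Assembly.
Variable G : zmodClosed (GA A).
Hypothesis J_G : cls A^T (J n) \in G.
Hypothesis J_GT : cls A (J n) \in transpose_group G.
Variable bF : 'rV[int]_n.
Hypothesis bE : forall j, (bF 0 j)%:~R = p.-1%:R * uJ 0 j :> rat.

Let P : K := \prod_j hj cF j (kJ bF j).

(** The sum is the pairing of gamma with J up to an integer, and J lies in [G]. So the level is an
    integer on the whole piece. *)
Lemma sum_u0_int (gam : GAT A) : gam \in transpose_group G ->
  exists L0 : int, \sum_j u0 A (rep gam) 0 j = L0%:~R.
Proof.
rewrite inE => /asboolP /(_ _ J_G).
have [u eu] : exists u, rep (cls A^T (J n)) = J n + u *m intmx A^T.
  by apply/cls_eqP; rewrite cls_rep.
rewrite eu pairingE (eq_bigr (fun i => (rep gam 0 i)%:~R * mulAmT A (J n) 0 i + (rep gam 0 i * u 0 i)%:~R)); last first.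
  by move=> i _; rewrite mulAmT_shift mulrDr intrM.
rewrite big_split /= -rmorph_sum /= => /intrP[z ez].
exists (z - \sum_i rep gam 0 i * u 0 i); rewrite intrB -ez addrK.
rewrite (eq_bigr (fun j => \sum_i (rep gam 0 i)%:~R * invA A i j)) => [|j _]; last first.
  by rewrite /u0 mxE; apply: eq_bigr => i _; rewrite mxE.
by rewrite exchange_big /=; apply: eq_bigr => i _; rewrite -mulr_sumr (wE A i).
Qed.

(** Modulo integers the age is the pairing of J with lambda, and J lies in the transpose group. So
    the truncation in [ST] is exact. *)
Lemma age_nat lam : lam \in G -> age lam = (Num.truncn (age lam))%:R.
Proof.
move=> hl; suff : age lam \is a Num.nat by move/Num.Theory.truncnK.
have [l0 [el hs ea _]] := good_rep lam.
rewrite Num.Theory.natrEint; apply/andP; split; last first.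
  by rewrite ea sumr_ge0 // => i _; have /andP[] := hs i.
have := J_GT; rewrite inE => /asboolP /(_ _ hl).
have [u eu] : exists u, rep (cls A (J n)) = J n + u *m intmx A.
  by apply/cls_eqP; rewrite cls_rep.
have [t et] : exists t, rep lam = l0 + t *m intmx A^T.
  by apply/cls_eqP; rewrite cls_rep.
have e1 : pairing A (rep (cls A (J n))) (rep lam) =
    \sum_i mulAmT A l0 0 i + (\sum_i t 0 i + \sum_j u 0 j * rep lam 0 j)%:~R.
  rewrite pairingE eu.
  rewrite (eq_bigr (fun i => mulAmT A l0 0 i + (t 0 i)%:~R +
      \sum_j (u 0 j)%:~R * (mulAmT A (rep lam) 0 i * (A j i)%:R))); last first.
    move=> i _; rewrite [(J n + _) 0 i]mxE [J n 0 i]mxE intrD mulrDl mul1r {1}et mulAmT_shift; congr (_ + _).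
    rewrite [(u *m _) 0 i]mxE rmorph_sum mulr_suml; apply: eq_bigr => j _ /=.
    by rewrite [intmx A j i]mxE intrM -mulrA [_%:~R * mulAmT _ _ _ _]mulrC.
  rewrite big_split /= big_split /= intrD addrA -!rmorph_sum /=; congr (_ + _).
  rewrite exchange_big /= rmorph_sum; apply: eq_bigr => j _ /=.
  by rewrite -mulr_sumr -mulAmT_inv intrM.
rewrite e1 -ea => /intrP[z ez]; apply/intrP.
exists (z - (\sum_i t 0 i + \sum_j u 0 j * rep lam 0 j)).
by rewrite intrB -ez addrK.
Qed.

Definition term (gam : GAT A) (lam : GA A) : K :=
  (-1) ^+ dimn lam * p%:R ^+ (Num.truncn (age lam) + n - 1) * trace_HFr p v pi cF gam lam.

(** The contributions that survive modulo [p]: the pair (J, 0), whose second class has dimension [n]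
    and gives the sign (-1)^n, and the pair (0, J), whose second class has dimension 0. *)
Definition main_term (gam : GAT A) (lam : GA A) : K :=
  (gam == cls A (J n))%:R * (lam == cls A^T 0)%:R * - ((-1) ^+ n * P)
  + (gam == cls A 0)%:R * (lam == cls A^T (J n))%:R.

Lemma term_bound gam lam : gam \in transpose_group G -> lam \in G ->
  v (term gam lam - main_term gam lam) <= p%:R^-1.
Proof.
move=> hg hl; rewrite /main_term; have pV : (0 : R) <= p%:R^-1 by rewrite invr_ge0 ltW // pR_gt0.
have [g1|g1] := eqVneq gam (cls A (J n)); have [l1|l1] := eqVneq lam (cls A^T 0).
- have -> : (gam == cls A 0) = false by rewrite g1 (negbTE cls_J_neq0).
  rewrite mul0r addr0 mul1r mul1r opprK /term.
  have [ea ed] := age_cls range_0; rewrite g1 l1 ea ed.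
  have -> : #|[set i | mulAmT A 0 0 i == 0]%SET| = n.
    by rewrite -[RHS]card_ord; apply: eq_card => i; rewrite inE mulAmT0 eqxx.
  have -> : \sum_i mulAmT A 0 0 i = 0 by rewrite big1 // => i _; exact: mulAmT0.
  rewrite Num.Theory.truncn0 add0n -mulrA -mulrDr vM vsign mul1r.
  exact: (sector_top bE).
all: rewrite ?mul0r ?mulr0 ?mul0r add0r.
all: have [g2|g2] := eqVneq gam (cls A 0); have [l2|l2] := eqVneq lam (cls A^T (J n)).
all: rewrite ?mul0r ?mulr0 ?subr0 ?mulr1.
all: try by move: cls_J_neq0; rewrite -g1 g2 eqxx.
all: try (have [ea ed] := age_cls range_J; rewrite /term g2 l2 ea ed (sum_w1 A_CY);
  have -> : #|[set i | mulAmT A (J n) 0 i == 0]%SET| = 0%N by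
    [apply/eqP; rewrite cards_eq0; apply/eqP/setP => i; rewrite !inE gt_eqF ?wt_gt0];
  by rewrite Num.Theory.truncn1 add1n subn1 sector_point expr0 mul1r mulfV ?subrr ?v0 // expf_neq0 // natK_eq0 -lt0n p_gt0).
(* The remaining pairs fall under [sector_bound]; each of its two exceptions contradicts one of the
   inequalities at hand. *)
all: have [l0 [el hs ea _]] := good_rep lam; have [L0 hL] := sum_u0_int hg; have [b hb] := bF_ex (rep gam);
  have ha := age_nat hl; rewrite ea in ha;
  have := @sector_bound (rep gam) l0 b L0 (Num.truncn (\sum_i mulAmT A l0 0 i)) hs hb hL ha;
  rewrite cls_rep el -ea => hh; rewrite /term -mulrA vM vsign mul1r; apply: hh => -[e1 e2].
all: try by rewrite e1 eqxx in g1.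
all: try by rewrite e1 eqxx in g2.
all: try by rewrite -el e2 eqxx in l1.
all: try by rewrite -el e2 eqxx in l2.
Qed.

Lemma A_detN : (`|\det (intmx A)| != 0)%N.
Proof. by have [N _ h] := invA_den A_unit. Qed.

Lemma ST_bound : v (ST p v pi cF A G - (1 - (-1) ^+ n * P)) <= p%:R^-1.
Proof.
have pV : (0 : R) <= p%:R^-1 by rewrite invr_ge0 ltW // pR_gt0.
have f1 : finite_set [set` transpose_group G] by apply: coker_finite; exact: A_detN.
have f2 : finite_set [set` (G : {pred GA A})].
  by apply: coker_finite; rewrite /intmx -map_trmx det_tr; exact: A_detN.
rewrite /ST fsbig_finite //.
set s1 := enum_fset _; have u1 : uniq s1 by exact: fset_uniq.
have m1 g : (g \in s1) = (g \in transpose_group G).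
  by have := in_fset_set f1 g; rewrite /s1 => ->; apply/idP/idP => [/set_mem //|hg]; exact/mem_set.
rewrite (eq_bigr (fun g => \sum_(lam <- fset_set [set` (G : {pred GA A})]) term g lam)) => [|g _]; last first.
  by rewrite fsbig_finite.
set s2 := enum_fset (fset_set [set` (G : {pred GA A})]); have u2 : uniq s2 by exact: fset_uniq.
have m2 l : (l \in s2) = (l \in G).
  by have := in_fset_set f2 l; rewrite /s2 => ->; apply/idP/idP => [/set_mem //|hg]; exact/mem_set.
have e0 : cls A^T 0 \in G by rewrite cls0 rpred0.
have e0' : cls A 0 \in transpose_group G.
  rewrite inE; apply/asboolP => lam _.
  have [u eu] : exists u, rep (cls A 0) = 0 + u *m intmx A by apply/cls_eqP; rewrite cls_rep.
  rewrite eu add0r pairingE.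
  rewrite (eq_bigr (fun i => \sum_j (u 0 j)%:~R * (mulAmT A (rep lam) 0 i * (A j i)%:R))); last first.
    move=> i _; rewrite [(u *m _) 0 i]mxE rmorph_sum mulr_suml; apply: eq_bigr => j _ /=.
    by rewrite [intmx A j i]mxE intrM -mulrA [_%:~R * mulAmT _ _ _ _]mulrC.
  rewrite exchange_big /=; apply: rpred_sum => j _.
  by rewrite -mulr_sumr -mulAmT_inv -intrM intr_int.
have <- : \sum_(g <- s1) \sum_(l <- s2) main_term g l = 1 - (-1) ^+ n * P.
  rewrite /main_term (eq_bigr (fun g => (g == cls A (J n))%:R * - ((-1) ^+ n * P) + (g == cls A 0)%:R)) => [|g _].
    by rewrite big_split /= -mulr_suml !sum_indicator ?m1 // mul1r addrC.
  rewrite big_split /= -!mulr_sumr -mulr_suml; congr (_ + _); last by rewrite sum_indicator ?mulr1 ?m2.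
  by rewrite -mulr_sumr sum_indicator ?mulr1 ?m2.
rewrite -sumrB big_seq; apply: v_sum => // g; rewrite m1 => hg.
by rewrite -sumrB big_seq; apply: v_sum => // l; rewrite m2 => hl; exact: term_bound.
Qed.

(** With X points there are (p - 1) X + 1 affine zeros, the zero vector included; modulo [p] this
    gives X = 1 + (-1)^n Nk. As Nk = (p - 1)! P, Wilson's theorem turns this into 1 - (-1)^n P. *)
Lemma card_points_bound (w : 'I_n -> nat) (m : nat) : (0 < m)%N ->
  (forall i, (w i)%:R = m%:R * mulAmT A (J n) 0 i) ->
  v ((1 - (-1) ^+ n * P) - (#|` fset_set (X_points p A w)|)%:R) <= p%:R^-1.
Proof.
move=> m0 hw; set X := #|` _|.
have w0 i : (0 < w i)%N by rewrite -(ltr0n rat) hw mulr_gt0 ?wt_gt0 // ltr0n.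
have Ww i : (\sum_j A i j * w j = m)%N.
  apply/eqP; rewrite -(eqr_nat rat) natr_sum -[X in _ == X]mulr1 -[X in _ == _ * X](A_wt i) mulr_sumr.
  by apply/eqP; apply: eq_bigr => j _; rewrite natrM hw mulrCA.
have hX := card_X_points p_prime w0 Ww.
have hS : #|[set y : 'rV['F_p]_n | We A y == 0]%SET| = (#|Sol p A|).+1.
  rewrite (cardsD1 (0 : 'rV['F_p]_n) [set y : 'rV['F_p]_n | We A y == 0]%SET) inE; have -> : We A (0 : 'rV['F_p]_n) == 0.
    apply/eqP; rewrite /We big1 // => i _.
    have [j Aij] : exists j, (0 < A i j)%N.
      apply: contrapT => /forallNP h; have := Ww i; rewrite big1 => [e|j _]; first by rewrite -e in m0.
      by have := h j => /negP; rewrite -eqn0Ngt => /eqP ->.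
    by rewrite (bigD1 j) //= mxE expr0n gtn_eqF // mul0r.
  by congr (1 + _)%N; apply: eq_card => y; rewrite !inE.
have hA := card_affine p_prime A_BH A_CY n_ge3 (kJE bE).
pose z : int := 1 + (-1) ^+ n * (Nk (kJ bF))%:Z - X%:Z.
have hz : (p%:Z %| z)%Z.
  rewrite (dvdz_pcharf (pchar_Fp p_prime)) /z rmorphB rmorphD rmorphM rmorphXn /= rmorphN1.
  rewrite -[(Nk _)%:~R]/((Nk _)%:R) -[X%:~R]/(X%:R).
  have : ((X * p.-1).+1)%:R = - (-1) ^+ n * (Nk (kJ bF))%:R :> 'F_p by rewrite hX -hS hA.
  have ep : (p.-1)%:R = -1 :> 'F_p.
    by apply/eqP; rewrite -addr_eq0 natr1 prednK ?p_gt0 // Fp_p0.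
  rewrite -natr1 natrM ep mulNr => /eqP; rewrite -subr_eq0 opprK => /eqP h.
  by apply/eqP; rewrite -[RHS]h; ring.
have [q hq] := dvdzP hz.
have vz : v (z%:~R) <= p%:R^-1.
  by rewrite hq intrM vM -[p%:~R]/(p%:R) vp ler_piMl ?v_int_le1 // invr_ge0 ltW // pR_gt0.
have vW : v (((p.-1)`!.+1)%:R) <= p%:R^-1.
  have : (p %| ((p.-1)`!).+1)%N by rewrite -Wilson ?p_prime // p_gt1.
  move=> /dvdnP[t ->]; rewrite natrM vM vp ler_piMl ?v_nat_le1 // invr_ge0 ltW // pR_gt0.
have -> : 1 - (-1) ^+ n * P - X%:R = z%:~R - (-1) ^+ n * (P * ((p.-1)`!.+1)%:R).
  rewrite /z rmorphB rmorphD rmorphM rmorphXn /= rmorphN1.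
  rewrite -[(Nk _)%:~R]/((Nk _)%:R) -[X%:~R]/(X%:R) (Nk_hj bE) -/P -natr1; ring.
by apply: vB => //; rewrite vM vsign mul1r vM (v_prod_hj bE) mul1r.
Qed.

End Assembly.

Lemma supertrace_congr (G : zmodClosed (GA A)) (w : 'I_n -> nat) (m : nat) :
  cls A^T (J n) \in G -> cls A (J n) \in transpose_group G -> (0 < m)%N ->
  (forall i, (w i)%:R = m%:R * mulAmT A (J n) 0 i) ->
  congr_modp p v (ST p v pi cF A G) (#|` fset_set (X_points p A w)|)%:R.
Proof.
move=> hJ hJT m0 hw; have [bF bE] := bF_ex (J n).
have h : v (ST p v pi cF A G - (#|` fset_set (X_points p A w)|)%:R) <= p%:R^-1.
  rewrite -(subrK (1 - (-1) ^+ n * \prod_j hj cF j (kJ bF j)) (ST p v pi cF A G)) -addrA.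
  by apply: vD; [exact: (ST_bound hJ hJT bE)|exact: (card_points_bound hJ hJT bE m0 hw)].
have p0 : (p%:R : K) != 0 by rewrite natK_eq0 -lt0n p_gt0.
exists ((ST p v pi cF A G - (#|` fset_set (X_points p A w)|)%:R) / p%:R); last by rewrite mulrC mulfVK.
by rewrite vM vV vp invrK -ler_pdivlMr ?pR_gt0 // mul1r.
Qed.

End Supertrace.

End Main.

Theorem corollary3p7 (p : nat) (p_prime : prime p)
  (R : realType) (K : closedFieldType) (v : K -> R) (K_Cp : is_Cp p v)
  (pi : K) (pi_root : pi ^+ p.-1 = - p%:R)
  (n : nat) (c : 'rV[int]_n -> K) (c_rec : is_frobenius_coef p c)
  (A : 'M[nat]_n) (A_BH : berglund_hubsch p A)
  (G : zmodClosed (GA A))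
  (J_G : cls A^T (J n) \in G) (J_GT : cls A (J n) \in transpose_group G)
  (A_CY : pairing A (J n) (J n) = 1) (n_ge3 : (3 <= n)%N)
  (m : nat) (w : 'I_n -> nat) (m_gt0 : (0 < m)%N)
  (w_def : forall i, (w i)%:R = m%:R * mulAmT A (J n) 0 i)
  (m_min : forall m' : nat, (0 < m')%N ->
     (forall i, m'%:R * mulAmT A (J n) 0 i \is a Num.int) -> (m <= m')%N) :
  congr_modp p v (ST p v pi c A G) (#|` fset_set (X_points p A w)|)%:R.
Proof.
exact: (supertrace_congr p_prime K_Cp pi_root c_rec A_BH A_CY n_ge3 J_G J_GT m_gt0 w_def).
Qed.
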